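(* Let $\omega_1,\omega_2,\omega_3$ be nonzero complex numbers with $\mathrm{Im}(\omega_1/\omega_2)\geq 0$, $\mathrm{Im}(\omega_3/\omega_1)>0$ and $\mathrm{Im}(\omega_3/\omega_2)>0$, and let $g_0,\ldots,g_4\in\mathbb{C}$ satisfy $$\mathrm{Im}(g_n/\omega_3)<0\quad (n=0,\ldots,4),\qquad \mathrm{Im}\big((\mathcal{A}-\omega_1-\omega_2)/\omega_3\big)>0,$$ where $\mathcal{A}=\sum_{n=0}^4 g_n$. Then $$\int_{-\omega_3/2}^{\omega_3/2}\frac{\prod_{n=0}^4 G(g_n\pm u;\boldsymbol{\omega})}{G(\pm 2u,\mathcal{A}\pm u;\boldsymbol{\omega})}\,\frac{du}{\omega_2}=\kappa\,\frac{\prod_{0\leq n<m\leq 4}G(g_n+g_m;\boldsymbol{\omega})}{\prod_{n=0}^4 G(\mathcal{A}-g_n;\boldsymbol{\omega})},$$ where $$\kappa=\frac{-2(\tilde q;\tilde q)_\infty}{(q;q)_\infty(p;p)_\infty(r;r)_\infty},$$ and the integration is along the straight line segment from $-\omega_3/2$ to $\omega_3/2$.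
   Context: Notation: $(a;x)_\infty=\prod_{n=0}^\infty(1-ax^n)$ for $|x|<1$; $\boldsymbol{\omega}=(\omega_1,\omega_2,\omega_3)$; $q=e^{2\pi i\omega_1/\omega_2}$, $p=e^{2\pi i\omega_3/\omega_2}$, $r=e^{2\pi i\omega_3/\omega_1}$, $\tilde q=e^{-2\pi i\omega_2/\omega_1}$, $\tilde p=e^{-2\pi i\omega_2/\omega_3}$, $\tilde r=e^{-2\pi i\omega_1/\omega_3}$. The modified elliptic gamma function $G(u;\boldsymbol{\omega})$ is the meromorphic function of $u$ defined, for $\mathrm{Im}(\omega_1/\omega_2),\mathrm{Im}(\omega_3/\omega_1),\mathrm{Im}(\omega_3/\omega_2)>0$, by $$G(u;\boldsymbol{\omega})=\prod_{j,k=0}^\infty\frac{(1-e^{-2\pi i u/\omega_2}q^{j+1}p^{k+1})(1-e^{2\pi i u/\omega_1}\tilde q^{\,j+1}r^k)}{(1-e^{2\pi i u/\omega_2}q^jp^k)(1-e^{-2\pi i u/\omega_1}\tilde q^{\,j}r^{k+1})},$$ and, for real $\omega_1/\omega_2>0$ (so $|q|=1$) with $\mathrm{Im}(\omega_3/\omega_1),\mathrm{Im}(\omega_3/\omega_2)>0$, by analytic continuation in the quasiperiods from the region $\mathrm{Im}(\omega_1/\omega_2)>0$. (Under the hypotheses, $\mathrm{Im}(\omega_1/\omega_2)=0$ forces $\omega_1/\omega_2>0$.) Explicitly, in the whole range $\mathrm{Im}(\omega_1/\omega_2)\ge 0$ the function is $$G(u;\boldsymbol{\omega})=e^{-\pi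 iP(u)}\,\Gamma(e^{-2\pi i u/\omega_3};\tilde r,\tilde p),\qquad \Gamma(z;x,y)=\prod_{j,k=0}^\infty\frac{1-z^{-1}x^{j+1}y^{k+1}}{1-zx^jy^k}\quad(|x|,|y|<1),$$ $$P(u)=\frac{1}{3\omega_1\omega_2\omega_3}\Big(u-\frac12\sum_{n=1}^3\omega_n\Big)\Big(u^2-u\sum_{n=1}^3\omega_n+\frac{\omega_1\omega_2\omega_3}{2}\sum_{n=1}^3\frac1{\omega_n}\Big).$$ Shorthand: $G(a,b;\boldsymbol{\omega})=G(a;\boldsymbol{\omega})G(b;\boldsymbol{\omega})$ and $G(a\pm b;\boldsymbol{\omega})=G(a+b;\boldsymbol{\omega})G(a-b;\boldsymbol{\omega})$; thus $G(\pm2u,\mathcal{A}\pm u;\boldsymbol{\omega})=G(2u;\boldsymbol{\omega})G(-2u;\boldsymbol{\omega})G(\mathcal{A}+u;\boldsymbol{\omega})G(\mathcal{A}-u;\boldsymbol{\omega})$. When $\omega_1/\omega_2>0$, the ratio $(\tilde q;\tilde q)_\infty/(q;q)_\infty$ is understood as the analytic continuation from $\mathrm{Im}(\omega_1/\omega_2)>0$; in the whole range it equals $\sqrt{\omega_1/(i\omega_2)}\;e^{\frac{\pi i}{12}(\omega_1/\omega_2+\omega_2/\omega_1)}$, with the principal branch of the square root (cut along the negative real axis). *)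

(* Defs.v *)
(* Stdlib reals with Coquelicot's complex numbers.
   Division is total ([/ 0 = 0]), and so are all the limits below. *)
From Stdlib Require Export Reals ClassicalEpsilon.
From Coquelicot Require Export Coquelicot.

Global Open Scope R_scope.
Global Open Scope C_scope.

Definition Cexp (z : C) : C := (exp (Re z) * cos (Im z), exp (Re z) * sin (Im z))%R.

Definition e2pi (x : C) : C := Cexp (2 * PI * Ci * x).

Fixpoint Cprod (n : nat) (f : nat -> C) : C :=
  match n with
  | O => 1
  | S n' => Cprod n' f * f n'
  end.

Definition C_lim_seq (s : nat -> C) : C :=
  (real (Lim_seq (fun n => Re (s n))), real (Lim_seq (fun n => Im (s n)))).

(* Every double product to which this is applied converges absolutely away from
   the zeros of its denominators, so square partial products may be used. *)
Definition Cprod_inf2 (f : nat -> nat -> C) : C :=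
  C_lim_seq (fun N => Cprod N (fun j => Cprod N (fun k => f j k))).

Definition qpoch (a x : C) : C :=
  C_lim_seq (fun N => Cprod N (fun n => 1 - a * x ^ n)).

(* [v] is the value at [a] of a function that is holomorphic on a disc around
   [a] and agrees with [f] on the part of the disc lying in [D]. *)
Definition is_continuation (D : C -> Prop) (f : C -> C) (a v : C) : Prop :=
  exists (d : posreal) (F : C -> C),
    (forall z : C, (Cmod (z - a) < d)%R ->
       @ex_derive C_AbsRing C_NormedModule F z) /\
    (forall z : C, (Cmod (z - a) < d)%R -> D z -> F z = f z) /\
    F a = v.

(* Unambiguous when [a] is a limit point of [D].  The value is 0 when there is
   no holomorphic continuation, e.g. at a pole of [f]; with [/ 0 = 0], the
   reciprocal then has its correct value 0 there. *)
Definition continuation (D : C -> Prop) (f : C -> C) (a : C) : C :=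
  match excluded_middle_informative (exists v, is_continuation D f a v) with
  | left H => proj1_sig (constructive_indefinite_description _ H)
  | right _ => 0
  end.

Definition generic (w1 w2 w3 : C) : Prop :=
  (0 < Im (w1 / w2))%R /\ (0 < Im (w3 / w1))%R /\ (0 < Im (w3 / w2))%R.

Definition q_ (w1 w2 w3 : C) : C := e2pi (w1 / w2).
Definition p_ (w1 w2 w3 : C) : C := e2pi (w3 / w2).
Definition r_ (w1 w2 w3 : C) : C := e2pi (w3 / w1).
Definition qt_ (w1 w2 w3 : C) : C := e2pi (- (w2 / w1)).

Definition Gprod (w1 w2 w3 u : C) : C :=
  let q := q_ w1 w2 w3 in
  let p := p_ w1 w2 w3 in
  let r := r_ w1 w2 w3 in
  let qt := qt_ w1 w2 w3 in
  Cprod_inf2 (fun j k =>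
    ((1 - e2pi (- (u / w2)) * q ^ (j + 1) * p ^ (k + 1)) *
     (1 - e2pi (u / w1) * qt ^ (j + 1) * r ^ k)) /
    ((1 - e2pi (u / w2) * q ^ j * p ^ k) *
     (1 - e2pi (- (u / w1)) * qt ^ j * r ^ (k + 1)))).

(* The meromorphic function of [u] given by the product.  Evaluating the product
   pointwise would not do: at e.g. [u = w2] a numerator and a denominator factor
   vanish together and the singularity is removable. *)
Definition G_generic (w1 w2 w3 u : C) : C :=
  continuation (fun z => z <> u) (Gprod w1 w2 w3) u.

(* Continuing in all the quasiperiods restricts to continuing in [w1] alone,
   which determines the value. *)
Definition G (w1 w2 w3 u : C) : C :=
  if excluded_middle_informative (generic w1 w2 w3)
  then G_generic w1 w2 w3 u
  else continuation (fun w => generic w w2 w3)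
                    (fun w => G_generic w w2 w3 u) w1.

Definition Gpm (w1 w2 w3 a b : C) : C := G w1 w2 w3 (a + b) * G w1 w2 w3 (a - b).

Definition qratio_generic (w1 w2 w3 : C) : C :=
  let q := q_ w1 w2 w3 in
  let qt := qt_ w1 w2 w3 in
  qpoch qt qt / qpoch q q.

Definition qratio (w1 w2 w3 : C) : C :=
  if excluded_middle_informative (generic w1 w2 w3)
  then qratio_generic w1 w2 w3
  else continuation (fun w => generic w w2 w3)
                    (fun w => qratio_generic w w2 w3) w1.

Definition kappa (w1 w2 w3 : C) : C :=
  let p := p_ w1 w2 w3 in
  let r := r_ w1 w2 w3 in
  - (2) * qratio w1 w2 w3 / (qpoch p p * qpoch r r).

(* The integral of [f] along the segment from [a] to [b] exists and equals [l]. *)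
Definition is_segment_int (f : C -> C) (a b l : C) : Prop :=
  @is_RInt C_R_NormedModule
    (fun t : R => f (a + t * (b - a)) * (b - a)) 0%R 1%R l.

(* Main.v *)
(* In the variable [z = e2pi (- (u / w3))] the modified elliptic gamma function is the
   exponential of a cubic polynomial times an ordinary elliptic gamma function.  This is
   the modular identity between three double products: their logarithms are bilateral
   series, and along a period line the Fourier coefficients of the series add up to
   those of a cubic, by Lagrange's interpolation identity.  The case of real [w1 / w2]
   follows by the identity theorem.  The cubics cancel between the two sides, leaving
   the elliptic beta integral with bases [x = e2pi (- (w1 / w3))],
   [y = e2pi (- (w2 / w3))] and parameters [t_n = e2pi (- (g n / w3))].

   The integral divided by the expected value is invariant under [t_0 -> x t_0]: by a
   theta function identity, the corresponding difference of integrands is a total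
   difference.  A function analytic in a strip with this invariance and invariant under
   [t_0 -> e^{2 pi i} t_0] is constant, so the quotient does not depend on the
   parameters.  Its value is found as [t_0 -> i] and [t_1 -> - i], where the integrand
   contains a Poisson kernel that concentrates at [z = i] and [z = - i].

   Holomorphy enters through uniform approximation ([uapp]) by trigonometric polynomials
   on strips and by polynomials on discs: Fourier coefficients then do not depend on the
   line, which replaces Cauchy's theorem and gives the identity theorem. *)
From Stdlib Require Import Arith ZArith Lra Lia List FunctionalExtensionality.
Require Import Defs.

Lemma C_eq (z w : C) : Re z = Re w -> Im z = Im w -> z = w.
Proof. destruct z, w; simpl; intros -> ->; reflexivity. Qed.

Lemma Re_plus (z w : C) : Re (z + w) = (Re z + Re w)%R. Proof. reflexivity. Qed.
Lemma Im_plus (z w : C) : Im (z + w) = (Im z + Im w)%R. Proof. reflexivity. Qed.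
Lemma Re_mult (z w : C) : Re (z * w) = (Re z * Re w - Im z * Im w)%R. Proof. reflexivity. Qed.
Lemma Im_mult (z w : C) : Im (z * w) = (Re z * Im w + Im z * Re w)%R. Proof. reflexivity. Qed.
Lemma Im_opp (z : C) : Im (- z) = (- Im z)%R. Proof. reflexivity. Qed.
Lemma Re_minus (z w : C) : Re (z - w) = (Re z - Re w)%R. Proof. reflexivity. Qed.
Lemma Im_minus (z w : C) : Im (z - w) = (Im z - Im w)%R. Proof. reflexivity. Qed.

Lemma Im_abs_Cmod (z : C) : (Rabs (Im z) <= Cmod z)%R.
Proof.
  replace (Im z) with (- Re (Ci * z))%R by (destruct z; simpl; ring).
  rewrite Rabs_Ropp; eapply Rle_trans; [apply re_le_Cmod|].
  rewrite Cmod_mult, Cmod_Ci; lra.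
Qed.

Lemma Cmod_le_abs (z : C) : (Cmod z <= Rabs (Re z) + Rabs (Im z))%R.
Proof.
  destruct z as [a b]; unfold Re, Im; simpl fst; simpl snd.
  replace (a, b) with (RtoC a + Ci * RtoC b)%C by (apply C_eq; simpl; ring).
  eapply Rle_trans; [apply Cmod_triangle|].
  rewrite Cmod_mult, !Cmod_R, Cmod_Ci; lra.
Qed.

Lemma Cmod_triangle_sub (x y : C) : (Cmod (x - y) <= Cmod x + Cmod y)%R.
Proof. unfold Cminus; eapply Rle_trans; [apply Cmod_triangle|]; rewrite Cmod_opp; lra. Qed.

Lemma Cmod_sub_sym (x y : C) : Cmod (x - y) = Cmod (y - x).
Proof. replace (x - y) with (- (y - x)) by ring; apply Cmod_opp. Qed.

Lemma Cmod_dist (x y z : C) : (Cmod (x - z) <= Cmod (x - y) + Cmod (y - z))%R.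
Proof. replace (x - z) with ((x - y) + (y - z)) by ring; apply Cmod_triangle. Qed.

Lemma Cmod_rev_triangle (x y : C) : (Cmod x - Cmod y <= Cmod (x - y))%R.
Proof.
  assert (H := Cmod_triangle (x - y) y).
  replace (x - y + y) with x in H by ring; lra.
Qed.

Lemma Cmod_small_eq (x y : C) : (forall eps : R, (0 < eps)%R -> (Cmod (x - y) <= eps)%R) -> x = y.
Proof.
  intros H.
  assert (Cmod (x - y) = 0%R).
  { apply Rle_antisym; [|apply Cmod_ge_0].
    apply Rnot_lt_le; intros Hlt.
    specialize (H (Cmod (x - y) / 2)%R); lra. }
  apply Cmod_eq_0 in H0.
  replace x with (x - y + y) by ring; rewrite H0; ring.
Qed.

Lemma Cmod_mult_sub (a b c d : C) :
  (Cmod (a * b - c * d) <= Cmod (a - c) * Cmod b + Cmod c * Cmod (b - d))%R.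
Proof.
  replace (a * b - c * d) with ((a - c) * b + c * (b - d)) by ring.
  eapply Rle_trans; [apply Cmod_triangle|]; rewrite !Cmod_mult; lra.
Qed.

Lemma Cmult_integral (a b : C) : a * b = 0 -> a = 0 \/ b = 0.
Proof.
  intros H.
  destruct (Ceq_dec a 0) as [|Ha]; [now left|right].
  replace b with (/ a * (a * b)) by (field; assumption); rewrite H; ring.
Qed.

Lemma one_sub_neq_0 (z : C) : (Cmod z < 1)%R -> 1 - z <> 0.
Proof.
  intros H H0.
  assert (z = 1) by (replace z with (1 - (1 - z)) by ring; rewrite H0; ring).
  subst; rewrite Cmod_1 in H; lra.
Qed.

Lemma one_sub_Cmod_lower (z : C) (r : R) : (Cmod z <= r)%R -> (1 - r <= Cmod (1 - z))%R.
Proof. intros H; generalize (Cmod_rev_triangle 1 z); rewrite Cmod_1; lra. Qed.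

Lemma Cdiv_0_r (x : C) : x / 0 = 0.
Proof.
  unfold Cdiv, Cinv; apply C_eq; simpl; unfold Rdiv.
  all: replace (0 * (0 * 1) + 0 * (0 * 1))%R with 0%R by ring; rewrite ?Rinv_0; ring.
Qed.

(** * Complex limits *)

Definition Ccvg (s : nat -> C) (l : C) : Prop := is_lim_seq (fun n => Cmod (s n - l)) 0%R.

Lemma Ccvg_eps (s : nat -> C) (l : C) :
  Ccvg s l <-> (forall eps : R, (0 < eps)%R -> exists N, forall n, (N <= n)%nat -> (Cmod (s n - l) < eps)%R).
Proof.
  unfold Ccvg; rewrite <- is_lim_seq_spec; split.
  - intros H eps He; destruct (H (mkposreal eps He)) as [N HN]; exists N; intros n Hn.
    specialize (HN n Hn); simpl in HN; rewrite Rminus_0_r, Rabs_pos_eq in HN by apply Cmod_ge_0; exact HN.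
  - intros H eps; destruct (H eps (cond_pos eps)) as [N HN]; exists N; intros n Hn.
    rewrite Rminus_0_r, Rabs_pos_eq by apply Cmod_ge_0; auto.
Qed.

Lemma Ccvg_squeeze (s : nat -> C) (l : C) (b : nat -> R) :
  (forall n, (Cmod (s n - l) <= b n)%R) -> is_lim_seq b 0%R -> Ccvg s l.
Proof.
  intros H Hb; apply (is_lim_seq_le_le (fun _ => 0%R) _ b); auto.
  - intros n; split; [apply Cmod_ge_0|auto].
  - apply is_lim_seq_const.
Qed.

Lemma Ccvg_const (c : C) : Ccvg (fun _ => c) c.
Proof.
  apply Ccvg_squeeze with (fun _ => 0%R); [|apply is_lim_seq_const].
  intros _; replace (c - c) with (RtoC 0) by ring; rewrite Cmod_0; lra.
Qed.

Lemma Ccvg_ext (s s' : nat -> C) (l : C) : (forall n, s n = s' n) -> Ccvg s l -> Ccvg s' l.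
Proof. intros H; apply is_lim_seq_ext; intros n; now rewrite H. Qed.

Lemma Ccvg_plus (s t : nat -> C) (a b : C) : Ccvg s a -> Ccvg t b -> Ccvg (fun n => s n + t n) (a + b).
Proof.
  intros Hs Ht; apply Ccvg_squeeze with (fun n => Cmod (s n - a) + Cmod (t n - b))%R.
  - intros n; replace (s n + t n - (a + b)) with ((s n - a) + (t n - b)) by ring; apply Cmod_triangle.
  - replace 0%R with (0 + 0)%R by ring; now apply is_lim_seq_plus'.
Qed.

Lemma Ccvg_bounded (s : nat -> C) (l : C) : Ccvg s l -> exists M, (0 < M)%R /\ forall n, (Cmod (s n) <= M)%R.
Proof.
  intros H; apply Ccvg_eps with (eps := 1%R) in H; [|lra]; destruct H as [N HN].
  assert (forall m, exists M, (0 < M)%R /\ forall n, (n < m)%nat -> (Cmod (s n) <= M)%R) as Hm.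
  { induction m as [|m [M [HM IH]]].
    - exists 1%R; split; [lra|intros; lia].
    - exists (M + Cmod (s m))%R; generalize (Cmod_ge_0 (s m)); split; [lra|].
      intros n Hn; destruct (Nat.eq_dec n m) as [->|]; [lra|].
      specialize (IH n ltac:(lia)); lra. }
  destruct (Hm N) as [M [HM HMb]].
  exists (M + Cmod l + 1)%R; generalize (Cmod_ge_0 l); split; [lra|intros n].
  destruct (le_lt_dec N n) as [Hn|Hn].
  - specialize (HN n Hn); generalize (Cmod_triangle (s n - l) l).
    replace (s n - l + l) with (s n) by ring; lra.
  - specialize (HMb n Hn); lra.
Qed.

Lemma Ccvg_mult (s t : nat -> C) (a b : C) : Ccvg s a -> Ccvg t b -> Ccvg (fun n => s n * t n) (a * b).
Proof.
  intros Hs Ht.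
  destruct (Ccvg_bounded t b Ht) as [M [HM HMb]].
  apply Ccvg_squeeze with (fun n => M * Cmod (s n - a) + Cmod a * Cmod (t n - b))%R.
  - intros n; eapply Rle_trans; [apply Cmod_mult_sub|].
    apply Rplus_le_compat_r; rewrite Rmult_comm; apply Rmult_le_compat_r; [apply Cmod_ge_0|auto].
  - replace (Finite 0) with (Finite (M * 0 + Cmod a * 0)) by (f_equal; ring).
    apply is_lim_seq_plus'; apply (is_lim_seq_scal_l _ _ (Finite 0)); auto.
Qed.

Lemma Ccvg_inv (s : nat -> C) (a : C) : a <> 0 -> Ccvg s a -> Ccvg (fun n => / s n) (/ a).
Proof.
  intros Ha Hs; apply Ccvg_eps; intros eps He.
  assert (Hp : (0 < Cmod a)%R) by now apply Cmod_gt_0.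
  destruct (proj1 (Ccvg_eps s a) Hs (Rmin (Cmod a / 2) (eps * (Cmod a * Cmod a) / 2))) as [N HN].
  { apply Rmin_pos; [lra|]; apply Rdiv_lt_0_compat; [|lra].
    apply Rmult_lt_0_compat; [lra|now apply Rmult_lt_0_compat]. }
  exists N; intros n Hn; specialize (HN n Hn).
  assert (H1 : (Cmod (s n - a) < Cmod a / 2)%R) by (eapply Rlt_le_trans; [apply HN|apply Rmin_l]).
  assert (H2 : (Cmod (s n - a) < eps * (Cmod a * Cmod a) / 2)%R) by (eapply Rlt_le_trans; [apply HN|apply Rmin_r]).
  assert (H3 : (Cmod a / 2 < Cmod (s n))%R).
  { generalize (Cmod_rev_triangle a (a - s n)); rewrite (Cmod_sub_sym a (s n)).
    replace (a - (a - s n)) with (s n) by ring; lra. }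
  assert (Hn0 : s n <> 0) by (apply Cmod_gt_0; lra).
  replace (/ s n - / a) with ((a - s n) * / (s n * a)) by (field; auto).
  rewrite Cmod_mult, Cmod_inv, Cmod_mult, Cmod_sub_sym by now apply Cmult_neq_0.
  apply Rmult_lt_reg_r with (Cmod (s n) * Cmod a)%R; [apply Rmult_lt_0_compat; lra|].
  rewrite Rmult_assoc, Rinv_l, Rmult_1_r by (apply Rgt_not_eq, Rmult_lt_0_compat; lra).
  eapply Rlt_trans; [apply H2|].
  replace (eps * (Cmod a * Cmod a) / 2)%R with (eps * (Cmod a / 2 * Cmod a))%R by field.
  apply Rmult_lt_compat_l; [lra|]; apply Rmult_lt_compat_r; lra.
Qed.

Lemma Ccvg_unique (s : nat -> C) (a b : C) : Ccvg s a -> Ccvg s b -> a = b.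
Proof.
  intros Ha Hb; apply Cmod_small_eq; intros eps He.
  destruct (proj1 (Ccvg_eps s a) Ha (eps / 2)%R) as [N HN]; [lra|].
  destruct (proj1 (Ccvg_eps s b) Hb (eps / 2)%R) as [M HM]; [lra|].
  specialize (HN (N + M)%nat ltac:(lia)); specialize (HM (N + M)%nat ltac:(lia)).
  generalize (Cmod_dist a (s (N + M)%nat) b); rewrite (Cmod_sub_sym a (s _)); lra.
Qed.

Lemma Ccvg_le (s : nat -> C) (a : C) (M : R) : Ccvg s a -> (forall n, (Cmod (s n) <= M)%R) -> (Cmod a <= M)%R.
Proof.
  intros Ha HM; apply Rnot_lt_le; intros Hlt.
  destruct (proj1 (Ccvg_eps s a) Ha (Cmod a - M)%R) as [N HN]; [lra|].
  specialize (HN N (le_n _)); specialize (HM N).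
  generalize (Cmod_rev_triangle a (a - s N)); rewrite (Cmod_sub_sym a (s N)).
  replace (a - (a - s N)) with (s N) by ring; lra.
Qed.

Lemma Ccvg_incr (s : nat -> C) (a : C) (k : nat) : Ccvg s a -> Ccvg (fun n => s (n + k)%nat) a.
Proof. intros H; unfold Ccvg; now apply (is_lim_seq_incr_n (fun n => Cmod (s n - a)) k). Qed.

Lemma Ccvg_C_lim_seq (s : nat -> C) (l : C) : Ccvg s l -> C_lim_seq s = l.
Proof.
  intros H; unfold C_lim_seq.
  assert (forall g : C -> R, (forall z w, g (z - w) = (g z - g w)%R) -> (forall z, (Rabs (g z) <= Cmod z)%R) ->
     is_lim_seq (fun n => g (s n)) (g l)) as Hg.
  { intros g Hl Hb.
    apply is_lim_seq_ext with (fun n => (g (s n) - g l) + g l)%R; [intros; ring|].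
    replace (Finite (g l)) with (Finite (0 + g l)) by (f_equal; ring).
    apply is_lim_seq_plus'; [|apply is_lim_seq_const].
    apply is_lim_seq_abs_0.
    apply is_lim_seq_le_le with (fun _ => 0%R) (fun n => Cmod (s n - l)); [|apply is_lim_seq_const|exact H].
    intros n; split; [apply Rabs_pos|rewrite <- Hl; apply Hb]. }
  apply C_eq; simpl.
  - erewrite is_lim_seq_unique; [|apply (Hg Re); [reflexivity|apply re_le_Cmod]]; reflexivity.
  - erewrite is_lim_seq_unique; [|apply (Hg Im); [reflexivity|apply Im_abs_Cmod]]; reflexivity.
Qed.

(* Completeness of [C] in the quantitative form in which it is used. *)
Lemma geometric_Ccvg (s : nat -> C) (M r : R) :
  (0 <= M)%R -> (0 <= r < 1)%R -> (forall n, (Cmod (s (S n) - s n) <= M * r ^ n)%R) ->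
  exists l, forall n, (Cmod (s n - l) <= M / (1 - r) * r ^ n)%R.
Proof.
  intros HM Hr H.
  assert (Hd : forall n k, (Cmod (s (n + k)%nat - s n) <= M * r ^ n * ((1 - r ^ k) / (1 - r)))%R).
  { intros n; induction k as [|k IH].
    - rewrite Nat.add_0_r; replace (s n - s n) with (RtoC 0) by ring; rewrite Cmod_0; simpl; right; field; lra.
    - rewrite Nat.add_succ_r; eapply Rle_trans; [apply (Cmod_dist _ (s (n + k)%nat))|].
      eapply Rle_trans; [apply Rplus_le_compat; [apply H|apply IH]|].
      right; rewrite pow_add; simpl; field; lra. }
  assert (Hd' : forall n k, (Cmod (s (n + k)%nat - s n) <= M / (1 - r) * r ^ n)%R).
  { intros n k; eapply Rle_trans; [apply Hd|].
    replace (M / (1 - r) * r ^ n)%R with (M * r ^ n * (1 / (1 - r)))%R by (field; lra).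
    apply Rmult_le_compat_l; [apply Rmult_le_pos; [lra|apply pow_le; lra]|].
    apply Rmult_le_compat_r; [left; apply Rinv_0_lt_compat; lra|].
    assert (0 <= r ^ k)%R by (apply pow_le; lra); lra. }
  assert (Hlim : is_lim_seq (fun n => M / (1 - r) * r ^ n)%R 0%R).
  { replace (Finite 0) with (Finite (M / (1 - r) * 0)) by (f_equal; ring).
    apply (is_lim_seq_scal_l _ _ (Finite 0)), is_lim_seq_geom; rewrite Rabs_pos_eq; lra. }
  assert (Hc : forall g : C -> R, (forall z w, g (z - w) = (g z - g w)%R) -> (forall z, (Rabs (g z) <= Cmod z)%R) ->
     exists l : R, is_lim_seq (fun n => g (s n)) l).
  { intros g Hl Hb.
    apply ex_lim_seq_cauchy_corr; intros eps.
    apply is_lim_seq_spec in Hlim; destruct (Hlim eps) as [N HN]; exists N.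
    assert (Hx : forall a b, (N <= a <= b)%nat -> (Rabs (g (s a) - g (s b)) < eps)%R).
    { intros a b Hab; rewrite <- Hl; eapply Rle_lt_trans; [apply Hb|].
      rewrite Cmod_sub_sym; replace b with (a + (b - a))%nat by lia.
      eapply Rle_lt_trans; [apply Hd'|]; specialize (HN a ltac:(lia)); rewrite Rminus_0_r in HN.
      eapply Rle_lt_trans; [apply Rle_abs|apply HN]. }
    intros n m Hn Hm; destruct (le_lt_dec n m); [apply Hx; lia|].
    rewrite Rabs_minus_sym; apply Hx; lia. }
  destruct (Hc Re) as [lr Hlr]; [reflexivity|apply re_le_Cmod|].
  destruct (Hc Im) as [li Hli]; [reflexivity|apply Im_abs_Cmod|].
  exists (lr, li).
  assert (Hcv : Ccvg s (lr, li)).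
  { apply Ccvg_squeeze with (fun n => Rabs (Re (s n) - lr) + Rabs (Im (s n) - li))%R.
    - intros n; apply Cmod_le_abs.
    - replace (Finite 0) with (Finite (Rabs (lr - lr) + Rabs (li - li)))
        by (f_equal; rewrite !Rminus_diag, Rabs_R0; ring).
      apply is_lim_seq_plus'; apply (is_lim_seq_abs _ (Finite _)); apply is_lim_seq_minus'; auto;
        apply is_lim_seq_const. }
  intros n; rewrite Cmod_sub_sym.
  apply (Ccvg_le (fun k => s (k + n)%nat - s n)).
  - unfold Cminus; apply Ccvg_plus; [now apply Ccvg_incr|apply Ccvg_const].
  - intros k; rewrite Nat.add_comm; apply Hd'.
Qed.

(** * The exponential *)

Lemma Cexp_plus (z w : C) : Cexp (z + w) = Cexp z * Cexp w.
Proof.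
  unfold Cexp; rewrite Re_plus, Im_plus, exp_plus, cos_plus, sin_plus.
  apply C_eq; simpl; ring.
Qed.

Lemma Cexp_0 : Cexp 0 = 1.
Proof. unfold Cexp; simpl; rewrite exp_0, cos_0, sin_0; apply C_eq; simpl; ring. Qed.

Lemma Cexp_neq_0 (z : C) : Cexp z <> 0.
Proof.
  intros H; assert (H1 : Cexp z * Cexp (- z) = 1).
  { rewrite <- Cexp_plus; replace (z + - z) with (RtoC 0) by ring; apply Cexp_0. }
  rewrite H, Cmult_0_l in H1; apply (f_equal Re) in H1; simpl in H1; lra.
Qed.

Lemma Cexp_opp (z : C) : Cexp (- z) = / Cexp z.
Proof.
  assert (H1 : Cexp z * Cexp (- z) = 1).
  { rewrite <- Cexp_plus; replace (z + - z) with (RtoC 0) by ring; apply Cexp_0. }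
  replace (Cexp (- z)) with (/ Cexp z * (Cexp z * Cexp (- z))) by (field; apply Cexp_neq_0).
  rewrite H1; ring.
Qed.

Lemma Cmod_Cexp (z : C) : Cmod (Cexp z) = exp (Re z).
Proof.
  unfold Cexp, Cmod; simpl fst; simpl snd.
  replace ((exp (Re z) * cos (Im z)) ^ 2 + (exp (Re z) * sin (Im z)) ^ 2)%R
    with (exp (Re z) ^ 2 * (Rsqr (sin (Im z)) + Rsqr (cos (Im z))))%R by (unfold Rsqr; ring).
  rewrite sin2_cos2, Rmult_1_r, sqrt_pow2; [reflexivity|left; apply exp_pos].
Qed.

Lemma e2pi_plus (x y : C) : e2pi (x + y) = e2pi x * e2pi y.
Proof. unfold e2pi; rewrite <- Cexp_plus; f_equal; ring. Qed.

Lemma e2pi_0 : e2pi 0 = 1.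
Proof. unfold e2pi; rewrite Cmult_0_r; apply Cexp_0. Qed.

Lemma e2pi_opp (x : C) : e2pi (- x) = / e2pi x.
Proof. unfold e2pi; rewrite <- Cexp_opp; f_equal; ring. Qed.

Lemma e2pi_minus (x y : C) : e2pi (x - y) = e2pi x / e2pi y.
Proof. unfold Cminus, Cdiv; now rewrite e2pi_plus, e2pi_opp. Qed.

Lemma e2pi_neq_0 (x : C) : e2pi x <> 0.
Proof. apply Cexp_neq_0. Qed.

Lemma Cmod_e2pi (x : C) : Cmod (e2pi x) = exp (- (2 * PI * Im x)).
Proof. unfold e2pi; rewrite Cmod_Cexp; f_equal; destruct x; simpl; ring. Qed.

Lemma e2pi_nat (n : nat) (x : C) : e2pi (INR n * x) = e2pi x ^ n.
Proof.
  induction n as [|n IH]; [simpl; rewrite Cmult_0_l; apply e2pi_0|].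
  rewrite S_INR, RtoC_plus; replace ((INR n + 1) * x) with (x + INR n * x) by ring.
  rewrite e2pi_plus, IH; reflexivity.
Qed.

Lemma e2pi_1 : e2pi 1 = 1.
Proof.
  unfold e2pi, Cexp; apply C_eq; simpl.
  all: match goal with |- context [cos ?a] => replace a with (2 * PI)%R by ring
       | |- context [sin ?a] => replace a with (2 * PI)%R by ring end.
  - rewrite cos_2PI; match goal with |- context [exp ?a] => replace a with 0%R by ring end; rewrite exp_0; ring.
  - rewrite sin_2PI; ring.
Qed.

Lemma e2pi_nat_1 (n : nat) : e2pi (INR n) = 1.
Proof.
  replace (RtoC (INR n)) with (INR n * 1) by ring; rewrite e2pi_nat, e2pi_1.
  induction n; simpl; [reflexivity|rewrite IHn; ring].
Qed.

Lemma e2pi_IZR (n : Z) : e2pi (IZR n) = 1.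
Proof.
  destruct (Z_le_gt_dec 0 n) as [Hn|Hn].
  - rewrite <- (Z2Nat.id n Hn), <- INR_IZR_INZ; apply e2pi_nat_1.
  - replace (RtoC (IZR n)) with (- RtoC (INR (Z.to_nat (- n)))).
    + rewrite e2pi_opp, e2pi_nat_1; field; injection; lra.
    + rewrite INR_IZR_INZ, Z2Nat.id, opp_IZR, RtoC_opp by lia; ring.
Qed.

Lemma Cmod_e2pi_lt_1 (x : C) : (0 < Im x)%R -> (Cmod (e2pi x) < 1)%R.
Proof.
  intros H; rewrite Cmod_e2pi, <- exp_0; apply exp_increasing.
  generalize PI_RGT_0; intros; apply Ropp_lt_gt_0_contravar.
  apply Rmult_lt_0_compat; lra.
Qed.

Lemma Cmod_e2pi_le (x : C) (y : R) : (y <= Im x)%R -> (Cmod (e2pi x) <= exp (- (2 * PI * y)))%R.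
Proof.
  intros H; rewrite Cmod_e2pi.
  destruct H as [H|H]; [left; apply exp_increasing|right; now rewrite H].
  apply Ropp_lt_contravar, Rmult_lt_compat_l; generalize PI_RGT_0; lra.
Qed.

(** * Integration over the unit interval *)

Definition cont01 (f : R -> C) : Prop :=
  forall x, (0 <= x <= 1)%R -> forall eps : R, (0 < eps)%R ->
  exists d : R, (0 < d)%R /\ forall y, (0 <= y <= 1)%R -> (Rabs (y - x) < d)%R -> (Cmod (f y - f x) < eps)%R.

Definition CI (f : R -> C) : C := (RInt (fun t => Re (f t)) 0 1, RInt (fun t => Im (f t)) 0 1).

Definition clamp (x : R) : R := Rmax 0 (Rmin 1 x).

Lemma clamp_in (x : R) : (0 <= clamp x <= 1)%R.
Proof. unfold clamp; split; [apply Rmax_l|]; apply Rmax_lub; [lra|apply Rmin_l]. Qed.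

Lemma clamp_id (x : R) : (0 <= x <= 1)%R -> clamp x = x.
Proof. intros H; unfold clamp; rewrite Rmin_right, Rmax_right; lra. Qed.

Lemma clamp_lip (x y : R) : (Rabs (clamp y - clamp x) <= Rabs (y - x))%R.
Proof.
  assert (H : forall z, (z <= 0 /\ clamp z = 0 \/ 0 <= z <= 1 /\ clamp z = z \/ 1 <= z /\ clamp z = 1)%R).
  { intros z; destruct (Rle_dec z 0); [left|destruct (Rle_dec z 1); right; [left|right]].
    - split; [assumption|]; unfold clamp; rewrite Rmin_right, Rmax_left; lra.
    - split; [lra|apply clamp_id; lra].
    - split; [lra|]; unfold clamp; rewrite Rmin_left, Rmax_right; lra. }
  unfold Rabs; destruct (H x) as [[? ->]|[[? ->]|[? ->]]], (H y) as [[? ->]|[[? ->]|[? ->]]];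
  repeat match goal with |- context [Rcase_abs ?a] => destruct (Rcase_abs a) end; lra.
Qed.

Lemma cont01_clamp (g : C -> R) (f : R -> C) :
  (forall z w, g (z - w) = (g z - g w)%R) -> (forall z, (Rabs (g z) <= Cmod z)%R) ->
  cont01 f -> forall x, continuous (fun t => g (f (clamp t))) x.
Proof.
  intros Hl Hb Hf x; apply continuity_pt_filterlim; intros eps He.
  destruct (Hf (clamp x) (clamp_in x) eps He) as [d [Hd H]].
  exists d; split; [exact Hd|]; intros y [_ Hy]; simpl in *; unfold R_dist in *.
  rewrite <- Hl; eapply Rle_lt_trans; [apply Hb|]; apply H; [apply clamp_in|].
  eapply Rle_lt_trans; [apply clamp_lip|exact Hy].
Qed.

Lemma cont01_ex_RInt (g : C -> R) (f : R -> C) :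
  (forall z w, g (z - w) = (g z - g w)%R) -> (forall z, (Rabs (g z) <= Cmod z)%R) ->
  cont01 f -> ex_RInt (fun t => g (f t)) 0 1.
Proof.
  intros Hl Hb Hf; apply ex_RInt_ext with (fun t => g (f (clamp t))).
  - rewrite Rmin_left, Rmax_right by lra; intros x Hx; rewrite clamp_id; lra || reflexivity.
  - apply (@ex_RInt_continuous R_CompleteNormedModule); intros; now apply cont01_clamp.
Qed.

Lemma cont01_ex_Re (f : R -> C) : cont01 f -> ex_RInt (fun t => Re (f t)) 0 1.
Proof. apply cont01_ex_RInt; [reflexivity|apply re_le_Cmod]. Qed.

Lemma cont01_ex_Im (f : R -> C) : cont01 f -> ex_RInt (fun t => Im (f t)) 0 1.
Proof. apply cont01_ex_RInt; [reflexivity|apply Im_abs_Cmod]. Qed.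

Lemma cont01_const (c : C) : cont01 (fun _ => c).
Proof.
  intros x Hx eps He; exists 1%R; split; [lra|]; intros y _ _.
  replace (c - c) with (RtoC 0) by ring; rewrite Cmod_0; exact He.
Qed.

Lemma cont01_ext (f g : R -> C) : (forall x, (0 <= x <= 1)%R -> f x = g x) -> cont01 f -> cont01 g.
Proof.
  intros H Hf x Hx eps He; destruct (Hf x Hx eps He) as [d [Hd Hd']].
  exists d; split; [exact Hd|]; intros y Hy Hxy; rewrite <- !H by assumption; auto.
Qed.

Lemma cont01_plus (f g : R -> C) : cont01 f -> cont01 g -> cont01 (fun x => f x + g x).
Proof.
  intros Hf Hg x Hx eps He.
  destruct (Hf x Hx (eps / 2)%R) as [d [Hd Hd']]; [lra|].
  destruct (Hg x Hx (eps / 2)%R) as [e [H2 He']]; [lra|].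
  exists (Rmin d e); split; [now apply Rmin_pos|]; intros y Hy Hxy.
  specialize (Hd' y Hy (Rlt_le_trans _ _ _ Hxy (Rmin_l _ _))).
  specialize (He' y Hy (Rlt_le_trans _ _ _ Hxy (Rmin_r _ _))).
  replace (f y + g y - (f x + g x)) with ((f y - f x) + (g y - g x)) by ring.
  eapply Rle_lt_trans; [apply Cmod_triangle|lra].
Qed.

Lemma cont01_mult (f g : R -> C) : cont01 f -> cont01 g -> cont01 (fun x => f x * g x).
Proof.
  intros Hf Hg x Hx eps He.
  set (K := (Cmod (f x) + Cmod (g x) + 1)%R).
  assert (HK : (0 < K)%R) by (unfold K; generalize (Cmod_ge_0 (f x)) (Cmod_ge_0 (g x)); lra).
  assert (HK1 : (0 < Rmin 1 (eps / (2 * K)))%R) by (apply Rmin_pos; [lra|apply Rdiv_lt_0_compat; lra]).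
  destruct (Hf x Hx _ HK1) as [d [Hd Hd']].
  destruct (Hg x Hx _ HK1) as [e [H2 He']].
  exists (Rmin d e); split; [now apply Rmin_pos|]; intros y Hy Hxy.
  specialize (Hd' y Hy (Rlt_le_trans _ _ _ Hxy (Rmin_l _ _))).
  specialize (He' y Hy (Rlt_le_trans _ _ _ Hxy (Rmin_r _ _))).
  assert (A := Rlt_le_trans _ _ _ Hd' (Rmin_r _ _)).
  assert (B := Rlt_le_trans _ _ _ He' (Rmin_r _ _)).
  assert (D := Rlt_le_trans _ _ _ He' (Rmin_l _ _)).
  assert (Hgy : (Cmod (g y) <= Cmod (g x) + 1)%R).
  { generalize (Cmod_triangle (g y - g x) (g x)); replace (g y - g x + g x) with (g y) by ring; lra. }
  eapply Rle_lt_trans; [apply Cmod_mult_sub|].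
  assert (E : (eps = eps / (2 * K) * K + eps / (2 * K) * K)%R) by (field; lra).
  rewrite E; apply Rplus_lt_le_compat.
  - apply Rle_lt_trans with (Cmod (f y - f x) * K)%R.
    + apply Rmult_le_compat_l; [apply Cmod_ge_0|]; unfold K; generalize (Cmod_ge_0 (f x)); lra.
    + now apply Rmult_lt_compat_r.
  - rewrite Rmult_comm; apply Rmult_le_compat; try apply Cmod_ge_0; [lra|].
    unfold K; generalize (Cmod_ge_0 (g x)); lra.
Qed.

Lemma cont01_lim (f : R -> C) :
  (forall eps : R, (0 < eps)%R -> exists g, cont01 g /\ forall x, (0 <= x <= 1)%R -> (Cmod (f x - g x) <= eps)%R) ->
  cont01 f.
Proof.
  intros H x Hx eps He.
  destruct (H (eps / 4)%R) as [g [Hg Hfg]]; [lra|].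
  destruct (Hg x Hx (eps / 4)%R) as [d [Hd Hd']]; [lra|].
  exists d; split; [exact Hd|]; intros y Hy Hxy; specialize (Hd' y Hy Hxy).
  assert (A := Hfg x Hx); assert (B := Hfg y Hy).
  eapply Rle_lt_trans; [apply (Cmod_dist _ (g y))|].
  eapply Rle_lt_trans; [apply Rplus_le_compat_l, (Cmod_dist _ (g x))|].
  rewrite (Cmod_sub_sym (g x) (f x)); lra.
Qed.

Lemma CI_ext (f g : R -> C) : (forall x, (0 <= x <= 1)%R -> f x = g x) -> CI f = CI g.
Proof.
  intros H; unfold CI; f_equal; apply RInt_ext; rewrite Rmin_left, Rmax_right by lra;
  intros x Hx; rewrite H; lra || reflexivity.
Qed.

Lemma CI_plus (f g : R -> C) : cont01 f -> cont01 g -> CI (fun x => f x + g x) = CI f + CI g.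
Proof.
  intros Hf Hg; apply C_eq; simpl; unfold CI, Re, Im; simpl.
  - now apply (RInt_plus (V := R_CompleteNormedModule)); apply cont01_ex_Re.
  - now apply (RInt_plus (V := R_CompleteNormedModule)); apply cont01_ex_Im.
Qed.

Lemma CI_scal (c : C) (f : R -> C) : cont01 f -> CI (fun x => c * f x) = c * CI f.
Proof.
  intros Hf.
  assert (H1 := cont01_ex_Re f Hf); assert (H2 := cont01_ex_Im f Hf).
  assert (S : forall a g, ex_RInt g 0 1 -> is_RInt (fun t => a * g t)%R 0 1 (a * RInt g 0 1)%R).
  { intros a g Hg; apply (is_RInt_scal (V := R_NormedModule)); now apply (RInt_correct (V := R_CompleteNormedModule)). }
  apply C_eq; simpl; apply is_RInt_unique.
  - apply (is_RInt_minus (V := R_NormedModule)); now apply S.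
  - apply (is_RInt_plus (V := R_NormedModule)); now apply S.
Qed.

Lemma CI_const (c : C) : CI (fun _ => c) = c.
Proof.
  apply C_eq; unfold CI; cbn -[RInt]; rewrite RInt_const; unfold scal; simpl; unfold mult; simpl; ring.
Qed.

Lemma CI_minus (f g : R -> C) : cont01 f -> cont01 g -> CI (fun x => f x - g x) = CI f - CI g.
Proof.
  intros Hf Hg.
  rewrite (CI_ext _ (fun x => f x + - (1) * g x)) by (intros; ring).
  rewrite CI_plus, CI_scal; auto; [ring|].
  apply cont01_mult; [apply cont01_const|auto].
Qed.

Lemma CI_bound (f : R -> C) (M : R) : cont01 f -> (forall x, (0 <= x <= 1)%R -> (Cmod (f x) <= M)%R) ->
  (Cmod (CI f) <= 2 * M)%R.
Proof.
  intros Hf HM; eapply Rle_trans; [apply Cmod_le_abs|].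
  replace (2 * M)%R with ((1 - 0) * M + (1 - 0) * M)%R by ring.
  apply Rplus_le_compat; apply abs_RInt_le_const; try lra.
  - now apply cont01_ex_Re.
  - intros; eapply Rle_trans; [apply re_le_Cmod|auto].
  - now apply cont01_ex_Im.
  - intros; eapply Rle_trans; [apply Im_abs_Cmod|auto].
Qed.

Lemma CI_le (f : R -> C) (g : R -> R) : cont01 f -> ex_RInt g 0 1 ->
  (forall x, (0 <= x <= 1)%R -> (Cmod (f x) <= g x)%R) -> (Cmod (CI f) <= 2 * RInt g 0 1)%R.
Proof.
  intros Hf Hg H; eapply Rle_trans; [apply Cmod_le_abs|].
  assert (A : forall h : C -> R, ex_RInt (fun t => h (f t)) 0 1 -> (forall z, (Rabs (h z) <= Cmod z)%R) ->
    (Rabs (RInt (fun t => h (f t)) 0 1) <= RInt g 0 1)%R).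
  { intros h He Hb; eapply Rle_trans; [apply abs_RInt_le; [lra|exact He]|].
    apply RInt_le; [lra|now apply ex_RInt_norm|exact Hg|].
    intros x Hx; eapply Rle_trans; [apply Hb|apply H; lra]. }
  replace (2 * RInt g 0 1)%R with (RInt g 0 1 + RInt g 0 1)%R by ring.
  apply Rplus_le_compat; apply A.
  - now apply cont01_ex_Re.
  - apply re_le_Cmod.
  - now apply cont01_ex_Im.
  - apply Im_abs_Cmod.
Qed.

Lemma CI_cont01_close (f g : R -> C) (eps : R) : cont01 f -> cont01 g ->
  (forall x, (0 <= x <= 1)%R -> (Cmod (f x - g x) <= eps)%R) -> (Cmod (CI f - CI g) <= 2 * eps)%R.
Proof.
  intros Hf Hg H; rewrite <- CI_minus by assumption; apply CI_bound; [|exact H].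
  apply cont01_ext with (fun x => f x + - (1) * g x); [intros; ring|].
  apply cont01_plus; [exact Hf|]; apply cont01_mult; [apply cont01_const|exact Hg].
Qed.

(** * Derivatives of complex functions of a real variable *)

Definition Cder (f : R -> C) (x : R) (d : C) : Prop :=
  is_derive (fun t => Re (f t)) x (Re d) /\ is_derive (fun t => Im (f t)) x (Im d).

Lemma Cder_ext (f g : R -> C) (x : R) (d : C) : (forall t, f t = g t) -> Cder f x d -> Cder g x d.
Proof. intros H [A B]; split; eapply is_derive_ext; eauto; intros; simpl; now rewrite H. Qed.

Lemma Cder_const (c : C) (x : R) : Cder (fun _ => c) x 0.
Proof. split; apply (is_derive_const (K := R_AbsRing) (V := R_NormedModule)). Qed.

Lemma Cder_id (x : R) : Cder (fun t => RtoC t) x 1.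
Proof. split; simpl; [apply (is_derive_id (K := R_AbsRing))|apply (is_derive_const (K := R_AbsRing) (V := R_NormedModule))]. Qed.

Lemma Cder_plus (f g : R -> C) (x : R) (d e : C) : Cder f x d -> Cder g x e -> Cder (fun t => f t + g t) x (d + e).
Proof. intros [A B] [D E]; split; now apply (is_derive_plus (K := R_AbsRing) (V := R_NormedModule)). Qed.

Lemma Cder_mult (f g : R -> C) (x : R) (d e : C) :
  Cder f x d -> Cder g x e -> Cder (fun t => f t * g t) x (d * g x + f x * e).
Proof.
  intros [A B] [D E].
  assert (M : forall u v : R -> R, forall du dv, is_derive u x du -> is_derive v x dv ->
     is_derive (fun t => u t * v t)%R x (du * v x + u x * dv)%R).
  { intros u v du dv Hu Hv; apply (is_derive_mult u v x du dv Hu Hv); intros; apply Rmult_comm. }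
  split; simpl.
  - evar_last; [apply (is_derive_minus (K := R_AbsRing) (V := R_NormedModule)); eapply M; eassumption|].
    unfold minus, plus, opp; simpl; unfold Re, Im; ring.
  - evar_last; [apply (is_derive_plus (K := R_AbsRing) (V := R_NormedModule)); eapply M; eassumption|].
    unfold plus; simpl; unfold Re, Im; ring.
Qed.

Lemma Cder_eq (f : R -> C) (x : R) (d e : C) : Cder f x d -> d = e -> Cder f x e.
Proof. now intros H <-. Qed.

Lemma Cder_scal (c : C) (f : R -> C) (x : R) (d : C) : Cder f x d -> Cder (fun t => c * f t) x (c * d).
Proof.
  intros H; eapply Cder_eq; [apply (Cder_mult (fun _ => c)); [apply Cder_const|exact H]|ring].
Qed.

Lemma Cder_Cexp (f : R -> C) (x : R) (d : C) : Cder f x d -> Cder (fun t => Cexp (f t)) x (d * Cexp (f x)).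
Proof.
  intros [A B].
  assert (Hcomp : forall (h : R -> R) (u : R -> R) du dh, is_derive u x du -> is_derive h (u x) dh ->
     is_derive (fun t => h (u t)) x (du * dh)%R).
  { intros h u du dh Hu Hh; apply (is_derive_comp (K := R_AbsRing) (V := R_NormedModule) h u x dh du); assumption. }
  assert (M : forall u v : R -> R, forall du dv, is_derive u x du -> is_derive v x dv ->
     is_derive (fun t => u t * v t)%R x (du * v x + u x * dv)%R).
  { intros u v du dv Hu Hv; apply (is_derive_mult u v x du dv Hu Hv); intros; apply Rmult_comm. }
  split; unfold Cexp; simpl.
  - evar_last; [apply M; eapply Hcomp; [apply A|apply is_derive_exp|apply B|apply is_derive_cos]|].
    unfold Re, Im; simpl; ring.
  - evar_last; [apply M; eapply Hcomp; [apply A|apply is_derive_exp|apply B|apply is_derive_sin]|].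
    unfold Re, Im; simpl; ring.
Qed.

Lemma Cder_cont01 (f : R -> C) : (forall x, (0 <= x <= 1)%R -> exists d, Cder f x d) -> cont01 f.
Proof.
  intros H x Hx eps He; destruct (H x Hx) as [d [A B]].
  assert (Hc : forall g : R -> R, ex_derive g x -> exists d : R, (0 < d)%R /\
     forall y, (Rabs (y - x) < d)%R -> (Rabs (g y - g x) < eps / 2)%R).
  { intros g Hg; apply ex_derive_continuous in Hg.
    apply continuity_pt_filterlim in Hg; destruct (Hg (eps / 2)%R ltac:(lra)) as [dd [Hd Hd']].
    exists dd; split; [exact Hd|]; intros y Hy.
    destruct (Req_dec y x) as [->|Hn]; [rewrite Rminus_diag, Rabs_R0; lra|].
    apply (Hd' y); split; [split; [exact I|auto]|exact Hy]. }
  destruct (Hc (fun t => Re (f t))) as [d1 [H1 H1']]; [eexists; apply A|].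
  destruct (Hc (fun t => Im (f t))) as [d2 [H2 H2']]; [eexists; apply B|].
  exists (Rmin d1 d2); split; [now apply Rmin_pos|]; intros y Hy Hxy.
  specialize (H1' y (Rlt_le_trans _ _ _ Hxy (Rmin_l _ _))).
  specialize (H2' y (Rlt_le_trans _ _ _ Hxy (Rmin_r _ _))).
  eapply Rle_lt_trans; [apply Cmod_le_abs|]; rewrite Re_minus, Im_minus; lra.
Qed.

Lemma CI_FTC (F f : R -> C) : (forall x, (0 <= x <= 1)%R -> Cder F x (f x)) -> cont01 f -> CI f = F 1%R - F 0%R.
Proof.
  intros HF Hf.
  assert (A : forall g : C -> R, (forall z w, g (z - w) = (g z - g w)%R) -> (forall z, (Rabs (g z) <= Cmod z)%R) ->
    (forall x, (0 <= x <= 1)%R -> is_derive (fun t => g (F t)) x (g (f x))) ->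
    RInt (fun t => g (f t)) 0 1 = (g (F 1%R) - g (F 0%R))%R).
  { intros g Hl Hb Hd.
    rewrite (RInt_ext _ (fun t => g (f (clamp t))))
      by (rewrite Rmin_left, Rmax_right by lra; intros x Hx; now rewrite clamp_id by lra).
    apply is_RInt_unique, (is_RInt_derive (V := R_CompleteNormedModule) (fun t => g (F t))).
    - rewrite Rmin_left, Rmax_right by lra; intros x Hx; rewrite clamp_id by lra; now apply Hd.
    - intros x _; now apply cont01_clamp. }
  apply C_eq; unfold CI; simpl; [apply (A Re)|apply (A Im)]; try reflexivity;
    try apply re_le_Cmod; try apply Im_abs_Cmod; intros x Hx; apply HF, Hx.
Qed.

Lemma Cder_e2pi_lin (a b : C) (x : R) :
  Cder (fun t => e2pi (a * t + b)) x (2 * PI * Ci * a * e2pi (a * x + b)).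
Proof.
  unfold e2pi.
  replace (2 * PI * Ci * a * Cexp (2 * PI * Ci * (a * x + b)))
    with ((2 * PI * Ci * a * 1) * Cexp (2 * PI * Ci * (a * x + b))) by ring.
  apply (Cder_Cexp (fun t => 2 * PI * Ci * (a * t + b))).
  apply Cder_ext with (fun t => (2 * PI * Ci * a) * RtoC t + 2 * PI * Ci * b); [intros; ring|].
  replace (2 * PI * Ci * a * 1) with ((0 * RtoC x + 2 * PI * Ci * a * 1) + 0) by ring.
  apply Cder_plus; [apply (Cder_mult (fun _ => 2 * PI * Ci * a)); [apply Cder_const|apply Cder_id]|apply Cder_const].
Qed.

Lemma cont01_e2pi_lin (a b : C) : cont01 (fun t => e2pi (a * t + b)).
Proof. apply Cder_cont01; intros; eexists; apply Cder_e2pi_lin. Qed.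

Lemma two_PI_Ci_neq_0 : 2 * PI * Ci <> 0.
Proof.
  repeat apply Cmult_neq_0; try (intros H; apply (f_equal Re) in H; simpl in H; generalize PI_RGT_0; lra).
  intros H; apply (f_equal Im) in H; simpl in H; lra.
Qed.

Lemma CI_e2pi_lin (a b : C) : a <> 0 ->
  CI (fun t => e2pi (a * t + b)) = (e2pi (a + b) - e2pi b) / (2 * PI * Ci * a).
Proof.
  intros Ha.
  rewrite (CI_FTC (fun t => / (2 * PI * Ci * a) * e2pi (a * t + b))).
  - replace (a * RtoC 1 + b) with (a + b) by ring; replace (a * RtoC 0 + b) with b by ring.
    field; split; [exact Ha|].
    split; [intros H; apply (f_equal Im) in H; simpl in H; lra|].
    intros H; apply (f_equal Re) in H; simpl in H; generalize PI_RGT_0; lra.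
  - intros x _.
    eapply Cder_eq; [apply Cder_scal, Cder_e2pi_lin|].
    rewrite Cmult_assoc, Cinv_l by (apply Cmult_neq_0; [apply two_PI_Ci_neq_0|exact Ha]); ring.
  - apply cont01_e2pi_lin.
Qed.

Lemma CI_e2pi_int (n : Z) : n <> 0%Z -> CI (fun t => e2pi (IZR n * t)) = 0.
Proof.
  intros Hn; assert (RtoC (IZR n) <> 0) by (intros H; apply (f_equal Re) in H; simpl in H; now apply eq_IZR in H).
  rewrite (CI_ext _ (fun t => e2pi (IZR n * t + 0))) by (intros; f_equal; ring).
  rewrite CI_e2pi_lin by assumption.
  rewrite Cplus_0_r, e2pi_IZR, e2pi_0; unfold Cdiv, Cminus; rewrite Cplus_opp_r; ring.
Qed.

Definition peak (x0 t : R) : R := ((1 + cos (2 * PI * (t - x0))) / 2)%R.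

Lemma peak_bounds (x0 t : R) : (0 <= peak x0 t <= 1)%R.
Proof. unfold peak; generalize (COS_bound (2 * PI * (t - x0))); lra. Qed.

Lemma peak_near (x0 t d : R) : (0 < d < 1/2)%R -> (Rabs (t - x0) <= d / 2)%R -> (peak x0 (x0 + d / 2) <= peak x0 t)%R.
Proof.
  intros Hd Ht; unfold peak; generalize PI_RGT_0; intros Hpi.
  assert (cos (2 * PI * (x0 + d / 2 - x0)) <= cos (2 * PI * (t - x0)))%R; [|lra].
  replace (cos (2 * PI * (t - x0))) with (cos (2 * PI * Rabs (t - x0))).
  - replace (x0 + d / 2 - x0)%R with (d / 2)%R by ring.
    generalize (Rabs_pos (t - x0)); intros.
    apply cos_decr_1; try nra.
  - unfold Rabs; destruct (Rcase_abs (t - x0)); [|reflexivity].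
    rewrite <- cos_neg; f_equal; ring.
Qed.

Lemma peak_far (x0 t d : R) : (0 < d < 1/2)%R -> (d <= Rabs (t - x0) <= 1 - d)%R -> (peak x0 t <= peak x0 (x0 + d))%R.
Proof.
  intros Hd Ht; unfold peak; generalize PI_RGT_0; intros Hpi.
  assert (cos (2 * PI * (t - x0)) <= cos (2 * PI * (x0 + d - x0)))%R; [|lra].
  replace (cos (2 * PI * (t - x0))) with (cos (2 * PI * Rabs (t - x0))).
  - replace (x0 + d - x0)%R with d by ring.
    revert Ht; generalize (Rabs (t - x0)); intros s Hs.
    destruct (Rle_dec s (1/2)).
    + apply cos_decr_1; nra.
    + replace (cos (2 * PI * s)) with (cos (2 * PI * (1 - s))).
      * apply cos_decr_1; nra.
      * rewrite <- (cos_neg (2 * PI * s)).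
        replace (2 * PI * (1 - s))%R with (- (2 * PI * s) + 2 * INR 1 * PI)%R by (simpl; ring).
        now rewrite cos_period.
  - unfold Rabs; destruct (Rcase_abs (t - x0)); [|reflexivity].
    rewrite <- cos_neg; f_equal; ring.
Qed.

Lemma peak_strict (x0 d : R) : (0 < d < 1/2)%R -> (peak x0 (x0 + d) < peak x0 (x0 + d / 2))%R.
Proof.
  intros Hd; unfold peak; generalize PI_RGT_0; intros Hpi.
  assert (cos (2 * PI * (x0 + d - x0)) < cos (2 * PI * (x0 + d / 2 - x0)))%R; [|lra].
  apply cos_decreasing_1; nra.
Qed.

(* A positive value at [x0] would survive in the integral against a high power
   of the peak. *)
Lemma peak_test (g : R -> R) (x0 M eps d : R) :
  (0 < d)%R -> (0 < x0 - d)%R -> (x0 + d < 1)%R -> (0 < eps)%R ->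
  (forall n, ex_RInt (fun t => g t * peak x0 t ^ n)%R 0 1) ->
  (forall t, (0 <= t <= 1)%R -> (- M <= g t)%R) ->
  (forall t, (Rabs (t - x0) <= d)%R -> (eps <= g t)%R) ->
  (forall n, RInt (fun t => g t * peak x0 t ^ n)%R 0 1 = 0%R) -> False.
Proof.
  intros Hd H0 H1 He Hex HM Hg Hint.
  assert (Hd2 : (0 < d < 1/2)%R) by lra.
  set (a := peak x0 (x0 + d / 2)); set (b := peak x0 (x0 + d)).
  assert (Hab : (b < a)%R) by now apply peak_strict.
  assert (Hb : (0 <= b)%R) by apply peak_bounds.
  assert (HM' : (- Rabs M <= 0)%R) by (generalize (Rabs_pos M); lra).
  assert (K : forall n, (d * eps * a ^ n <= Rabs M * b ^ n)%R).
  { intros n.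
    set (h := fun t => (g t * peak x0 t ^ n)%R).
    assert (E1 : ex_RInt h 0 (x0 - d / 2)) by (apply (ex_RInt_Chasles_1 (V := R_CompleteNormedModule)) with 1%R; [lra|apply Hex]).
    assert (E2 : ex_RInt h (x0 - d / 2) 1) by (apply (ex_RInt_Chasles_2 (V := R_CompleteNormedModule)) with 0%R; [lra|apply Hex]).
    assert (E3 : ex_RInt h (x0 - d / 2) (x0 + d / 2)) by (apply (ex_RInt_Chasles_1 (V := R_CompleteNormedModule)) with 1%R; [lra|apply E2]).
    assert (E4 : ex_RInt h (x0 + d / 2) 1) by (apply (ex_RInt_Chasles_2 (V := R_CompleteNormedModule)) with (x0 - d / 2)%R; [lra|apply E2]).
    assert (S : (RInt h 0 (x0 - d / 2) + (RInt h (x0 - d / 2) (x0 + d / 2) + RInt h (x0 + d / 2) 1) = 0)%R).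
    { assert (Q1 := RInt_Chasles (V := R_CompleteNormedModule) h 0 (x0 - d / 2) 1 E1 E2).
      assert (Q2 := RInt_Chasles (V := R_CompleteNormedModule) h (x0 - d / 2) (x0 + d / 2) 1 E3 E4).
      assert (Q3 := Hint n); fold h in Q3; unfold plus in Q1, Q2; simpl in Q1, Q2; lra. }
    assert (Hout : forall t, (0 <= t <= 1)%R -> (d / 2 <= Rabs (t - x0))%R -> (- Rabs M * b ^ n <= h t)%R).
    { intros t Ht Htd; unfold h.
      assert (Hp : (0 <= peak x0 t ^ n)%R) by (apply pow_le, peak_bounds).
      assert (Hbn : (0 <= b ^ n)%R) by now apply pow_le.
      destruct (Rle_dec d (Rabs (t - x0))) as [Hf|Hf].
      - assert (Hfar : (peak x0 t ^ n <= b ^ n)%R).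
        { apply pow_incr; split; [apply peak_bounds|]; apply peak_far; [lra|split; [exact Hf|]].
          apply Rabs_le; lra. }
        apply Rle_trans with (- Rabs M * peak x0 t ^ n)%R.
        + apply Rmult_le_compat_neg_l; lra.
        + apply Rmult_le_compat_r; [exact Hp|]; specialize (HM t Ht); generalize (Rle_abs M); lra.
      - apply Rle_trans with 0%R; [generalize (Rabs_pos M); nra|].
        apply Rmult_le_pos; [|exact Hp]; specialize (Hg t ltac:(lra)); lra. }
    assert (Hin : forall t, (Rabs (t - x0) <= d / 2)%R -> (eps * a ^ n <= h t)%R).
    { intros t Ht; unfold h; apply Rmult_le_compat; [lra|apply pow_le; lra|apply Hg; lra|].
      apply pow_incr; split; [lra|now apply peak_near]. }
    assert (Low : forall c u v, (u <= v)%R -> ex_RInt h u v -> (forall t, (u < t < v)%R -> (c <= h t)%R) ->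
      ((v - u) * c <= RInt h u v)%R).
    { intros c u v Huv Hh Hc.
      replace ((v - u) * c)%R with (RInt (fun _ => c) u v) by (rewrite RInt_const; reflexivity).
      apply RInt_le; auto; apply (ex_RInt_const (V := R_NormedModule)). }
    assert (L1 := Low (- Rabs M * b ^ n)%R 0%R (x0 - d / 2)%R ltac:(lra) E1
      (fun t Ht => Hout t ltac:(lra) ltac:(rewrite Rabs_left; lra))).
    assert (L3 := Low (- Rabs M * b ^ n)%R (x0 + d / 2)%R 1%R ltac:(lra) E4
      (fun t Ht => Hout t ltac:(lra) ltac:(rewrite Rabs_right; lra))).
    assert (L2 := Low (eps * a ^ n)%R (x0 - d / 2)%R (x0 + d / 2)%R ltac:(lra) E3
      (fun t Ht => Hin t ltac:(apply Rabs_le; lra))).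
    assert (Hbn : (0 <= b ^ n)%R) by now apply pow_le.
    assert (0 <= Rabs M * b ^ n)%R by (apply Rmult_le_pos; [apply Rabs_pos|exact Hbn]).
    nra. }
  assert (Hr : (0 <= b / a < 1)%R).
  { split; [apply Rdiv_le_0_compat; lra|].
    apply Rmult_lt_reg_r with a; [lra|]; unfold Rdiv; rewrite Rmult_assoc, Rinv_l; lra. }
  assert (Hlim : is_lim_seq (fun n => Rabs M * (b / a) ^ n)%R 0%R).
  { replace (Finite 0) with (Finite (Rabs M * 0)) by (f_equal; ring).
    apply (is_lim_seq_scal_l _ _ (Finite 0)), is_lim_seq_geom; rewrite Rabs_pos_eq; lra. }
  assert (Hde : (0 < d * eps)%R) by now apply Rmult_lt_0_compat.
  apply is_lim_seq_spec in Hlim; destruct (Hlim (mkposreal _ Hde)) as [N HN].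
  specialize (HN N (le_n _)); simpl in HN; rewrite Rminus_0_r in HN.
  apply Rle_not_lt in HN; [exact HN|].
  assert (Han : (0 < a ^ N)%R) by (apply pow_lt; lra).
  eapply Rle_trans; [|apply Rle_abs].
  unfold Rdiv; rewrite Rpow_mult_distr, pow_inv.
  apply Rmult_le_reg_r with (a ^ N)%R; [exact Han|].
  replace (Rabs M * (b ^ N * / a ^ N) * a ^ N)%R with (Rabs M * b ^ N)%R by (field; lra).
  apply K.
Qed.

Lemma e2pi_R (x : R) : e2pi x = (cos (2 * PI * x), sin (2 * PI * x))%R.
Proof.
  unfold e2pi, Cexp.
  replace (Re (2 * PI * Ci * x)) with 0%R by (simpl; ring).
  replace (Im (2 * PI * Ci * x)) with (2 * PI * x)%R by (simpl; ring).
  rewrite exp_0; apply C_eq; simpl; ring.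
Qed.

Lemma peak_e2pi (x0 t : R) : RtoC (peak x0 t) = / 4 * (2 + e2pi (t - x0) + e2pi (- (t - x0))).
Proof.
  rewrite <- RtoC_minus, <- RtoC_opp, !e2pi_R; unfold peak.
  replace (2 * PI * - (t - x0))%R with (- (2 * PI * (t - x0)))%R by ring; rewrite cos_neg, sin_neg.
  rewrite <- RtoC_inv by lra; apply C_eq; simpl; field.
Qed.

Lemma fourier_uniqueness (f : R -> C) : cont01 f ->
  (forall n : Z, CI (fun t => f t * e2pi (IZR n * t)) = 0) -> forall x, (0 < x < 1)%R -> f x = 0.
Proof.
  intros Hf Hn x0 Hx0.
  destruct (Ceq_dec (f x0) 0) as [|Hne]; [assumption|exfalso].
  assert (He : forall n : Z, cont01 (fun t => e2pi (IZR n * t))).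
  { intros n; apply cont01_ext with (fun t => e2pi (IZR n * t + 0)); [intros; f_equal; ring|apply cont01_e2pi_lin]. }
  assert (Hp : forall n, cont01 (fun t => RtoC (peak x0 t ^ n)) /\
     forall m : Z, CI (fun t => f t * e2pi (IZR m * t) * RtoC (peak x0 t ^ n)) = 0).
  { induction n as [|n [IHc IH]].
    - split; [simpl; apply cont01_const|]; intros m; rewrite <- (Hn m); apply CI_ext; intros; simpl; ring.
    - assert (Hpk : forall t, RtoC (peak x0 t ^ S n) =
         / 4 * (2 * RtoC (peak x0 t ^ n) + (e2pi (- x0) * (e2pi (IZR 1 * t) * RtoC (peak x0 t ^ n)) +
           e2pi x0 * (e2pi (IZR (-1) * t) * RtoC (peak x0 t ^ n))))).
      { intros t; simpl pow; rewrite RtoC_mult, peak_e2pi.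
        replace (t - x0) with (- x0 + IZR 1 * t) by ring; replace (- (- x0 + IZR 1 * t)) with (x0 + IZR (-1) * t) by ring.
        rewrite !e2pi_plus; ring. }
      assert (Hce : forall m : Z, cont01 (fun t => e2pi (IZR m * t) * RtoC (peak x0 t ^ n))) by (intros; apply cont01_mult; auto).
      split.
      + apply cont01_ext with (fun t => / 4 * (2 * RtoC (peak x0 t ^ n) + (e2pi (- x0) * (e2pi (IZR 1 * t) * RtoC (peak x0 t ^ n)) +
           e2pi x0 * (e2pi (IZR (-1) * t) * RtoC (peak x0 t ^ n))))); [intros; symmetry; apply Hpk|].
        apply cont01_mult; [apply cont01_const|]; apply cont01_plus; [apply cont01_mult; [apply cont01_const|exact IHc]|].
        apply cont01_plus; (apply cont01_mult; [apply cont01_const|apply Hce]).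
      + intros m.
        assert (Hc : forall m : Z, cont01 (fun t => f t * e2pi (IZR m * t) * RtoC (peak x0 t ^ n)))
          by (intros; repeat apply cont01_mult; auto).
        rewrite (CI_ext _ (fun t => / 4 * (2 * (f t * e2pi (IZR m * t) * RtoC (peak x0 t ^ n)) +
          (e2pi (- x0) * (f t * e2pi (IZR (m + 1) * t) * RtoC (peak x0 t ^ n)) +
           e2pi x0 * (f t * e2pi (IZR (m + -1) * t) * RtoC (peak x0 t ^ n)))))).
        * rewrite CI_scal, !CI_plus, !CI_scal, !IH; [ring|..]; auto;
          repeat first [apply Hc | apply cont01_plus | apply cont01_mult | apply cont01_const].
        * intros t _; rewrite Hpk, !plus_IZR, !RtoC_plus, !Cmult_plus_distr_r, !e2pi_plus; ring. }
  set (c := Cconj (f x0)).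
  assert (Hcf : cont01 (fun t => c * f t)) by (apply cont01_mult; [apply cont01_const|exact Hf]).
  set (eps := (Cmod (f x0) ^ 2)%R).
  assert (Heps : (0 < eps)%R) by (apply pow_lt; now apply Cmod_gt_0).
  assert (Hval : Re (c * f x0) = eps).
  { unfold c, eps; rewrite Cmod2_alt; destruct (f x0); simpl; ring. }
  destruct (Hcf x0 ltac:(lra) (eps / 2)%R ltac:(lra)) as [d [Hd Hd']].
  set (d0 := Rmin (d / 2) (Rmin (x0 / 2) ((1 - x0) / 2))).
  assert (Hd0 : (0 < d0)%R) by (unfold d0; repeat apply Rmin_pos; lra).
  assert (d0 <= d / 2)%R by apply Rmin_l.
  assert (d0 <= x0 / 2)%R by (eapply Rle_trans; [apply Rmin_r|apply Rmin_l]).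
  assert (d0 <= (1 - x0) / 2)%R by (eapply Rle_trans; [apply Rmin_r|apply Rmin_r]).
  assert (HB : exists M, forall t, (0 <= t <= 1)%R -> (- M <= Re (c * f t))%R).
  { destruct (continuity_ab_min (fun t => Re (c * f (clamp t))) 0 1) as [m [Hm _]]; [lra| |].
    - intros t _; apply continuity_pt_filterlim.
      apply (cont01_clamp Re (fun t => c * f t)); [reflexivity|apply re_le_Cmod|exact Hcf].
    - exists (- Re (c * f (clamp m)))%R; intros t Ht; rewrite Ropp_involutive.
      specialize (Hm t Ht); simpl in Hm; now rewrite (clamp_id t Ht) in Hm. }
  destruct HB as [M HM].
  assert (Hre : forall n t, (Re (c * f t) * peak x0 t ^ n)%R = Re (c * (f t * e2pi (IZR 0 * t) * RtoC (peak x0 t ^ n)))).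
  { intros n t; replace (IZR 0 * t) with (RtoC 0) by ring; rewrite e2pi_0.
    generalize (peak x0 t ^ n)%R; intros r; simpl; ring. }
  assert (Hcc : forall n, cont01 (fun t => f t * e2pi (IZR 0 * t) * RtoC (peak x0 t ^ n))).
  { intros n; apply cont01_mult; [apply cont01_mult; auto|apply Hp]. }
  apply (peak_test (fun t => Re (c * f t)) x0 M (eps / 2) d0); try lra; auto.
  - intros n; eapply ex_RInt_ext; [intros; symmetry; apply Hre|].
    apply (cont01_ex_Re (fun t => c * (f t * e2pi (IZR 0 * t) * RtoC (peak x0 t ^ n)))).
    apply cont01_mult; [apply cont01_const|auto].
  - intros t Ht.
    assert (Ht' := Rabs_le_between (t - x0) d0); apply Ht' in Ht.
    specialize (Hd' t ltac:(lra) ltac:(apply Rabs_lt_between; lra)).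
    generalize (re_le_Cmod (c * f t - c * f x0)); rewrite Re_minus, Hval; intros Hr.
    apply Rabs_le_between in Hr; lra.
  - intros n; rewrite (RInt_ext _ (fun t => Re (c * (f t * e2pi (IZR 0 * t) * RtoC (peak x0 t ^ n))))) by (intros; apply Hre).
    assert (HH := CI_scal c _ (Hcc n)); rewrite (proj2 (Hp n) 0%Z), Cmult_0_r in HH.
    apply (f_equal Re) in HH; exact HH.
Qed.

(** * Finite and infinite products *)

Lemma Cprod_ext (n : nat) (f g : nat -> C) : (forall k, (k < n)%nat -> f k = g k) -> Cprod n f = Cprod n g.
Proof. induction n; intros H; simpl; [reflexivity|]; rewrite IHn, H; auto. Qed.

Lemma Cprod_mult (n : nat) (f g : nat -> C) : Cprod n (fun k => f k * g k) = Cprod n f * Cprod n g.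
Proof. induction n; simpl; [ring|rewrite IHn; ring]. Qed.

Lemma Cprod_1 (n : nat) : Cprod n (fun _ => 1) = 1.
Proof. induction n; simpl; [reflexivity|rewrite IHn; ring]. Qed.

Lemma Cprod_inv (n : nat) (f : nat -> C) : (forall k, (k < n)%nat -> f k <> 0) ->
  Cprod n (fun k => / f k) = / Cprod n f.
Proof.
  intros H; assert (A : Cprod n f <> 0 /\ Cprod n (fun k => / f k) = / Cprod n f); [|apply A].
  induction n; simpl; [split; [|field]; injection; lra|].
  destruct IHn as [B D]; [auto|]; split; [apply Cmult_neq_0; auto|]; rewrite D; field; auto.
Qed.

Lemma Cprod_neq_0 (n : nat) (f : nat -> C) : (forall k, (k < n)%nat -> f k <> 0) -> Cprod n f <> 0.
Proof. induction n; intros H; simpl; [injection; lra|]; apply Cmult_neq_0; auto. Qed.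

Lemma Cprod_S_l (n : nat) (f : nat -> C) : Cprod (S n) f = f O * Cprod n (fun k => f (S k)).
Proof. induction n; [simpl; ring|]; change (Cprod (S (S n)) f) with (Cprod (S n) f * f (S n)); rewrite IHn; simpl; ring. Qed.

Lemma Cprod_swap (n m : nat) (f : nat -> nat -> C) :
  Cprod n (fun j => Cprod m (fun k => f j k)) = Cprod m (fun k => Cprod n (fun j => f j k)).
Proof. induction n; simpl; [now rewrite Cprod_1|]; rewrite IHn, <- Cprod_mult; reflexivity. Qed.

Lemma Cprod_bound (n : nat) (a : nat -> C) (S : nat -> R) : S O = 0%R ->
  (forall k, (k < n)%nat -> (Cmod (a k) <= S (Datatypes.S k) - S k)%R) ->
  (Cmod (Cprod n (fun k => 1 - a k)%C) <= exp (S n))%R /\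
  (Cmod (Cprod n (fun k => 1 - a k)%C - 1) <= exp (S n) - 1)%R.
Proof.
  intros H0 H; induction n as [|n IH].
  - simpl; rewrite H0, exp_0; replace (1 - 1) with (RtoC 0) by ring; rewrite Cmod_0, Cmod_1; lra.
  - destruct IH as [I1 I2]; [auto|].
    specialize (H n ltac:(lia)); simpl.
    set (P := Cprod n (fun k => 1 - a k)%C) in *.
    assert (He : (1 + Cmod (a n) <= exp (S (Datatypes.S n) - S n))%R).
    { eapply Rle_trans; [apply exp_ineq1_le|]; destruct H as [H| ->]; [left; now apply exp_increasing|lra]. }
    assert (E : exp (S (Datatypes.S n)) = (exp (S n) * exp (S (Datatypes.S n) - S n))%R)
      by (rewrite <- exp_plus; f_equal; ring).
    assert (Hm : (Cmod (1 - a n) <= 1 + Cmod (a n))%R) by (eapply Rle_trans; [apply Cmod_triangle_sub|rewrite Cmod_1; lra]).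
    generalize (Cmod_ge_0 P) (Cmod_ge_0 (a n)) (exp_pos (S n)) (Cmod_ge_0 (1 - a n)); intros.
    split.
    + rewrite Cmod_mult, E; apply Rmult_le_compat; lra.
    + replace (P * (1 - a n) - 1) with ((P - 1) + - (P * a n)) by ring.
      eapply Rle_trans; [apply Cmod_triangle|]; rewrite Cmod_opp, Cmod_mult, E; nra.
Qed.

Lemma geom_step (c r : R) (k : nat) : (r < 1)%R ->
  (c * (1 - r ^ S k) / (1 - r) - c * (1 - r ^ k) / (1 - r) = c * r ^ k)%R.
Proof. intros; simpl; field; lra. Qed.

Lemma geom_le (c r : R) (k : nat) : (0 <= c)%R -> (0 <= r < 1)%R -> (c * (1 - r ^ k) / (1 - r) <= c / (1 - r))%R.
Proof.
  intros Hc Hr; unfold Rdiv; apply Rmult_le_compat_r; [left; apply Rinv_0_lt_compat; lra|].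
  assert (0 <= r ^ k)%R by (apply pow_le; lra); nra.
Qed.

Lemma exp_le_mono (x y : R) : (x <= y)%R -> (exp x <= exp y)%R.
Proof. intros [H| ->]; [left; now apply exp_increasing|lra]. Qed.

Lemma Cprod_geom_bound (n : nat) (a : nat -> C) (c r : R) : (0 <= c)%R -> (0 <= r < 1)%R ->
  (forall k, (k < n)%nat -> (Cmod (a k) <= c * r ^ k)%R) ->
  (Cmod (Cprod n (fun k => 1 - a k)%C) <= exp (c / (1 - r)))%R /\
  (Cmod (Cprod n (fun k => 1 - a k)%C - 1) <= exp (c / (1 - r)) - 1)%R.
Proof.
  intros Hc Hr Ha.
  destruct (Cprod_bound n a (fun k => c * (1 - r ^ k) / (1 - r))%R) as [A B].
  - simpl; field; lra.
  - intros k Hk; rewrite geom_step by lra; auto.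
  - assert (E := exp_le_mono _ _ (geom_le c r n Hc Hr)); split; lra.
Qed.

Lemma Cprod_geom_exp (n : nat) (f : nat -> C) (c r : R) : (0 <= c)%R -> (0 <= r < 1)%R ->
  (forall k, (k < n)%nat -> (Cmod (f k) <= exp (c * r ^ k))%R) ->
  (Cmod (Cprod n f) <= exp (c / (1 - r)))%R.
Proof.
  intros Hc Hr Hf.
  assert (H : (Cmod (Cprod n f) <= exp (c * (1 - r ^ n) / (1 - r)))%R).
  { induction n as [|n IH]; simpl Cprod.
    - rewrite Cmod_1; simpl; replace (c * (1 - 1) / (1 - r))%R with 0%R by (field; lra); rewrite exp_0; lra.
    - rewrite Cmod_mult.
      replace (exp (c * (1 - r ^ S n) / (1 - r))) with (exp (c * (1 - r ^ n) / (1 - r)) * exp (c * r ^ n))%R.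
      + apply Rmult_le_compat; try apply Cmod_ge_0; auto.
      + rewrite <- exp_plus; f_equal; rewrite <- (geom_step c r n); lra. }
  eapply Rle_trans; [apply H|]; now apply exp_le_mono, geom_le.
Qed.

Lemma exp_sub_1_le (x : R) : (0 <= x)%R -> (exp x - 1 <= x * exp x)%R.
Proof.
  intros Hx; generalize (exp_ineq1_le (- x)); rewrite exp_Ropp; intros H.
  assert (He := exp_pos x).
  assert ((1 + - x) * exp x <= 1)%R; [|lra].
  replace 1%R with (/ exp x * exp x)%R at 2 by (field; lra).
  apply Rmult_le_compat_r; lra.
Qed.

Definition qprt (N : nat) (z y : C) : C := Cprod N (fun k => 1 - z * y ^ k).

Definition dprt (N : nat) (z x y : C) : C := Cprod N (fun j => Cprod N (fun k => 1 - z * x ^ j * y ^ k)).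

Definition dpoch (z x y : C) : C := Cprod_inf2 (fun j k => 1 - z * x ^ j * y ^ k).

Lemma Cmod_mult_pow_le (z y : C) (c r : R) (k : nat) : (Cmod z <= c)%R -> (Cmod y <= r)%R -> (Cmod (z * y ^ k) <= c * r ^ k)%R.
Proof.
  intros Hz Hy; rewrite Cmod_mult, Cmod_pow; apply Rmult_le_compat; auto; try apply Cmod_ge_0.
  - apply pow_le, Cmod_ge_0.
  - apply pow_incr; split; [apply Cmod_ge_0|exact Hy].
Qed.

Lemma qprt_bound (N : nat) (z y : C) (c r : R) : (0 <= r < 1)%R -> (Cmod z <= c)%R -> (Cmod y <= r)%R ->
  (Cmod (qprt N z y) <= exp (c / (1 - r)))%R /\ (Cmod (qprt N z y - 1) <= exp (c / (1 - r)) - 1)%R.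
Proof.
  intros Hr Hz Hy; apply Cprod_geom_bound; auto.
  - eapply Rle_trans; [apply Cmod_ge_0|exact Hz].
  - intros k _; now apply Cmod_mult_pow_le.
Qed.

Lemma dprt_rows (N : nat) (z x y : C) : dprt N z x y = Cprod N (fun j => qprt N (z * x ^ j) y).
Proof. reflexivity. Qed.

Lemma dprt_sym (N : nat) (z x y : C) : dprt N z x y = dprt N z y x.
Proof. unfold dprt; rewrite Cprod_swap; apply Cprod_ext; intros j _; apply Cprod_ext; intros k _; ring. Qed.

Lemma dprt_bound (N : nat) (z x y : C) (c r : R) : (0 <= r < 1)%R -> (Cmod z <= c)%R -> (Cmod x <= r)%R -> (Cmod y <= r)%R ->
  (Cmod (dprt N z x y) <= exp (c / (1 - r) / (1 - r)))%R.
Proof.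
  intros Hr Hz Hx Hy.
  assert (Hc : (0 <= c)%R) by (eapply Rle_trans; [apply Cmod_ge_0|exact Hz]).
  apply (Cprod_geom_exp N (fun j => qprt N (z * x ^ j) y)); [apply Rdiv_le_0_compat; lra|exact Hr|].
  intros k _; replace (c / (1 - r) * r ^ k)%R with (c * r ^ k / (1 - r))%R by (field; lra).
  apply qprt_bound; auto; now apply Cmod_mult_pow_le.
Qed.

Lemma dprt_S (N : nat) (z x y : C) :
  dprt (S N) z x y = dprt N z x y * (qprt N (z * y ^ N) x * qprt (S N) (z * x ^ N) y).
Proof.
  unfold dprt at 1.
  change (Cprod (S N) (fun j => Cprod (S N) (fun k => 1 - z * x ^ j * y ^ k)))
    with (Cprod N (fun j => Cprod N (fun k => 1 - z * x ^ j * y ^ k) * (1 - z * x ^ j * y ^ N)) *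
       qprt (S N) (z * x ^ N) y).
  rewrite Cprod_mult; fold (dprt N z x y).
  rewrite <- Cmult_assoc; f_equal; f_equal; unfold qprt; apply Cprod_ext; intros; ring.
Qed.

Lemma qpoch_approx (z y : C) (c r : R) : (0 <= r < 1)%R -> (Cmod z <= c)%R -> (Cmod y <= r)%R ->
  forall N, (Cmod (qprt N z y - qpoch z y) <= exp (c / (1 - r)) * c / (1 - r) * r ^ N)%R.
Proof.
  intros Hr Hz Hy.
  assert (Hc : (0 <= c)%R) by (eapply Rle_trans; [apply Cmod_ge_0|exact Hz]).
  destruct (geometric_Ccvg (fun N => qprt N z y) (exp (c / (1 - r)) * c) r) as [l Hl]; auto.
  - apply Rmult_le_pos; [left; apply exp_pos|exact Hc].
  - intros n; replace (qprt (S n) z y - qprt n z y) with (- (qprt n z y * (z * y ^ n))) by (unfold qprt; simpl; ring).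
    rewrite Cmod_opp, Cmod_mult, Rmult_assoc; apply Rmult_le_compat; try apply Cmod_ge_0.
    + now apply qprt_bound.
    + now apply Cmod_mult_pow_le.
  - replace (qpoch z y) with l; [exact Hl|]; symmetry; apply Ccvg_C_lim_seq.
    apply Ccvg_squeeze with (1 := Hl).
    replace (Finite 0) with (Finite (exp (c / (1 - r)) * c / (1 - r) * 0)) by (f_equal; ring).
    apply (is_lim_seq_scal_l _ _ (Finite 0)), is_lim_seq_geom; rewrite Rabs_pos_eq; lra.
Qed.

Definition dpoch_const (c r : R) : R :=
  (exp (c / (1 - r) / (1 - r)) * (2 * (c / (1 - r)) * exp (2 * (c / (1 - r)))) / (1 - r))%R.

Lemma dpoch_approx (z x y : C) (c r : R) : (0 <= r < 1)%R -> (Cmod z <= c)%R -> (Cmod x <= r)%R -> (Cmod y <= r)%R ->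
  forall N, (Cmod (dprt N z x y - dpoch z x y) <= dpoch_const c r * r ^ N)%R.
Proof.
  intros Hr Hz Hx Hy.
  assert (Hc : (0 <= c)%R) by (eapply Rle_trans; [apply Cmod_ge_0|exact Hz]).
  assert (Hcr : (0 <= c / (1 - r))%R) by (apply Rdiv_le_0_compat; lra).
  destruct (geometric_Ccvg (fun N => dprt N z x y)
     (exp (c / (1 - r) / (1 - r)) * (2 * (c / (1 - r)) * exp (2 * (c / (1 - r))))) r) as [l Hl]; auto.
  - apply Rmult_le_pos; [left; apply exp_pos|apply Rmult_le_pos; [lra|left; apply exp_pos]].
  - intros n; rewrite dprt_S.
    set (A := qprt n (z * y ^ n) x); set (B := qprt (S n) (z * x ^ n) y).
    set (s := (c * r ^ n / (1 - r))%R).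
    destruct (qprt_bound n (z * y ^ n) x (c * r ^ n) r) as [A1 A2]; auto; [now apply Cmod_mult_pow_le|].
    destruct (qprt_bound (S n) (z * x ^ n) y (c * r ^ n) r) as [B1 B2]; auto; [now apply Cmod_mult_pow_le|].
    fold A s in A1, A2; fold B s in B1, B2.
    replace (dprt n z x y * (A * B) - dprt n z x y) with (dprt n z x y * (A * B - 1)) by ring.
    rewrite Cmod_mult, Rmult_assoc; apply Rmult_le_compat; try apply Cmod_ge_0; [now apply dprt_bound|].
    assert (Hrn : (0 <= r ^ n <= 1)%R) by (split; [apply pow_le; lra|rewrite <- (pow1 n); apply pow_incr; lra]).
    assert (Hs : (0 <= s <= c / (1 - r))%R).
    { unfold s; replace (c * r ^ n / (1 - r))%R with (c / (1 - r) * r ^ n)%R by (field; lra); nra. }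
    apply Rle_trans with (exp (2 * s) - 1)%R.
    + replace (A * B - 1) with ((A - 1) * B + (B - 1)) by ring.
      eapply Rle_trans; [apply Cmod_triangle|]; rewrite Cmod_mult.
      replace (exp (2 * s)) with (exp s * exp s)%R by (rewrite <- exp_plus; f_equal; ring).
      generalize (Cmod_ge_0 (A - 1)) (Cmod_ge_0 B) (exp_pos s); nra.
    + eapply Rle_trans; [apply exp_sub_1_le; lra|].
      replace (2 * (c / (1 - r)) * exp (2 * (c / (1 - r))) * r ^ n)%R with (2 * s * exp (2 * (c / (1 - r))))%R
        by (unfold s; field; lra).
      apply Rmult_le_compat_l; [lra|]; apply exp_le_mono; lra.
  - replace (dpoch z x y) with l; [exact Hl|]; symmetry; apply (Ccvg_C_lim_seq (fun N => dprt N z x y)).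
    apply Ccvg_squeeze with (1 := Hl).
    match goal with |- is_lim_seq (fun n => ?a * r ^ n)%R _ => replace (Finite 0) with (Finite (a * 0)) by (f_equal; ring) end.
    apply (is_lim_seq_scal_l _ _ (Finite 0)), is_lim_seq_geom; rewrite Rabs_pos_eq; lra.
Qed.

Lemma lim_geom (c r : R) : (0 <= r < 1)%R -> is_lim_seq (fun n => c * r ^ n)%R 0%R.
Proof.
  intros Hr; replace (Finite 0) with (Finite (c * 0)) by (f_equal; ring).
  apply (is_lim_seq_scal_l _ _ (Finite 0)), is_lim_seq_geom; rewrite Rabs_pos_eq; lra.
Qed.

Lemma two_bounds (x y : C) : (Cmod x < 1)%R -> (Cmod y < 1)%R ->
  exists r : R, (0 <= r < 1)%R /\ (Cmod x <= r)%R /\ (Cmod y <= r)%R.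
Proof.
  intros Hx Hy; exists (Rmax (Cmod x) (Cmod y)); repeat split; [|now apply Rmax_lub_lt|apply Rmax_l|apply Rmax_r].
  eapply Rle_trans; [apply (Cmod_ge_0 x)|apply Rmax_l].
Qed.

Lemma qprt_cvg (z y : C) : (Cmod y < 1)%R -> Ccvg (fun N => qprt N z y) (qpoch z y).
Proof.
  intros Hy; eapply Ccvg_squeeze; [apply (qpoch_approx z y (Cmod z) (Cmod y)); try lra|].
  - split; [apply Cmod_ge_0|exact Hy].
  - apply lim_geom; split; [apply Cmod_ge_0|exact Hy].
Qed.

Lemma dprt_cvg (z x y : C) : (Cmod x < 1)%R -> (Cmod y < 1)%R -> Ccvg (fun N => dprt N z x y) (dpoch z x y).
Proof.
  intros Hx Hy; destruct (two_bounds x y Hx Hy) as [r [Hr [H1 H2]]].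
  eapply Ccvg_squeeze; [apply (dpoch_approx z x y (Cmod z) r); auto; lra|now apply lim_geom].
Qed.

Lemma qprt_row_cvg (z x y : C) : (Cmod x < 1)%R -> (Cmod y < 1)%R -> Ccvg (fun N => qprt N (z * x ^ N) y) 1.
Proof.
  intros Hx Hy; destruct (two_bounds x y Hx Hy) as [r [Hr [H1 H2]]].
  apply Ccvg_squeeze with (fun N => exp (Cmod z / (1 - r) * r ^ N) - 1)%R.
  - intros N; replace (Cmod z / (1 - r) * r ^ N)%R with (Cmod z * r ^ N / (1 - r))%R by (field; lra).
    apply qprt_bound; auto; apply Cmod_mult_pow_le; lra.
  - replace (Finite 0) with (Finite (exp 0 - 1)) by (rewrite exp_0; f_equal; ring).
    apply is_lim_seq_minus'; [|apply is_lim_seq_const].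
    apply (is_lim_seq_continuous exp); [apply derivable_continuous_pt, derivable_pt_exp|now apply lim_geom].
Qed.

Lemma dpoch_step (z x y : C) : (Cmod x < 1)%R -> (Cmod y < 1)%R -> dpoch z x y = qpoch z y * dpoch (z * x) x y.
Proof.
  intros Hx Hy.
  apply (Ccvg_unique (fun N => dprt N z x y * qprt N (z * x ^ N) y)).
  - replace (dpoch z x y) with (dpoch z x y * 1) by ring.
    apply Ccvg_mult; [now apply dprt_cvg|now apply qprt_row_cvg].
  - apply Ccvg_ext with (fun N => qprt N z y * dprt N (z * x) x y).
    + intros N; rewrite !dprt_rows.
      change (Cprod N (fun j => qprt N (z * x ^ j) y) * qprt N (z * x ^ N) y) with (Cprod (S N) (fun j => qprt N (z * x ^ j) y)).
      rewrite Cprod_S_l; f_equal; [f_equal; simpl; ring|].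
      apply Cprod_ext; intros; f_equal; simpl; ring.
    + apply Ccvg_mult; [now apply qprt_cvg|now apply dprt_cvg].
Qed.

Lemma dpoch_sym (z x y : C) : (Cmod x < 1)%R -> (Cmod y < 1)%R -> dpoch z x y = dpoch z y x.
Proof.
  intros Hx Hy; apply (Ccvg_unique (fun N => dprt N z x y)); [now apply dprt_cvg|].
  apply Ccvg_ext with (fun N => dprt N z y x); [intros; apply dprt_sym|now apply dprt_cvg].
Qed.

Lemma qpoch_step (z y : C) : (Cmod y < 1)%R -> qpoch z y = (1 - z) * qpoch (z * y) y.
Proof.
  intros Hy; apply (Ccvg_unique (fun N => qprt (N + 1) z y)).
  - apply (Ccvg_incr (fun N => qprt N z y)); now apply qprt_cvg.
  - apply Ccvg_ext with (fun N => (1 - z) * qprt N (z * y) y).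
    + intros N; rewrite Nat.add_1_r; unfold qprt; rewrite Cprod_S_l; f_equal; [simpl; ring|].
      apply Cprod_ext; intros; simpl; ring.
    + apply Ccvg_mult; [apply Ccvg_const|now apply qprt_cvg].
Qed.

Lemma inv_one_sub_bound (a : C) (r : R) : (r < 1)%R -> (Cmod a <= r)%R -> (Cmod (/ (1 - a)) <= exp (Cmod a / (1 - r)))%R.
Proof.
  intros Hr Ha; assert (H0 : 1 - a <> 0) by (apply one_sub_neq_0; lra).
  rewrite Cmod_inv by assumption.
  assert (H1 := one_sub_Cmod_lower a r Ha).
  assert (H2 := one_sub_Cmod_lower a (Cmod a) (Rle_refl _)).
  eapply Rle_trans; [|apply exp_ineq1_le].
  generalize (Cmod_ge_0 a); intros.
  apply Rle_trans with (/ (1 - Cmod a))%R; [apply Rinv_le_contravar; lra|].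
  apply Rmult_le_reg_r with (1 - Cmod a)%R; [lra|]; rewrite Rinv_l by lra.
  assert ((Cmod a / (1 - Cmod a)) <= Cmod a / (1 - r))%R.
  { unfold Rdiv; apply Rmult_le_compat_l; [lra|]; apply Rinv_le_contravar; lra. }
  replace 1%R with ((1 + Cmod a / (1 - Cmod a)) * (1 - Cmod a))%R at 1 by (field; lra).
  apply Rmult_le_compat_r; lra.
Qed.

Lemma dprt_inv_bound (N : nat) (z x y : C) (c r : R) : (0 <= r < 1)%R -> (c < 1)%R -> (Cmod z <= c)%R -> (Cmod x <= r)%R -> (Cmod y <= r)%R ->
  dprt N z x y <> 0 /\ (Cmod (/ dprt N z x y) <= exp (c / (1 - c) / (1 - r) / (1 - r)))%R.
Proof.
  intros Hr Hc1 Hz Hx Hy.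
  assert (Hc : (0 <= c)%R) by (eapply Rle_trans; [apply Cmod_ge_0|exact Hz]).
  assert (Hp : forall k, (0 <= r ^ k <= 1)%R) by (intros; split; [apply pow_le; lra|rewrite <- (pow1 k); apply pow_incr; lra]).
  assert (Hs : forall j k, (Cmod (z * x ^ j * y ^ k) <= c * r ^ j * r ^ k)%R)
    by (intros; repeat apply Cmod_mult_pow_le; auto).
  assert (Hs' : forall j k, (Cmod (z * x ^ j * y ^ k) <= c)%R).
  { intros j k; eapply Rle_trans; [apply Hs|]; generalize (Hp j) (Hp k); intros.
    assert (0 <= r ^ j * r ^ k <= 1)%R by nra; rewrite Rmult_assoc; nra. }
  assert (Hn : forall j k, 1 - z * x ^ j * y ^ k <> 0) by (intros j k; apply one_sub_neq_0; specialize (Hs' j k); lra).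
  assert (Hrow : forall j, qprt N (z * x ^ j) y <> 0) by (intros; apply Cprod_neq_0; intros; apply Hn).
  split; [apply (Cprod_neq_0 N (fun j => qprt N (z * x ^ j) y)); intros; apply Hrow|].
  rewrite dprt_rows, <- Cprod_inv by (intros; apply Hrow).
  assert (0 <= c / (1 - c))%R by (apply Rdiv_le_0_compat; lra).
  apply Cprod_geom_exp; auto; [apply Rdiv_le_0_compat; lra|].
  intros j _; unfold qprt; rewrite <- Cprod_inv by (intros; apply Hn).
  replace (c / (1 - c) / (1 - r) * r ^ j)%R with (c / (1 - c) * r ^ j / (1 - r))%R by (field; lra).
  apply Cprod_geom_exp; auto; [apply Rmult_le_pos; [lra|apply Hp]|].
  intros k _; eapply Rle_trans; [apply (inv_one_sub_bound _ c); auto|].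
  apply exp_le_mono.
  replace (c / (1 - c) * r ^ j * r ^ k)%R with (c * r ^ j * r ^ k / (1 - c))%R by (field; lra).
  unfold Rdiv; apply Rmult_le_compat_r; [left; apply Rinv_0_lt_compat; lra|apply Hs].
Qed.

Lemma dpoch_inv_bound (z x y : C) (c r : R) : (0 <= r < 1)%R -> (c < 1)%R -> (Cmod z <= c)%R -> (Cmod x <= r)%R -> (Cmod y <= r)%R ->
  dpoch z x y <> 0 /\ (Cmod (/ dpoch z x y) <= exp (c / (1 - c) / (1 - r) / (1 - r)))%R.
Proof.
  intros Hr Hc Hz Hx Hy.
  set (K := exp (c / (1 - c) / (1 - r) / (1 - r))).
  assert (HK : (0 < K)%R) by apply exp_pos.
  assert (Hlow : forall N, (/ K <= Cmod (dprt N z x y))%R).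
  { intros N; destruct (dprt_inv_bound N z x y c r) as [A B]; auto; fold K in B.
    rewrite Cmod_inv in B by assumption.
    rewrite <- (Rinv_inv (Cmod (dprt N z x y))); apply Rinv_le_contravar; [|exact B].
    apply Rinv_0_lt_compat; now apply Cmod_gt_0. }
  assert (H0 : (/ K <= Cmod (dpoch z x y))%R).
  { apply Rnot_lt_le; intros Hlt.
    destruct (proj1 (Ccvg_eps _ _) (dprt_cvg z x y ltac:(lra) ltac:(lra)) (/ K - Cmod (dpoch z x y))%R ltac:(lra)) as [N HN].
    specialize (HN N (le_n _)); specialize (Hlow N).
    generalize (Cmod_rev_triangle (dprt N z x y) (dpoch z x y)); lra. }
  assert (Hne : dpoch z x y <> 0) by (apply Cmod_gt_0; generalize (Rinv_0_lt_compat K HK); lra).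
  split; [exact Hne|]; rewrite Cmod_inv by assumption.
  rewrite <- (Rinv_inv K); apply Rinv_le_contravar; [now apply Rinv_0_lt_compat|exact H0].
Qed.

Lemma dpoch_neq_0_small (z x y : C) : (Cmod z < 1)%R -> (Cmod x < 1)%R -> (Cmod y < 1)%R -> dpoch z x y <> 0.
Proof.
  intros Hz Hx Hy; destruct (two_bounds x y Hx Hy) as [r [Hr [H1 H2]]].
  apply (dpoch_inv_bound z x y (Cmod z) r); auto; lra.
Qed.

Lemma qpoch_neq_0_small (z y : C) : (Cmod z < 1)%R -> (Cmod y < 1)%R -> qpoch z y <> 0.
Proof.
  intros Hz Hy H; apply (dpoch_neq_0_small z 0 y); auto; [rewrite Cmod_0; lra|].
  rewrite dpoch_step, H by (rewrite ?Cmod_0; lra); ring.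
Qed.

Lemma pow_small (z x : C) : (Cmod x < 1)%R -> exists n, (Cmod (z * x ^ n) < 1)%R.
Proof.
  intros Hx.
  assert (H := lim_geom (Cmod z) (Cmod x) (conj (Cmod_ge_0 _) Hx)); apply is_lim_seq_spec in H.
  destruct (H (mkposreal 1 Rlt_0_1)) as [N HN]; exists N; specialize (HN N (le_n _)); simpl in HN.
  rewrite Rminus_0_r in HN; rewrite Cmod_mult, Cmod_pow; eapply Rle_lt_trans; [apply Rle_abs|exact HN].
Qed.

Lemma qpoch_zero (z y : C) : (Cmod y < 1)%R -> qpoch z y = 0 -> exists k, 1 - z * y ^ k = 0.
Proof.
  intros Hy; destruct (pow_small z y Hy) as [n Hn]; revert z Hn; induction n as [|n IH]; intros z Hn H0.
  - exfalso; apply (qpoch_neq_0_small z y); auto; rewrite <- (Cmult_1_r z); exact Hn.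
  - rewrite qpoch_step in H0 by assumption; apply Cmult_integral in H0; destruct H0 as [H0|H0].
    + exists O; simpl; rewrite Cmult_1_r; exact H0.
    + destruct (IH (z * y)) as [k Hk]; auto.
      * rewrite <- Cmult_assoc; exact Hn.
      * exists (S k); simpl; rewrite Cmult_assoc; exact Hk.
Qed.

Lemma dpoch_zero (z x y : C) : (Cmod x < 1)%R -> (Cmod y < 1)%R -> dpoch z x y = 0 -> exists j k, 1 - z * x ^ j * y ^ k = 0.
Proof.
  intros Hx Hy; destruct (pow_small z x Hx) as [n Hn]; revert z Hn; induction n as [|n IH]; intros z Hn H0.
  - exfalso; apply (dpoch_neq_0_small z x y); auto; rewrite <- (Cmult_1_r z); exact Hn.
  - rewrite dpoch_step in H0 by assumption; apply Cmult_integral in H0; destruct H0 as [H0|H0].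
    + destruct (qpoch_zero z y Hy H0) as [k Hk]; exists O, k; simpl; rewrite Cmult_1_r; exact Hk.
    + destruct (IH (z * x)) as [j [k Hk]]; auto.
      * rewrite <- Cmult_assoc; exact Hn.
      * exists (S j), k; simpl; rewrite Cmult_assoc; exact Hk.
Qed.

(** * Theta and elliptic gamma functions *)

Definition theta (z p : C) : C := qpoch z p * qpoch (p / z) p.

Definition egamma (z x y : C) : C := dpoch (x * y / z) x y / dpoch z x y.

Lemma theta_shift (z p : C) : (Cmod p < 1)%R -> z <> 0 -> p <> 0 -> theta (p * z) p = - (theta z p / z).
Proof.
  intros Hp Hz Hp0; unfold theta.
  replace (p / (p * z)) with (/ z) by (field; auto).
  rewrite (qpoch_step z p), (qpoch_step (/ z) p) by assumption.
  replace (z * p) with (p * z) by ring; replace (/ z * p) with (p / z) by (field; auto).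
  field; auto.
Qed.

Lemma theta_inv (z p : C) : (Cmod p < 1)%R -> z <> 0 -> theta (/ z) p = - (theta z p / z).
Proof.
  intros Hp Hz; unfold theta.
  replace (p / / z) with (z * p) by (field; auto).
  rewrite (qpoch_step z p), (qpoch_step (/ z) p) by assumption.
  replace (/ z * p) with (p / z) by (field; auto).
  field; auto.
Qed.

Lemma theta_1 (p : C) : (Cmod p < 1)%R -> theta 1 p = 0.
Proof. intros Hp; unfold theta; rewrite qpoch_step by assumption; ring. Qed.

Lemma theta_neq_0 (z p : C) : (Cmod p < 1)%R -> (Cmod p < Cmod z < 1)%R -> theta z p <> 0.
Proof.
  intros Hp [H1 H2]; assert (Hz : z <> 0) by (apply Cmod_gt_0; eapply Rle_lt_trans; [apply Cmod_ge_0|exact H1]).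
  assert (Hz' : (0 < Cmod z)%R) by now apply Cmod_gt_0.
  apply Cmult_neq_0; apply qpoch_neq_0_small; auto.
  rewrite Cmod_div by assumption; apply Rmult_lt_reg_r with (Cmod z); [exact Hz'|].
  unfold Rdiv; rewrite Rmult_assoc, Rinv_l; lra.
Qed.

Lemma egamma_shift (z x y : C) : (Cmod x < 1)%R -> (Cmod y < 1)%R -> z <> 0 -> x <> 0 -> dpoch z x y <> 0 ->
  egamma (x * z) x y = theta z y * egamma z x y.
Proof.
  intros Hx Hy Hz Hx0 Hd; unfold egamma, theta.
  replace (x * y / (x * z)) with (y / z) by (field; auto).
  rewrite (dpoch_step z x y) in Hd |- * by assumption.
  rewrite (dpoch_step (y / z) x y) by assumption.
  replace (z * x) with (x * z) in * by ring; replace (y / z * x) with (x * y / z) by (field; auto).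
  assert (qpoch z y <> 0) by (intros E; apply Hd; rewrite E; ring).
  assert (dpoch (x * z) x y <> 0) by (intros E; apply Hd; rewrite E; ring).
  field; auto.
Qed.

(** * Uniform approximation by an algebra of functions *)

Definition uapp {T : Type} (S : (T -> C) -> Prop) (K : T -> Prop) (f : T -> C) : Prop :=
  forall eps : R, (0 < eps)%R -> exists P, S P /\ forall x, K x -> (Cmod (f x - P x) <= eps)%R.

Definition is_alg {T : Type} (S : (T -> C) -> Prop) (K : T -> Prop) : Prop :=
  (forall c, S (fun _ => c)) /\
  (forall f g, S f -> S g -> S (fun x => f x + g x)) /\
  (forall f g, S f -> S g -> S (fun x => f x * g x)) /\
  (forall f, S f -> exists M : R, forall x, K x -> (Cmod (f x) <= M)%R).

Lemma uapp_in {T : Type} (S : (T -> C) -> Prop) (K : T -> Prop) (f : T -> C) : S f -> uapp S K f.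
Proof.
  intros H eps He; exists f; split; [exact H|]; intros x _.
  replace (f x - f x) with (RtoC 0) by ring; rewrite Cmod_0; lra.
Qed.

Lemma uapp_ext {T : Type} (S : (T -> C) -> Prop) (K : T -> Prop) (f g : T -> C) :
  (forall x, K x -> f x = g x) -> uapp S K f -> uapp S K g.
Proof.
  intros H Hf eps He; destruct (Hf eps He) as [P [HP HPf]]; exists P; split; [exact HP|].
  intros x Hx; rewrite <- H by assumption; auto.
Qed.

Lemma uapp_sub {T : Type} (S : (T -> C) -> Prop) (K L : T -> Prop) (f : T -> C) :
  (forall x, L x -> K x) -> uapp S K f -> uapp S L f.
Proof. intros H Hf eps He; destruct (Hf eps He) as [P [HP HPf]]; exists P; split; auto. Qed.

Lemma uapp_lim {T : Type} (S : (T -> C) -> Prop) (K : T -> Prop) (f : T -> C) :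
  (forall eps : R, (0 < eps)%R -> exists g, uapp S K g /\ forall x, K x -> (Cmod (f x - g x) <= eps)%R) -> uapp S K f.
Proof.
  intros H eps He; destruct (H (eps / 2)%R ltac:(lra)) as [g [Hg Hfg]].
  destruct (Hg (eps / 2)%R ltac:(lra)) as [P [HP HPg]]; exists P; split; [exact HP|].
  intros x Hx; eapply Rle_trans; [apply (Cmod_dist _ (g x))|]; specialize (Hfg x Hx); specialize (HPg x Hx); lra.
Qed.

Lemma uapp_seq {T : Type} (S : (T -> C) -> Prop) (K : T -> Prop) (f : T -> C) (g : nat -> T -> C) (b : nat -> R) :
  (forall n, uapp S K (g n)) -> is_lim_seq b 0%R -> (forall n x, K x -> (Cmod (f x - g n x) <= b n)%R) -> uapp S K f.
Proof.
  intros Hg Hb H; apply uapp_lim; intros eps He.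
  apply is_lim_seq_spec in Hb; destruct (Hb (mkposreal eps He)) as [N HN]; exists (g N); split; [apply Hg|].
  intros x Hx; specialize (HN N (le_n _)); simpl in HN; rewrite Rminus_0_r in HN.
  eapply Rle_trans; [apply H; exact Hx|]; generalize (Rle_abs (b N)); lra.
Qed.

Lemma uapp_const {T : Type} (S : (T -> C) -> Prop) (K : T -> Prop) (c : C) : is_alg S K -> uapp S K (fun _ => c).
Proof. intros [H _]; apply uapp_in, H. Qed.

Lemma uapp_plus {T : Type} (S : (T -> C) -> Prop) (K : T -> Prop) (f g : T -> C) :
  is_alg S K -> uapp S K f -> uapp S K g -> uapp S K (fun x => f x + g x).
Proof.
  intros [_ [HS _]] Hf Hg eps He.
  destruct (Hf (eps / 2)%R ltac:(lra)) as [P [HP HPf]]; destruct (Hg (eps / 2)%R ltac:(lra)) as [Q [HQ HQg]].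
  exists (fun x => P x + Q x); split; [auto|]; intros x Hx.
  replace (f x + g x - (P x + Q x)) with ((f x - P x) + (g x - Q x)) by ring.
  eapply Rle_trans; [apply Cmod_triangle|]; specialize (HPf x Hx); specialize (HQg x Hx); lra.
Qed.

Lemma uapp_bounded {T : Type} (S : (T -> C) -> Prop) (K : T -> Prop) (f : T -> C) :
  is_alg S K -> uapp S K f -> exists M : R, (0 < M)%R /\ forall x, K x -> (Cmod (f x) <= M)%R.
Proof.
  intros [_ [_ [_ HB]]] Hf; destruct (Hf 1%R ltac:(lra)) as [P [HP HPf]]; destruct (HB P HP) as [M HM].
  exists (Rabs M + 1)%R; split; [generalize (Rabs_pos M); lra|]; intros x Hx.
  specialize (HPf x Hx); specialize (HM x Hx); generalize (Cmod_triangle (f x - P x) (P x)) (Rle_abs M).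
  replace (f x - P x + P x) with (f x) by ring; lra.
Qed.

Lemma uapp_mult {T : Type} (S : (T -> C) -> Prop) (K : T -> Prop) (f g : T -> C) :
  is_alg S K -> uapp S K f -> uapp S K g -> uapp S K (fun x => f x * g x).
Proof.
  intros HA Hf Hg eps He.
  destruct (uapp_bounded S K f HA Hf) as [M [HM HMf]]; destruct (uapp_bounded S K g HA Hg) as [L [HL HLg]].
  set (e1 := Rmin 1 (eps / (M + L + 1))%R).
  assert (He1 : (0 < e1)%R) by (apply Rmin_pos; [lra|apply Rdiv_lt_0_compat; lra]).
  destruct (Hf e1 He1) as [P [HP HPf]]; destruct (Hg e1 He1) as [Q [HQ HQg]].
  exists (fun x => P x * Q x); split; [now apply HA|]; intros x Hx.
  specialize (HPf x Hx); specialize (HQg x Hx); specialize (HMf x Hx); specialize (HLg x Hx).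
  eapply Rle_trans; [apply Cmod_mult_sub|].
  assert (HPx : (Cmod (P x) <= M + 1)%R).
  { generalize (Cmod_triangle (P x - f x) (f x)); replace (P x - f x + f x) with (P x) by ring.
    rewrite (Cmod_sub_sym (P x)); assert (e1 <= 1)%R by apply Rmin_l; lra. }
  assert (E : (e1 * (M + L + 1) <= eps)%R).
  { assert (e1 <= eps / (M + L + 1))%R by apply Rmin_r.
    apply Rmult_le_compat_r with (r := (M + L + 1)%R) in H; [|lra].
    unfold Rdiv in H; rewrite Rmult_assoc, Rinv_l in H; lra. }
  apply Rle_trans with (e1 * L + (M + 1) * e1)%R; [|lra].
  apply Rplus_le_compat; apply Rmult_le_compat; auto; apply Cmod_ge_0.
Qed.

Lemma uapp_scal {T : Type} (S : (T -> C) -> Prop) (K : T -> Prop) (c : C) (f : T -> C) :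
  is_alg S K -> uapp S K f -> uapp S K (fun x => c * f x).
Proof. intros HA Hf; apply uapp_mult; auto; now apply uapp_const. Qed.

Lemma uapp_opp {T : Type} (S : (T -> C) -> Prop) (K : T -> Prop) (f : T -> C) :
  is_alg S K -> uapp S K f -> uapp S K (fun x => - f x).
Proof. intros HA Hf; apply uapp_ext with (fun x => - (1) * f x); [intros; ring|now apply uapp_scal]. Qed.

Lemma uapp_minus {T : Type} (S : (T -> C) -> Prop) (K : T -> Prop) (f g : T -> C) :
  is_alg S K -> uapp S K f -> uapp S K g -> uapp S K (fun x => f x - g x).
Proof. intros HA Hf Hg; unfold Cminus; apply uapp_plus; auto; now apply uapp_opp. Qed.

Lemma uapp_pow {T : Type} (S : (T -> C) -> Prop) (K : T -> Prop) (f : T -> C) (n : nat) :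
  is_alg S K -> uapp S K f -> uapp S K (fun x => f x ^ n).
Proof.
  intros HA Hf; induction n; simpl; [now apply uapp_const|now apply uapp_mult].
Qed.

Lemma uapp_Cprod {T : Type} (S : (T -> C) -> Prop) (K : T -> Prop) (n : nat) (f : nat -> T -> C) :
  is_alg S K -> (forall k, (k < n)%nat -> uapp S K (f k)) -> uapp S K (fun x => Cprod n (fun k => f k x)).
Proof.
  intros HA Hf; induction n; simpl; [now apply uapp_const|]; apply uapp_mult; auto.
Qed.


Lemma uapp_inv_one_sub {T : Type} (S : (T -> C) -> Prop) (K : T -> Prop) (f : T -> C) (r : R) :
  is_alg S K -> (0 <= r < 1)%R -> uapp S K f -> (forall x, K x -> (Cmod (f x) <= r)%R) -> uapp S K (fun x => / (1 - f x)).
Proof.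
  intros HA Hr Hf HB.
  apply (uapp_seq S K _ (fun n x => (1 - f x ^ n) / (1 - f x)) (fun n => / (1 - r) * r ^ n)%R).
  - intros n; induction n as [|n IH].
    + apply uapp_ext with (fun _ => 0); [|now apply uapp_const].
      intros x Hx; simpl; field; apply one_sub_neq_0; specialize (HB x Hx); lra.
    + apply uapp_ext with (fun x => (1 - f x ^ n) / (1 - f x) + f x ^ n).
      * intros x Hx; simpl; field; apply one_sub_neq_0; specialize (HB x Hx); lra.
      * apply uapp_plus; [exact HA|exact IH|now apply uapp_pow].
  - now apply lim_geom.
  - intros n x Hx; specialize (HB x Hx).
    assert (H0 : 1 - f x <> 0) by (apply one_sub_neq_0; lra).
    replace (/ (1 - f x) - (1 - f x ^ n) / (1 - f x)) with (/ (1 - f x) * f x ^ n) by (field; auto).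
    rewrite Cmod_mult, Cmod_inv, Cmod_pow by assumption.
    assert (H1 := one_sub_Cmod_lower _ _ HB).
    apply Rmult_le_compat.
    + left; apply Rinv_0_lt_compat; lra.
    + apply pow_le, Cmod_ge_0.
    + apply Rinv_le_contravar; lra.
    + apply pow_incr; split; [apply Cmod_ge_0|exact HB].
Qed.

Lemma uapp_qpoch {T : Type} (S : (T -> C) -> Prop) (K : T -> Prop) (z y : T -> C) (r : R) :
  is_alg S K -> (0 <= r < 1)%R -> uapp S K z -> uapp S K y -> (forall x, K x -> (Cmod (y x) <= r)%R) ->
  uapp S K (fun x => qpoch (z x) (y x)).
Proof.
  intros HA Hr Hz Hy HB; destruct (uapp_bounded S K z HA Hz) as [c [Hc Hzc]].
  eapply uapp_seq with (g := fun n x => qprt n (z x) (y x)).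
  - intros n; apply uapp_Cprod; [exact HA|]; intros k _.
    apply uapp_minus; [exact HA|now apply uapp_const|]; apply uapp_mult; auto; now apply uapp_pow.
  - apply (lim_geom (exp (c / (1 - r)) * c / (1 - r)) r); exact Hr.
  - intros n x Hx; rewrite Cmod_sub_sym; apply qpoch_approx; auto.
Qed.

Lemma uapp_dprt {T : Type} (S : (T -> C) -> Prop) (K : T -> Prop) (n : nat) (z x y : T -> C) :
  is_alg S K -> uapp S K z -> uapp S K x -> uapp S K y -> uapp S K (fun t => dprt n (z t) (x t) (y t)).
Proof.
  intros HA Hz Hx Hy; apply (uapp_Cprod S K n (fun j t => Cprod n (fun k => 1 - z t * x t ^ j * y t ^ k))); [exact HA|]; intros j _.
  apply uapp_Cprod; [exact HA|]; intros k _.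
  apply uapp_minus; [exact HA|now apply uapp_const|]; repeat apply uapp_mult; auto; now apply uapp_pow.
Qed.

Lemma uapp_dpoch {T : Type} (S : (T -> C) -> Prop) (K : T -> Prop) (z x y : T -> C) (r : R) :
  is_alg S K -> (0 <= r < 1)%R -> uapp S K z -> uapp S K x -> uapp S K y ->
  (forall t, K t -> (Cmod (x t) <= r)%R) -> (forall t, K t -> (Cmod (y t) <= r)%R) ->
  uapp S K (fun t => dpoch (z t) (x t) (y t)).
Proof.
  intros HA Hr Hz Hx Hy HBx HBy; destruct (uapp_bounded S K z HA Hz) as [c [Hc Hzc]].
  eapply uapp_seq with (g := fun n t => dprt n (z t) (x t) (y t)).
  - intros n; now apply uapp_dprt.
  - apply (lim_geom (dpoch_const c r) r); exact Hr.
  - intros n t Ht; rewrite Cmod_sub_sym; apply dpoch_approx; auto.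
Qed.

Lemma uapp_dpoch_inv {T : Type} (S : (T -> C) -> Prop) (K : T -> Prop) (z x y : T -> C) (c r : R) :
  is_alg S K -> (0 <= r < 1)%R -> (0 <= c < 1)%R -> uapp S K z -> uapp S K x -> uapp S K y -> (forall t, K t -> (Cmod (z t) <= c)%R) ->
  (forall t, K t -> (Cmod (x t) <= r)%R) -> (forall t, K t -> (Cmod (y t) <= r)%R) ->
  uapp S K (fun t => / dpoch (z t) (x t) (y t)).
Proof.
  intros HA Hr Hc Hz Hx Hy HBz HBx HBy.
  set (B := exp (c / (1 - c) / (1 - r) / (1 - r))).
  assert (HB : (0 < B)%R) by apply exp_pos.
  assert (Hfac : forall j k t, K t -> (Cmod (z t * x t ^ j * y t ^ k) <= c)%R).
  { intros j k t Ht; rewrite !Cmod_mult, !Cmod_pow.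
    assert (P : forall w n, (Cmod w <= r)%R -> (0 <= Cmod w ^ n <= 1)%R).
    { intros w n Hw; split; [apply pow_le, Cmod_ge_0|rewrite <- (pow1 n); apply pow_incr; split; [apply Cmod_ge_0|lra]]. }
    generalize (P _ j (HBx t Ht)) (P _ k (HBy t Ht)) (HBz t Ht) (Cmod_ge_0 (z t)); intros.
    assert (0 <= Cmod (x t) ^ j * Cmod (y t) ^ k <= 1)%R by nra; rewrite Rmult_assoc; nra. }
  apply (uapp_seq S K _ (fun n t => / dprt n (z t) (x t) (y t)) (fun n => B * B * dpoch_const c r * r ^ n)%R).
  - intros n; apply uapp_ext with (fun t => Cprod n (fun j => Cprod n (fun k => / (1 - z t * x t ^ j * y t ^ k)))).
    + intros t Ht; unfold dprt.
      assert (Hn : forall j k, 1 - z t * x t ^ j * y t ^ k <> 0)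
        by (intros j k; apply one_sub_neq_0; specialize (Hfac j k t Ht); lra).
      rewrite <- Cprod_inv.
      * apply Cprod_ext; intros j _; apply Cprod_inv; intros; apply Hn.
      * intros j _; apply Cprod_neq_0; intros; apply Hn.
    + apply (uapp_Cprod S K n (fun j t => Cprod n (fun k => / (1 - z t * x t ^ j * y t ^ k)))); [exact HA|]; intros j _.
      apply uapp_Cprod; [exact HA|]; intros k _.
      apply uapp_inv_one_sub with c; auto.
      repeat apply uapp_mult; auto; now apply uapp_pow.
  - now apply lim_geom.
  - intros n t Ht.
    destruct (dpoch_inv_bound (z t) (x t) (y t) c r) as [D1 D2]; auto; [lra|].
    destruct (dprt_inv_bound n (z t) (x t) (y t) c r) as [E1 E2]; auto; [lra|].
    fold B in D2, E2.
    replace (/ dpoch (z t) (x t) (y t) - / dprt n (z t) (x t) (y t))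
      with (/ dpoch (z t) (x t) (y t) * / dprt n (z t) (x t) (y t) * (dprt n (z t) (x t) (y t) - dpoch (z t) (x t) (y t)))
      by (field; auto).
    rewrite !Cmod_mult, (Rmult_assoc (B * B)).
    apply Rmult_le_compat; try apply Cmod_ge_0.
    + apply Rmult_le_pos; apply Cmod_ge_0.
    + apply Rmult_le_compat; auto; apply Cmod_ge_0.
    + apply dpoch_approx; auto.
Qed.

(** * The exponential as a uniform limit *)

Lemma Cexp_integral (w : C) : Cexp w - 1 = w * CI (fun t => Cexp (w * t)).
Proof.
  assert (D : forall x, Cder (fun t => Cexp (w * t)) x (w * Cexp (w * x))).
  { intros x; eapply Cder_eq; [apply (Cder_Cexp (fun t => w * t)), Cder_scal, Cder_id|]; ring. }
  assert (Hc : cont01 (fun t => Cexp (w * t))) by (apply Cder_cont01; intros; eexists; apply D).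
  rewrite <- CI_scal by assumption.
  rewrite (CI_FTC (fun t => Cexp (w * t))); [|intros; apply D|apply cont01_mult; [apply cont01_const|exact Hc]].
  rewrite Cmult_0_r, Cexp_0, Cmult_1_r; reflexivity.
Qed.

Lemma Cexp_minus_1_bound (w : C) : (Cmod w <= 1)%R -> (Cmod (Cexp w - 1) <= 2 * exp 1 * Cmod w)%R.
Proof.
  intros Hw; rewrite Cexp_integral, Cmod_mult, Rmult_comm; apply Rmult_le_compat_r; [apply Cmod_ge_0|].
  apply CI_bound.
  - apply Cder_cont01; intros; eexists; apply (Cder_Cexp (fun t => w * t)), Cder_scal, Cder_id.
  - intros x Hx; rewrite Cmod_Cexp; apply exp_le_mono.
    eapply Rle_trans; [apply Rle_abs|]; eapply Rle_trans; [apply re_le_Cmod|].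
    rewrite Cmod_mult, Cmod_R, Rabs_pos_eq by lra; generalize (Cmod_ge_0 w); nra.
Qed.

Lemma Cexp_taylor1 (w : C) : (Cmod w <= 1)%R -> (Cmod (Cexp w - 1 - w) <= 4 * exp 1 * (Cmod w * Cmod w))%R.
Proof.
  intros Hw.
  assert (Hc : cont01 (fun t => Cexp (w * t))) by (apply Cder_cont01; intros; eexists; apply (Cder_Cexp (fun t => w * t)), Cder_scal, Cder_id).
  replace (Cexp w - 1 - w) with (w * (CI (fun t => Cexp (w * t)) - CI (fun _ => 1)))
    by (rewrite CI_const, (Cexp_integral w); ring).
  rewrite Cmod_mult.
  apply Rle_trans with (Cmod w * (2 * (2 * exp 1 * Cmod w)))%R; [|lra].
  apply Rmult_le_compat_l; [apply Cmod_ge_0|].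
  apply CI_cont01_close; [exact Hc|apply cont01_const|].
  intros x Hx.
  assert (Hx' : (Cmod (w * x) <= Cmod w)%R).
  { rewrite Cmod_mult, Cmod_R, Rabs_pos_eq by lra; generalize (Cmod_ge_0 w); nra. }
  eapply Rle_trans; [apply Cexp_minus_1_bound; lra|].
  apply Rmult_le_compat_l; [generalize (exp_pos 1); lra|exact Hx'].
Qed.

Lemma Cpow_sub_bound (a b : C) (M : R) (n : nat) : (1 <= M)%R -> (Cmod a <= M)%R -> (Cmod b <= M)%R ->
  (Cmod (a ^ n - b ^ n) <= INR n * M ^ n * Cmod (a - b))%R.
Proof.
  intros HM Ha Hb; induction n as [|n IH].
  - simpl; replace (1 - 1) with (RtoC 0) by ring; rewrite Cmod_0; lra.
  - change (a ^ S n) with (a * a ^ n); change (b ^ S n) with (b * b ^ n).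
    eapply Rle_trans; [apply Cmod_mult_sub|].
    assert (P : (Cmod (a ^ n) <= M ^ n)%R) by (rewrite Cmod_pow; apply pow_incr; split; [apply Cmod_ge_0|exact Ha]).
    assert (Q : (1 <= M ^ n)%R) by (rewrite <- (pow1 n); apply pow_incr; lra).
    generalize (Cmod_ge_0 (a - b)) (Cmod_ge_0 b) (Cmod_ge_0 (a ^ n - b ^ n)) (pos_INR n); intros.
    rewrite S_INR; change (M ^ S n)%R with (M * M ^ n)%R.
    apply Rle_trans with (Cmod (a - b) * M ^ n + M * (INR n * M ^ n * Cmod (a - b)))%R.
    + apply Rplus_le_compat; [now apply Rmult_le_compat_l|]; apply Rmult_le_compat; auto.
    + revert Q H; generalize (M ^ n)%R (Cmod (a - b)); intros m d Q H.
      assert (d * m <= d * m * M)%R; [|lra].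
      rewrite <- (Rmult_1_r (d * m)) at 1; apply Rmult_le_compat_l; [apply Rmult_le_pos|]; lra.
Qed.

Lemma Cexp_euler (z : C) (c : R) (n : nat) : (Cmod z <= c)%R -> (c <= INR (S n))%R ->
  (Cmod (Cexp z - (1 + z / INR (S n)) ^ S n) <= exp c * (4 * exp 1 * (c * c)) * / INR (S n))%R.
Proof.
  intros Hz Hc; set (N := INR (S n)) in *.
  assert (HN : (0 < N)%R) by (unfold N; apply lt_0_INR; lia).
  assert (HN0 : RtoC N <> 0) by (intros H; apply (f_equal Re) in H; simpl in H; lra).
  set (w := z / N).
  assert (Hw : Cmod w = (Cmod z / N)%R) by (unfold w; rewrite Cmod_div, Cmod_R, Rabs_pos_eq by (auto; lra); reflexivity).
  assert (Hw1 : (Cmod w <= c / N)%R) by (rewrite Hw; apply Rmult_le_compat_r; [left; now apply Rinv_0_lt_compat|exact Hz]).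
  assert (HcN : (c / N <= 1)%R) by (apply Rmult_le_reg_r with N; [exact HN|]; unfold Rdiv; rewrite Rmult_assoc, Rinv_l; lra).
  assert (E : Cexp z = Cexp w ^ S n).
  { replace z with (N * w) by (unfold w; field; auto); unfold N.
    generalize (S n); intros m; induction m as [|m IH].
    - simpl; rewrite Cmult_0_l; apply Cexp_0.
    - rewrite S_INR, RtoC_plus; replace ((INR m + 1) * w) with (w + INR m * w) by ring.
      rewrite Cexp_plus, IH; reflexivity. }
  rewrite E; set (M := exp (c / N)).
  assert (HM : (1 + c / N <= M)%R) by apply exp_ineq1_le.
  assert (H0 : (0 <= c / N)%R) by (eapply Rle_trans; [apply Cmod_ge_0|exact Hw1]).
  eapply Rle_trans; [apply (Cpow_sub_bound _ _ M)|].
  - lra.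
  - rewrite Cmod_Cexp; apply exp_le_mono.
    eapply Rle_trans; [apply Rle_abs|]; eapply Rle_trans; [apply re_le_Cmod|exact Hw1].
  - eapply Rle_trans; [apply Cmod_triangle|]; rewrite Cmod_1; lra.
  - replace (Cexp w - (1 + w)) with (Cexp w - 1 - w) by ring.
    assert (HMn : (M ^ S n = exp c)%R).
    { unfold M; transitivity (exp (INR (S n) * (c / N))); [|f_equal; unfold N; field; apply Rgt_not_eq; exact HN].
      generalize (S n); intros m; induction m as [|m IH]; [simpl; rewrite Rmult_0_l, exp_0; reflexivity|].
      rewrite S_INR, Rmult_plus_distr_r, exp_plus, <- IH; simpl; rewrite Rmult_1_l; ring. }
    rewrite HMn; fold N.
    apply Rle_trans with (N * exp c * (4 * exp 1 * (c / N * (c / N))))%R.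
    + apply Rmult_le_compat_l; [apply Rmult_le_pos; [lra|left; apply exp_pos]|].
      eapply Rle_trans; [apply Cexp_taylor1; lra|].
      apply Rmult_le_compat_l; [generalize (exp_pos 1); lra|].
      apply Rmult_le_compat; auto; apply Cmod_ge_0.
    + right; field; lra.
Qed.

Lemma uapp_Cexp {T : Type} (S : (T -> C) -> Prop) (K : T -> Prop) (f : T -> C) :
  is_alg S K -> uapp S K f -> uapp S K (fun x => Cexp (f x)).
Proof.
  intros HA Hf; destruct (uapp_bounded S K f HA Hf) as [c [Hc Hfc]].
  destruct (INR_archimed 1 c ltac:(lra)) as [n0 Hn0].
  apply (uapp_seq S K _ (fun n x => (1 + f x / INR (Datatypes.S (n + n0))) ^ Datatypes.S (n + n0))
    (fun n => exp c * (4 * exp 1 * (c * c)) * / INR (Datatypes.S (n + n0)))%R).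
  - intros n; apply uapp_pow; [exact HA|]; apply uapp_plus; [exact HA|now apply uapp_const|].
    unfold Cdiv; apply uapp_mult; auto; now apply uapp_const.
  - replace (Finite 0) with (Finite (exp c * (4 * exp 1 * (c * c)) * 0)) by (f_equal; ring).
    apply (is_lim_seq_scal_l _ _ (Finite 0)).
    apply (is_lim_seq_incr_n (fun n => / INR (Datatypes.S n))%R n0).
    apply (is_lim_seq_incr_1 (fun n => / INR n)%R).
    apply (is_lim_seq_inv _ p_infty); [apply is_lim_seq_INR|discriminate].
  - intros n x Hx; apply Cexp_euler; [auto|].
    rewrite S_INR, plus_INR; generalize (pos_INR n); lra.
Qed.

Lemma uapp_e2pi {T : Type} (S : (T -> C) -> Prop) (K : T -> Prop) (f : T -> C) :
  is_alg S K -> uapp S K f -> uapp S K (fun x => e2pi (f x)).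
Proof. intros HA Hf; unfold e2pi; apply uapp_Cexp; [exact HA|]; now apply uapp_scal. Qed.

(** * Trigonometric polynomials on strips *)

Fixpoint teval (l : list (C * Z * Z)) (x : C * C) : C :=
  match l with
  | nil => 0
  | (c, n, m) :: l' => c * e2pi (IZR n * fst x + IZR m * snd x) + teval l' x
  end.

Definition trig (f : C * C -> C) : Prop := exists l, forall x, f x = teval l x.

Definition strip (a b c d : R) (x : C * C) : Prop := (a <= Im (fst x) <= b)%R /\ (c <= Im (snd x) <= d)%R.

Lemma trig_const (c : C) : trig (fun _ => c).
Proof.
  exists ((c, 0%Z, 0%Z) :: nil); intros x; simpl.
  replace (0 * fst x + 0 * snd x) with (RtoC 0) by ring; rewrite e2pi_0; ring.
Qed.

Lemma trig_plus (f g : C * C -> C) : trig f -> trig g -> trig (fun x => f x + g x).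
Proof.
  intros [l Hl] [k Hk]; exists (l ++ k); intros x; rewrite Hl, Hk; clear.
  induction l as [|[[c n] m] l IH]; simpl; [ring|rewrite <- IH; ring].
Qed.

Lemma trig_mult (f g : C * C -> C) : trig f -> trig g -> trig (fun x => f x * g x).
Proof.
  intros [l Hl] [k Hk].
  exists (flat_map (fun t => map (fun u => (fst (fst t) * fst (fst u), (snd (fst t) + snd (fst u))%Z, (snd t + snd u)%Z)) k) l).
  intros x; rewrite Hl, Hk; clear.
  induction l as [|[[c n] m] l IH]; simpl; [ring|].
  assert (Happ : forall a b, teval (a ++ b) x = teval a x + teval b x).
  { induction a as [|[[c' n'] m'] a IHa]; intros; simpl; [ring|rewrite IHa; ring]. }
  rewrite Happ, <- IH, Cmult_plus_distr_r; f_equal; clear.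
  induction k as [|[[c' n'] m'] k IH]; simpl; [ring|]; rewrite <- IH.
  rewrite !plus_IZR, !RtoC_plus.
  replace ((IZR n + IZR n') * fst x + (IZR m + IZR m') * snd x) with ((IZR n * fst x + IZR m * snd x) + (IZR n' * fst x + IZR m' * snd x)) by ring.
  rewrite (e2pi_plus (IZR n * fst x + IZR m * snd x)); ring.
Qed.

Lemma Im_lin (n m : R) (x : C * C) : Im (n * fst x + m * snd x) = (n * Im (fst x) + m * Im (snd x))%R.
Proof. destruct x as [[a b] [c d]]; simpl; ring. Qed.

Lemma trig_bounded (a b c d : R) (f : C * C -> C) : trig f -> exists M : R, forall x, strip a b c d x -> (Cmod (f x) <= M)%R.
Proof.
  intros [l Hl]; revert f Hl; induction l as [|[[e n] m] l IH]; intros f Hl.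
  - exists 0%R; intros x _; rewrite Hl; simpl; rewrite Cmod_0; lra.
  - destruct (IH (teval l)) as [M HM]; [reflexivity|].
    set (y := (- (Rabs (IZR n) * (Rabs a + Rabs b) + Rabs (IZR m) * (Rabs c + Rabs d)))%R).
    exists (Cmod e * exp (- (2 * PI * y)) + M)%R; intros x Hx; rewrite Hl; simpl.
    eapply Rle_trans; [apply Cmod_triangle|]; apply Rplus_le_compat; [|auto].
    rewrite Cmod_mult; apply Rmult_le_compat_l; [apply Cmod_ge_0|]; apply Cmod_e2pi_le.
    rewrite Im_lin; destruct Hx as [Hx1 Hx2].
    assert (B : forall k u v w, (u <= w <= v)%R -> (- (Rabs k * (Rabs u + Rabs v)) <= k * w)%R).
    { intros k u v w Hw.
      assert (Rabs w <= Rabs u + Rabs v)%R.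
      { unfold Rabs; destruct (Rcase_abs w), (Rcase_abs u), (Rcase_abs v); lra. }
      assert (Rabs (k * w) <= Rabs k * (Rabs u + Rabs v))%R.
      { rewrite Rabs_mult; apply Rmult_le_compat_l; [apply Rabs_pos|assumption]. }
      generalize (Rle_abs (- (k * w))); rewrite Rabs_Ropp; lra. }
    generalize (B (IZR n) _ _ _ Hx1) (B (IZR m) _ _ _ Hx2); unfold y; lra.
Qed.

Lemma trig_alg (a b c d : R) : is_alg trig (strip a b c d).
Proof.
  split; [apply trig_const|split; [apply trig_plus|split; [apply trig_mult|]]].
  intros f; apply trig_bounded.
Qed.

Lemma trig_e2pi (c : C) (n m : Z) : trig (fun x => c * e2pi (IZR n * fst x + IZR m * snd x)).
Proof. exists ((c, n, m) :: nil); intros x; simpl; ring. Qed.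

Lemma trig_cont01 (f : C * C -> C) (v w a b : C) : trig f -> cont01 (fun t => f (v + a * t, w + b * t)).
Proof.
  intros [l Hl]; apply cont01_ext with (fun t => teval l (v + a * t, w + b * t)); [intros; now rewrite Hl|]; clear Hl.
  induction l as [|[[c n] m] l IH]; simpl; [apply cont01_const|].
  apply cont01_plus; [|exact IH]; apply cont01_mult; [apply cont01_const|].
  apply cont01_ext with (fun t => e2pi ((IZR n * a + IZR m * b) * t + (IZR n * v + IZR m * w))); [intros; f_equal; ring|apply cont01_e2pi_lin].
Qed.

Lemma uapp_trig_cont01 (K : C * C -> Prop) (f : C * C -> C) (v w a b : C) : uapp trig K f ->
  (forall t : R, (0 <= t <= 1)%R -> K (v + a * t, w + b * t)) -> cont01 (fun t => f (v + a * t, w + b * t)).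
Proof.
  intros Hf HK; apply cont01_lim; intros eps He; destruct (Hf eps He) as [P [HP HPf]].
  exists (fun t => P (v + a * t, w + b * t)); split; [now apply trig_cont01|]; intros; apply HPf; auto.
Qed.

Definition coef (f : C -> C) (n : Z) (v : C) : C := CI (fun t => f (v + t) * e2pi (- (IZR n * (v + t)))).

Lemma CI_e2pi_shift (n : Z) (v : C) : CI (fun t => e2pi (IZR n * (v + t))) = if Z.eq_dec n 0 then 1 else 0.
Proof.
  destruct (Z.eq_dec n 0) as [->|Hn].
  - rewrite (CI_ext _ (fun _ => 1)); [apply CI_const|].
    intros t _; rewrite Cmult_0_l; apply e2pi_0.
  - rewrite (CI_ext _ (fun t => e2pi (IZR n * v) * e2pi (IZR n * t))).
    + rewrite CI_scal, CI_e2pi_int; [ring|exact Hn|].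
      apply cont01_ext with (fun t => e2pi (IZR n * t + 0)); [intros; f_equal; ring|apply cont01_e2pi_lin].
    + intros t _; rewrite <- e2pi_plus; f_equal; ring.
Qed.

Lemma cont01_shift_e2pi (n : Z) (v : C) : cont01 (fun t => e2pi (- (IZR n * (v + t)))).
Proof. apply cont01_ext with (fun t => e2pi (- IZR n * t + (- (IZR n * v)))); [intros; f_equal; ring|apply cont01_e2pi_lin]. Qed.

Lemma trig_coef (f : C * C -> C) (n : Z) (v v' w : C) : trig f ->
  coef (fun s => f (s, w)) n v = coef (fun s => f (s, w)) n v'.
Proof.
  intros [l Hl].
  assert (E : forall u, coef (fun s => f (s, w)) n u = coef (fun s => teval l (s, w)) n u)
    by (intros; apply CI_ext; intros; now rewrite Hl).
  rewrite !E; clear E Hl; induction l as [|[[c k] m] l IH].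
  - unfold coef; simpl; apply f_equal; apply functional_extensionality; intros; ring.
  - assert (S : forall u, coef (fun s => teval ((c, k, m) :: l) (s, w)) n u =
       c * e2pi (IZR m * w) * (if Z.eq_dec (k - n) 0 then 1 else 0) + coef (fun s => teval l (s, w)) n u).
    { intros u; rewrite <- (CI_e2pi_shift (k - n) u); unfold coef.
      assert (C1 : cont01 (fun t => e2pi (IZR (k - n) * (u + t)))).
      { apply cont01_ext with (fun t => e2pi (IZR (k - n) * t + IZR (k - n) * u)); [intros; f_equal; ring|apply cont01_e2pi_lin]. }
      rewrite <- CI_scal, <- CI_plus; auto.
      - apply CI_ext; intros t _; simpl; rewrite Cmult_plus_distr_r; f_equal.
        rewrite <- !Cmult_assoc, <- !e2pi_plus; do 2 f_equal; rewrite minus_IZR, RtoC_minus; ring.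
      - apply cont01_mult; [apply cont01_const|exact C1].
      - apply cont01_mult; [|apply cont01_shift_e2pi].
        apply cont01_ext with (fun t => teval l (u + 1 * t, w + 0 * t)); [intros; do 2 f_equal; ring|].
        apply trig_cont01; exists l; reflexivity. }
    rewrite !S, IH; reflexivity.
Qed.

Lemma uapp_coef (a b c d : R) (f : C * C -> C) (n : Z) (v v' w : C) : uapp trig (strip a b c d) f ->
  (a <= Im v <= b)%R -> (a <= Im v' <= b)%R -> (c <= Im w <= d)%R ->
  coef (fun s => f (s, w)) n v = coef (fun s => f (s, w)) n v'.
Proof.
  intros Hf Hv Hv' Hw; apply Cmod_small_eq; intros eps He.
  assert (HB : exists B : R, (0 < B)%R /\ forall u t, (u = v \/ u = v') -> (Cmod (e2pi (- (IZR n * (u + RtoC t)))) <= B)%R).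
  { exists (Cmod (e2pi (- (IZR n * v))) + Cmod (e2pi (- (IZR n * v'))))%R.
    assert (forall z, (0 < Cmod (e2pi z))%R) by (intros; apply Cmod_gt_0, e2pi_neq_0).
    split; [apply Rplus_lt_0_compat; auto|].
    intros u t Hu; replace (- (IZR n * (u + t))) with (- (IZR n * u) + RtoC (- IZR n * t)) by (rewrite RtoC_mult, RtoC_opp; ring).
    rewrite e2pi_plus, Cmod_mult.
    replace (Cmod (e2pi (RtoC (- IZR n * t)))) with 1%R.
    - generalize (H (- (IZR n * v))) (H (- (IZR n * v'))); destruct Hu as [-> | ->]; lra.
    - rewrite Cmod_e2pi; simpl; rewrite Rmult_0_r, Ropp_0, exp_0; reflexivity. }
  destruct HB as [B [HB HBb]].
  destruct (Hf (eps / (4 * B))%R) as [P [HP HPf]]; [apply Rdiv_lt_0_compat; lra|].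
  assert (Hin : forall u t, (u = v \/ u = v') -> strip a b c d (u + RtoC t, w)).
  { intros u t Hu; split; simpl; [|exact Hw]; destruct Hu as [-> | ->]; unfold Im in *; lra. }
  assert (HC : forall u, (u = v \/ u = v') -> (Cmod (coef (fun s => f (s, w)) n u - coef (fun s => P (s, w)) n u) <= eps / 2)%R).
  { intros u Hu; replace (eps / 2)%R with (2 * (eps / (4 * B) * B))%R by (field; lra).
    apply CI_cont01_close.
    - apply cont01_mult; [|apply cont01_shift_e2pi].
      apply cont01_ext with (fun t => f (u + 1 * t, w + 0 * t)); [intros; do 2 f_equal; ring|].
      apply (uapp_trig_cont01 (strip a b c d)); [exact Hf|]; intros t _.
      replace (u + 1 * t) with (u + t) by ring; replace (w + 0 * t) with w by ring; auto.
    - apply cont01_mult; [|apply cont01_shift_e2pi].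
      apply cont01_ext with (fun t => P (u + 1 * t, w + 0 * t)); [intros; do 2 f_equal; ring|now apply trig_cont01].
    - intros t _; replace (f (u + t, w) * e2pi (- (IZR n * (u + t))) - P (u + t, w) * e2pi (- (IZR n * (u + t))))
        with ((f (u + t, w) - P (u + t, w)) * e2pi (- (IZR n * (u + t)))) by ring.
      rewrite Cmod_mult; apply Rmult_le_compat; try apply Cmod_ge_0; auto. }
  eapply Rle_trans; [apply (Cmod_dist _ (coef (fun s => P (s, w)) n v))|].
  rewrite (trig_coef P n v v' w HP) at 2.
  generalize (HC v (or_introl eq_refl)) (HC v' (or_intror eq_refl)).
  rewrite (Cmod_sub_sym (coef (fun s => P (s, w)) n v')); lra.
Qed.

Lemma uapp_line_cont01 (a b c d : R) (f : C * C -> C) (v w : C) : uapp trig (strip a b c d) f ->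
  (a <= Im v <= b)%R -> (c <= Im w <= d)%R -> cont01 (fun t => f (v + t, w)).
Proof.
  intros Hf Hv Hw; apply cont01_ext with (fun t => f (v + 1 * t, w + 0 * t)); [intros; do 2 f_equal; ring|].
  apply (uapp_trig_cont01 (strip a b c d)); [exact Hf|]; intros t _; split; unfold Im in *; simpl; lra.
Qed.

(* Fourier coefficients do not depend on the line, so their vanishing on one
   line is the identity theorem for the strip. *)
Lemma uapp_unique (a b c d : R) (f : C * C -> C) (v w : C) : uapp trig (strip a b c d) f ->
  (a <= Im v <= b)%R -> (c <= Im w <= d)%R -> (forall n, coef (fun s => f (s, w)) n v = 0) ->
  forall s, (a <= Im s <= b)%R -> f (s, w) = 0.
Proof.
  intros Hf Hv Hw Hn s Hs.
  set (v' := s - RtoC (1/2)).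
  assert (Hv' : (a <= Im v' <= b)%R) by (unfold v', Im in *; simpl; lra).
  assert (Hc : cont01 (fun t => f (v' + t, w))) by (now apply (uapp_line_cont01 a b c d)).
  assert (H := fourier_uniqueness (fun t => f (v' + t, w)) Hc).
  replace s with (v' + RtoC (1/2)) by (unfold v'; ring); apply H; [|lra].
  intros n; specialize (Hn (- n)%Z); rewrite (uapp_coef a b c d f (- n) v v' w) in Hn by assumption.
  unfold coef in Hn.
  rewrite (CI_ext _ (fun t => e2pi (IZR n * v') * (f (v' + t, w) * e2pi (IZR n * t)))) in Hn.
  - rewrite CI_scal in Hn.
    + apply Cmult_integral in Hn; destruct Hn as [Hn|Hn]; [now apply e2pi_neq_0 in Hn|exact Hn].
    + apply cont01_mult; [exact Hc|].
      apply cont01_ext with (fun t => e2pi (IZR n * t + 0)); [intros; f_equal; ring|apply cont01_e2pi_lin].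
  - intros t _; rewrite opp_IZR, RtoC_opp.
    replace (- (- IZR n * (v' + t))) with (IZR n * v' + IZR n * t) by ring; rewrite e2pi_plus; ring.
Qed.

Lemma uapp_CI (a b c d : R) (f : C * C -> C) (w : C) : uapp trig (strip a b c d) f -> (c <= Im w <= d)%R ->
  uapp trig (strip a b c d) (fun x => CI (fun t => f (fst x, w + t))).
Proof.
  intros Hf Hw eps He; destruct (Hf (eps / 2)%R ltac:(lra)) as [P [HP HPf]].
  assert (Hl : forall x t, strip a b c d x -> strip a b c d (fst x, w + RtoC t)).
  { intros x t [Hx _]; split; [exact Hx|]; unfold Im in *; simpl; lra. }
  exists (fun x => CI (fun t => P (fst x, w + t))); split.
  - destruct HP as [l Hl'].
    exists (map (fun t => (fst (fst t) * (e2pi (- (IZR (snd t) * w)) * (e2pi (IZR (snd t) * w) * (if Z.eq_dec (snd t) 0 then 1 else 0))), snd (fst t), 0%Z)) l).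
    intros x; rewrite (CI_ext _ (fun t => teval l (fst x, w + t))) by (intros; apply Hl'); clear Hl'.
    induction l as [|[[e n] m] l IH]; simpl; [apply CI_const|].
    rewrite CI_plus.
    + rewrite IH; f_equal.
      rewrite (CI_ext _ (fun t => e * e2pi (IZR n * fst x) * e2pi (IZR m * (w + t)))) by (intros; rewrite <- Cmult_assoc, <- e2pi_plus; reflexivity).
      rewrite CI_scal, CI_e2pi_shift.
      * replace (IZR n * fst x + 0 * snd x) with (IZR n * fst x) by ring.
        rewrite (Cmult_assoc (e2pi (- _))), <- e2pi_plus.
        replace (- (IZR m * w) + IZR m * w) with (RtoC 0) by ring; rewrite e2pi_0; ring.
      * apply cont01_ext with (fun t => e2pi (IZR m * t + IZR m * w)); [intros; f_equal; ring|apply cont01_e2pi_lin].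
    + apply cont01_mult; [apply cont01_const|].
      apply cont01_ext with (fun t => e2pi (IZR m * t + (IZR n * fst x + IZR m * w))); [intros; f_equal; ring|apply cont01_e2pi_lin].
    + apply cont01_ext with (fun t => teval l (fst x + 0 * t, w + 1 * t)); [intros; do 2 f_equal; ring|].
      apply trig_cont01; exists l; reflexivity.
  - intros x Hx; replace eps with (2 * (eps / 2))%R by field.
    apply CI_cont01_close.
    + apply cont01_ext with (fun t => f (fst x + 0 * t, w + 1 * t)); [intros; do 2 f_equal; ring|].
      apply (uapp_trig_cont01 (strip a b c d)); [exact Hf|]; intros t _.
      replace (fst x + 0 * t) with (fst x) by ring; replace (w + 1 * t) with (w + t) by ring; auto.
    + apply cont01_ext with (fun t => P (fst x + 0 * t, w + 1 * t)); [intros; do 2 f_equal; ring|now apply trig_cont01].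
    + intros t _; apply HPf; auto.
Qed.

(** * Polynomial approximation on discs *)

Fixpoint peval (l : list C) (z : C) : C := match l with nil => 0 | c :: l' => c + z * peval l' z end.

Definition pol (f : C -> C) : Prop := exists l, forall z, f z = peval l z.

Definition disc (a : C) (R0 : R) (z : C) : Prop := (Cmod (z - a) <= R0)%R.

Lemma pol_ext (f g : C -> C) : (forall z, f z = g z) -> pol f -> pol g.
Proof. intros H [l Hl]; exists l; intros z; rewrite <- H; apply Hl. Qed.

Lemma pol_const (c : C) : pol (fun _ => c).
Proof. exists (c :: nil); intros z; simpl; ring. Qed.

Lemma pol_shift (c : C) (f : C -> C) : pol f -> pol (fun z => c + z * f z).
Proof. intros [l Hl]; exists (c :: l); intros z; simpl; now rewrite Hl. Qed.

Lemma pol_ind (Q : (C -> C) -> Prop) : (forall f g, (forall z, f z = g z) -> Q f -> Q g) -> Q (fun _ => 0) ->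
  (forall c f, pol f -> Q f -> Q (fun z => c + z * f z)) -> forall f, pol f -> Q f.
Proof.
  intros He H0 HS f [l Hl]; apply He with (peval l); [intros; symmetry; apply Hl|]; clear Hl f.
  induction l as [|c l IH]; simpl; [exact H0|apply HS; [exists l; reflexivity|exact IH]].
Qed.

Lemma pol_plus (f g : C -> C) : pol f -> pol g -> pol (fun z => f z + g z).
Proof.
  intros [l Hl] [k Hk]; apply pol_ext with (fun z => peval l z + peval k z); [intros; now rewrite Hl, Hk|].
  clear; revert k; induction l as [|c l IH]; intros k; simpl.
  - exists k; intros; ring.
  - destruct k as [|d k]; simpl; [exists (c :: l); intros; simpl; ring|].
    apply pol_ext with (fun z => (c + d) + z * (peval l z + peval k z)); [intros; ring|apply pol_shift, IH].
Qed.

Lemma pol_scal (c : C) (f : C -> C) : pol f -> pol (fun z => c * f z).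
Proof.
  revert f; apply pol_ind.
  - intros f g H; apply pol_ext; intros; now rewrite H.
  - apply pol_ext with (fun _ => 0); [intros; ring|apply pol_const].
  - intros d f _ Hf; apply pol_ext with (fun z => c * d + z * (c * f z)); [intros; ring|now apply pol_shift].
Qed.

Lemma pol_mult (f g : C -> C) : pol f -> pol g -> pol (fun z => f z * g z).
Proof.
  intros Hf Hg; revert f Hf; apply pol_ind.
  - intros f h H; apply pol_ext; intros; now rewrite H.
  - apply pol_ext with (fun _ => 0); [intros; ring|apply pol_const].
  - intros c f _ Hf; apply pol_ext with (fun z => c * g z + (0 + z * (f z * g z))); [intros; ring|].
    apply pol_plus; [now apply pol_scal|now apply pol_shift].
Qed.

Lemma pol_id : pol (fun z => z).
Proof. apply pol_ext with (fun z => 0 + z * 1); [intros; ring|apply pol_shift, pol_const]. Qed.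

Lemma pol_alg (a : C) (R0 : R) : is_alg pol (disc a R0).
Proof.
  split; [apply pol_const|split; [apply pol_plus|split; [apply pol_mult|]]].
  apply pol_ind.
  - intros f g H [M HM]; exists M; intros; rewrite <- H; auto.
  - exists 0%R; intros; rewrite Cmod_0; lra.
  - intros c f _ [M HM]; exists (Cmod c + (Cmod a + R0) * M)%R; intros z Hz.
    eapply Rle_trans; [apply Cmod_triangle|]; apply Rplus_le_compat_l; rewrite Cmod_mult.
    apply Rmult_le_compat; try apply Cmod_ge_0; [|auto].
    unfold disc in Hz; generalize (Cmod_triangle (z - a) a); replace (z - a + a) with z by ring; lra.
Qed.

Lemma pol_comp_add (f : C -> C) (a : C) : pol f -> pol (fun h => f (a + h)).
Proof.
  revert f; apply pol_ind.
  - intros f g H; apply pol_ext; intros; now rewrite H.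
  - apply pol_const.
  - intros c f _ Hf; apply pol_plus; [apply pol_const|]; apply pol_mult; [|exact Hf].
    apply pol_plus; [apply pol_const|apply pol_id].
Qed.

Lemma uapp_pol_comp_add (f : C -> C) (a b : C) (R0 r : R) : uapp pol (disc a R0) f -> (Cmod (b - a) + r <= R0)%R ->
  uapp pol (disc 0 r) (fun h => f (b + h)).
Proof.
  intros Hf Hr eps He; destruct (Hf eps He) as [P [HP HPf]].
  exists (fun h => P (b + h)); split; [now apply pol_comp_add|]; intros h Hh; apply HPf.
  unfold disc in *; replace (b + h - a) with ((b - a) + (h - 0)) by ring.
  eapply Rle_trans; [apply Cmod_triangle|lra].
Qed.

Lemma pol_trig (f : C -> C) (a r : C) : pol f -> trig (fun x => f (a + r * e2pi (fst x))).
Proof.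
  revert f; apply pol_ind.
  - intros f g H [l Hl]; exists l; intros; rewrite <- H; apply Hl.
  - apply trig_const.
  - intros c f _ Hf; apply trig_plus; [apply trig_const|]; apply trig_mult; [|exact Hf].
    apply trig_plus; [apply trig_const|].
    destruct (trig_e2pi r 1 0) as [l Hl]; exists l; intros x; rewrite <- Hl; do 2 f_equal; ring.
Qed.

Lemma CI_peval (l : list C) (r : R) (k : nat) :
  CI (fun t => peval l (r * e2pi t) * e2pi (- (INR k * t))) = RtoC (r ^ k) * nth k l 0 /\
  CI (fun t => peval l (r * e2pi t) * e2pi (INR (S k) * t)) = 0.
Proof.
  assert (Hc : forall l n, cont01 (fun t => peval l (r * e2pi t) * e2pi (IZR n * t))).
  { intros m n; apply cont01_mult.
    - destruct (pol_trig (peval m) 0 r) as [q Hq]; [exists m; reflexivity|].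
      apply cont01_ext with (fun t => teval q (0 + 1 * t, 0 + 0 * t)).
      + intros t _; rewrite <- Hq; simpl; f_equal; rewrite Cplus_0_l; f_equal; f_equal; ring.
      + apply trig_cont01; exists q; reflexivity.
    - apply cont01_ext with (fun t => e2pi (IZR n * t + 0)); [intros; f_equal; ring|apply cont01_e2pi_lin]. }
  assert (He : forall n, cont01 (fun t => e2pi (IZR n * t))).
  { intros n; apply cont01_ext with (fun t => e2pi (IZR n * t + 0)); [intros; f_equal; ring|apply cont01_e2pi_lin]. }
  assert (Hstep : forall c m (n : Z), CI (fun t => peval (c :: m) (r * e2pi t) * e2pi (IZR n * t)) =
     c * (if Z.eq_dec n 0 then 1 else 0) + r * CI (fun t => peval m (r * e2pi t) * e2pi (IZR (n + 1) * t))).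
  { intros c m n; rewrite <- (CI_e2pi_shift n 0).
    rewrite <- !CI_scal, <- CI_plus.
    - apply CI_ext; intros t _; simpl; rewrite plus_IZR, RtoC_plus, Cplus_0_l.
      replace ((IZR n + 1) * t) with (t + IZR n * t) by ring; rewrite e2pi_plus; ring.
    - apply cont01_mult; [apply cont01_const|]; apply cont01_ext with (fun t => e2pi (IZR n * t)); [intros; f_equal; ring|auto].
    - apply cont01_mult; [apply cont01_const|auto].
    - auto.
    - apply cont01_ext with (fun t => e2pi (IZR n * t)); [intros; f_equal; ring|auto]. }
  assert (Hneg : forall k l, CI (fun t => peval l (r * e2pi t) * e2pi (IZR (- Z.of_nat k) * t)) = RtoC (r ^ k) * nth k l 0).
  { assert (Hpos : forall m (n : Z), (0 < n)%Z -> CI (fun t => peval m (r * e2pi t) * e2pi (IZR n * t)) = 0).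
    { induction m as [|c m IH]; intros n Hn.
      - rewrite (CI_ext _ (fun _ => 0)) by (intros; simpl; ring); apply CI_const.
      - rewrite Hstep, IH by lia; destruct (Z.eq_dec n 0); [lia|ring]. }
    intros k'; induction k' as [|k' IH]; intros [|c m].
    - rewrite (CI_ext _ (fun _ => 0)) by (intros; simpl; ring); rewrite CI_const; simpl; ring.
    - rewrite Hstep, Hpos by lia; simpl; ring.
    - rewrite (CI_ext _ (fun _ => 0)) by (intros; simpl; ring); rewrite CI_const; simpl; ring.
    - rewrite Hstep; replace (- Z.of_nat (S k') + 1)%Z with (- Z.of_nat k')%Z by lia; rewrite IH.
      destruct (Z.eq_dec (- Z.of_nat (S k')) 0); [lia|].
      change (r ^ S k')%R with (r * r ^ k')%R; rewrite RtoC_mult; simpl nth; ring. }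
  split.
  - rewrite <- Hneg; apply CI_ext; intros t _; do 2 f_equal; rewrite opp_IZR, RtoC_opp, <- INR_IZR_INZ; ring.
  - assert (Hpos : forall m (n : Z), (0 < n)%Z -> CI (fun t => peval m (r * e2pi t) * e2pi (IZR n * t)) = 0).
    { induction m as [|c m IH]; intros n Hn.
      - rewrite (CI_ext _ (fun _ => 0)) by (intros; simpl; ring); apply CI_const.
      - rewrite Hstep, IH by lia; destruct (Z.eq_dec n 0); [lia|ring]. }
    rewrite <- (Hpos l (Z.of_nat (S k))) by lia; apply CI_ext; intros t _; rewrite <- INR_IZR_INZ; reflexivity.
Qed.

Lemma peval_bound (l : list C) (A q : R) (h : C) : (0 <= A)%R -> (0 < q)%R ->
  (forall k, (Cmod (nth k l 0%C) <= A * q ^ k)%R) -> (Cmod h * q <= 1 / 2)%R -> (Cmod (peval l h) <= 2 * A)%R.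
Proof.
  intros HA Hq; revert A HA; induction l as [|c l IH]; intros A HA Hl Hh; simpl.
  - rewrite Cmod_0; lra.
  - eapply Rle_trans; [apply Cmod_triangle|]; rewrite Cmod_mult.
    assert (H1 : (Cmod (peval l h) <= 2 * (A * q))%R).
    { apply IH; [apply Rmult_le_pos; lra| |exact Hh].
      intros k; specialize (Hl (S k)); simpl in Hl; lra. }
    specialize (Hl O); simpl in Hl; generalize (Cmod_ge_0 h) (Cmod_ge_0 (peval l h)); intros.
    assert (Cmod h * Cmod (peval l h) <= Cmod h * (2 * (A * q)))%R by now apply Rmult_le_compat_l.
    assert (Cmod h * q * (2 * A) <= 1 / 2 * (2 * A))%R by (apply Rmult_le_compat_r; lra); lra.
Qed.

Lemma Cmod_e2pi_R (t : R) : Cmod (e2pi t) = 1%R.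
Proof. rewrite Cmod_e2pi; simpl; rewrite Rmult_0_r, Ropp_0, exp_0; reflexivity. Qed.

Lemma Cplus_sub_cancel (x z : C) : x + (z - x) = z.
Proof. ring. Qed.

Lemma is_derive_quadratic (f : C -> C) (x L : C) (d K : R) : (0 < d)%R ->
  (forall h : C, (Cmod h <= d)%R -> (Cmod (f (x + h)%C - f x - h * L) <= K * (Cmod h * Cmod h))%R) ->
  @is_derive C_AbsRing C_NormedModule f x L.
Proof.
  intros Hd H; split.
  - apply (is_linear_scal_l (K := C_AbsRing) (V := C_NormedModule)).
  - intros y Hy.
    replace y with x in *.
    2: { apply (is_filter_lim_locally_unique (K := C_AbsRing) (V := AbsRing_NormedModule C_AbsRing)) in Hy; exact Hy. }
    intros eps; clear Hy.
    set (K1 := (Rabs K + 1)%R).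
    assert (HK1 : (0 < K1)%R) by (unfold K1; generalize (Rabs_pos K); lra).
    assert (He : (0 < Rmin d (eps / K1))%R) by (apply Rmin_pos; [exact Hd|apply Rdiv_lt_0_compat; [apply cond_pos|exact HK1]]).
    exists (mkposreal _ He); intros z Hz.
    change (Cmod (z - x) < Rmin d (eps / K1))%R in Hz.
    change (Cmod (f z - f x - (z - x) * L) <= eps * Cmod (z - x))%R.
    specialize (H (Cminus z x)); assert (E := Cplus_sub_cancel x z); rewrite E in H; clear E.
    eapply Rle_trans; [apply H; eapply Rle_trans; [left; apply Hz|apply Rmin_l]|].
    rewrite <- Rmult_assoc; apply Rmult_le_compat_r; [apply Cmod_ge_0|].
    apply Rle_trans with (K1 * Cmod (z - x))%R.
    + apply Rmult_le_compat_r; [apply Cmod_ge_0|]; unfold K1; generalize (Rle_abs K); lra.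
    + apply Rle_trans with (K1 * (eps / K1))%R; [|right; field; lra].
      apply Rmult_le_compat_l; [lra|]; left; eapply Rlt_le_trans; [apply Hz|apply Rmin_r].
Qed.

Lemma uapp_pol_ex_derive (f : C -> C) (a x : C) (R0 : R) : uapp pol (disc a R0) f -> (Cmod (x - a) < R0)%R ->
  @ex_derive C_AbsRing C_NormedModule f x.
Proof.
  intros Hf Hx.
  set (r := (R0 - Cmod (x - a))%R); assert (Hr : (0 < r)%R) by (unfold r; lra).
  assert (Hg : uapp pol (disc 0 r) (fun h => f (x + h))) by (eapply uapp_pol_comp_add; [exact Hf|unfold r; lra]).
  set (g := fun h => f (x + h)) in Hg.
  destruct (uapp_bounded pol (disc 0 r) g (pol_alg 0 r) Hg) as [M [HM HMg]].
  assert (Hcirc : forall t : R, disc 0 r (r * e2pi t)).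
  { intros t; unfold disc; replace (r * e2pi t - 0) with (r * e2pi t) by ring.
    rewrite Cmod_mult, Cmod_R, Cmod_e2pi_R, Rabs_pos_eq by lra; lra. }
  assert (Hcp : forall P, pol P -> cont01 (fun t => P (r * e2pi t))).
  { intros P HP; destruct (pol_trig P 0 r HP) as [q Hq].
    apply cont01_ext with (fun t => teval q (0 + 1 * t, 0 + 0 * t)).
    - intros t _; rewrite <- Hq; simpl; f_equal; rewrite Cplus_0_l; f_equal; f_equal; ring.
    - apply trig_cont01; exists q; reflexivity. }
  assert (Hcg : cont01 (fun t => g (r * e2pi t))).
  { apply cont01_lim; intros eps He; destruct (Hg eps He) as [P [HP HPg]].
    exists (fun t => P (r * e2pi t)); split; [now apply Hcp|]; intros; apply HPg, Hcirc. }
  assert (Hce : cont01 (fun t => e2pi (- (INR 1 * t)))).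
  { apply cont01_ext with (fun t => e2pi (- (1) * t + 0)); [intros; f_equal; simpl; ring|apply cont01_e2pi_lin]. }
  set (L := / r * CI (fun t => g (r * e2pi t) * e2pi (- (INR 1 * t)))).
  exists L; apply is_derive_quadratic with (r / 2)%R (4 * (M + 1) / (r * r))%R; [lra|].
  intros h Hh; apply le_epsilon; intros eps He.
  set (e1 := Rmin 1 (eps / 4)); assert (He1 : (0 < e1)%R) by (apply Rmin_pos; lra).
  destruct (Hg e1 He1) as [P [[l Hl] HPg]].
  assert (HPb : forall z, disc 0 r z -> (Cmod (P z) <= M + 1)%R).
  { intros z Hz; specialize (HPg z Hz); specialize (HMg z Hz).
    generalize (Cmod_triangle (P z - g z) (g z)) (Rmin_l 1 (eps / 4)); replace (P z - g z + g z) with (P z) by ring.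
    rewrite (Cmod_sub_sym (P z)); fold e1; lra. }
  assert (Hcoef : forall k, (Cmod (nth k l 0%C) <= 2 * (M + 1) * (/ r) ^ k)%R).
  { intros k; destruct (CI_peval l r k) as [Hk _].
    assert (Hb : (Cmod (CI (fun t => peval l (r * e2pi t) * e2pi (- (INR k * t)))%C) <= 2 * (M + 1))%R).
    { apply CI_bound.
      - apply cont01_mult.
        + apply cont01_ext with (fun t => P (r * e2pi t)); [intros; apply Hl|apply Hcp; exists l; exact Hl].
        + apply cont01_ext with (fun t => e2pi (- INR k * t + 0)); [intros; f_equal; ring|apply cont01_e2pi_lin].
      - intros t _; rewrite Cmod_mult, <- RtoC_mult, <- RtoC_opp, Cmod_e2pi_R, Rmult_1_r, <- Hl; apply HPb, Hcirc. }
    rewrite Hk, Cmod_mult, Cmod_R, Rabs_pos_eq in Hb by (apply pow_le; lra).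
    rewrite pow_inv; apply Rmult_le_reg_l with (r ^ k)%R; [now apply pow_lt|].
    replace (r ^ k * (2 * (M + 1) * / r ^ k))%R with (2 * (M + 1))%R; [exact Hb|].
    field; apply pow_nonzero; lra. }
  assert (Hpoly : (Cmod (P h - P 0 - h * nth 1 l 0%C) <= 4 * (M + 1) / (r * r) * (Cmod h * Cmod h))%R).
  { rewrite !Hl.
    assert (E : peval l h - peval l 0 - h * nth 1 l 0%C = h * (h * peval (tl (tl l)) h)).
    { destruct l as [|c0 [|c1 l]]; simpl; ring. }
    rewrite E, !Cmod_mult.
    assert (B : (Cmod (peval (tl (tl l)) h) <= 2 * (2 * (M + 1) * (/ r * / r)))%R).
    { apply peval_bound with (q := (/ r)%R).
      - repeat apply Rmult_le_pos; try lra; left; now apply Rinv_0_lt_compat.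
      - now apply Rinv_0_lt_compat.
      - intros k; replace (nth k (tl (tl l)) 0) with (nth (S (S k)) l 0).
        + eapply Rle_trans; [apply Hcoef|]; right; simpl; ring.
        + destruct l as [|c0 [|c1 l]]; simpl; try reflexivity; destruct k; reflexivity.
      - apply Rmult_le_reg_r with r; [exact Hr|]; rewrite Rmult_assoc, Rinv_l by lra; lra. }
    generalize (Cmod_ge_0 h); intros Hh0.
    apply Rle_trans with (Cmod h * (Cmod h * (2 * (2 * (M + 1) * (/ r * / r)))))%R.
    - repeat apply Rmult_le_compat_l; auto.
    - right; field; lra. }
  assert (HL : (Cmod (nth 1 l 0%C - L) <= 2 * e1 / r)%R).
  { destruct (CI_peval l r 1) as [Hk _].
    replace (nth 1 l 0) with (/ r * CI (fun t => peval l (r * e2pi t) * e2pi (- (INR 1 * t)))).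
    2: { rewrite Hk, pow_1; field; intros E; apply (f_equal Re) in E; simpl in E; lra. }
    unfold L; replace (/ r * CI (fun t => peval l (r * e2pi t) * e2pi (- (INR 1 * t))) - / r * CI (fun t => g (r * e2pi t) * e2pi (- (INR 1 * t))))
      with (/ r * (CI (fun t => peval l (r * e2pi t) * e2pi (- (INR 1 * t))) - CI (fun t => g (r * e2pi t) * e2pi (- (INR 1 * t))))) by ring.
    rewrite <- RtoC_inv, Cmod_mult, Cmod_R, Rabs_pos_eq by (try (left; apply Rinv_0_lt_compat); lra).
    unfold Rdiv; rewrite (Rmult_comm (2 * e1)); apply Rmult_le_compat_l; [left; now apply Rinv_0_lt_compat|].
    apply CI_cont01_close.
    - apply cont01_mult; [|exact Hce].
      apply cont01_ext with (fun t => P (r * e2pi t)); [intros; apply Hl|apply Hcp; exists l; exact Hl].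
    - apply cont01_mult; [exact Hcg|exact Hce].
    - intros t _; specialize (HPg _ (Hcirc t)).
      replace (peval l (r * e2pi t) * e2pi (- (INR 1 * t)) - g (r * e2pi t) * e2pi (- (INR 1 * t)))
        with (- ((g (r * e2pi t) - P (r * e2pi t)) * e2pi (- (INR 1 * t)))) by (rewrite Hl; ring).
      rewrite Cmod_opp, Cmod_mult, <- RtoC_mult, <- RtoC_opp, Cmod_e2pi_R, Rmult_1_r; exact HPg. }
  assert (Hdh : disc 0 r h) by (unfold disc; replace (h - 0) with h by ring; lra).
  assert (Hd0 : disc 0 r 0) by (unfold disc; replace (0 - 0) with (RtoC 0) by ring; rewrite Cmod_0; lra).
  replace (f (x + h) - f x - h * L) with
    ((P h - P 0 - h * nth 1 l 0) + ((g h - P h) + (- (g 0 - P 0) + h * (nth 1 l 0 - L))))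
    by (unfold g; rewrite Cplus_0_r; ring).
  assert (A1 := HPg h Hdh); assert (A2 := HPg 0 Hd0).
  assert (A3 : (Cmod (h * (nth 1 l 0 - L)) <= e1)%R).
  { rewrite Cmod_mult; apply Rle_trans with (r / 2 * (2 * e1 / r))%R; [|right; field; lra].
    apply Rmult_le_compat; auto; apply Cmod_ge_0. }
  assert (A4 : (e1 <= eps / 4)%R) by apply Rmin_r.
  eapply Rle_trans; [apply Cmod_triangle|]; apply Rplus_le_compat; [exact Hpoly|].
  eapply Rle_trans; [apply Cmod_triangle|].
  eapply Rle_trans; [apply Rplus_le_compat_l, Cmod_triangle|]; rewrite Cmod_opp; lra.
Qed.

Lemma polar (a b : R) : (a * a + b * b = 1)%R -> exists th, cos th = a /\ sin th = b.
Proof.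
  intros H; assert (Ha : (-1 <= a <= 1)%R) by nra.
  assert (Hs : sin (acos a) = Rabs b).
  { rewrite sin_acos by assumption; replace (1 - a²)%R with (b²)%R by (unfold Rsqr; lra); apply sqrt_Rsqr_abs. }
  destruct (Rle_dec 0 b) as [Hb|Hb].
  - exists (acos a); split; [now apply cos_acos|rewrite Hs; now apply Rabs_pos_eq].
  - exists (- acos a)%R; split; [rewrite cos_neg; now apply cos_acos|].
    rewrite sin_neg, Hs, Rabs_left by lra; ring.
Qed.

Lemma e2pi_surj (w : C) : w <> 0 -> exists s, e2pi s = w.
Proof.
  intros Hw; assert (Hm : (0 < Cmod w)%R) by now apply Cmod_gt_0.
  assert (Hsq : (Re w * Re w + Im w * Im w = Cmod w * Cmod w)%R).
  { generalize (Cmod2_alt w); simpl; rewrite !Rmult_1_r; lra. }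
  destruct (polar (Re w / Cmod w) (Im w / Cmod w)) as [th [H1 H2]].
  { replace (Re w / Cmod w * (Re w / Cmod w) + Im w / Cmod w * (Im w / Cmod w))%R
      with ((Re w * Re w + Im w * Im w) / (Cmod w * Cmod w))%R by (field; lra).
    rewrite Hsq; field; lra. }
  generalize PI_RGT_0; intros Hpi.
  set (s := (th / (2 * PI), - (ln (Cmod w) / (2 * PI)))%R); exists s.
  unfold e2pi, Cexp.
  replace (Re (2 * PI * Ci * s)) with (ln (Cmod w)) by (simpl; field; lra).
  replace (Im (2 * PI * Ci * s)) with th by (simpl; field; lra).
  rewrite exp_ln, H1, H2 by assumption; apply C_eq; simpl; unfold Re, Im; field; lra.
Qed.

(* Near [a] write [z = a + e2pi s]; the strip version of the identity theorem
   applies to [s]. *)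
Lemma uapp_pol_identity (f : C -> C) (a : C) (R0 d : R) : uapp pol (disc a R0) f -> (0 < d)%R ->
  (forall z, (Cmod (z - a) < d)%R -> f z = 0) -> forall z, (Cmod (z - a) <= R0)%R -> f z = 0.
Proof.
  intros Hf Hd H0 z Hz.
  destruct (Ceq_dec (z - a) 0) as [E|E].
  - apply H0; rewrite E, Cmod_0; exact Hd.
  - destruct (e2pi_surj _ E) as [s Hs].
    assert (Hz' : (0 < Cmod (z - a))%R) by now apply Cmod_gt_0.
    generalize PI_RGT_0; intros Hpi.
    set (y1 := (Rmax (Im s) (1 - ln d / (2 * PI)))%R).
    assert (Hlow : (exp (- (2 * PI * y1)) < d)%R).
    { apply Rlt_le_trans with (exp (ln d)); [apply exp_increasing|rewrite exp_ln; lra].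
      apply Rle_lt_trans with (- (2 * PI * (1 - ln d / (2 * PI))))%R.
      - apply Ropp_le_contravar, Rmult_le_compat_l; [lra|apply Rmax_r].
      - replace (- (2 * PI * (1 - ln d / (2 * PI))))%R with (ln d - 2 * PI)%R by (field; lra); lra. }
    assert (Hg : uapp trig (strip (Im s) y1 0 0) (fun x => f (a + 1 * e2pi (fst x)))).
    { intros eps He; destruct (Hf eps He) as [P [HP HPf]].
      exists (fun x => P (a + 1 * e2pi (fst x))); split; [now apply pol_trig|].
      intros x [Hx _]; apply HPf; unfold disc; replace (a + 1 * e2pi (fst x) - a) with (e2pi (fst x)) by ring.
      eapply Rle_trans; [apply Cmod_e2pi_le, Hx|]; rewrite <- Cmod_e2pi, Hs; exact Hz. }
    replace z with (a + 1 * e2pi (fst (s, RtoC 0))) by (simpl; rewrite Hs; ring).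
    apply (uapp_unique (Im s) y1 0 0 _ (0, y1)%R (RtoC 0) Hg).
    + simpl; split; [apply Rmax_l|lra].
    + simpl; lra.
    + intros n; unfold coef; rewrite (CI_ext _ (fun _ => 0)); [apply CI_const|].
      intros t _; rewrite H0; [ring|].
      simpl fst; replace (a + 1 * e2pi ((0, y1)%R + t) - a) with (e2pi ((0, y1)%R + t)) by ring.
      rewrite Cmod_e2pi; simpl; rewrite Rplus_0_r; exact Hlow.
    + split; [lra|apply Rmax_l].
Qed.

(** * Absolutely convergent series *)

Fixpoint Rps (b : nat -> R) (N : nat) : R := match N with O => 0%R | S N' => (Rps b N' + b N')%R end.

Fixpoint Cps (a : nat -> C) (N : nat) : C := match N with O => 0 | S N' => Cps a N' + a N' end.

Definition Csum (a : nat -> C) : C := C_lim_seq (Cps a).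

Definition summable (b : nat -> R) : Prop := (forall n, (0 <= b n)%R) /\ exists M : R, forall N, (Rps b N <= M)%R.

Lemma summable_tail (b : nat -> R) : summable b -> exists t : nat -> R, is_lim_seq t 0%R /\
  forall N k, (Rps b (N + k) - Rps b N <= t N)%R.
Proof.
  intros [H0 [M HM]].
  assert (Hincr : forall n, (Rps b n <= Rps b (S n))%R) by (intros n; simpl; specialize (H0 n); lra).
  destruct (ex_finite_lim_seq_incr (Rps b) M Hincr HM) as [l Hl].
  exists (fun N => l - Rps b N)%R; split.
  - replace (Finite 0) with (Finite (l - l)) by (f_equal; ring); apply is_lim_seq_minus'; [apply is_lim_seq_const|exact Hl].
  - intros N k; assert (Rps b (N + k) <= l)%R; [|lra].
    apply (is_lim_seq_incr_compare (Rps b) l Hl Hincr).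
Qed.

Lemma Cps_sub_bound (a : nat -> C) (b : nat -> R) (N k : nat) : (forall n, (Cmod (a n) <= b n)%R) ->
  (Cmod (Cps a (N + k) - Cps a N) <= Rps b (N + k) - Rps b N)%R.
Proof.
  intros H; induction k as [|k IH].
  - rewrite Nat.add_0_r; replace (Cps a N - Cps a N) with (RtoC 0) by ring; rewrite Cmod_0; lra.
  - rewrite Nat.add_succ_r; simpl; eapply Rle_trans; [apply (Cmod_dist _ (Cps a (N + k)))|].
    replace (Cps a (N + k) + a (N + k)%nat - Cps a (N + k)) with (a (N + k)%nat) by ring.
    specialize (H (N + k)%nat); lra.
Qed.

Lemma Ccvg_cauchy (s : nat -> C) (t : nat -> R) : is_lim_seq t 0%R ->
  (forall N k, (Cmod (s (N + k)%nat - s N) <= t N)%R) -> exists l, forall N, (Cmod (s N - l) <= t N)%R.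
Proof.
  intros Ht H.
  assert (Hc : forall g : C -> R, (forall z w, g (z - w) = (g z - g w)%R) -> (forall z, (Rabs (g z) <= Cmod z)%R) ->
     exists l : R, is_lim_seq (fun n => g (s n)) l).
  { intros g Hl Hb; apply ex_lim_seq_cauchy_corr; intros eps.
    apply is_lim_seq_spec in Ht; destruct (Ht eps) as [N HN]; exists N.
    assert (Hx : forall a b, (N <= a <= b)%nat -> (Rabs (g (s a) - g (s b)) < eps)%R).
    { intros a b Hab; rewrite <- Hl; eapply Rle_lt_trans; [apply Hb|].
      rewrite Cmod_sub_sym; replace b with (a + (b - a))%nat by lia.
      eapply Rle_lt_trans; [apply H|]; specialize (HN a ltac:(lia)); rewrite Rminus_0_r in HN.
      eapply Rle_lt_trans; [apply Rle_abs|apply HN]. }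
    intros n m Hn Hm; destruct (le_lt_dec n m); [apply Hx; lia|].
    rewrite Rabs_minus_sym; apply Hx; lia. }
  destruct (Hc Re) as [lr Hlr]; [reflexivity|apply re_le_Cmod|].
  destruct (Hc Im) as [li Hli]; [reflexivity|apply Im_abs_Cmod|].
  exists (lr, li).
  assert (Hcv : Ccvg s (lr, li)).
  { apply Ccvg_squeeze with (fun n => Rabs (Re (s n) - lr) + Rabs (Im (s n) - li))%R.
    - intros n; apply Cmod_le_abs.
    - replace (Finite 0) with (Finite (Rabs (lr - lr) + Rabs (li - li)))
        by (f_equal; rewrite !Rminus_diag, Rabs_R0; ring).
      apply is_lim_seq_plus'; apply (is_lim_seq_abs _ (Finite _)); apply is_lim_seq_minus'; auto;
        apply is_lim_seq_const. }
  intros n; rewrite Cmod_sub_sym.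
  apply (Ccvg_le (fun k => s (k + n)%nat - s n)).
  - unfold Cminus; apply Ccvg_plus; [now apply Ccvg_incr|apply Ccvg_const].
  - intros k; rewrite Nat.add_comm; apply H.
Qed.

Lemma Csum_approx (b : nat -> R) : summable b -> exists t : nat -> R, is_lim_seq t 0%R /\
  forall a, (forall n, (Cmod (a n) <= b n)%R) -> forall N, (Cmod (Cps a N - Csum a) <= t N)%R.
Proof.
  intros Hb; destruct (summable_tail b Hb) as [t [Ht Htb]]; exists t; split; [exact Ht|].
  intros a Ha; destruct (Ccvg_cauchy (Cps a) t Ht) as [l Hl].
  - intros N k; eapply Rle_trans; [apply Cps_sub_bound, Ha|apply Htb].
  - replace (Csum a) with l; [exact Hl|]; symmetry; apply Ccvg_C_lim_seq; now apply Ccvg_squeeze with t.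
Qed.

Lemma Csum_cvg (b : nat -> R) (a : nat -> C) : summable b -> (forall n, (Cmod (a n) <= b n)%R) -> Ccvg (Cps a) (Csum a).
Proof.
  intros Hb Ha; destruct (Csum_approx b Hb) as [t [Ht H]]; apply Ccvg_squeeze with t; auto.
Qed.

Lemma Csum_eq (a : nat -> C) (l : C) : Ccvg (Cps a) l -> Csum a = l.
Proof. apply Ccvg_C_lim_seq. Qed.

Lemma Cps_plus (a a' : nat -> C) (N : nat) : Cps (fun n => a n + a' n) N = Cps a N + Cps a' N.
Proof. induction N; simpl; [ring|rewrite IHN; ring]. Qed.

Lemma Cps_scal (c : C) (a : nat -> C) (N : nat) : Cps (fun n => c * a n) N = c * Cps a N.
Proof. induction N; simpl; [ring|rewrite IHN; ring]. Qed.

Lemma Cps_ext (a a' : nat -> C) (N : nat) : (forall n, a n = a' n) -> Cps a N = Cps a' N.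
Proof. intros H; induction N; simpl; [reflexivity|now rewrite IHN, H]. Qed.

Lemma Csum_ext (a a' : nat -> C) : (forall n, a n = a' n) -> Csum a = Csum a'.
Proof. intros H; f_equal; now apply functional_extensionality. Qed.

Lemma Csum_minus (b b' : nat -> R) (a a' : nat -> C) : summable b -> summable b' ->
  (forall n, (Cmod (a n) <= b n)%R) -> (forall n, (Cmod (a' n) <= b' n)%R) ->
  Csum (fun n => a n - a' n) = Csum a - Csum a'.
Proof.
  intros Hb Hb' Ha Ha'; apply Csum_eq.
  apply Ccvg_ext with (fun N => Cps a N + - (1) * Cps a' N).
  - intros N; rewrite <- Cps_scal, <- Cps_plus; apply Cps_ext; intros; ring.
  - replace (Csum a - Csum a') with (Csum a + - (1) * Csum a') by ring.
    apply Ccvg_plus; [now apply (Csum_cvg b)|].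
    apply Ccvg_mult; [apply Ccvg_const|now apply (Csum_cvg b')].
Qed.

Lemma summable_geom (c r : R) : (0 <= c)%R -> (0 <= r < 1)%R -> summable (fun n => c * r ^ n)%R.
Proof.
  intros Hc Hr; split; [intros; apply Rmult_le_pos; [lra|apply pow_le; lra]|].
  exists (c / (1 - r))%R; intros N; eapply Rle_trans; [|apply (geom_le c r N Hc Hr)].
  induction N as [|N IH]; simpl; [right; field; lra|].
  replace (c * (1 - r * r ^ N) / (1 - r))%R with (c * (1 - r ^ N) / (1 - r) + c * r ^ N)%R by (field; lra); lra.
Qed.

Lemma summable_inv_sq (c : R) : (0 <= c)%R -> summable (fun n => c * (/ INR (S n) * / INR (S n)))%R.
Proof.
  intros Hc.
  assert (Hp : forall n, (0 < INR (S n))%R) by (intros; apply lt_0_INR; lia).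
  split; [intros n; specialize (Hp n); repeat apply Rmult_le_pos; try (left; now apply Rinv_0_lt_compat); lra|].
  exists (c * 2)%R.
  assert (H : forall N, (Rps (fun n => c * (/ INR (S n) * / INR (S n))) (S N) <= c * (2 - / INR (S N)))%R).
  { induction N as [|N IH].
    - simpl; rewrite Rinv_1; lra.
    - change (Rps (fun n => c * (/ INR (S n) * / INR (S n)))%R (S (S N))) with
        (Rps (fun n => c * (/ INR (S n) * / INR (S n)))%R (S N) + c * (/ INR (S (S N)) * / INR (S (S N))))%R.
      apply Rle_trans with (c * (2 - / INR (S N)) + c * (/ INR (S (S N)) * / INR (S (S N))))%R; [lra|].
      rewrite <- Rmult_plus_distr_l; apply Rmult_le_compat_l; [exact Hc|].
      generalize (Hp N) (Hp (S N)); rewrite (S_INR (S N)); generalize (INR (S N)); intros x Hx Hx1.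
      assert (E : (/ x - / (x + 1) = / x * / (x + 1))%R) by (field; lra).
      assert (L : (/ (x + 1) * / (x + 1) <= / x * / (x + 1))%R).
      { apply Rmult_le_compat_r; [left; now apply Rinv_0_lt_compat|apply Rinv_le_contravar; lra]. }
      lra. }
  intros [|N]; [simpl; lra|]; eapply Rle_trans; [apply H|].
  apply Rmult_le_compat_l; [exact Hc|]; generalize (Rinv_0_lt_compat _ (Hp N)); lra.
Qed.

Lemma summable_plus (b b' : nat -> R) : summable b -> summable b' -> summable (fun n => b n + b' n)%R.
Proof.
  intros [H1 [M HM]] [H2 [M' HM']]; split; [intros n; specialize (H1 n); specialize (H2 n); lra|].
  exists (M + M')%R; intros N; specialize (HM N); specialize (HM' N).
  replace (Rps (fun n => b n + b' n)%R N) with (Rps b N + Rps b' N)%R; [lra|].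
  clear; induction N; simpl; [ring|rewrite <- IHN; ring].
Qed.

Lemma Csum_CI (f : nat -> R -> C) (b : nat -> R) : summable b -> (forall n, cont01 (f n)) ->
  (forall n x, (0 <= x <= 1)%R -> (Cmod (f n x) <= b n)%R) ->
  cont01 (fun x => Csum (fun n => f n x)) /\ CI (fun x => Csum (fun n => f n x)) = Csum (fun n => CI (f n)).
Proof.
  intros Hb Hf HB; destruct (Csum_approx b Hb) as [t [Ht H]].
  assert (Hps : forall N, cont01 (fun x => Cps (fun n => f n x) N)).
  { induction N; simpl; [apply cont01_const|now apply cont01_plus]. }
  assert (Hclose : forall N x, (0 <= x <= 1)%R -> (Cmod (Csum (fun n => f n x) - Cps (fun n => f n x) N) <= t N)%R).
  { intros N x Hx; rewrite Cmod_sub_sym; apply H; intros n; now apply HB. }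
  assert (Hc : cont01 (fun x => Csum (fun n => f n x))).
  { apply cont01_lim; intros eps He; apply is_lim_seq_spec in Ht; destruct (Ht (mkposreal eps He)) as [N HN].
    exists (fun x => Cps (fun n => f n x) N); split; [apply Hps|]; intros x Hx.
    specialize (HN N (le_n _)); simpl in HN; rewrite Rminus_0_r in HN.
    eapply Rle_trans; [now apply Hclose|]; generalize (Rle_abs (t N)); lra. }
  split; [exact Hc|]; symmetry; apply Csum_eq.
  apply Ccvg_squeeze with (fun N => 2 * t N)%R.
  - intros N; rewrite Cmod_sub_sym.
    replace (Cps (fun n => CI (f n)) N) with (CI (fun x => Cps (fun n => f n x) N)).
    + apply CI_cont01_close; auto.
    + clear Hclose; induction N; simpl; [apply CI_const|]; rewrite CI_plus, IHN; auto.
  - replace (Finite 0) with (Finite (2 * 0)) by (f_equal; ring); now apply (is_lim_seq_scal_l _ _ (Finite 0)).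
Qed.

Lemma Csum_single (a : nat -> C) (m : nat) : (forall n, n <> m -> a n = 0) -> Csum a = a m.
Proof.
  intros H; apply Csum_eq; apply Ccvg_eps; intros eps He; exists (S m); intros n Hn.
  replace (Cps a n) with (a m); [replace (a m - a m) with (RtoC 0) by ring; rewrite Cmod_0; exact He|].
  assert (H0 : forall k, (k <= m)%nat -> Cps a k = 0).
  { induction k; simpl; intros; [reflexivity|]; rewrite IHk, H by lia; ring. }
  replace n with (S m + (n - S m))%nat by lia; generalize (n - S m)%nat; intros k.
  induction k as [|k IH].
  - rewrite Nat.add_0_r; simpl; rewrite H0 by lia; ring.
  - rewrite Nat.add_succ_r; change (Cps a (S (S m + k))) with (Cps a (S m + k) + a (S m + k)%nat); rewrite <- IH, (H (S m + k)%nat) by lia; ring.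
Qed.

(** * The logarithm of the double product *)

Lemma Ccvg_Cexp (s : nat -> C) (l : C) : Ccvg s l -> Ccvg (fun n => Cexp (s n)) (Cexp l).
Proof.
  intros H; apply Ccvg_eps; intros eps He.
  set (B := (Cmod (Cexp l) * (2 * exp 1) + 1)%R).
  assert (HB : (0 < B)%R).
  { unfold B; generalize (Rmult_le_pos _ _ (Cmod_ge_0 (Cexp l)) (Rlt_le _ _ (exp_pos 1))); lra. }
  destruct (proj1 (Ccvg_eps s l) H (Rmin 1 (eps / B))) as [N HN].
  { apply Rmin_pos; [lra|now apply Rdiv_lt_0_compat]. }
  exists N; intros n Hn; specialize (HN n Hn).
  assert (H1 : (Cmod (s n - l) < 1)%R) by (eapply Rlt_le_trans; [apply HN|apply Rmin_l]).
  assert (H2 : (Cmod (s n - l) < eps / B)%R) by (eapply Rlt_le_trans; [apply HN|apply Rmin_r]).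
  replace (Cexp (s n) - Cexp l) with (Cexp l * (Cexp (s n - l) - 1)).
  - rewrite Cmod_mult.
    apply Rle_lt_trans with (Cmod (Cexp l) * (2 * exp 1 * Cmod (s n - l)))%R.
    + apply Rmult_le_compat_l; [apply Cmod_ge_0|]; apply Cexp_minus_1_bound; lra.
    + apply Rle_lt_trans with (B * Cmod (s n - l))%R.
      * unfold B; generalize (Cmod_ge_0 (s n - l)); lra.
      * apply Rmult_lt_compat_l with (r := B) in H2; [|exact HB].
        replace (B * (eps / B))%R with eps in H2 by (field; lra); exact H2.
  - unfold Cminus at 1; rewrite Cmult_plus_distr_l, <- Cexp_plus; replace (l + (s n - l)) with (s n) by ring; ring.
Qed.

Definition psum (c : nat -> C) (z : C) : C := Csum (fun n => c n * z ^ S n).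

Lemma psum_term_bound (c : nat -> C) (z : C) (M : R) : (forall n, (Cmod (c n) <= M)%R) ->
  forall n, (Cmod (c n * z ^ S n)%C <= M * Cmod z * Cmod z ^ n)%R.
Proof.
  intros Hc n; rewrite Cmod_mult, Cmod_pow, Rmult_assoc; change (Cmod z * Cmod z ^ n)%R with (Cmod z ^ S n)%R; apply Rmult_le_compat_r; [apply pow_le, Cmod_ge_0|apply Hc].
Qed.

Lemma psum_summable (c : nat -> C) (z : C) (M : R) : (forall n, (Cmod (c n) <= M)%R) -> (Cmod z < 1)%R ->
  summable (fun n => M * Cmod z * Cmod z ^ n)%R.
Proof.
  intros Hc Hz; apply summable_geom; [|split; [apply Cmod_ge_0|exact Hz]].
  apply Rmult_le_pos; [eapply Rle_trans; [apply Cmod_ge_0|apply (Hc O)]|apply Cmod_ge_0].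
Qed.

Lemma psum_bound (c : nat -> C) (z : C) (M : R) : (forall n, (Cmod (c n) <= M)%R) -> (Cmod z < 1)%R ->
  (Cmod (psum c z) <= M * Cmod z / (1 - Cmod z))%R.
Proof.
  intros Hc Hz; assert (Hs := psum_summable c z M Hc Hz).
  assert (H0 : (0 <= M * Cmod z)%R) by (apply Rmult_le_pos; [eapply Rle_trans; [apply Cmod_ge_0|apply (Hc O)]|apply Cmod_ge_0]).
  apply (Ccvg_le (Cps (fun n => c n * z ^ S n))).
  - eapply Csum_cvg; [apply Hs|]; now apply psum_term_bound.
  - intros N; generalize (Cps_sub_bound (fun n => c n * z ^ S n) _ 0 N (psum_term_bound c z M Hc)); simpl.
    replace (Cps (fun n => c n * (z * z ^ n)) N - 0) with (Cps (fun n => c n * (z * z ^ n)) N) by ring.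
    intros H; eapply Rle_trans; [apply H|]; rewrite Rminus_0_r.
    eapply Rle_trans; [|apply (geom_le (M * Cmod z) (Cmod z) N); [exact H0|split; [apply Cmod_ge_0|exact Hz]]].
    clear H; induction N; simpl; [right; field; lra|].
    eapply Rle_trans; [apply Rplus_le_compat_r, IHN|]; right; field; lra.
Qed.

Lemma psum_sub (c c' : nat -> C) (z w : C) (M M' : R) : (forall n, (Cmod (c n) <= M)%R) -> (forall n, (Cmod (c' n) <= M')%R) ->
  (Cmod z < 1)%R -> (Cmod w < 1)%R ->
  psum c z - psum c' w = Csum (fun n => c n * z ^ S n - c' n * w ^ S n).
Proof.
  intros Hc Hc' Hz Hw; symmetry.
  apply (Csum_minus _ _ (fun n => c n * z ^ S n) (fun n => c' n * w ^ S n) (psum_summable c z M Hc Hz) (psum_summable c' w M' Hc' Hw));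
  now apply psum_term_bound.
Qed.

Lemma Cexp_psum_cvg (c : nat -> C) (z x : C) (M : R) : (forall n, (Cmod (c n) <= M)%R) -> (Cmod z < 1)%R -> (Cmod x < 1)%R ->
  Ccvg (fun N => Cexp (psum c (z * x ^ N))) 1.
Proof.
  intros Hc Hz Hx; rewrite <- Cexp_0; apply Ccvg_Cexp.
  assert (HM : (0 <= M)%R) by (eapply Rle_trans; [apply Cmod_ge_0|apply (Hc O)]).
  apply Ccvg_squeeze with (fun N => M * Cmod z / (1 - Cmod z) * Cmod x ^ N)%R.
  - intros N; replace (psum c (z * x ^ N) - 0) with (psum c (z * x ^ N)) by ring.
    assert (Hp : (0 <= Cmod x ^ N <= 1)%R).
    { split; [apply pow_le, Cmod_ge_0|rewrite <- (pow1 N); apply pow_incr; split; [apply Cmod_ge_0|lra]]. }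
    assert (Hzx : (Cmod (z * x ^ N) <= Cmod z)%R) by (rewrite Cmod_mult, Cmod_pow; generalize (Cmod_ge_0 z); nra).
    eapply Rle_trans; [apply (psum_bound c _ M Hc); lra|].
    rewrite Cmod_mult, Cmod_pow in *.
    replace (M * Cmod z / (1 - Cmod z) * Cmod x ^ N)%R with (M * (Cmod z * Cmod x ^ N) / (1 - Cmod z))%R by (field; lra).
    unfold Rdiv; apply Rmult_le_compat_l.
    + apply Rmult_le_pos; [exact HM|]; apply Rmult_le_pos; [apply Cmod_ge_0|lra].
    + apply Rinv_le_contravar; lra.
  - apply lim_geom; split; [apply Cmod_ge_0|exact Hx].
Qed.

Lemma Cmod_inv_nat (n : nat) : Cmod (/ RtoC (INR (S n))) = (/ INR (S n))%R.
Proof.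
  assert (0 < INR (S n))%R by (apply lt_0_INR; lia).
  rewrite <- RtoC_inv, Cmod_R, Rabs_pos_eq by (try (left; apply Rinv_0_lt_compat); lra); reflexivity.
Qed.

Lemma INR_S_neq_0 (n : nat) : RtoC (INR (S n)) <> 0.
Proof. intros H; apply (f_equal Re) in H; revert H; apply (not_0_INR (S n)); lia. Qed.

Lemma inv_nat_le_1 (n : nat) : (0 < / INR (S n) <= 1)%R.
Proof.
  assert (1 <= INR (S n))%R by (rewrite S_INR; generalize (pos_INR n); lra).
  split; [apply Rinv_0_lt_compat; lra|rewrite <- Rinv_1; apply Rinv_le_contravar; lra].
Qed.

Lemma Cexp_log_series (z : C) : (Cmod z < 1)%R -> Cexp (psum (fun n => / INR (S n)) z) * (1 - z) = 1.
Proof.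
  intros Hz.
  set (s := fun (N : nat) (w : C) => Cps (fun n => / INR (S n) * w ^ S n) N).
  assert (Hd : forall N t, Cder (fun t => s N (RtoC t * z)) t (z * Cps (fun n => (t * z) ^ n) N)).
  { intros N t; induction N as [|N IH].
    - unfold s; simpl; eapply Cder_eq; [apply Cder_const|ring].
    - unfold s; cbn [Cps]; eapply Cder_eq.
      + apply Cder_plus; [exact IH|apply Cder_scal].
        assert (HP : forall m, Cder (fun t => (RtoC t * z) ^ S m) t (INR (S m) * z * (t * z) ^ m)).
        { induction m as [|m IHm].
          - simpl; eapply Cder_ext; [intros; symmetry; apply Cmult_1_r|].
            eapply Cder_eq; [apply Cder_mult; [apply Cder_id|apply Cder_const]|cbv beta; ring].
          - change (fun t0 : R => (RtoC t0 * z) ^ S (S m)) with (fun t0 : R => (RtoC t0 * z) * (RtoC t0 * z) ^ S m).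
            eapply Cder_eq; [apply (Cder_mult (fun t0 => RtoC t0 * z)); [apply Cder_mult; [apply Cder_id|apply Cder_const]|exact IHm]|].
            rewrite (S_INR (S m)), RtoC_plus; simpl Cpow; ring. }
        apply HP.
      + rewrite Cmult_plus_distr_l; f_equal.
        replace (/ INR (S N) * (INR (S N) * z * (t * z) ^ N)) with (/ INR (S N) * INR (S N) * (z * (t * z) ^ N)) by ring.
        rewrite Cinv_l by apply INR_S_neq_0; ring. }
  assert (Hgs : forall N w, (1 - w) * Cps (fun n => w ^ n) N = 1 - w ^ N).
  { intros N w; induction N; simpl; [ring|rewrite Cmult_plus_distr_l, IHN; ring]. }
  assert (Hg : forall N t, Cder (fun t => Cexp (s N (RtoC t * z)) * (1 - t * z)) t (- (z * (t * z) ^ N * Cexp (s N (t * z))))).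
  { intros N t; eapply Cder_eq.
    - apply Cder_mult; [apply Cder_Cexp, Hd|].
      apply Cder_ext with (fun t => 1 + (- z) * t); [intros; ring|].
      apply Cder_plus; [apply Cder_const|apply Cder_scal, Cder_id].
    - cbv beta; replace (z * Cps (fun n => (t * z) ^ n) N * Cexp (s N (t * z)) * (1 - t * z))
        with (z * Cexp (s N (t * z)) * ((1 - t * z) * Cps (fun n => (t * z) ^ n) N)) by ring.
      rewrite Hgs; ring. }
  set (B := (Cmod z / (1 - Cmod z))%R).
  assert (Hsb : forall N w, (Cmod w <= Cmod z)%R -> (Cmod (s N w) <= B)%R).
  { intros N w Hw; unfold s.
    generalize (Cps_sub_bound (fun n => / INR (S n) * w ^ S n) (fun n => Cmod z * Cmod z ^ n)%R 0 N).
    intros H; simpl in H.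
    replace (Cps (fun n => / INR (S n) * w ^ S n) N) with (Cps (fun n => / INR (S n) * w ^ S n) N - 0) by ring.
    eapply Rle_trans; [apply H|].
    - intros n; change (w * w ^ n) with (w ^ S n).
      rewrite Cmod_mult, Cmod_pow; change (match n with O => 1 | S _ => INR n + 1 end)%R with (INR (S n)); rewrite Cmod_inv_nat.
      rewrite <- (Rmult_1_l (Cmod z * Cmod z ^ n)); apply Rmult_le_compat.
      + left; apply inv_nat_le_1.
      + apply pow_le, Cmod_ge_0.
      + apply inv_nat_le_1.
      + change (Cmod z * Cmod z ^ n)%R with (Cmod z ^ S n)%R; apply pow_incr; split; [apply Cmod_ge_0|exact Hw].
    - rewrite Rminus_0_r; eapply Rle_trans; [|apply (geom_le (Cmod z) (Cmod z) N); [apply Cmod_ge_0|split; [apply Cmod_ge_0|exact Hz]]].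
      clear H; induction N; simpl; [right; field; lra|].
      eapply Rle_trans; [apply Rplus_le_compat_r, IHN|]; right; field; lra. }
  assert (Hbound : forall N, (Cmod (Cexp (s N z) * (1 - z) - 1) <= 2 * (Cmod z * exp B) * Cmod z ^ N)%R).
  { intros N.
    assert (Hcd : cont01 (fun t => - (z * (t * z) ^ N * Cexp (s N (t * z))))).
    { apply cont01_ext with (fun t => (- z) * (RtoC t * z) ^ N * Cexp (s N (t * z))); [intros; ring|].
      assert (Hlin : cont01 (fun t => RtoC t * z)).
      { apply Cder_cont01; intros; eexists; apply Cder_mult; [apply Cder_id|apply Cder_const]. }
      apply cont01_mult; [apply cont01_mult; [apply cont01_const|]|].
      - clear -Hlin; induction N; simpl; [apply cont01_const|now apply cont01_mult].
      - apply Cder_cont01; intros; eexists; apply Cder_Cexp, Hd. }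
    assert (F := CI_FTC (fun t => Cexp (s N (RtoC t * z)) * (1 - t * z)) _ (fun t _ => Hg N t) Hcd).
    assert (E0 : s N (RtoC 0 * z) = 0).
    { unfold s; clear; induction N; cbn [Cps]; [reflexivity|]; rewrite IHN; simpl Cpow; ring. }
    simpl in F; rewrite E0, Cexp_0, Cmult_1_l in F.
    replace (Cexp (s N z) * (1 - z) - 1) with (Cexp (s N z) * (1 - z) - 1 * (1 - 0 * z)) by ring; rewrite <- F.
    rewrite Rmult_assoc; apply CI_bound; [exact Hcd|]; intros t Ht.
    assert (Htz : (Cmod (t * z) <= Cmod z)%R).
    { rewrite Cmod_mult, Cmod_R, Rabs_pos_eq by lra; generalize (Cmod_ge_0 z); nra. }
    rewrite Cmod_opp, !Cmod_mult, Cmod_pow, Cmod_Cexp.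
    replace (Cmod z * exp B * Cmod z ^ N)%R with (Cmod z * Cmod z ^ N * exp B)%R by ring.
    apply Rmult_le_compat.
    - apply Rmult_le_pos; [apply Cmod_ge_0|apply pow_le, Cmod_ge_0].
    - left; apply exp_pos.
    - apply Rmult_le_compat_l; [apply Cmod_ge_0|]; apply pow_incr; split; [apply Cmod_ge_0|exact Htz].
    - apply exp_le_mono; eapply Rle_trans; [apply Rle_abs|]; eapply Rle_trans; [apply re_le_Cmod|]; now apply Hsb. }
  apply (Ccvg_unique (fun N => Cexp (s N z) * (1 - z))).
  - apply Ccvg_mult; [|apply Ccvg_const]; apply Ccvg_Cexp.
    assert (Hone : forall n, (Cmod (/ RtoC (INR (S n))) <= 1)%R) by (intros n; rewrite Cmod_inv_nat; apply inv_nat_le_1).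
    exact (Csum_cvg _ _ (psum_summable _ z 1 Hone Hz) (psum_term_bound _ z 1 Hone)).
  - apply Ccvg_squeeze with (1 := Hbound); apply lim_geom; split; [apply Cmod_ge_0|exact Hz].
Qed.

Lemma inv_one_sub_pow_bound (x : C) (n : nat) : (Cmod x < 1)%R -> 1 - x ^ S n <> 0 /\ (Cmod (/ (1 - x ^ S n)) <= / (1 - Cmod x))%R.
Proof.
  intros Hx; assert (H : (Cmod (x ^ S n) <= Cmod x)%R).
  { rewrite Cmod_pow; simpl.
    assert (Cmod x ^ n <= 1)%R by (rewrite <- (pow1 n); apply pow_incr; split; [apply Cmod_ge_0|lra]).
    generalize (Cmod_ge_0 x); nra. }
  assert (H0 : 1 - x ^ S n <> 0) by (apply one_sub_neq_0; lra).
  split; [exact H0|]; rewrite Cmod_inv by assumption.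
  apply Rinv_le_contravar; [lra|]; now apply one_sub_Cmod_lower.
Qed.

Lemma coef1_bound (y : C) (n : nat) : (Cmod y < 1)%R -> (Cmod (/ INR (S n) * / (1 - y ^ S n)) <= / (1 - Cmod y))%R.
Proof.
  intros Hy; destruct (inv_one_sub_pow_bound y n Hy) as [_ H].
  rewrite Cmod_mult, Cmod_inv_nat, <- (Rmult_1_l (/ (1 - Cmod y))).
  apply Rmult_le_compat; try apply Cmod_ge_0; auto; [left|]; apply inv_nat_le_1.
Qed.

Lemma coef2_bound (x y : C) (n : nat) : (Cmod x < 1)%R -> (Cmod y < 1)%R ->
  (Cmod (/ INR (S n) * / (1 - x ^ S n) * / (1 - y ^ S n)) <= / (1 - Cmod x) * / (1 - Cmod y))%R.
Proof.
  intros Hx Hy; destruct (inv_one_sub_pow_bound y n Hy) as [_ H]; rewrite Cmod_mult.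
  apply Rmult_le_compat; try apply Cmod_ge_0; auto; now apply coef1_bound.
Qed.

Lemma Cmod_mult_pow_lt_1 (z x : C) (n : nat) : (Cmod z < 1)%R -> (Cmod x < 1)%R -> (Cmod (z * x ^ n) < 1)%R.
Proof.
  intros Hz Hx; rewrite Cmod_mult, Cmod_pow.
  assert (Cmod x ^ n <= 1)%R by (rewrite <- (pow1 n); apply pow_incr; split; [apply Cmod_ge_0|lra]).
  assert (0 <= Cmod x ^ n)%R by (apply pow_le, Cmod_ge_0).
  generalize (Cmod_ge_0 z); nra.
Qed.

Lemma Cpow_mult_distr (a b : C) (n : nat) : (a * b) ^ n = a ^ n * b ^ n.
Proof. induction n; simpl; [ring|rewrite IHn; ring]. Qed.

Lemma Cexp_log_qpoch (z y : C) : (Cmod z < 1)%R -> (Cmod y < 1)%R ->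
  Cexp (psum (fun n => / INR (S n) * / (1 - y ^ S n)) z) * qpoch z y = 1.
Proof.
  intros Hz Hy; set (c := fun n => / INR (S n) * / (1 - y ^ S n)).
  assert (Hc : forall n, (Cmod (c n) <= / (1 - Cmod y))%R) by (intros; now apply coef1_bound).
  assert (Hstep : forall w, (Cmod w < 1)%R -> Cexp (psum c w) * (1 - w) = Cexp (psum c (w * y))).
  { intros w Hw.
    assert (Hwy : (Cmod (w * y) < 1)%R) by (generalize (Cmod_mult_pow_lt_1 w y 1 Hw Hy); simpl; now rewrite Cmult_1_r).
    replace (psum c w) with (psum c (w * y) + (psum c w - psum c (w * y))) by ring.
    rewrite (psum_sub c c w (w * y) _ _ Hc Hc Hw Hwy), Cexp_plus.
    rewrite (Csum_ext _ (fun n => / INR (S n) * w ^ S n)).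
    - fold (psum (fun n => / INR (S n)) w); rewrite <- Cmult_assoc, Cexp_log_series by assumption; ring.
    - intros n; rewrite Cpow_mult_distr; unfold c; destruct (inv_one_sub_pow_bound y n Hy) as [H0 _].
      generalize (INR_S_neq_0 n); revert H0; generalize (y ^ S n) (w ^ S n) (RtoC (INR (S n))); intros; field; auto. }
  apply (Ccvg_unique (fun N => Cexp (psum c z) * qprt N z y)).
  - apply Ccvg_mult; [apply Ccvg_const|now apply qprt_cvg].
  - apply Ccvg_ext with (fun N => Cexp (psum c (z * y ^ N))).
    + induction n as [|n IH]; [unfold qprt; simpl; rewrite !Cmult_1_r; reflexivity|].
      unfold qprt in *; simpl Cprod; rewrite Cmult_assoc, <- IH, Hstep by now apply Cmod_mult_pow_lt_1.
      do 2 f_equal; simpl; ring.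
    + now apply (Cexp_psum_cvg c z y (/ (1 - Cmod y))%R).
Qed.

Lemma dpoch_cvg_1 (z x y : C) : (Cmod x < 1)%R -> (Cmod y < 1)%R -> Ccvg (fun N => dpoch (z * x ^ N) x y) 1.
Proof.
  intros Hx Hy; destruct (two_bounds x y Hx Hy) as [r [Hr [H1 H2]]].
  assert (Hd : forall w, (Cmod (dpoch w x y - 1) <= exp ((exp (Cmod w / (1 - r)) * (Cmod w / (1 - r))) / (1 - r)) - 1)%R).
  { intros w; apply (Ccvg_le (fun N => dprt N w x y - 1)).
    - unfold Cminus; apply Ccvg_plus; [now apply dprt_cvg|apply Ccvg_const].
    - intros N; set (s := (Cmod w / (1 - r))%R).
      assert (Hs : (0 <= s)%R) by (apply Rdiv_le_0_compat; [apply Cmod_ge_0|lra]).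
      rewrite dprt_rows.
      rewrite (Cprod_ext N _ (fun j => 1 - (1 - qprt N (w * x ^ j) y))) by (intros; ring).
      apply Cprod_geom_bound; [apply Rmult_le_pos; [left; apply exp_pos|exact Hs]|exact Hr|].
      intros k _; rewrite Cmod_sub_sym.
      destruct (qprt_bound N (w * x ^ k) y (Cmod w * r ^ k) r) as [_ B]; auto; [apply Cmod_mult_pow_le; lra|].
      eapply Rle_trans; [apply B|].
      replace (Cmod w * r ^ k / (1 - r))%R with (s * r ^ k)%R by (unfold s; field; lra).
      assert (Hk : (0 <= r ^ k <= 1)%R) by (split; [apply pow_le; lra|rewrite <- (pow1 k); apply pow_incr; lra]).
      eapply Rle_trans; [apply exp_sub_1_le; nra|].
      replace (exp s * s * r ^ k)%R with (s * r ^ k * exp s)%R by ring.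
      apply Rmult_le_compat_l; [nra|]; apply exp_le_mono; nra. }
  eapply Ccvg_squeeze; [intros N; apply Hd|].
  replace (Finite 0) with (Finite (exp (exp (0 / (1 - r)) * (0 / (1 - r)) / (1 - r)) - 1)).
  2: { unfold Rdiv; rewrite !Rmult_0_l, Rmult_0_r, Rmult_0_l, exp_0; f_equal; ring. }
  assert (Hlim : is_lim_seq (fun n => Cmod (z * x ^ n)) 0%R).
  { apply is_lim_seq_ext with (fun n => Cmod z * Cmod x ^ n)%R; [intros; now rewrite Cmod_mult, Cmod_pow|].
    apply lim_geom; split; [apply Cmod_ge_0|exact Hx]. }
  apply (is_lim_seq_continuous (fun w => exp (exp (w / (1 - r)) * (w / (1 - r)) / (1 - r)) - 1)%R _ 0%R); [|exact Hlim].
  apply derivable_continuous_pt; apply ex_derive_Reals_0; auto_derive; lra.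
Qed.

(* Both sides are invariant under [z -> z x], and tend to [1] along [z x^N]. *)
Lemma Cexp_log_dpoch (z x y : C) : (Cmod z < 1)%R -> (Cmod x < 1)%R -> (Cmod y < 1)%R ->
  Cexp (psum (fun n => / INR (S n) * / (1 - x ^ S n) * / (1 - y ^ S n)) z) * dpoch z x y = 1.
Proof.
  intros Hz Hx Hy; set (c := fun n => / INR (S n) * / (1 - x ^ S n) * / (1 - y ^ S n)).
  assert (Hc : forall n, (Cmod (c n) <= / (1 - Cmod x) * / (1 - Cmod y))%R) by (intros; now apply coef2_bound).
  assert (Hstep : forall w, (Cmod w < 1)%R -> Cexp (psum c w) * dpoch w x y = Cexp (psum c (w * x)) * dpoch (w * x) x y).
  { intros w Hw.
    assert (Hwx : (Cmod (w * x) < 1)%R) by (generalize (Cmod_mult_pow_lt_1 w x 1 Hw Hx); simpl; now rewrite Cmult_1_r).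
    replace (psum c w) with (psum c (w * x) + (psum c w - psum c (w * x))) by ring.
    rewrite (psum_sub c c w (w * x) _ _ Hc Hc Hw Hwx), Cexp_plus, dpoch_step by assumption.
    rewrite (Csum_ext _ (fun n => / INR (S n) * / (1 - y ^ S n) * w ^ S n)).
    - fold (psum (fun n => / INR (S n) * / (1 - y ^ S n)) w).
      transitivity (Cexp (psum c (w * x)) * dpoch (w * x) x y *
        (Cexp (psum (fun n => / INR (S n) * / (1 - y ^ S n)) w) * qpoch w y)); [ring|].
      rewrite Cexp_log_qpoch by assumption; ring.
    - intros n; rewrite Cpow_mult_distr; unfold c.
      destruct (inv_one_sub_pow_bound y n Hy) as [H0 _]; destruct (inv_one_sub_pow_bound x n Hx) as [H1 _].
      generalize (INR_S_neq_0 n); revert H0 H1; generalize (x ^ S n) (y ^ S n) (w ^ S n) (RtoC (INR (S n))); intros; field; auto. }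
  apply (Ccvg_unique (fun N => Cexp (psum c (z * x ^ N)) * dpoch (z * x ^ N) x y)).
  - apply Ccvg_ext with (fun _ => Cexp (psum c z) * dpoch z x y); [|apply Ccvg_const].
    induction n as [|n IH]; [simpl; now rewrite Cmult_1_r|].
    rewrite IH, Hstep by now apply Cmod_mult_pow_lt_1.
    replace (z * x ^ n * x) with (z * x ^ S n) by (simpl; ring); reflexivity.
  - replace (RtoC 1) with (RtoC 1 * RtoC 1) by ring; apply Ccvg_mult; [|now apply dpoch_cvg_1].
    now apply (Cexp_psum_cvg c z x (/ (1 - Cmod x) * / (1 - Cmod y))%R).
Qed.

(** * Bilateral series *)

(* Bilateral sums are taken symmetrically and without their term of index 0. *)
Definition bil (f : Z -> C) : C := Csum (fun n => f (Z.of_nat (S n)) + f (- Z.of_nat (S n))%Z).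

Definition dom (f : Z -> C) : Prop :=
  exists b, summable b /\ forall k : Z, k <> 0%Z -> (Cmod (f k) <= b (Nat.pred (Z.abs_nat k)))%R.

Definition sgl (n : Z) (f : Z -> C) : C := if Z.eq_dec n 0 then 0 else f n.

Lemma abs_nat_pos (n : nat) : Nat.pred (Z.abs_nat (Z.of_nat (S n))) = n.
Proof. lia. Qed.

Lemma abs_nat_neg (n : nat) : Nat.pred (Z.abs_nat (- Z.of_nat (S n))) = n.
Proof. lia. Qed.

Lemma bil_ext (f g : Z -> C) : (forall k, k <> 0%Z -> f k = g k) -> bil f = bil g.
Proof. intros H; apply Csum_ext; intros n; rewrite !H by lia; reflexivity. Qed.

Lemma dom_mult_bounded (f g : Z -> C) (M : R) : dom f -> (forall k, k <> 0%Z -> (Cmod (g k) <= M)%R) -> dom (fun k => f k * g k).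
Proof.
  intros [b [[Hb [B HB]] Hf]] Hg.
  assert (HM : (0 <= M)%R) by (eapply Rle_trans; [apply Cmod_ge_0|apply (Hg 1%Z); lia]).
  exists (fun n => b n * M)%R; split.
  - split; [intros n; apply Rmult_le_pos; auto|exists (B * M)%R; intros N].
    replace (Rps (fun n => b n * M)%R N) with (Rps b N * M)%R by (clear; induction N; simpl; [ring|rewrite <- IHN; ring]).
    apply Rmult_le_compat_r; auto.
  - intros k Hk; rewrite Cmod_mult; apply Rmult_le_compat; auto; apply Cmod_ge_0.
Qed.

Lemma dom_ext (f g : Z -> C) : (forall k, k <> 0%Z -> f k = g k) -> dom f -> dom g.
Proof. intros H [b [Hb Hf]]; exists b; split; [exact Hb|]; intros k Hk; rewrite <- H by assumption; auto. Qed.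

Lemma Csum_scal_r (b : nat -> R) (a : nat -> C) (c : C) : summable b -> (forall n, (Cmod (a n) <= b n)%R) ->
  Csum (fun n => a n * c) = Csum a * c.
Proof.
  intros Hb Ha; apply Csum_eq; apply Ccvg_ext with (fun N => Cps a N * c).
  - intros N; rewrite Cmult_comm, <- Cps_scal; apply Cps_ext; intros; ring.
  - apply Ccvg_mult; [now apply (Csum_cvg b)|apply Ccvg_const].
Qed.

Lemma bil_CI (f : Z -> R -> C) (g : Z -> C) (h : R -> C) (M : R) : dom g -> (forall k, k <> 0%Z -> cont01 (f k)) -> cont01 h ->
  (forall x, (0 <= x <= 1)%R -> (Cmod (h x) <= 1)%R) ->
  (forall k x, k <> 0%Z -> (0 <= x <= 1)%R -> (Cmod (f k x) <= M)%R) ->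
  cont01 (fun x => bil (fun k => g k * f k x)) /\
  CI (fun x => bil (fun k => g k * f k x) * h x) = bil (fun k => g k * CI (fun x => f k x * h x)).
Proof.
  intros Hg Hf Hh Hh1 HM.
  assert (H0 : (0 <= M)%R) by (eapply Rle_trans; [apply Cmod_ge_0|apply (HM 1%Z 0%R); [lia|lra]]).
  destruct (dom_mult_bounded g (fun _ => RtoC M) M Hg) as [b [Hb Hbb]].
  { intros; rewrite Cmod_R, Rabs_pos_eq; lra. }
  assert (Hk : forall k x, k <> 0%Z -> (0 <= x <= 1)%R -> (Cmod (g k * f k x) <= b (Nat.pred (Z.abs_nat k)))%R).
  { intros k x Hk Hx; eapply Rle_trans; [|apply Hbb; exact Hk]; rewrite !Cmod_mult.
    apply Rmult_le_compat_l; [apply Cmod_ge_0|]; rewrite Cmod_R, Rabs_pos_eq by assumption; auto. }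
  set (u := fun (n : nat) (x : R) => g (Z.of_nat (S n)) * f (Z.of_nat (S n)) x + g (- Z.of_nat (S n))%Z * f (- Z.of_nat (S n))%Z x).
  assert (Hb2 : summable (fun n => b n + b n)%R) by now apply summable_plus.
  assert (Hu : forall n x, (0 <= x <= 1)%R -> (Cmod (u n x) <= b n + b n)%R).
  { intros n x Hx; eapply Rle_trans; [apply Cmod_triangle|]; apply Rplus_le_compat.
    - replace (b n) with (b (Nat.pred (Z.abs_nat (Z.of_nat (S n))))) by (now rewrite abs_nat_pos); apply Hk; [lia|exact Hx].
    - replace (b n) with (b (Nat.pred (Z.abs_nat (- Z.of_nat (S n))))) by (now rewrite abs_nat_neg); apply Hk; [lia|exact Hx]. }
  assert (Huc : forall n, cont01 (u n)).
  { intros n; apply cont01_plus; apply cont01_mult; try apply cont01_const; apply Hf; lia. }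
  split; [apply (Csum_CI u (fun n => b n + b n)%R Hb2 Huc Hu)|].
  destruct (Csum_CI (fun n x => u n x * h x) (fun n => b n + b n)%R Hb2) as [_ B].
  - intros n; now apply cont01_mult.
  - intros n x Hx; rewrite Cmod_mult, <- (Rmult_1_r (b n + b n)); apply Rmult_le_compat; try apply Cmod_ge_0; auto.
  - rewrite (CI_ext _ (fun x => Csum (fun n => u n x * h x))).
    + rewrite B; apply Csum_ext; intros n; unfold u.
      rewrite (CI_ext _ (fun x => g (Z.of_nat (S n)) * (f (Z.of_nat (S n)) x * h x) + g (- Z.of_nat (S n))%Z * (f (- Z.of_nat (S n))%Z x * h x)))
        by (intros; ring).
      assert (Hfh : forall k, k <> 0%Z -> cont01 (fun x => f k x * h x)) by (intros; apply cont01_mult; auto).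
      rewrite CI_plus, !CI_scal; try (apply cont01_mult; [apply cont01_const|]); try (apply Hfh; lia); reflexivity.
    + intros x Hx; symmetry; apply (Csum_scal_r (fun n => b n + b n)%R); auto.
Qed.

Lemma bil_delta (g : Z -> C) (n : Z) : bil (fun k => g k * (if Z.eq_dec k n then 1 else 0)) = sgl n g.
Proof.
  unfold bil, sgl; destruct (Z.eq_dec n 0) as [->|Hn].
  - rewrite (Csum_ext _ (fun _ => 0)).
    + apply (Csum_single (fun _ => 0) 0); intros; ring.
    + intros m; destruct (Z.eq_dec _ 0); [lia|]; destruct (Z.eq_dec _ 0); [lia|ring].
  - rewrite (Csum_single _ (Nat.pred (Z.abs_nat n))).
    + destruct (Z_lt_le_dec 0 n) as [H|H].
      * replace (Z.of_nat (S (Nat.pred (Z.abs_nat n)))) with n by lia.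
        destruct (Z.eq_dec n n); [|lia]; destruct (Z.eq_dec (- n) n); [lia|ring].
      * replace (Z.of_nat (S (Nat.pred (Z.abs_nat n)))) with (- n)%Z by lia; rewrite Z.opp_involutive.
        destruct (Z.eq_dec n n); [|lia]; destruct (Z.eq_dec (- n) n); [lia|ring].
    + intros m Hm; destruct (Z.eq_dec _ n); [lia|]; destruct (Z.eq_dec _ n); [lia|ring].
Qed.

(** * Fourier coefficients of the building blocks *)

Definition Ek (k : Z) (x : R) (w : C) : C := e2pi (IZR k * x * w) / (1 - e2pi (IZR k * w)).

(* The [n]-th Fourier coefficient of [x |-> Ek k x w] on [0, 1]. *)
Definition Jk (k n : Z) (w : C) : C := - (1) / (2 * PI * Ci * (IZR k * w - IZR n)).

Lemma Im_IZR_mult (k : Z) (w : C) : Im (IZR k * w) = (IZR k * Im w)%R.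
Proof. destruct w; simpl; ring. Qed.

Lemma Im_RR_mult (a b : R) (w : C) : Im (a * b * w) = (a * b * Im w)%R.
Proof. destruct w; simpl; ring. Qed.

Lemma abs_IZR_pow (s : R) (k : Z) : exp (IZR (Z.abs k) * s) = (exp s ^ Z.abs_nat k)%R.
Proof.
  rewrite <- Nat2Z.id with (n := Z.abs_nat k), Zabs2Nat.id_abs.
  rewrite <- (Z2Nat.id (Z.abs k)) at 1 by lia; rewrite <- INR_IZR_INZ.
  generalize (Z.to_nat (Z.abs k)); intros n; induction n as [|n IH]; [simpl; rewrite Rmult_0_l; apply exp_0|].
  rewrite S_INR, Rmult_plus_distr_r, Rmult_1_l, exp_plus, IH; simpl; ring.
Qed.

Lemma one_sub_e2pi_neq_0 (z : C) : Im z <> 0%R -> 1 - e2pi z <> 0.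
Proof.
  intros Hz H.
  assert (E : e2pi z = 1) by (replace (e2pi z) with (1 - (1 - e2pi z)) by ring; rewrite H; ring).
  apply (f_equal Cmod) in E; rewrite Cmod_e2pi, Cmod_1, <- exp_0 in E; apply exp_inv in E.
  generalize PI_RGT_0; intros; apply Hz; nra.
Qed.

Lemma reflect_fraction (a b : C) : b <> 0 -> 1 - b <> 0 -> - (a * / b / (1 - / b)) = a / (1 - b).
Proof.
  intros Hb H1; replace (1 - / b) with (- (1 - b) * / b) by (field; exact Hb).
  assert (- (1 - b) <> 0) by (intros H; apply H1; replace (1 - b) with (- - (1 - b)) by ring; rewrite H; ring).
  field; repeat split; auto; intros H2; apply H; replace (- (1 - b)) with (b - 1) by ring; exact H2.
Qed.

Lemma Ek_bound (k : Z) (x m : R) (w : C) : k <> 0%Z -> Im w <> 0%R -> (0 <= m)%R -> (m <= x)%R -> (m <= 1 - x)%R ->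
  (Cmod (Ek k x w) <= / (1 - exp (- (2 * PI * Rabs (Im w)))) * exp (- (2 * PI * Rabs (Im w) * m)) ^ Z.abs_nat k)%R.
Proof.
  intros Hk Hw Hm Hmx Hmx'; generalize PI_RGT_0; intros Hpi.
  set (h := Rabs (Im w)); assert (Hh : (0 < h)%R) by (unfold h; now apply Rabs_pos_lt).
  rewrite <- abs_IZR_pow.
  assert (Hkh : (IZR (Z.abs k) * h = Rabs (IZR k * Im w))%R) by (rewrite Rabs_mult, abs_IZR; reflexivity).
  assert (Hk1 : (1 <= IZR (Z.abs k))%R) by (apply IZR_le; lia).
  assert (Hrho : (exp (- (2 * PI * h)) < 1)%R) by (rewrite <- exp_0; apply exp_increasing; nra).
  assert (Hden : forall z, (IZR (Z.abs k) * h <= Im z)%R -> (1 - exp (- (2 * PI * h)) <= Cmod (1 - e2pi z))%R).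
  { intros z Hz; eapply Rle_trans; [|apply one_sub_Cmod_lower, Cmod_e2pi_le, Hz].
    apply Rplus_le_compat_l, Ropp_le_contravar, exp_le_mono, Ropp_le_contravar, Rmult_le_compat_l; [lra|].
    rewrite <- (Rmult_1_l h) at 1; apply Rmult_le_compat_r; lra. }
  assert (Hmain : forall z v, (IZR (Z.abs k) * h <= Im z)%R -> (m * (IZR (Z.abs k) * h) <= Im v)%R ->
    (Cmod (e2pi v / (1 - e2pi z)) <= / (1 - exp (- (2 * PI * h))) * exp (IZR (Z.abs k) * - (2 * PI * h * m)))%R).
  { intros z v Hz Hv; assert (D := Hden z Hz).
    assert (H0 : 1 - e2pi z <> 0) by (apply Cmod_gt_0; lra).
    rewrite Cmod_div by assumption; unfold Rdiv; rewrite Rmult_comm; apply Rmult_le_compat.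
    - left; apply Rinv_0_lt_compat; lra.
    - apply Cmod_ge_0.
    - apply Rinv_le_contravar; lra.
    - rewrite Cmod_e2pi; apply exp_le_mono.
      replace (IZR (Z.abs k) * - (2 * PI * h * m))%R with (- (2 * PI * (m * (IZR (Z.abs k) * h))))%R by ring.
      apply Ropp_le_contravar, Rmult_le_compat_l; lra. }
  unfold Ek; destruct (Rle_dec 0 (IZR k * Im w)) as [Hs|Hs].
  - rewrite Rabs_pos_eq in Hkh by assumption.
    apply Hmain; [rewrite Im_IZR_mult; lra|rewrite Im_RR_mult].
    rewrite Hkh; replace (IZR k * x * Im w)%R with (x * (IZR k * Im w))%R by ring; apply Rmult_le_compat_r; lra.
  - rewrite Rabs_left in Hkh by lra.
    assert (Hne : 1 - e2pi (IZR k * w) <> 0) by (apply one_sub_e2pi_neq_0; rewrite Im_IZR_mult; lra).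
    replace (e2pi (IZR k * x * w) / (1 - e2pi (IZR k * w)))
      with (- (e2pi (- (IZR k * (1 - x) * w)) / (1 - e2pi (- (IZR k * w))))).
    + rewrite Cmod_opp; apply Hmain; [rewrite Im_opp, Im_IZR_mult; lra|].
      rewrite Im_opp; replace (1 - x) with (RtoC (1 - x)) by (rewrite RtoC_minus; reflexivity); rewrite Im_RR_mult.
      rewrite Hkh; replace (- (IZR k * (1 - x) * Im w))%R with ((1 - x) * - (IZR k * Im w))%R by ring; apply Rmult_le_compat_r; lra.
    + replace (- (IZR k * (1 - x) * w)) with (IZR k * x * w + - (IZR k * w)) by ring.
      rewrite e2pi_plus, e2pi_opp; apply reflect_fraction; [apply e2pi_neq_0|exact Hne].
Qed.

Lemma Ek_bounded (w : C) : Im w <> 0%R -> exists M : R, forall k x, k <> 0%Z -> (0 <= x <= 1)%R -> (Cmod (Ek k x w) <= M)%R.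
Proof.
  intros Hw; exists (/ (1 - exp (- (2 * PI * Rabs (Im w)))))%R; intros k x Hk Hx.
  eapply Rle_trans; [apply (Ek_bound k x 0 w Hk Hw); lra|].
  rewrite Rmult_0_r, Ropp_0, exp_0, pow1; lra.
Qed.

Lemma Ek_dom (w : C) (x : R) : Im w <> 0%R -> (0 < x < 1)%R -> dom (fun k => Ek k x w).
Proof.
  intros Hw Hx; generalize PI_RGT_0; intros Hpi.
  set (m := Rmin x (1 - x)); assert (Hm : (0 < m)%R) by (apply Rmin_pos; lra).
  assert (Hh : (0 < Rabs (Im w))%R) by now apply Rabs_pos_lt.
  set (s := exp (- (2 * PI * Rabs (Im w) * m))).
  assert (Hs : (0 <= s < 1)%R).
  { split; [left; apply exp_pos|unfold s; rewrite <- exp_0; apply exp_increasing].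
    apply Ropp_lt_gt_0_contravar; apply Rmult_lt_0_compat; [apply Rmult_lt_0_compat; lra|exact Hm]. }
  set (K := (/ (1 - exp (- (2 * PI * Rabs (Im w)))))%R).
  assert (HK : (0 < K)%R).
  { apply Rinv_0_lt_compat; assert (exp (- (2 * PI * Rabs (Im w))) < exp 0)%R; [|rewrite exp_0 in *; lra].
    apply exp_increasing; nra. }
  exists (fun n => K * s * s ^ n)%R; split; [apply summable_geom; [apply Rmult_le_pos; lra|exact Hs]|].
  intros k Hk; eapply Rle_trans; [apply (Ek_bound k x m w Hk Hw); [lra|apply Rmin_l|apply Rmin_r]|].
  fold s K; rewrite Rmult_assoc; right; f_equal.
  replace (Z.abs_nat k) with (S (Nat.pred (Z.abs_nat k))) at 1 by lia; reflexivity.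
Qed.

Lemma Ek_cont01 (k : Z) (w : C) : cont01 (fun x => Ek k x w).
Proof.
  unfold Ek, Cdiv; apply cont01_mult; [|apply cont01_const].
  apply cont01_ext with (fun x => e2pi (IZR k * w * x + 0)); [intros; f_equal; ring|apply cont01_e2pi_lin].
Qed.

Lemma cont01_e2pi_IZR (n : Z) : cont01 (fun x => e2pi (IZR n * x)).
Proof. apply cont01_ext with (fun t => e2pi (IZR n * t + 0)); [intros; f_equal; ring|apply cont01_e2pi_lin]. Qed.

Lemma cont01_e2pi_neg (n : Z) : cont01 (fun x => e2pi (- (IZR n * x))).
Proof. apply cont01_ext with (fun t => e2pi (- IZR n * t + 0)); [intros; f_equal; ring|apply cont01_e2pi_lin]. Qed.

Lemma lin_neq_0 (k n : Z) (w : C) : k <> 0%Z -> Im w <> 0%R -> IZR k * w - IZR n <> 0.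
Proof.
  intros Hk Hw H; apply (f_equal Im) in H; rewrite Im_minus, Im_IZR_mult in H; simpl in H.
  apply Hw; apply Rmult_eq_reg_l with (IZR k); [lra|]; intros E; apply Hk; now apply eq_IZR.
Qed.

Lemma CI_Ek (k n : Z) (w : C) : k <> 0%Z -> Im w <> 0%R -> CI (fun x => Ek k x w * e2pi (- (IZR n * x))) = Jk k n w.
Proof.
  intros Hk Hw; assert (Hl := lin_neq_0 k n w Hk Hw).
  assert (Hne : 1 - e2pi (IZR k * w) <> 0).
  { apply one_sub_e2pi_neq_0; rewrite Im_IZR_mult; intros E; apply Rmult_integral in E; destruct E as [E|E]; [|auto].
    apply Hk; now apply eq_IZR. }
  rewrite (CI_ext _ (fun x => / (1 - e2pi (IZR k * w)) * e2pi ((IZR k * w - IZR n) * x + 0))).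
  - rewrite CI_scal, CI_e2pi_lin by (assumption || apply cont01_e2pi_lin).
    rewrite Cplus_0_r, e2pi_0; rewrite e2pi_minus, e2pi_IZR.
    unfold Jk; generalize two_PI_Ci_neq_0; intros Hp.
    revert Hl Hne Hp; generalize (IZR k * w - IZR n) (e2pi (IZR k * w)) (2 * PI * Ci); intros a b c Ha Hb Hc.
    replace (b * / 1) with b by (field; injection; lra); field; auto.
  - intros x _; unfold Ek, Cdiv; rewrite Cplus_0_r.
    replace ((IZR k * w - IZR n) * x) with (IZR k * x * w + - (IZR n * x)) by ring; rewrite e2pi_plus; ring.
Qed.

Lemma CI_delta (k n : Z) : CI (fun x => e2pi (IZR k * x) * e2pi (- (IZR n * x))) = if Z.eq_dec k n then 1 else 0.
Proof.
  assert (H := CI_e2pi_int (k - n)).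
  rewrite (CI_ext _ (fun x => e2pi (IZR (k - n) * x))).
  - destruct (Z.eq_dec k n) as [->|Hk]; [|apply H; lia].
    rewrite (CI_ext _ (fun _ => 1)); [apply CI_const|]; intros x _; rewrite Z.sub_diag, Cmult_0_l; apply e2pi_0.
  - intros x _; rewrite <- e2pi_plus, minus_IZR, RtoC_minus; f_equal; ring.
Qed.

Lemma Cmod_e2pi_neg (n : Z) (x : R) : Cmod (e2pi (- (IZR n * x))) = 1%R.
Proof. rewrite <- RtoC_mult, <- RtoC_opp, Cmod_e2pi; simpl; rewrite Rmult_0_r, Ropp_0, exp_0; reflexivity. Qed.

Lemma bil_e2pi (A : Z -> C) : dom A -> cont01 (fun x => bil (fun k => A k * e2pi (IZR k * x))) /\
  forall n, CI (fun x => bil (fun k => A k * e2pi (IZR k * x)) * e2pi (- (IZR n * x))) = sgl n A.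
Proof.
  intros HA.
  assert (H := fun n => bil_CI (fun k x => e2pi (IZR k * x)) A (fun x => e2pi (- (IZR n * x))) 1 HA
    (fun k _ => cont01_e2pi_IZR k) (cont01_e2pi_neg n) (fun x _ => Req_le _ _ (Cmod_e2pi_neg n x))).
  assert (H1 : forall (k : Z) (x : R), k <> 0%Z -> (0 <= x <= 1)%R -> (Cmod (e2pi (IZR k * x)) <= 1)%R).
  { intros; rewrite <- RtoC_mult, Cmod_e2pi; simpl; rewrite Rmult_0_r, Ropp_0, exp_0; lra. }
  split; [apply (H 0%Z H1)|]; intros n; rewrite (proj2 (H n H1)), <- bil_delta.
  apply bil_ext; intros; now rewrite CI_delta.
Qed.

Lemma bil_Ek (A : Z -> C) (w : C) : dom A -> Im w <> 0%R -> cont01 (fun x => bil (fun k => A k * Ek k x w)) /\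
  forall n, CI (fun x => bil (fun k => A k * Ek k x w) * e2pi (- (IZR n * x))) = bil (fun k => A k * Jk k n w).
Proof.
  intros HA Hw; destruct (Ek_bounded w Hw) as [M HM].
  assert (H := fun n => bil_CI (fun k x => Ek k x w) A (fun x => e2pi (- (IZR n * x))) M HA
    (fun k _ => Ek_cont01 k w) (cont01_e2pi_neg n) (fun x _ => Req_le _ _ (Cmod_e2pi_neg n x)) HM).
  split; [apply (H 0%Z)|]; intros n; rewrite (proj2 (H n)).
  apply bil_ext; intros; now rewrite CI_Ek.
Qed.

Lemma sgl_Ek (m : Z) (A : Z -> C) (w : C) : Im w <> 0%R -> cont01 (fun x => sgl m (fun k => A k * Ek k x w)) /\
  forall n, CI (fun x => sgl m (fun k => A k * Ek k x w) * e2pi (- (IZR n * x))) = sgl m (fun k => A k * Jk k n w).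
Proof.
  intros Hw; unfold sgl; destruct (Z.eq_dec m 0) as [->|Hm].
  - split; [apply cont01_const|]; intros n.
    rewrite (CI_ext _ (fun _ => 0)) by (intros; ring); apply CI_const.
  - split; [apply cont01_mult; [apply cont01_const|apply Ek_cont01]|]; intros n.
    rewrite (CI_ext _ (fun x => A m * (Ek m x w * e2pi (- (IZR n * x))))) by (intros; ring).
    rewrite CI_scal, CI_Ek by (assumption || (apply cont01_mult; [apply Ek_cont01|apply cont01_e2pi_neg])); reflexivity.
Qed.

Lemma fourier_zero (f : R -> C) : cont01 f -> (forall n : Z, CI (fun t => f t * e2pi (- (IZR n * t))) = 0) ->
  forall x, (0 < x < 1)%R -> f x = 0.
Proof.
  intros Hf Hn; apply fourier_uniqueness; [exact Hf|]; intros n; rewrite <- (Hn (- n)%Z).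
  apply CI_ext; intros t _; rewrite opp_IZR, RtoC_opp; do 2 f_equal; ring.
Qed.

(* The [n]-th Fourier coefficient of [x |-> (x - 1/2) ^ j] on [0, 1], for [j <= 3]. *)
Definition mom (n : Z) (j : nat) : C :=
  let b := - (1) / (2 * PI * Ci * IZR n) in
  if Z.eq_dec n 0 then match j with 0 => 1 | 2 => / 12 | _ => 0 end
  else match j with 0 => 0 | 1 => b | 2 => - (2) * b * b | _ => b / 4 + 6 * b * b * b end.

Definition ypow (x : R) (j : nat) : C := (x - / 2) ^ j.

Lemma cont01_ypow (j : nat) : cont01 (fun x => ypow x j).
Proof.
  assert (H : cont01 (fun x => RtoC x - / 2)).
  { apply Cder_cont01; intros x _; exists (1 + 0); apply Cder_plus; [apply Cder_id|apply Cder_const]. }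
  unfold ypow; induction j; simpl; [apply cont01_const|now apply cont01_mult].
Qed.

Lemma Cder_y (x : R) : Cder (fun t => RtoC t - / 2) x 1.
Proof. eapply Cder_eq; [apply Cder_plus; [apply Cder_id|apply Cder_const]|ring]. Qed.

Lemma Cder_pow_y (x : R) (m : nat) : Cder (fun t => (RtoC t - / 2) ^ S m) x (INR (S m) * (x - / 2) ^ m).
Proof.
  induction m as [|m IHm].
  - eapply Cder_ext; [intros; symmetry; apply Cmult_1_r|]; eapply Cder_eq; [apply Cder_y|simpl; ring].
  - change (fun t : R => (RtoC t - / 2) ^ S (S m)) with (fun t : R => (RtoC t - / 2) * (RtoC t - / 2) ^ S m).
    eapply Cder_eq; [apply (Cder_mult (fun t => RtoC t - / 2)); [apply Cder_y|apply IHm]|].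
    rewrite (S_INR (S m)), RtoC_plus; simpl Cpow; ring.
Qed.

Lemma CI_ypow (n : Z) (j : nat) : (j <= 3)%nat -> CI (fun x => ypow x j * e2pi (- (IZR n * x))) = mom n j.
Proof.
  intros Hj.
  assert (H2 : RtoC 2 <> 0) by (injection; lra).
  assert (H12 : RtoC 12 <> 0) by (injection; lra).
  assert (Hy0 : RtoC 0 - / 2 = - / 2) by ring.
  assert (Hy1 : RtoC 1 - / 2 = / 2) by (field; exact H2).
  assert (FT : forall G : R -> C, (forall x, Cder G x (ypow x j * e2pi (- (IZR n * x)))) ->
    CI (fun x => ypow x j * e2pi (- (IZR n * x))) = G 1%R - G 0%R).
  { intros G HG; apply CI_FTC; [intros; apply HG|]; apply cont01_mult; [apply cont01_ypow|apply cont01_e2pi_neg]. }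
  unfold mom; destruct (Z.eq_dec n 0) as [->|Hn].
  - assert (He : forall x : R, e2pi (- (0 * x)) = 1) by (intros; replace (- (0 * x)) with (RtoC 0) by ring; apply e2pi_0).
    assert (P : CI (fun x => ypow x j * e2pi (- (0 * x))) = / RtoC (INR (S j)) * ((/ 2) ^ S j - (- / 2) ^ S j)).
    { rewrite (FT (fun t => / RtoC (INR (S j)) * (RtoC t - / 2) ^ S j)); [rewrite Hy0, Hy1; ring|].
      intros x; rewrite He; eapply Cder_eq; [apply Cder_scal|].
      - apply Cder_pow_y.
      - unfold ypow; rewrite Cmult_assoc, Cinv_l by apply INR_S_neq_0; ring. }
    rewrite P; destruct j as [|[|[|[|j]]]]; [..|lia]; simpl.
    + field.
    + replace (1 + 1)%R with 2%R by ring; field.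
    + replace (1 + 1 + 1)%R with 3%R by ring; field.
    + ring.
  - set (l := - (2 * PI * Ci * IZR n)).
    assert (Hl : l <> 0).
    { unfold l; intros E; assert (E' : 2 * PI * Ci * IZR n = 0) by (replace (2 * PI * Ci * IZR n) with (- - (2 * PI * Ci * IZR n)) by ring; rewrite E; ring).
      apply Cmult_integral in E'; destruct E' as [E'|E']; [now apply two_PI_Ci_neq_0 in E'|].
      apply (f_equal Re) in E'; simpl in E'; now apply eq_IZR in E'. }
    set (b := - (1) / (2 * PI * Ci * IZR n)).
    assert (Hb : b = / l).
    { unfold b; replace (2 * PI * Ci * IZR n) with (- l) by (unfold l; ring).
      field; exact Hl. }
    assert (De : forall x, Cder (fun t => e2pi (- (IZR n * t))) x (l * e2pi (- (IZR n * x)))).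
    { intros x; apply Cder_ext with (fun t => e2pi (- IZR n * t + 0)); [intros; f_equal; ring|].
      eapply Cder_eq; [apply Cder_e2pi_lin|]; unfold l; replace (- IZR n * x + 0) with (- (IZR n * x)) by ring; ring. }
    assert (E1 : e2pi (- (IZR n * 1%R)) = 1).
    { rewrite Cmult_1_r, <- RtoC_opp, <- opp_IZR; apply e2pi_IZR. }
    assert (E0 : e2pi (- (IZR n * 0%R)) = 1) by (replace (- (IZR n * 0)) with (RtoC 0) by ring; apply e2pi_0).
    rewrite Hb; destruct j as [|[|[|[|j]]]]; [..|lia].
    + rewrite (FT (fun t => / l * e2pi (- (IZR n * t)))).
      * rewrite E1, E0; ring.
      * intros x; eapply Cder_eq; [apply Cder_scal, De|]; unfold ypow; simpl; field; exact Hl.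
    + rewrite (FT (fun t => (/ l * (t - / 2) + - / (l * l)) * e2pi (- (IZR n * t)))).
      * rewrite E1, E0, Hy0, Hy1; field; auto.
      * intros x; eapply Cder_eq; [apply Cder_mult; [apply Cder_plus; [apply Cder_scal, Cder_y|apply Cder_const]|apply De]|].
        unfold ypow; simpl; field; auto.
    + rewrite (FT (fun t => (/ l * ((t - / 2) * (t - / 2)) + (- (2) / (l * l) * (t - / 2) + 2 / (l * l * l))) * e2pi (- (IZR n * t)))).
      * rewrite E1, E0, Hy0, Hy1; field; auto.
      * intros x; eapply Cder_eq; [apply Cder_mult; [apply Cder_plus; [apply Cder_scal, Cder_mult; apply Cder_y|
          apply Cder_plus; [apply Cder_scal, Cder_y|apply Cder_const]]|apply De]|].
        unfold ypow; simpl; field; auto.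
    + rewrite (FT (fun t => (/ l * ((t - / 2) * ((t - / 2) * (t - / 2))) + (- (3) / (l * l) * ((t - / 2) * (t - / 2)) +
         (6 / (l * l * l) * (t - / 2) + - (6) / (l * l * l * l)))) * e2pi (- (IZR n * t)))).
      * rewrite E1, E0, Hy0, Hy1; assert (RtoC 4 = 2 * 2) by (rewrite <- RtoC_mult; f_equal; ring).
        rewrite H; field; auto.
      * intros x; eapply Cder_eq; [apply Cder_mult; [apply Cder_plus; [apply Cder_scal, Cder_mult; [apply Cder_y|apply Cder_mult; apply Cder_y]|
          apply Cder_plus; [apply Cder_scal, Cder_mult; apply Cder_y|apply Cder_plus; [apply Cder_scal, Cder_y|apply Cder_const]]]|apply De]|].
        unfold ypow; simpl; field; auto.
Qed.

Lemma Cmod_inv_IZR (k : Z) : k <> 0%Z -> (Cmod (/ RtoC (IZR k)) = / IZR (Z.abs k))%R.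
Proof.
  intros Hk; rewrite Cmod_inv, Cmod_R, abs_IZR; [reflexivity|].
  intros E; apply (f_equal Re) in E; simpl in E; now apply eq_IZR in E.
Qed.

Lemma Cmod_inv_IZR_le (k : Z) : k <> 0%Z -> (Cmod (/ RtoC (IZR k)) <= 1)%R.
Proof.
  intros Hk; rewrite Cmod_inv_IZR by assumption; rewrite <- Rinv_1; apply Rinv_le_contravar; [lra|].
  apply (IZR_le 1); lia.
Qed.

Lemma Jk_bound (k n : Z) (w : C) : k <> 0%Z -> Im w <> 0%R ->
  (Cmod (Jk k n w) <= / (2 * PI * Rabs (Im w)) * / IZR (Z.abs k))%R.
Proof.
  intros Hk Hw; generalize PI_RGT_0; intros Hpi.
  assert (Hh : (0 < Rabs (Im w))%R) by now apply Rabs_pos_lt.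
  assert (Hk1 : (1 <= IZR (Z.abs k))%R) by (apply (IZR_le 1); lia).
  assert (H0 := lin_neq_0 k n w Hk Hw).
  unfold Jk; rewrite Cmod_div by (apply Cmult_neq_0; [apply two_PI_Ci_neq_0|exact H0]).
  rewrite Cmod_opp, Cmod_1, !Cmod_mult, Cmod_Ci, !Cmod_R, (Rabs_pos_eq 2), (Rabs_pos_eq PI) by lra.
  unfold Rdiv; rewrite Rmult_1_l, <- Rinv_mult; apply Rinv_le_contravar.
  - apply Rmult_lt_0_compat; [apply Rmult_lt_0_compat; [lra|exact Hh]|lra].
  - rewrite Rmult_1_r, Rmult_assoc; apply Rmult_le_compat_l; [lra|].
    eapply Rle_trans; [|apply Im_abs_Cmod].
    rewrite Im_minus, Im_IZR_mult; simpl; rewrite Rminus_0_r, Rabs_mult, abs_IZR; lra.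
Qed.

Lemma Jk_bounded (n : Z) (w : C) : Im w <> 0%R -> exists M : R, forall k, k <> 0%Z -> (Cmod (Jk k n w) <= M)%R.
Proof.
  intros Hw; generalize PI_RGT_0; intros Hpi.
  assert (Hh : (0 < Rabs (Im w))%R) by now apply Rabs_pos_lt.
  exists (/ (2 * PI * Rabs (Im w)))%R; intros k Hk; eapply Rle_trans; [now apply Jk_bound|].
  rewrite <- Cmod_inv_IZR by assumption.
  rewrite <- (Rmult_1_r (/ (2 * PI * Rabs (Im w)))) at 2; apply Rmult_le_compat_l; [|now apply Cmod_inv_IZR_le].
  left; apply Rinv_0_lt_compat; apply Rmult_lt_0_compat; lra.
Qed.

Lemma dom_inv_Jk (n : Z) (w : C) : Im w <> 0%R -> dom (fun k => / IZR k * Jk k n w).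
Proof.
  intros Hw; generalize PI_RGT_0; intros Hpi.
  assert (Hh : (0 < Rabs (Im w))%R) by now apply Rabs_pos_lt.
  assert (HK : (0 < / (2 * PI * Rabs (Im w)))%R) by (apply Rinv_0_lt_compat, Rmult_lt_0_compat; lra).
  exists (fun n => / (2 * PI * Rabs (Im w)) * (/ INR (S n) * / INR (S n)))%R; split; [apply summable_inv_sq; lra|].
  intros k Hk; replace (S (Nat.pred (Z.abs_nat k))) with (Z.abs_nat k) by lia.
  rewrite INR_IZR_INZ, Zabs2Nat.id_abs, Cmod_mult, Cmod_inv_IZR by assumption.
  apply Rle_trans with (/ IZR (Z.abs k) * (/ (2 * PI * Rabs (Im w)) * / IZR (Z.abs k)))%R; [|right; ring].
  apply Rmult_le_compat_l; [rewrite <- Cmod_inv_IZR by assumption; apply Cmod_ge_0|now apply Jk_bound].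
Qed.

Lemma dom_scal_l (g f : Z -> C) (M : R) : dom f -> (forall k, k <> 0%Z -> (Cmod (g k) <= M)%R) -> dom (fun k => g k * f k).
Proof. intros Hf Hg; apply dom_ext with (fun k => f k * g k); [intros; ring|now apply dom_mult_bounded with M]. Qed.

Lemma Cmod_e2pi_IZR_R (k : Z) (x : R) : Cmod (e2pi (IZR k * x)) = 1%R.
Proof. rewrite <- RtoC_mult, Cmod_e2pi; simpl; rewrite Rmult_0_r, Ropp_0, exp_0; reflexivity. Qed.

(* A cubic polynomial in [y1], [y2], [y3] in which [yi ^ j] is replaced by the [j]-th
   entry of a sequence, so that Fourier coefficients can be taken variable by variable. *)
Definition cubicQ (w1 w2 w3 : C) (A B D : nat -> C) : C :=
  (w1 * w1 * w1 * (A 3%nat * B 0%nat * D 0%nat) + w2 * w2 * w2 * (A 0%nat * B 3%nat * D 0%nat) + w3 * w3 * w3 * (A 0%nat * B 0%nat * D 3%nat)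
   + 3 * w1 * w1 * w2 * (A 2%nat * B 1%nat * D 0%nat) + 3 * w1 * w2 * w2 * (A 1%nat * B 2%nat * D 0%nat)
   + 3 * w1 * w1 * w3 * (A 2%nat * B 0%nat * D 1%nat) + 3 * w1 * w3 * w3 * (A 1%nat * B 0%nat * D 2%nat)
   + 3 * w2 * w2 * w3 * (A 0%nat * B 2%nat * D 1%nat) + 3 * w2 * w3 * w3 * (A 0%nat * B 1%nat * D 2%nat)
   + 6 * w1 * w2 * w3 * (A 1%nat * B 1%nat * D 1%nat)
   - (w1 * w1 + w2 * w2 + w3 * w3) / 4 *
     (w1 * (A 1%nat * B 0%nat * D 0%nat) + w2 * (A 0%nat * B 1%nat * D 0%nat) + w3 * (A 0%nat * B 0%nat * D 1%nat)))
  / (3 * w1 * w2 * w3).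

Lemma CI_cubic (n : Z) (q : nat -> C) :
  cont01 (fun x => q 0%nat * ypow x 0 + q 1%nat * ypow x 1 + q 2%nat * ypow x 2 + q 3%nat * ypow x 3) /\
  CI (fun x => (q 0%nat * ypow x 0 + q 1%nat * ypow x 1 + q 2%nat * ypow x 2 + q 3%nat * ypow x 3) * e2pi (- (IZR n * x))) =
  q 0%nat * mom n 0 + q 1%nat * mom n 1 + q 2%nat * mom n 2 + q 3%nat * mom n 3.
Proof.
  assert (Hc : forall j, cont01 (fun x => q j * ypow x j)) by (intros; apply cont01_mult; [apply cont01_const|apply cont01_ypow]).
  split; [repeat apply cont01_plus; apply Hc|].
  assert (Hd : forall j, cont01 (fun x => ypow x j * e2pi (- (IZR n * x)))) by (intros; apply cont01_mult; [apply cont01_ypow|apply cont01_e2pi_neg]).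
  assert (He : forall j, cont01 (fun x => q j * (ypow x j * e2pi (- (IZR n * x))))) by (intros; apply cont01_mult; [apply cont01_const|apply Hd]).
  rewrite <- !CI_ypow by lia; rewrite <- !CI_scal, <- !CI_plus by (try apply Hd; repeat apply cont01_plus; apply He).
  apply CI_ext; intros; ring.
Qed.

Definition cub1 (w1 w2 w3 : C) (B D : nat -> C) (j : nat) : C :=
  cubicQ w1 w2 w3 (fun i => if Nat.eq_dec i j then 1 else 0) B D.
Definition cub2 (w1 w2 w3 : C) (A D : nat -> C) (j : nat) : C :=
  cubicQ w1 w2 w3 A (fun i => if Nat.eq_dec i j then 1 else 0) D.
Definition cub3 (w1 w2 w3 : C) (A B : nat -> C) (j : nat) : C :=
  cubicQ w1 w2 w3 A B (fun i => if Nat.eq_dec i j then 1 else 0).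

Lemma cub1_E (w1 w2 w3 : C) (A B D : nat -> C) : cubicQ w1 w2 w3 A B D =
  cub1 w1 w2 w3 B D 0 * A 0%nat + cub1 w1 w2 w3 B D 1 * A 1%nat + cub1 w1 w2 w3 B D 2 * A 2%nat + cub1 w1 w2 w3 B D 3 * A 3%nat.
Proof. unfold cub1, cubicQ, Cdiv; simpl; ring. Qed.
Lemma cub2_E (w1 w2 w3 : C) (A B D : nat -> C) : cubicQ w1 w2 w3 A B D =
  cub2 w1 w2 w3 A D 0 * B 0%nat + cub2 w1 w2 w3 A D 1 * B 1%nat + cub2 w1 w2 w3 A D 2 * B 2%nat + cub2 w1 w2 w3 A D 3 * B 3%nat.
Proof. unfold cub2, cubicQ, Cdiv; simpl; ring. Qed.
Lemma cub3_E (w1 w2 w3 : C) (A B D : nat -> C) : cubicQ w1 w2 w3 A B D =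
  cub3 w1 w2 w3 A B 0 * D 0%nat + cub3 w1 w2 w3 A B 1 * D 1%nat + cub3 w1 w2 w3 A B 2 * D 2%nat + cub3 w1 w2 w3 A B 3 * D 3%nat.
Proof. unfold cub3, cubicQ, Cdiv; simpl; ring. Qed.

Lemma fourier_zero4 (f1 f2 f3 : R -> C) (q : nat -> C) (e1 e2 e3 : Z -> C) :
  cont01 f1 -> cont01 f2 -> cont01 f3 ->
  (forall n, CI (fun x => f1 x * e2pi (- (IZR n * x))) = e1 n) ->
  (forall n, CI (fun x => f2 x * e2pi (- (IZR n * x))) = e2 n) ->
  (forall n, CI (fun x => f3 x * e2pi (- (IZR n * x))) = e3 n) ->
  (forall n, e1 n + e2 n + e3 n + (q 0%nat * mom n 0 + q 1%nat * mom n 1 + q 2%nat * mom n 2 + q 3%nat * mom n 3) = 0) ->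
  forall x, (0 < x < 1)%R ->
  f1 x + f2 x + f3 x + (q 0%nat * ypow x 0 + q 1%nat * ypow x 1 + q 2%nat * ypow x 2 + q 3%nat * ypow x 3) = 0.
Proof.
  intros C1 C2 C3 E1 E2 E3 H x Hx.
  set (f := fun x => f1 x + f2 x + f3 x + (q 0%nat * ypow x 0 + q 1%nat * ypow x 1 + q 2%nat * ypow x 2 + q 3%nat * ypow x 3)).
  assert (Hq := fun n => CI_cubic n q).
  change (f x = 0); apply fourier_zero; [|intros n|exact Hx].
  - unfold f; apply cont01_plus; [repeat apply cont01_plus; assumption|apply (Hq 0%Z)].
  - rewrite <- (H n), <- E1, <- E2, <- E3, <- (proj2 (Hq n)).
    assert (He := cont01_e2pi_neg n).
    rewrite <- !CI_plus; try (repeat apply cont01_plus; apply cont01_mult; try assumption; apply (Hq 0%Z)).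
    apply CI_ext; intros; unfold f; ring.
Qed.

Lemma IZR_neq_0_C (n : Z) : n <> 0%Z -> RtoC (IZR n) <> 0.
Proof. intros Hn E; apply (f_equal Re) in E; simpl in E; now apply eq_IZR in E. Qed.

Lemma Im_div_swap (a b : C) : a <> 0 -> b <> 0 -> Im (a / b) <> 0%R -> Im (b / a) <> 0%R.
Proof.
  intros Ha Hb H E; apply H.
  assert (Hr : b / a = RtoC (Re (b / a))) by (apply C_eq; [reflexivity|exact E]).
  replace (a / b) with (/ (b / a)) by (field; auto); rewrite Hr.
  rewrite <- RtoC_inv; [reflexivity|].
  intros E'; rewrite E' in Hr; apply Ha; assert (b = 0); [|contradiction].
  replace b with (b / a * a) by (field; auto); rewrite Hr; ring.
Qed.

Lemma lin2_neq_0 (a b : C) (n m : Z) : b <> 0 -> n <> 0%Z -> Im (a / b) <> 0%R -> IZR n * a - IZR m * b <> 0.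
Proof.
  intros Hb Hn H E; apply (lin_neq_0 n m (a / b) Hn H).
  replace (IZR n * (a / b) - IZR m) with ((IZR n * a - IZR m * b) / b) by (field; auto).
  rewrite E; unfold Cdiv; ring.
Qed.

(* Lagrange's identity [sum 1/(a_i prod_(j<>i) (a_i - a_j)) = 1/(a_1 a_2 a_3)]
   with [a_i = n_i/w_i], and its degenerations. *)
Lemma coefficient_identity (w1 w2 w3 : C) (n1 n2 n3 : Z) :
  w1 <> 0 -> w2 <> 0 -> w3 <> 0 -> Im (w1 / w2) <> 0%R -> Im (w3 / w1) <> 0%R -> Im (w3 / w2) <> 0%R ->
  sgl n1 (fun k => / IZR k * Jk k n2 (w2 / w1) * Jk k n3 (w3 / w1)) +
  sgl n2 (fun k => / IZR k * Jk k n1 (w1 / w2) * Jk k n3 (w3 / w2)) +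
  sgl n3 (fun k => / IZR k * Jk k n1 (w1 / w3) * Jk k n2 (w2 / w3)) +
  PI * Ci * cubicQ w1 w2 w3 (mom n1) (mom n2) (mom n3) = 0.
Proof.
  intros H1 H2 H3 I12 I31 I32.
  assert (Hp := two_PI_Ci_neq_0).
  assert (I21 := Im_div_swap _ _ H1 H2 I12); assert (I13 := Im_div_swap _ _ H3 H1 I31); assert (I23 := Im_div_swap _ _ H3 H2 I32).
  replace (PI * Ci) with (2 * PI * Ci / 2) by (field).
  unfold sgl, Jk, mom, cubicQ.
  revert Hp; generalize (2 * PI * Ci); intros c Hc.
  destruct (Z.eq_dec n1 0) as [E1|N1], (Z.eq_dec n2 0) as [E2|N2], (Z.eq_dec n3 0) as [E3|N3]; subst.
  all: try (assert (K1 := IZR_neq_0_C n1 ltac:(assumption))).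
  all: try (assert (K2 := IZR_neq_0_C n2 ltac:(assumption))).
  all: try (assert (K3 := IZR_neq_0_C n3 ltac:(assumption))).
  all: try (assert (L12 := lin2_neq_0 w1 w2 n2 n1 H2 ltac:(assumption) I12)).
  all: try (assert (L21 := lin2_neq_0 w2 w1 n1 n2 H1 ltac:(assumption) I21)).
  all: try (assert (L13 := lin2_neq_0 w1 w3 n3 n1 H3 ltac:(assumption) I13)).
  all: try (assert (L31 := lin2_neq_0 w3 w1 n1 n3 H1 ltac:(assumption) I31)).
  all: try (assert (L23 := lin2_neq_0 w2 w3 n3 n2 H3 ltac:(assumption) I23)).
  all: try (assert (L32 := lin2_neq_0 w3 w2 n2 n3 H2 ltac:(assumption) I32)).
  all: field; repeat split; assumption.
Qed.

Definition Tser (u1 u2 u3 : C) (x1 x2 x3 : R) : C :=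
  bil (fun k => / IZR k * Ek k x2 (u2 / u1) * Ek k x3 (u3 / u1) * e2pi (IZR k * x1)).

Lemma dom_inv_Ek (g : Z -> C) (w : C) (x M : R) : Im w <> 0%R -> (0 < x < 1)%R ->
  (forall k, k <> 0%Z -> (Cmod (g k) <= M)%R) -> dom (fun k => / IZR k * g k * Ek k x w).
Proof.
  intros Hw Hx Hg; apply dom_ext with (fun k => (/ IZR k * g k) * Ek k x w); [reflexivity|].
  apply dom_scal_l with (1 * M)%R; [now apply Ek_dom|]; intros k Hk; rewrite Cmod_mult.
  apply Rmult_le_compat; try apply Cmod_ge_0; [now apply Cmod_inv_IZR_le|auto].
Qed.

Lemma Tser_identity_coef12 (w1 w2 w3 : C) (n1 n2 : Z) (x3 : R) :
  w1 <> 0 -> w2 <> 0 -> w3 <> 0 -> Im (w1 / w2) <> 0%R -> Im (w3 / w1) <> 0%R -> Im (w3 / w2) <> 0%R -> (0 < x3 < 1)%R ->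
  sgl n1 (fun k => / IZR k * Jk k n2 (w2 / w1) * Ek k x3 (w3 / w1)) +
  sgl n2 (fun k => / IZR k * Jk k n1 (w1 / w2) * Ek k x3 (w3 / w2)) +
  bil (fun k => / IZR k * Jk k n1 (w1 / w3) * Jk k n2 (w2 / w3) * e2pi (IZR k * x3)) +
  PI * Ci * cubicQ w1 w2 w3 (mom n1) (mom n2) (ypow x3) = 0.
Proof.
  intros H1 H2 H3 I12 I31 I32 Hx3.
  assert (I21 := Im_div_swap _ _ H1 H2 I12); assert (I13 := Im_div_swap _ _ H3 H1 I31); assert (I23 := Im_div_swap _ _ H3 H2 I32).
  destruct (Jk_bounded n2 (w2 / w3) I23) as [M HM].
  assert (D3 : dom (fun k => / IZR k * Jk k n1 (w1 / w3) * Jk k n2 (w2 / w3))).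
  { apply dom_mult_bounded with M; [now apply dom_inv_Jk|exact HM]. }
  destruct (sgl_Ek n1 (fun k => / IZR k * Jk k n2 (w2 / w1)) (w3 / w1) I31) as [C1 E1].
  destruct (sgl_Ek n2 (fun k => / IZR k * Jk k n1 (w1 / w2)) (w3 / w2) I32) as [C2 E2].
  destruct (bil_e2pi _ D3) as [C3 E3].
  rewrite cub3_E.
  assert (F := fourier_zero4 _ _ _ (fun j => PI * Ci * cub3 w1 w2 w3 (mom n1) (mom n2) j) _ _ _ C1 C2 C3 E1 E2 E3).
  rewrite <- F with (x := x3); [cbv beta; ring| |exact Hx3].
  intros n3; rewrite <- (coefficient_identity w1 w2 w3 n1 n2 n3) by assumption; rewrite cub3_E; cbv beta; ring.
Qed.

Lemma Tser_identity_coef1 (w1 w2 w3 : C) (n1 : Z) (x2 x3 : R) :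
  w1 <> 0 -> w2 <> 0 -> w3 <> 0 -> Im (w1 / w2) <> 0%R -> Im (w3 / w1) <> 0%R -> Im (w3 / w2) <> 0%R ->
  (0 < x2 < 1)%R -> (0 < x3 < 1)%R ->
  sgl n1 (fun k => / IZR k * Ek k x3 (w3 / w1) * Ek k x2 (w2 / w1)) +
  bil (fun k => / IZR k * Jk k n1 (w1 / w2) * Ek k x3 (w3 / w2) * e2pi (IZR k * x2)) +
  bil (fun k => / IZR k * Jk k n1 (w1 / w3) * e2pi (IZR k * x3) * Ek k x2 (w2 / w3)) +
  PI * Ci * cubicQ w1 w2 w3 (mom n1) (ypow x2) (ypow x3) = 0.
Proof.
  intros H1 H2 H3 I12 I31 I32 Hx2 Hx3.
  assert (I21 := Im_div_swap _ _ H1 H2 I12); assert (I13 := Im_div_swap _ _ H3 H1 I31); assert (I23 := Im_div_swap _ _ H3 H2 I32).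
  destruct (Jk_bounded n1 (w1 / w2) I12) as [M HM].
  assert (D2 : dom (fun k => / IZR k * Jk k n1 (w1 / w2) * Ek k x3 (w3 / w2))) by (now apply dom_inv_Ek with M).
  assert (D3 : dom (fun k => / IZR k * Jk k n1 (w1 / w3) * e2pi (IZR k * x3))).
  { apply dom_mult_bounded with 1%R; [now apply dom_inv_Jk|]; intros; rewrite Cmod_e2pi_IZR_R; lra. }
  destruct (sgl_Ek n1 (fun k => / IZR k * Ek k x3 (w3 / w1)) (w2 / w1) I21) as [C1 E1].
  destruct (bil_e2pi _ D2) as [C2 E2].
  destruct (bil_Ek _ (w2 / w3) D3 I23) as [C3 E3].
  rewrite cub2_E.
  assert (F := fourier_zero4 _ _ _ (fun j => PI * Ci * cub2 w1 w2 w3 (mom n1) (ypow x3) j) _ _ _ C1 C2 C3 E1 E2 E3).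
  rewrite <- F with (x := x2); [cbv beta; ring| |exact Hx2].
  intros n2; rewrite <- (Tser_identity_coef12 w1 w2 w3 n1 n2 x3) by assumption; rewrite cub2_E; cbv beta.
  rewrite (bil_ext (fun k => / IZR k * Jk k n1 (w1 / w3) * Jk k n2 (w2 / w3) * e2pi (IZR k * x3))
    (fun k => / IZR k * Jk k n1 (w1 / w3) * e2pi (IZR k * x3) * Jk k n2 (w2 / w3))) by (intros; ring).
  replace (sgl n1 (fun k => / IZR k * Jk k n2 (w2 / w1) * Ek k x3 (w3 / w1)))
    with (sgl n1 (fun k => / IZR k * Ek k x3 (w3 / w1) * Jk k n2 (w2 / w1))) by (unfold sgl; destruct (Z.eq_dec n1 0); [reflexivity|cbv beta; ring]).
  ring.
Qed.

Lemma Tser_identity (w1 w2 w3 : C) (x1 x2 x3 : R) :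
  w1 <> 0 -> w2 <> 0 -> w3 <> 0 -> Im (w1 / w2) <> 0%R -> Im (w3 / w1) <> 0%R -> Im (w3 / w2) <> 0%R ->
  (0 < x1 < 1)%R -> (0 < x2 < 1)%R -> (0 < x3 < 1)%R ->
  Tser w1 w2 w3 x1 x2 x3 + Tser w2 w1 w3 x2 x1 x3 + Tser w3 w1 w2 x3 x1 x2 +
  PI * Ci * cubicQ w1 w2 w3 (ypow x1) (ypow x2) (ypow x3) = 0.
Proof.
  intros H1 H2 H3 I12 I31 I32 Hx1 Hx2 Hx3.
  assert (I21 := Im_div_swap _ _ H1 H2 I12); assert (I13 := Im_div_swap _ _ H3 H1 I31); assert (I23 := Im_div_swap _ _ H3 H2 I32).
  destruct (Ek_bounded (w2 / w1) I21) as [M HM].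
  assert (D1 : dom (fun k => / IZR k * Ek k x2 (w2 / w1) * Ek k x3 (w3 / w1))).
  { apply dom_inv_Ek with M; auto; intros; apply HM; auto; lra. }
  assert (D2 : dom (fun k => / IZR k * e2pi (IZR k * x2) * Ek k x3 (w3 / w2))).
  { apply dom_inv_Ek with 1%R; auto; intros; rewrite Cmod_e2pi_IZR_R; lra. }
  assert (D3 : dom (fun k => / IZR k * e2pi (IZR k * x3) * Ek k x2 (w2 / w3))).
  { apply dom_inv_Ek with 1%R; auto; intros; rewrite Cmod_e2pi_IZR_R; lra. }
  destruct (bil_e2pi _ D1) as [C1 E1].
  destruct (bil_Ek _ (w1 / w2) D2 I12) as [C2 E2].
  destruct (bil_Ek _ (w1 / w3) D3 I13) as [C3 E3].
  unfold Tser; rewrite cub1_E.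
  assert (F := fourier_zero4 _ _ _ (fun j => PI * Ci * cub1 w1 w2 w3 (ypow x2) (ypow x3) j) _ _ _ C1 C2 C3 E1 E2 E3).
  rewrite (bil_ext (fun k => / IZR k * Ek k x1 (w1 / w2) * Ek k x3 (w3 / w2) * e2pi (IZR k * x2)) (fun k => / IZR k * e2pi (IZR k * x2) * Ek k x3 (w3 / w2) * Ek k x1 (w1 / w2))) by (intros; ring).
  rewrite (bil_ext (fun k => / IZR k * Ek k x1 (w1 / w3) * Ek k x2 (w2 / w3) * e2pi (IZR k * x3))
    (fun k => / IZR k * e2pi (IZR k * x3) * Ek k x2 (w2 / w3) * Ek k x1 (w1 / w3))) by (intros; ring).
  rewrite <- F with (x := x1); [cbv beta; ring| |exact Hx1].
  intros n1; rewrite <- (Tser_identity_coef1 w1 w2 w3 n1 x2 x3) by assumption; rewrite cub1_E; cbv beta.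
  rewrite (bil_ext (fun k => / IZR k * Jk k n1 (w1 / w2) * Ek k x3 (w3 / w2) * e2pi (IZR k * x2))
    (fun k => / IZR k * e2pi (IZR k * x2) * Ek k x3 (w3 / w2) * Jk k n1 (w1 / w2))) by (intros; ring).
  rewrite (bil_ext (fun k => / IZR k * Jk k n1 (w1 / w3) * e2pi (IZR k * x3) * Ek k x2 (w2 / w3))
    (fun k => / IZR k * e2pi (IZR k * x3) * Ek k x2 (w2 / w3) * Jk k n1 (w1 / w3))) by (intros; ring).
  replace (sgl n1 (fun k => / IZR k * Ek k x3 (w3 / w1) * Ek k x2 (w2 / w1)))
    with (sgl n1 (fun k => / IZR k * Ek k x2 (w2 / w1) * Ek k x3 (w3 / w1))) by (unfold sgl; destruct (Z.eq_dec n1 0); [reflexivity|cbv beta; ring]).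
  ring.
Qed.

Lemma Ek_opp (k : Z) (x : R) (w : C) : k <> 0%Z -> Im w <> 0%R -> Ek k x w = - Ek k (1 - x) (- w).
Proof.
  intros Hk Hw.
  assert (Hk0 : IZR k <> 0%R) by (intros E; apply Hk; now apply eq_IZR).
  unfold Ek; rewrite RtoC_minus.
  replace (IZR k * (1 - x) * - w) with (IZR k * x * w + - (IZR k * w)) by ring.
  replace (IZR k * - w) with (- (IZR k * w)) by ring.
  rewrite e2pi_plus, e2pi_opp; symmetry; apply reflect_fraction; [apply e2pi_neq_0|].
  apply one_sub_e2pi_neq_0; rewrite Im_IZR_mult; now apply Rmult_integral_contrapositive.
Qed.

Lemma bil_opp (f : Z -> C) : dom f -> bil (fun k => - f k) = - bil f.
Proof.
  intros [b [Hb Hf]]; unfold bil.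
  transitivity (Csum (fun n => (f (Z.of_nat (S n)) + f (- Z.of_nat (S n))%Z) * - (1))); [apply Csum_ext; intros; ring|].
  rewrite (Csum_scal_r (fun n => b n + b n)%R); [ring|now apply summable_plus|].
  intros n; eapply Rle_trans; [apply Cmod_triangle|]; apply Rplus_le_compat.
  - replace (b n) with (b (Nat.pred (Z.abs_nat (Z.of_nat (S n))))) by (now rewrite abs_nat_pos); apply Hf; lia.
  - replace (b n) with (b (Nat.pred (Z.abs_nat (- Z.of_nat (S n))))) by (now rewrite abs_nat_neg); apply Hf; lia.
Qed.

Lemma Tser_dom (u1 u2 u3 : C) (x1 x2 x3 : R) : Im (u2 / u1) <> 0%R -> Im (u3 / u1) <> 0%R -> (0 <= x2 <= 1)%R -> (0 < x3 < 1)%R ->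
  dom (fun k => / IZR k * Ek k x2 (u2 / u1) * Ek k x3 (u3 / u1) * e2pi (IZR k * x1)).
Proof.
  intros H2 H3 Hx2 Hx3; destruct (Ek_bounded _ H2) as [M HM].
  apply dom_mult_bounded with 1%R; [|intros; rewrite Cmod_e2pi_IZR_R; lra].
  apply dom_inv_Ek with M; auto.
Qed.

Lemma Cdiv_opp_l (a b : C) : - a / b = - (a / b).
Proof. unfold Cdiv; ring. Qed.

Lemma Tser_opp (u1 u2 u3 : C) (x1 x2 x3 : R) : Im (u2 / u1) <> 0%R -> Im (u3 / u1) <> 0%R -> (0 < x2 < 1)%R -> (0 < x3 < 1)%R ->
  Tser u1 u2 u3 x1 x2 x3 = - Tser u1 (- u2) u3 x1 (1 - x2) x3.
Proof.
  intros H2 H3 Hx2 Hx3; unfold Tser; rewrite Cdiv_opp_l, <- bil_opp.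
  - apply bil_ext; intros k Hk; rewrite (Ek_opp k x2) by assumption; ring.
  - rewrite <- Cdiv_opp_l; apply Tser_dom; auto; [|lra].
    rewrite Cdiv_opp_l, Im_opp; lra.
Qed.

Lemma Tser_sym (u1 u2 u3 : C) (x1 x2 x3 : R) : Tser u1 u2 u3 x1 x2 x3 = Tser u1 u3 u2 x1 x3 x2.
Proof. unfold Tser; apply bil_ext; intros; ring. Qed.

Lemma Cexp_Tser (u1 u2 u3 : C) (x1 x2 x3 : R) : u1 <> 0 -> (0 < Im (u2 / u1))%R -> (0 < Im (u3 / u1))%R ->
  (0 < x2 < 1)%R -> (0 < x3 < 1)%R ->
  Cexp (Tser u1 u2 u3 x1 x2 x3) =
  egamma (e2pi ((x1 * u1 + x2 * u2 + x3 * u3) / u1)) (e2pi (u2 / u1)) (e2pi (u3 / u1)).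
Proof.
  intros Hu H2 H3 Hx2 Hx3.
  set (X := e2pi (u2 / u1)); set (Y := e2pi (u3 / u1)); set (z := e2pi ((x1 * u1 + x2 * u2 + x3 * u3) / u1)).
  assert (HX : (Cmod X < 1)%R) by now apply Cmod_e2pi_lt_1.
  assert (HY : (Cmod Y < 1)%R) by now apply Cmod_e2pi_lt_1.
  assert (Ez : (x1 * u1 + x2 * u2 + x3 * u3) / u1 = x1 + x2 * (u2 / u1) + x3 * (u3 / u1)) by (field; exact Hu).
  assert (EXYz : X * Y / z = e2pi (- x1 + (1 - x2)%R * (u2 / u1) + (1 - x3)%R * (u3 / u1))).
  { unfold X, Y, z; rewrite <- e2pi_plus, <- e2pi_minus, Ez, !RtoC_minus; f_equal; ring. }
  assert (Him : forall a b c : R, Im (a + b * (u2 / u1) + c * (u3 / u1)) = (b * Im (u2 / u1) + c * Im (u3 / u1))%R).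
  { intros; destruct (u2 / u1), (u3 / u1); simpl; ring. }
  assert (Hz : (Cmod z < 1)%R).
  { apply Cmod_e2pi_lt_1; rewrite Ez, Him; apply Rplus_lt_0_compat; apply Rmult_lt_0_compat; lra. }
  assert (Hz' : (Cmod (X * Y / z) < 1)%R).
  { rewrite EXYz; apply Cmod_e2pi_lt_1; rewrite <- RtoC_opp, Him; apply Rplus_lt_0_compat; apply Rmult_lt_0_compat; lra. }
  set (c := fun n => / INR (S n) * / (1 - X ^ S n) * / (1 - Y ^ S n)).
  assert (Hc : forall n, (Cmod (c n) <= / (1 - Cmod X) * / (1 - Cmod Y))%R) by (intros; now apply coef2_bound).
  assert (ET : Tser u1 u2 u3 x1 x2 x3 = psum c z - psum c (X * Y / z)).
  { rewrite (psum_sub c c z (X * Y / z) _ _ Hc Hc Hz Hz'); unfold Tser, bil; apply Csum_ext; intros n.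
    set (N := Z.of_nat (S n)).
    assert (EN : RtoC (IZR N) = RtoC (INR (S n))) by (unfold N; now rewrite <- INR_IZR_INZ).
    assert (EN' : RtoC (IZR (- N)) = - RtoC (INR (S n))) by (rewrite opp_IZR, RtoC_opp, EN; reflexivity).
    destruct (inv_one_sub_pow_bound X n HX) as [HX1 _]; destruct (inv_one_sub_pow_bound Y n HY) as [HY1 _].
    assert (HN := INR_S_neq_0 n).
    unfold Cminus at 1; f_equal.
    - unfold Ek, c, z, X, Y; rewrite EN, <- !e2pi_nat, Ez.
      replace (INR (S n) * (x1 + x2 * (u2 / u1) + x3 * (u3 / u1)))
        with (INR (S n) * x2 * (u2 / u1) + INR (S n) * x3 * (u3 / u1) + INR (S n) * x1) by ring.
      rewrite !e2pi_plus; unfold Cdiv; ring.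
    - rewrite (Ek_opp (- N) x2), (Ek_opp (- N) x3) by (try lia; lra).
      unfold Ek, c; rewrite EXYz, EN'; unfold X, Y; rewrite <- !e2pi_nat.
      replace (- INR (S n) * - (u2 / u1)) with (INR (S n) * (u2 / u1)) by ring.
      replace (- INR (S n) * - (u3 / u1)) with (INR (S n) * (u3 / u1)) by ring.
      replace (INR (S n) * (- x1 + (1 - x2)%R * (u2 / u1) + (1 - x3)%R * (u3 / u1)))
        with (- INR (S n) * (1 - x2)%R * - (u2 / u1) + - INR (S n) * (1 - x3)%R * - (u3 / u1) + - INR (S n) * x1) by ring.
      rewrite !e2pi_plus.
      replace (/ - INR (S n)) with (- / INR (S n)) by (field; exact HN); unfold Cdiv; ring. }
  rewrite ET; unfold Cminus; rewrite Cexp_plus, Cexp_opp.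
  assert (A := Cexp_log_dpoch z X Y Hz HX HY); assert (B := Cexp_log_dpoch _ X Y Hz' HX HY); fold c in A, B.
  assert (D1 := dpoch_neq_0_small z X Y Hz HX HY).
  unfold egamma.
  replace (Cexp (psum c z)) with (/ dpoch z X Y).
  - replace (dpoch (X * Y / z) X Y) with (/ Cexp (psum c (X * Y / z))); [unfold Cdiv; ring|].
    rewrite <- (Cmult_1_r (/ _)), <- B; field; apply Cexp_neq_0.
  - rewrite <- (Cmult_1_r (/ _)), <- A; field; exact D1.
Qed.

Definition Pcub (w1 w2 w3 u : C) : C :=
  / (3 * w1 * w2 * w3) * (u - (w1 + w2 + w3) / 2) *
  (u * u - u * (w1 + w2 + w3) + w1 * w2 * w3 / 2 * (/ w1 + / w2 + / w3)).

Lemma cubicQ_Pcub (w1 w2 w3 : C) (x1 x2 x3 : R) : w1 <> 0 -> w2 <> 0 -> w3 <> 0 ->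
  cubicQ w1 w2 w3 (ypow x1) (ypow x2) (ypow x3) = Pcub w1 w2 w3 (x1 * w1 + x2 * w2 + x3 * w3).
Proof. intros; unfold cubicQ, Pcub, ypow; simpl; field; auto. Qed.

Lemma e2pi_cong (x y : C) : x = y -> e2pi x = e2pi y.
Proof. now intros ->. Qed.

(* [modN1 / modD1] and [modN2 / modD2] are the two elliptic gamma functions whose
   product is [Gprod]; [modN3 / modD3] is [Gamma (e2pi (- (u / w3)))]. *)
Definition modN1 (w1 w2 w3 u : C) : C :=
  dpoch (e2pi (- (u / w2)) * e2pi (w1 / w2) * e2pi (w3 / w2)) (e2pi (w1 / w2)) (e2pi (w3 / w2)).
Definition modD1 (w1 w2 w3 u : C) : C := dpoch (e2pi (u / w2)) (e2pi (w1 / w2)) (e2pi (w3 / w2)).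
Definition modN2 (w1 w2 w3 u : C) : C := dpoch (e2pi (u / w1) * e2pi (- (w2 / w1))) (e2pi (- (w2 / w1))) (e2pi (w3 / w1)).
Definition modD2 (w1 w2 w3 u : C) : C := dpoch (e2pi (- (u / w1)) * e2pi (w3 / w1)) (e2pi (- (w2 / w1))) (e2pi (w3 / w1)).
Definition modN3 (w1 w2 w3 u : C) : C :=
  dpoch (e2pi (u / w3) * e2pi (- (w1 / w3)) * e2pi (- (w2 / w3))) (e2pi (- (w1 / w3))) (e2pi (- (w2 / w3))).
Definition modD3 (w1 w2 w3 u : C) : C := dpoch (e2pi (- (u / w3))) (e2pi (- (w1 / w3))) (e2pi (- (w2 / w3))).

Lemma Im_inv_neg (a b : C) : a <> 0 -> b <> 0 -> (0 < Im (a / b))%R -> (0 < Im (- (b / a)))%R.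
Proof.
  intros Ha Hb H.
  replace (b / a) with (/ (a / b)) by (field; auto).
  revert H; generalize (a / b); intros [x y] H; simpl in *.
  replace (- (- y / (x * (x * 1) + y * (y * 1))))%R with (y / (x * x + y * y))%R by (field; nra).
  apply Rdiv_lt_0_compat; nra.
Qed.

Lemma generic_neq_0 (w1 w2 w3 : C) : generic w1 w2 w3 -> w1 <> 0 /\ w2 <> 0 /\ w3 <> 0.
Proof.
  intros [H1 [H2 H3]]; repeat split; intros E; subst.
  - unfold Cdiv in H1; rewrite Cmult_0_l in H1; simpl in H1; lra.
  - rewrite Cdiv_0_r in H1; simpl in H1; lra.
  - unfold Cdiv in H2; rewrite Cmult_0_l in H2; simpl in H2; lra.
Qed.

Lemma modular_local (w1 w2 w3 : C) (x1 x2 x3 : R) : generic w1 w2 w3 ->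
  (0 < x1 < 1)%R -> (0 < x2 < 1)%R -> (0 < x3 < 1)%R ->
  let u := x1 * w1 + x2 * w2 + x3 * w3 in
  modN1 w1 w2 w3 u * modN2 w1 w2 w3 u * modD3 w1 w2 w3 u =
  e2pi (- (Pcub w1 w2 w3 u / 2)) * (modD1 w1 w2 w3 u * modD2 w1 w2 w3 u * modN3 w1 w2 w3 u).
Proof.
  intros Hg Hx1 Hx2 Hx3 u.
  destruct (generic_neq_0 _ _ _ Hg) as [H1 [H2 H3]]; destruct Hg as [I12 [I31 I32]].
  assert (I21 := Im_inv_neg _ _ H1 H2 I12); assert (I13 := Im_inv_neg _ _ H3 H1 I31); assert (I23 := Im_inv_neg _ _ H3 H2 I32).
  rewrite Im_opp in I21, I13, I23.
  assert (M := Tser_identity w1 w2 w3 x1 x2 x3 H1 H2 H3 ltac:(lra) ltac:(lra) ltac:(lra) Hx1 Hx2 Hx3).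
  rewrite cubicQ_Pcub in M by assumption; fold u in M.
  assert (E2 := Cexp_Tser w2 w1 w3 x2 x1 x3 H2 I12 I32 Hx1 Hx3).
  assert (E1 := Cexp_Tser w1 (- w2) w3 x1 (1 - x2) x3 H1 ltac:(rewrite Cdiv_opp_l, Im_opp; lra) I31 ltac:(lra) Hx3).
  assert (E3 := Cexp_Tser w3 (- w2) (- w1) x3 (1 - x2) (1 - x1) H3
    ltac:(rewrite Cdiv_opp_l, Im_opp; lra) ltac:(rewrite Cdiv_opp_l, Im_opp; lra) ltac:(lra) ltac:(lra)).
  rewrite (Tser_opp w1 w2 w3) in M by (assumption || lra).
  rewrite (Tser_opp w3 w1 w2), (Tser_sym w3 (- w1) w2), (Tser_opp w3 w2 (- w1)) in M by (rewrite ?Cdiv_opp_l, ?Im_opp; assumption || lra).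
  assert (HC : Cexp (Tser w2 w1 w3 x2 x1 x3) * / Cexp (Tser w1 (- w2) w3 x1 (1 - x2) x3) *
     Cexp (Tser w3 (- w2) (- w1) x3 (1 - x2) (1 - x1)) = e2pi (- (Pcub w1 w2 w3 u / 2))).
  { rewrite <- Cexp_opp, <- !Cexp_plus; unfold e2pi; f_equal.
    match type of M with ?a = _ => transitivity (a - PI * Ci * Pcub w1 w2 w3 u) end; [ring|rewrite M; field]. }
  rewrite E1, E2, E3 in HC; clear E1 E2 E3 M.
  set (q := e2pi (w1 / w2)) in *; set (p := e2pi (w3 / w2)) in *; set (r := e2pi (w3 / w1)) in *.
  rewrite !Cdiv_opp_l in HC.
  set (qt := e2pi (- (w2 / w1))) in *; set (rt := e2pi (- (w1 / w3))) in *; set (pt := e2pi (- (w2 / w3))) in *.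
  assert (Hq : (Cmod q < 1)%R) by now apply Cmod_e2pi_lt_1.
  assert (Hp : (Cmod p < 1)%R) by now apply Cmod_e2pi_lt_1.
  assert (Hr : (Cmod r < 1)%R) by now apply Cmod_e2pi_lt_1.
  assert (Hqt : (Cmod qt < 1)%R) by (apply Cmod_e2pi_lt_1; rewrite Im_opp; exact I21).
  assert (Hrt : (Cmod rt < 1)%R) by (apply Cmod_e2pi_lt_1; rewrite Im_opp; exact I13).
  assert (Hpt : (Cmod pt < 1)%R) by (apply Cmod_e2pi_lt_1; rewrite Im_opp; exact I23).
  replace (e2pi ((x2 * w2 + x1 * w1 + x3 * w3) / w2)) with (e2pi (u / w2)) in HC by (apply e2pi_cong; unfold u; field; auto).
  replace (e2pi ((x1 * w1 + (1 - x2)%R * - w2 + x3 * w3) / w1)) with (e2pi (u / w1) * qt) in HC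
    by (unfold qt; rewrite <- e2pi_plus; apply e2pi_cong; unfold u; rewrite RtoC_minus; field; auto).
  replace (e2pi ((x3 * w3 + (1 - x2)%R * - w2 + (1 - x1)%R * - w1) / w3)) with (e2pi (u / w3) * rt * pt) in HC
    by (unfold rt, pt; rewrite <- !e2pi_plus; apply e2pi_cong; unfold u; rewrite !RtoC_minus; field; auto).
  unfold egamma in HC.
  replace (q * p / e2pi (u / w2)) with (e2pi (- (u / w2)) * q * p) in HC by (rewrite e2pi_opp; unfold Cdiv; ring).
  replace (qt * r / (e2pi (u / w1) * qt)) with (e2pi (- (u / w1)) * r) in HC
    by (rewrite e2pi_opp; field; split; apply e2pi_neq_0).
  replace (pt * rt / (e2pi (u / w3) * rt * pt)) with (e2pi (- (u / w3))) in HC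
    by (rewrite e2pi_opp; field; repeat split; apply e2pi_neq_0).
  rewrite !(dpoch_sym _ pt rt) in HC by assumption.
  unfold modN1, modN2, modN3, modD1, modD2, modD3; fold q p r qt rt pt; rewrite <- HC.
  assert (Him1 : forall a b c : R, forall v w : C, Im (a + b * v + c * w) = (b * Im v + c * Im w)%R).
  { intros a b c [v v'] [w w']; simpl; ring. }
  assert (Hpos : forall b c s t : R, (0 < b)%R -> (0 < c)%R -> (0 < s)%R -> (0 < t)%R -> (0 < b * s + c * t)%R).
  { intros; apply Rplus_lt_0_compat; now apply Rmult_lt_0_compat. }
  assert (D1 : dpoch (e2pi (u / w2)) q p <> 0).
  { apply dpoch_neq_0_small; auto; apply Cmod_e2pi_lt_1.
    replace (u / w2) with (x2 + x1 * (w1 / w2) + x3 * (w3 / w2)) by (unfold u; field; auto); rewrite Him1; apply Hpos; lra. }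
  assert (D2 : dpoch (e2pi (- (u / w1)) * r) qt r <> 0).
  { apply dpoch_neq_0_small; auto; unfold r; rewrite <- e2pi_plus; apply Cmod_e2pi_lt_1.
    replace (- (u / w1) + w3 / w1) with ((- x1)%R + x2 * (- (w2 / w1)) + (1 - x3)%R * (w3 / w1))
      by (unfold u; rewrite RtoC_opp, RtoC_minus; field; auto).
    rewrite Him1, Im_opp; apply Hpos; lra. }
  assert (D2' : dpoch (e2pi (u / w1) * qt) qt r <> 0).
  { apply dpoch_neq_0_small; auto; unfold qt; rewrite <- e2pi_plus; apply Cmod_e2pi_lt_1.
    replace (u / w1 + - (w2 / w1)) with (x1 + (1 - x2)%R * (- (w2 / w1)) + x3 * (w3 / w1))
      by (unfold u; rewrite RtoC_minus; field; auto).
    rewrite Him1, Im_opp; apply Hpos; lra. }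
  assert (D3 : dpoch (e2pi (u / w3) * rt * pt) rt pt <> 0).
  { apply dpoch_neq_0_small; auto; unfold rt, pt; rewrite <- !e2pi_plus; apply Cmod_e2pi_lt_1.
    replace (u / w3 + - (w1 / w3) + - (w2 / w3)) with (x3 + (1 - x1)%R * (- (w1 / w3)) + (1 - x2)%R * (- (w2 / w3)))
      by (unfold u; rewrite !RtoC_minus; field; auto).
    rewrite Him1, !Im_opp; apply Hpos; lra. }
  field; repeat split; assumption.
Qed.

Ltac uapp_tac :=
  repeat first
  [ apply uapp_plus; [apply pol_alg| | ]
  | apply uapp_minus; [apply pol_alg| | ]
  | apply uapp_opp; [apply pol_alg| ]
  | apply uapp_const; apply pol_alg
  | apply (uapp_in pol _ (fun u => u)); apply pol_id
  | apply uapp_mult; [apply pol_alg| | ]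
  | apply uapp_e2pi; [apply pol_alg| ] ].

Lemma uapp_dpoch_cst (a : C) (R0 : R) (z : C -> C) (x y : C) : (Cmod x < 1)%R -> (Cmod y < 1)%R ->
  uapp pol (disc a R0) z -> uapp pol (disc a R0) (fun t => dpoch (z t) x y).
Proof.
  intros Hx Hy Hz; destruct (two_bounds x y Hx Hy) as [r [Hr [H1 H2]]].
  apply (uapp_dpoch pol (disc a R0) z (fun _ => x) (fun _ => y) r); auto; try apply pol_alg; apply uapp_const, pol_alg.
Qed.

Lemma Cinv_0 : / RtoC 0 = 0.
Proof. generalize (Cdiv_0_r 1); unfold Cdiv; now rewrite Cmult_1_l. Qed.

Lemma Cinv_mult_total (a b : C) : / (a * b) = / a * / b.
Proof.
  destruct (Ceq_dec a 0) as [->|Ha]; [rewrite Cmult_0_l, Cinv_0; ring|].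
  destruct (Ceq_dec b 0) as [->|Hb]; [rewrite Cmult_0_r, Cinv_0; ring|].
  field; auto.
Qed.

Lemma Cinv_inv_total (a : C) : / / a = a.
Proof. destruct (Ceq_dec a 0) as [->|Ha]; [now rewrite !Cinv_0|field; auto]. Qed.

Lemma Cinv_neq_0_C (a : C) : a <> 0 -> / a <> 0.
Proof.
  intros Ha E; assert (H : a * / a = 1) by (field; exact Ha).
  rewrite E, Cmult_0_r in H; apply (f_equal Re) in H; simpl in H; lra.
Qed.

Lemma near_center (w1 w2 w3 : C) : generic w1 w2 w3 -> exists d : R, (0 < d)%R /\
  forall u, (Cmod (u - (w1 + w2 + w3) / 2) < d)%R ->
  exists x1 x2 x3 : R, (0 < x1 < 1)%R /\ (0 < x2 < 1)%R /\ (0 < x3 < 1)%R /\ u = x1 * w1 + x2 * w2 + x3 * w3.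
Proof.
  intros Hg; destruct (generic_neq_0 _ _ _ Hg) as [H1 [H2 H3]]; destruct Hg as [I _].
  set (T := w1 / w2) in *; set (i := Im T) in *.
  assert (Hw2 : (0 < Cmod w2)%R) by now apply Cmod_gt_0.
  set (L := (1 + (1 + Cmod T) / i)%R).
  assert (Hi : (0 < / i)%R) by now apply Rinv_0_lt_compat.
  assert (HL : (1 <= L)%R) by (unfold L, Rdiv; generalize (Cmod_ge_0 T); intros; nra).
  exists (Cmod w2 * / (4 * L))%R; split; [apply Rmult_lt_0_compat; [exact Hw2|apply Rinv_0_lt_compat; lra]|].
  intros u Hu; set (v := (u - (w1 + w2 + w3) / 2) / w2).
  assert (Hv : (Cmod v < / (4 * L))%R).
  { unfold v; rewrite Cmod_div by assumption; apply Rmult_lt_reg_r with (Cmod w2); [exact Hw2|].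
    unfold Rdiv; rewrite Rmult_assoc, Rinv_l by lra; rewrite Rmult_1_r, (Rmult_comm (/ _)); exact Hu. }
  assert (HvL : (Cmod v * L < / 4)%R).
  { apply Rmult_lt_reg_r with (/ L)%R; [apply Rinv_0_lt_compat; lra|].
    rewrite Rmult_assoc, Rinv_r, Rmult_1_r, <- Rinv_mult by lra; exact Hv. }
  set (a := (Im v / i)%R); set (b := (Re v - a * Re T)%R).
  assert (Ha : (Rabs a <= Cmod v * / i)%R).
  { unfold a, Rdiv; rewrite Rabs_mult, (Rabs_pos_eq (/ i)) by lra; apply Rmult_le_compat_r; [lra|apply Im_abs_Cmod]. }
  assert (Hb : (Rabs b <= Cmod v + Cmod v * / i * Cmod T)%R).
  { unfold b; eapply Rle_trans; [apply Rabs_triang|]; rewrite Rabs_Ropp, Rabs_mult.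
    apply Rplus_le_compat; [apply re_le_Cmod|]; apply Rmult_le_compat; try apply Rabs_pos; [exact Ha|apply re_le_Cmod]. }
  assert (HLb : (Cmod v + Cmod v * / i * Cmod T + Cmod v * / i = Cmod v * L)%R) by (unfold L, Rdiv; ring).
  assert (H0 : (0 <= Cmod v * / i)%R) by (apply Rmult_le_pos; [apply Cmod_ge_0|lra]).
  assert (H0' : (0 <= Cmod v * / i * Cmod T)%R) by (apply Rmult_le_pos; [exact H0|apply Cmod_ge_0]).
  generalize (Cmod_ge_0 v); intros.
  apply Rabs_le_between in Ha; apply Rabs_le_between in Hb.
  exists (1 / 2 + a)%R, (1 / 2 + b)%R, (1 / 2)%R; repeat split; try lra.
  assert (Ev : v = a * T + b).
  { apply C_eq; rewrite ?Re_plus, ?Im_plus, ?Re_mult, ?Im_mult; cbn [Re Im RtoC fst snd]; fold i; unfold b, a.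
    - change (fst v) with (Re v); change (fst T) with (Re T); ring.
    - change (snd T) with i; change (snd v) with (Im v); field; lra. }
  replace u with (v * w2 + (w1 + w2 + w3) / 2) by (unfold v; field; exact H2).
  rewrite Ev, !RtoC_plus, RtoC_div by lra; unfold T; field; auto.
Qed.

Lemma modular_identity (w1 w2 w3 u : C) : generic w1 w2 w3 ->
  modN1 w1 w2 w3 u * modN2 w1 w2 w3 u * modD3 w1 w2 w3 u =
  e2pi (- (Pcub w1 w2 w3 u / 2)) * (modD1 w1 w2 w3 u * modD2 w1 w2 w3 u * modN3 w1 w2 w3 u).
Proof.
  intros Hg; destruct (near_center _ _ _ Hg) as [d [Hd Hloc]].
  destruct (generic_neq_0 _ _ _ Hg) as [H1 [H2 H3]].
  assert (Hg' := Hg); destruct Hg' as [I12 [I31 I32]].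
  assert (Hq := Cmod_e2pi_lt_1 _ I12); assert (Hr := Cmod_e2pi_lt_1 _ I31); assert (Hp := Cmod_e2pi_lt_1 _ I32).
  assert (Hqt := Cmod_e2pi_lt_1 _ (Im_inv_neg _ _ H1 H2 I12)).
  assert (Hrt := Cmod_e2pi_lt_1 _ (Im_inv_neg _ _ H3 H1 I31)).
  assert (Hpt := Cmod_e2pi_lt_1 _ (Im_inv_neg _ _ H3 H2 I32)).
  set (u0 := (w1 + w2 + w3) / 2).
  set (f := fun u => modN1 w1 w2 w3 u * modN2 w1 w2 w3 u * modD3 w1 w2 w3 u -
    e2pi (- (Pcub w1 w2 w3 u / 2)) * (modD1 w1 w2 w3 u * modD2 w1 w2 w3 u * modN3 w1 w2 w3 u)).
  assert (Hf : forall R0, uapp pol (disc u0 R0) f).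
  { intros R0; unfold f, modN1, modN2, modN3, modD1, modD2, modD3, Pcub, Cdiv.
    apply uapp_minus; [apply pol_alg| |].
    - apply uapp_mult; [apply pol_alg|apply uapp_mult; [apply pol_alg| |]|];
        (apply uapp_dpoch_cst; [assumption|assumption|uapp_tac]).
    - apply uapp_mult; [apply pol_alg|uapp_tac|].
      apply uapp_mult; [apply pol_alg|apply uapp_mult; [apply pol_alg| |]|];
        (apply uapp_dpoch_cst; [assumption|assumption|uapp_tac]). }
  assert (H0 : f u = 0).
  { apply (uapp_pol_identity f u0 (Cmod (u - u0)) d (Hf _) Hd); [|lra].
    intros z Hz; destruct (Hloc z Hz) as [x1 [x2 [x3 [Hx1 [Hx2 [Hx3 ->]]]]]].
    unfold f; rewrite modular_local by assumption; ring. }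
  unfold f in H0.
  match type of H0 with ?a - ?b = _ => replace a with (a - b + b) by ring end; rewrite H0; ring.
Qed.

Lemma ex_derive_Ccvg (F : C -> C) (a : C) (v : nat -> C) :
  @ex_derive C_AbsRing C_NormedModule F a -> Ccvg v a -> Ccvg (fun n => F (v n)) (F a).
Proof.
  intros HF Hv; apply Ccvg_eps; intros eps He.
  assert (Hc := ex_derive_continuous (K := C_AbsRing) (V := C_NormedModule) F a HF).
  destruct (Hc (fun y => Cmod (y - F a) < eps)%R) as [d Hd].
  - exists (mkposreal (eps / 2) ltac:(lra)); intros y [Hy1 Hy2].
    eapply Rle_lt_trans; [apply Cmod_le_abs|].
    change (Rabs (fst y - fst (F a)) < eps / 2)%R in Hy1; change (Rabs (snd y - snd (F a)) < eps / 2)%R in Hy2.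
    rewrite Re_minus, Im_minus; unfold Re, Im; lra.
  - destruct (proj1 (Ccvg_eps v a) Hv d (cond_pos d)) as [N HN]; exists N; intros n Hn.
    apply Hd; apply (HN n Hn).
Qed.

Lemma continuation_eq (D : C -> Prop) (f : C -> C) (a v : C) (s : nat -> C) :
  Ccvg s a -> (forall n, D (s n)) -> is_continuation D f a v -> continuation D f a = v.
Proof.
  intros Hs HD Hv; unfold continuation.
  destruct (excluded_middle_informative (exists v, is_continuation D f a v)) as [H|H]; [|exfalso; eauto].
  destruct (constructive_indefinite_description _ H) as [v' Hv']; simpl; clear H.
  destruct Hv as [d [F [HF [HFf HFa]]]]; destruct Hv' as [d' [F' [HF' [HFf' HFa']]]].
  destruct (proj1 (Ccvg_eps s a) Hs (Rmin d d')) as [N HN]; [apply Rmin_pos; apply cond_pos|].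
  assert (Ha : forall e : posreal, (Cmod (a - a) < e)%R).
  { intros e; replace (a - a) with (RtoC 0) by ring; rewrite Cmod_0; apply cond_pos. }
  rewrite <- HFa, <- HFa'.
  apply (Ccvg_unique (fun n => F' (s (n + N)%nat))).
  - apply (ex_derive_Ccvg F' a (fun n => s (n + N)%nat)); [apply HF', Ha|now apply Ccvg_incr].
  - apply Ccvg_ext with (fun n => F (s (n + N)%nat)).
    + intros n; specialize (HN (n + N)%nat ltac:(lia)).
      rewrite HFf, HFf'; auto; eapply Rlt_le_trans; [apply HN|apply Rmin_r|apply HN|apply Rmin_l].
    + apply (ex_derive_Ccvg F a (fun n => s (n + N)%nat)); [apply HF, Ha|now apply Ccvg_incr].
Qed.

Lemma Ccvg_approach (a b : C) : Ccvg (fun n => a + (/ INR (S n))%R * b) a.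
Proof.
  apply Ccvg_squeeze with (fun n => / INR (S n) * Cmod b)%R.
  - intros n; replace (a + (/ INR (S n))%R * b - a) with ((/ INR (S n))%R * b) by ring.
    rewrite Cmod_mult, Cmod_R, Rabs_pos_eq by (left; apply inv_nat_le_1); lra.
  - replace (Finite 0) with (Finite (0 * Cmod b)) by (f_equal; ring).
    apply (is_lim_seq_scal_r _ _ (Finite 0)).
    apply (is_lim_seq_incr_1 (fun n => / INR n)%R).
    apply (is_lim_seq_inv _ p_infty); [apply is_lim_seq_INR|discriminate].
Qed.

Lemma uapp_pol_Ccvg (f : C -> C) (a : C) (R0 : R) (v : nat -> C) : (0 < R0)%R -> uapp pol (disc a R0) f ->
  Ccvg v a -> Ccvg (fun n => f (v n)) (f a).
Proof.
  intros HR Hf Hv; apply ex_derive_Ccvg; [|exact Hv]; apply (uapp_pol_ex_derive f a a R0 Hf).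
  replace (a - a) with (RtoC 0) by ring; rewrite Cmod_0; exact HR.
Qed.

Lemma uapp_pol_continuous (f : C -> C) (a : C) (R0 eps : R) : (0 < R0)%R -> (0 < eps)%R -> uapp pol (disc a R0) f ->
  exists d : R, (0 < d <= R0)%R /\ forall z, (Cmod (z - a) <= d)%R -> (Cmod (f z - f a) <= eps)%R.
Proof.
  intros HR He Hf.
  assert (Haa : (Cmod (a - a) < R0)%R) by (replace (a - a) with (RtoC 0) by ring; rewrite Cmod_0; exact HR).
  assert (Hc := ex_derive_continuous (K := C_AbsRing) (V := C_NormedModule) f a (uapp_pol_ex_derive f a a R0 Hf Haa)).
  destruct (Hc (fun y => Cmod (y - f a) < eps)%R) as [d Hd].
  - exists (mkposreal (eps / 2) ltac:(lra)); intros y [Hy1 Hy2].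
    eapply Rle_lt_trans; [apply Cmod_le_abs|].
    change (Rabs (fst y - fst (f a)) < eps / 2)%R in Hy1; change (Rabs (snd y - snd (f a)) < eps / 2)%R in Hy2.
    rewrite Re_minus, Im_minus; unfold Re, Im; lra.
  - exists (Rmin R0 (d / 2)); split.
    + split; [apply Rmin_pos; [exact HR|generalize (cond_pos d); lra]|apply Rmin_l].
    + intros z Hz; left; apply Hd.
      change (Cmod (z - a) < d)%R; eapply Rle_lt_trans; [apply Hz|].
      eapply Rle_lt_trans; [apply Rmin_r|generalize (cond_pos d); lra].
Qed.

Lemma uapp_pol_inv (f : C -> C) (a : C) (R0 : R) : (0 < R0)%R -> uapp pol (disc a R0) f -> f a <> 0 ->
  exists d : R, (0 < d <= R0)%R /\ uapp pol (disc a d) (fun z => / f z) /\ forall z, (Cmod (z - a) <= d)%R -> f z <> 0.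
Proof.
  intros HR Hf Ha; assert (Hm : (0 < Cmod (f a))%R) by now apply Cmod_gt_0.
  destruct (uapp_pol_continuous f a R0 (Cmod (f a) / 2) HR ltac:(lra) Hf) as [d [Hd Hfd]].
  assert (Hs : forall z, (Cmod (z - a) <= d)%R -> (Cmod (1 - f z / f a) <= / 2)%R).
  { intros z Hz; replace (1 - f z / f a) with (- ((f z - f a) / f a)) by (field; exact Ha).
    rewrite Cmod_opp, Cmod_div by assumption; apply Rmult_le_reg_r with (Cmod (f a)); [exact Hm|].
    unfold Rdiv; rewrite Rmult_assoc, Rinv_l, Rmult_1_r by lra; specialize (Hfd z Hz); lra. }
  assert (Hne : forall z, (Cmod (z - a) <= d)%R -> f z <> 0).
  { intros z Hz E; specialize (Hs z Hz); rewrite E in Hs.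
    replace (1 - 0 / f a) with (RtoC 1) in Hs by (field; exact Ha); rewrite Cmod_1 in Hs; lra. }
  exists d; split; [exact Hd|split; [|exact Hne]].
  apply uapp_ext with (fun z => / f a * / (1 - (1 - f z / f a))).
  - intros z Hz; replace (1 - (1 - f z / f a)) with (f z / f a) by ring.
    specialize (Hne z Hz); field; split; assumption.
  - apply uapp_scal; [apply pol_alg|].
    apply (uapp_inv_one_sub pol (disc a d) (fun z => 1 - f z / f a) (/ 2)); [apply pol_alg|lra| |exact Hs].
    apply uapp_minus; [apply pol_alg|apply uapp_const, pol_alg|].
    unfold Cdiv; apply uapp_mult; [apply pol_alg| |apply uapp_const, pol_alg].
    apply uapp_sub with (disc a R0); [|exact Hf]; intros z Hz; unfold disc in *; lra.
Qed.

Lemma dpoch_0 (x y : C) : dpoch 0 x y = 1.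
Proof.
  apply (Ccvg_C_lim_seq (fun N => dprt N 0 x y)); apply Ccvg_ext with (fun _ => 1); [|apply Ccvg_const].
  intros N; unfold dprt.
  rewrite (Cprod_ext N _ (fun _ => 1)); [symmetry; apply Cprod_1|].
  intros j _; rewrite (Cprod_ext N _ (fun _ => 1)); [apply Cprod_1|intros; ring].
Qed.

Lemma dpoch_factor_zero (z x y : C) (j k : nat) : (Cmod x < 1)%R -> (Cmod y < 1)%R -> 1 - z * x ^ j * y ^ k = 0 -> dpoch z x y = 0.
Proof.
  intros Hx Hy H.
  apply (Ccvg_unique (fun N => dprt (N + S (j + k)) z x y)); [apply (Ccvg_incr (fun N => dprt N z x y)); now apply dprt_cvg|].
  apply Ccvg_ext with (fun _ => 0); [|apply Ccvg_const].
  assert (Hz : forall (n : nat) (f : nat -> C) (m : nat), (m < n)%nat -> f m = 0 -> Cprod n f = 0).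
  { induction n as [|n IH]; intros f m Hm E; [lia|simpl].
    destruct (Nat.eq_dec m n) as [->|]; [rewrite E; ring|rewrite (IH f m) by (assumption || lia); ring]. }
  intros N; symmetry; unfold dprt; apply (Hz _ _ j); [lia|]; apply (Hz _ _ k); [lia|exact H].
Qed.

Lemma qpoch_isolated (z0 y : C) : (Cmod y < 1)%R -> y <> 0 ->
  exists e : R, (0 < e)%R /\ forall z, z <> z0 -> (Cmod (z - z0) < e)%R -> qpoch z y <> 0.
Proof.
  intros Hy Hy0; destruct (pow_small z0 y Hy) as [n Hn]; revert z0 Hn; induction n as [|n IH]; intros z0 Hn.
  - simpl in Hn; rewrite Cmult_1_r in Hn; exists (1 - Cmod z0)%R; split; [lra|]; intros z _ Hz.
    apply qpoch_neq_0_small; auto.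
    generalize (Cmod_triangle (z - z0) z0); replace (z - z0 + z0) with z by ring; lra.
  - destruct (IH (z0 * y)) as [e [He H]]; [rewrite <- Cmult_assoc; exact Hn|].
    assert (H1 : exists e1 : R, (0 < e1)%R /\ forall z, z <> z0 -> (Cmod (z - z0) < e1)%R -> 1 - z <> 0).
    { destruct (Ceq_dec z0 1) as [->|E].
      - exists 1%R; split; [lra|]; intros z Hz _ E; apply Hz; replace z with (1 - (1 - z)) by ring; rewrite E; ring.
      - exists (Cmod (1 - z0)); split.
        + apply Cmod_gt_0; intros E'; apply E; replace z0 with (1 - (1 - z0)) by ring; rewrite E'; ring.
        + intros z _ Hz E'; replace (1 - z0) with (z - z0 + (1 - z)) in Hz by ring; rewrite E', Cplus_0_r in Hz; lra. }
    destruct H1 as [e1 [He1 H1]].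
    exists (Rmin e e1); split; [now apply Rmin_pos|]; intros z Hz Hzz.
    rewrite qpoch_step by assumption; apply Cmult_neq_0.
    + apply H1; [exact Hz|eapply Rlt_le_trans; [apply Hzz|apply Rmin_r]].
    + apply H.
      * intros E; apply Hz; replace z with (z * y / y) by (field; auto); rewrite E; field; auto.
      * replace (z * y - z0 * y) with ((z - z0) * y) by ring; rewrite Cmod_mult.
        apply Rle_lt_trans with (Cmod (z - z0)); [generalize (Cmod_ge_0 (z - z0)); nra|].
        eapply Rlt_le_trans; [apply Hzz|apply Rmin_l].
Qed.

Lemma dpoch_isolated (z0 x y : C) : (Cmod x < 1)%R -> (Cmod y < 1)%R -> x <> 0 -> y <> 0 ->
  exists e : R, (0 < e)%R /\ forall z, z <> z0 -> (Cmod (z - z0) < e)%R -> dpoch z x y <> 0.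
Proof.
  intros Hx Hy Hx0 Hy0; destruct (pow_small z0 x Hx) as [n Hn]; revert z0 Hn; induction n as [|n IH]; intros z0 Hn.
  - simpl in Hn; rewrite Cmult_1_r in Hn; exists (1 - Cmod z0)%R; split; [lra|]; intros z _ Hz.
    apply dpoch_neq_0_small; auto.
    generalize (Cmod_triangle (z - z0) z0); replace (z - z0 + z0) with z by ring; lra.
  - destruct (IH (z0 * x)) as [e [He H]]; [rewrite <- Cmult_assoc; exact Hn|].
    destruct (qpoch_isolated z0 y Hy Hy0) as [e1 [He1 H1]].
    exists (Rmin e e1); split; [now apply Rmin_pos|]; intros z Hz Hzz.
    rewrite dpoch_step by assumption; apply Cmult_neq_0.
    + apply H1; [exact Hz|eapply Rlt_le_trans; [apply Hzz|apply Rmin_r]].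
    + apply H.
      * intros E; apply Hz; replace z with (z * x / x) by (field; auto); rewrite E; field; auto.
      * replace (z * x - z0 * x) with ((z - z0) * x) by ring; rewrite Cmod_mult.
        apply Rle_lt_trans with (Cmod (z - z0)); [generalize (Cmod_ge_0 (z - z0)); nra|].
        eapply Rlt_le_trans; [apply Hzz|apply Rmin_l].
Qed.

Lemma Cexp_small_neq_1 (w : C) : w <> 0 -> (Cmod w < / (4 * exp 1))%R -> Cexp w <> 1.
Proof.
  intros Hw Hs E; assert (Hw' : (0 < Cmod w)%R) by now apply Cmod_gt_0.
  assert (H4 : (1 <= 4 * exp 1)%R) by (generalize (exp_ineq1_le 1); lra).
  assert (H1 : (Cmod w <= 1)%R).
  { left; eapply Rlt_le_trans; [apply Hs|]; apply Rle_trans with (/ 1)%R; [apply Rinv_le_contravar; lra|rewrite Rinv_1; lra]. }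
  assert (T := Cexp_taylor1 w H1); rewrite E in T.
  replace (1 - 1 - w) with (- w) in T by ring; rewrite Cmod_opp in T.
  apply Rmult_lt_compat_l with (r := (4 * exp 1)%R) in Hs; [|lra]; rewrite Rinv_r in Hs by lra.
  nra.
Qed.

Lemma e2pi_lin_isolated (b c u : C) : b <> 0 ->
  exists e : R, (0 < e)%R /\ forall z, z <> u -> (Cmod (z - u) < e)%R -> e2pi (b * z + c) <> e2pi (b * u + c).
Proof.
  intros Hb; set (k := 2 * PI * Ci * b).
  assert (Hk : k <> 0) by (apply Cmult_neq_0; [apply two_PI_Ci_neq_0|exact Hb]).
  assert (Hk' : (0 < Cmod k)%R) by now apply Cmod_gt_0.
  assert (H4 : (0 < 4 * exp 1)%R) by (generalize (exp_pos 1); lra).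
  exists (/ (4 * exp 1) / Cmod k)%R; split; [apply Rdiv_lt_0_compat; [now apply Rinv_0_lt_compat|exact Hk']|].
  intros z Hz Hzu E; apply (Cexp_small_neq_1 (k * (z - u))).
  - apply Cmult_neq_0; [exact Hk|]; intros E'; apply Hz; replace z with (z - u + u) by ring; rewrite E'; ring.
  - rewrite Cmod_mult, Rmult_comm; apply Rmult_lt_reg_r with (/ Cmod k)%R; [now apply Rinv_0_lt_compat|].
    rewrite Rmult_assoc, Rinv_r, Rmult_1_r by lra; exact Hzu.
  - replace (Cexp (k * (z - u))) with (e2pi (b * z + c) / e2pi (b * u + c)); [rewrite E; field; apply e2pi_neq_0|].
    rewrite <- e2pi_minus; unfold e2pi, k; f_equal; ring.
Qed.

Lemma dpoch_e2pi_isolated (b c u x y : C) : b <> 0 -> (Cmod x < 1)%R -> (Cmod y < 1)%R -> x <> 0 -> y <> 0 ->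
  exists e : R, (0 < e)%R /\ forall z, z <> u -> (Cmod (z - u) < e)%R -> dpoch (e2pi (b * z + c)) x y <> 0.
Proof.
  intros Hb Hx Hy Hx0 Hy0.
  destruct (e2pi_lin_isolated b c u Hb) as [e1 [He1 H1]].
  destruct (dpoch_isolated (e2pi (b * u + c)) x y Hx Hy Hx0 Hy0) as [e2 [He2 H2]].
  destruct (uapp_pol_continuous (fun z => e2pi (b * z + c)) u 1 (e2 / 2)) as [d [Hd Hdz]]; [lra|lra|uapp_tac|].
  exists (Rmin e1 d); split; [apply Rmin_pos; lra|]; intros z Hz Hzu.
  apply H2; [apply H1; [exact Hz|eapply Rlt_le_trans; [apply Hzu|apply Rmin_l]]|].
  eapply Rle_lt_trans; [apply Hdz; left; eapply Rlt_le_trans; [apply Hzu|apply Rmin_r]|lra].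
Qed.

Lemma Gprod_value (w1 w2 w3 z : C) : generic w1 w2 w3 -> modD1 w1 w2 w3 z <> 0 -> modD2 w1 w2 w3 z <> 0 ->
  Gprod w1 w2 w3 z = (modN1 w1 w2 w3 z * modN2 w1 w2 w3 z) / (modD1 w1 w2 w3 z * modD2 w1 w2 w3 z).
Proof.
  intros Hg HD1 HD2.
  destruct (generic_neq_0 _ _ _ Hg) as [H1 [H2 H3]]; destruct Hg as [I12 [I31 I32]].
  assert (Hq := Cmod_e2pi_lt_1 _ I12); assert (Hr := Cmod_e2pi_lt_1 _ I31); assert (Hp := Cmod_e2pi_lt_1 _ I32).
  assert (Hqt := Cmod_e2pi_lt_1 _ (Im_inv_neg _ _ H1 H2 I12)).
  unfold Gprod, q_, p_, r_, qt_, Cprod_inf2; apply Ccvg_C_lim_seq.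
  unfold modN1, modN2, modD1, modD2 in *.
  set (q := e2pi (w1 / w2)) in *; set (p := e2pi (w3 / w2)) in *; set (r := e2pi (w3 / w1)) in *; set (qt := e2pi (- (w2 / w1))) in *.
  assert (F1 : forall j k, 1 - e2pi (z / w2) * q ^ j * p ^ k <> 0) by (intros j k E; apply HD1; now apply (dpoch_factor_zero _ _ _ j k)).
  assert (F2 : forall j k, 1 - e2pi (- (z / w1)) * r * qt ^ j * r ^ k <> 0) by (intros j k E; apply HD2; now apply (dpoch_factor_zero _ _ _ j k)).
  assert (P1' : forall N, dprt N (e2pi (z / w2)) q p <> 0).
  { intros N; apply Cprod_neq_0; intros; apply Cprod_neq_0; intros; apply F1. }
  assert (P2' : forall N, dprt N (e2pi (- (z / w1)) * r) qt r <> 0).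
  { intros N; apply Cprod_neq_0; intros; apply Cprod_neq_0; intros; apply F2. }
  apply Ccvg_ext with (fun N => (dprt N (e2pi (- (z / w2)) * q * p) q p * dprt N (e2pi (z / w1) * qt) qt r) *
     / (dprt N (e2pi (z / w2)) q p * dprt N (e2pi (- (z / w1)) * r) qt r)).
  - intros N; unfold dprt at 1 2; rewrite <- Cprod_mult.
    rewrite Cinv_mult_total.
    replace (/ dprt N (e2pi (z / w2)) q p) with (Cprod N (fun j => Cprod N (fun k => / (1 - e2pi (z / w2) * q ^ j * p ^ k)))).
    2: { unfold dprt; rewrite <- Cprod_inv; [apply Cprod_ext; intros; apply Cprod_inv; intros; apply F1|].
         intros; apply Cprod_neq_0; intros; apply F1. }
    replace (/ dprt N (e2pi (- (z / w1)) * r) qt r) with (Cprod N (fun j => Cprod N (fun k => / (1 - e2pi (- (z / w1)) * r * qt ^ j * r ^ k)))).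
    2: { unfold dprt; rewrite <- Cprod_inv; [apply Cprod_ext; intros; apply Cprod_inv; intros; apply F2|].
         intros; apply Cprod_neq_0; intros; apply F2. }
    rewrite <- !Cprod_mult; apply Cprod_ext; intros j _; rewrite <- !Cprod_mult; apply Cprod_ext; intros k _.
    rewrite !Nat.add_1_r.
    assert (A1 := F1 j k); assert (A2 := F2 j k).
    change (q ^ S j) with (q * q ^ j); change (p ^ S k) with (p * p ^ k); change (qt ^ S j) with (qt * qt ^ j); change (r ^ S k) with (r * r ^ k).
    replace (1 - e2pi (- (z / w1)) * qt ^ j * (r * r ^ k)) with (1 - e2pi (- (z / w1)) * r * qt ^ j * r ^ k) by ring.
    field; auto.
  - unfold Cdiv; apply Ccvg_mult; [apply Ccvg_mult; now apply dprt_cvg|].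
    apply Ccvg_inv; [now apply Cmult_neq_0|]; apply Ccvg_mult; now apply dprt_cvg.
Qed.

Definition Gval (w1 w2 w3 u : C) : C := e2pi (- (Pcub w1 w2 w3 u / 2)) * (modN3 w1 w2 w3 u * / modD3 w1 w2 w3 u).

Lemma G_generic_value (w1 w2 w3 u : C) : generic w1 w2 w3 -> modD3 w1 w2 w3 u <> 0 -> G_generic w1 w2 w3 u = Gval w1 w2 w3 u.
Proof.
  intros Hg HD; unfold G_generic.
  destruct (generic_neq_0 _ _ _ Hg) as [H1 [H2 H3]].
  assert (Hg' := Hg); destruct Hg' as [I12 [I31 I32]].
  assert (Hq := Cmod_e2pi_lt_1 _ I12); assert (Hr := Cmod_e2pi_lt_1 _ I31); assert (Hp := Cmod_e2pi_lt_1 _ I32).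
  assert (Hqt := Cmod_e2pi_lt_1 _ (Im_inv_neg _ _ H1 H2 I12)).
  assert (Hrt := Cmod_e2pi_lt_1 _ (Im_inv_neg _ _ H3 H1 I31)).
  assert (Hpt := Cmod_e2pi_lt_1 _ (Im_inv_neg _ _ H3 H2 I32)).
  apply (continuation_eq _ _ _ _ (fun n => u + (/ INR (S n))%R * 1)); [apply Ccvg_approach| |].
  - intros n E; assert (E' : RtoC (/ INR (S n))%R = 0) by (replace (RtoC (/ INR (S n))) with (u + (/ INR (S n))%R * 1 - u) by ring; rewrite E; ring).
    apply RtoC_inj in E'; generalize (inv_nat_le_1 n); lra.
  - destruct (uapp_pol_inv (modD3 w1 w2 w3) u 1) as [d1 [Hd1 [Hi Hne]]]; [lra| |exact HD|].
    { unfold modD3, Cdiv; apply uapp_dpoch_cst; [assumption|assumption|uapp_tac]. }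
    assert (Hiso1 : exists e : R, (0 < e)%R /\ forall z, z <> u -> (Cmod (z - u) < e)%R -> modD1 w1 w2 w3 z <> 0).
    { destruct (dpoch_e2pi_isolated (/ w2) 0 u (e2pi (w1 / w2)) (e2pi (w3 / w2))) as [e [He H]]; auto using e2pi_neq_0.
      { now apply Cinv_neq_0_C. }
      exists e; split; [exact He|]; intros z Hz Hzu; unfold modD1.
      replace (z / w2) with (/ w2 * z + 0) by (unfold Cdiv; ring); auto. }
    assert (Hiso2 : exists e : R, (0 < e)%R /\ forall z, z <> u -> (Cmod (z - u) < e)%R -> modD2 w1 w2 w3 z <> 0).
    { destruct (dpoch_e2pi_isolated (- / w1) (w3 / w1) u (e2pi (- (w2 / w1))) (e2pi (w3 / w1))) as [e [He H]]; auto using e2pi_neq_0.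
      { intros E; apply (Cinv_neq_0_C w1 H1); replace (/ w1) with (- - / w1) by ring; rewrite E; ring. }
      exists e; split; [exact He|]; intros z Hz Hzu; unfold modD2; rewrite <- e2pi_plus.
      replace (- (z / w1) + w3 / w1) with (- / w1 * z + w3 / w1) by (unfold Cdiv; ring); auto. }
    destruct Hiso1 as [e1 [He1 Hz1]]; destruct Hiso2 as [e2 [He2 Hz2]].
    assert (Hd : (0 < Rmin d1 (Rmin e1 e2))%R) by (repeat apply Rmin_pos; lra).
    exists (mkposreal _ Hd), (Gval w1 w2 w3); simpl pos.
    assert (L1 : forall z, (Cmod (z - u) < Rmin d1 (Rmin e1 e2))%R -> (Cmod (z - u) < d1)%R) by (intros; eapply Rlt_le_trans; [eassumption|apply Rmin_l]).
    assert (L2 : forall z, (Cmod (z - u) < Rmin d1 (Rmin e1 e2))%R -> (Cmod (z - u) < e1)%R)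
      by (intros; eapply Rlt_le_trans; [eassumption|eapply Rle_trans; [apply Rmin_r|apply Rmin_l]]).
    assert (L3 : forall z, (Cmod (z - u) < Rmin d1 (Rmin e1 e2))%R -> (Cmod (z - u) < e2)%R)
      by (intros; eapply Rlt_le_trans; [eassumption|eapply Rle_trans; [apply Rmin_r|apply Rmin_r]]).
    split; [|split; [|reflexivity]].
    + intros z Hz; apply (uapp_pol_ex_derive (Gval w1 w2 w3) u z d1); [|now apply L1].
      unfold Gval; apply uapp_mult; [apply pol_alg| |apply uapp_mult; [apply pol_alg| |exact Hi]].
      * unfold Pcub, Cdiv; uapp_tac.
      * unfold modN3, Cdiv; apply uapp_dpoch_cst; [assumption|assumption|uapp_tac].
    + intros z Hz Hzu.
      assert (A1 := Hz1 z Hzu (L2 z Hz)); assert (A2 := Hz2 z Hzu (L3 z Hz)); assert (A3 := Hne z (Rlt_le _ _ (L1 z Hz))).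
      rewrite Gprod_value by assumption; assert (M := modular_identity w1 w2 w3 z Hg); unfold Gval.
      revert M A1 A2 A3; generalize (modN1 w1 w2 w3 z) (modN2 w1 w2 w3 z) (modN3 w1 w2 w3 z) (modD1 w1 w2 w3 z) (modD2 w1 w2 w3 z) (modD3 w1 w2 w3 z) (e2pi (- (Pcub w1 w2 w3 z / 2))).
      intros n1 n2 n3 d1' d2' d3' e M A1 A2 A3.
      replace (n1 * n2) with (n1 * n2 * d3' * / d3') by (field; auto); rewrite M; field; auto.
Qed.

Lemma qpoch_self_neq_0 (x : C) : (Cmod x < 1)%R -> qpoch x x <> 0.
Proof. intros; now apply qpoch_neq_0_small. Qed.

Lemma kappa_generic (w1 w2 w3 : C) : generic w1 w2 w3 ->
  qpoch (e2pi (- (w2 / w1))) (e2pi (- (w2 / w1))) * (qpoch (e2pi (- (w1 / w3))) (e2pi (- (w1 / w3))) *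
    qpoch (e2pi (- (w2 / w3))) (e2pi (- (w2 / w3)))) * w2 =
  - (e2pi (- (Pcub w1 w2 w3 0 / 2)) * w3 * (qpoch (e2pi (w1 / w2)) (e2pi (w1 / w2)) *
    (qpoch (e2pi (w3 / w2)) (e2pi (w3 / w2)) * qpoch (e2pi (w3 / w1)) (e2pi (w3 / w1))))).
Proof.
  intros Hg; destruct (generic_neq_0 _ _ _ Hg) as [H1 [H2 H3]].
  assert (Hg' := Hg); destruct Hg' as [I12 [I31 I32]].
  assert (Hq := Cmod_e2pi_lt_1 _ I12); assert (Hr := Cmod_e2pi_lt_1 _ I31); assert (Hp := Cmod_e2pi_lt_1 _ I32).
  assert (Hqt := Cmod_e2pi_lt_1 _ (Im_inv_neg _ _ H1 H2 I12)).
  assert (Hrt := Cmod_e2pi_lt_1 _ (Im_inv_neg _ _ H3 H1 I31)).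
  assert (Hpt := Cmod_e2pi_lt_1 _ (Im_inv_neg _ _ H3 H2 I32)).
  set (q := e2pi (w1 / w2)) in *; set (p := e2pi (w3 / w2)) in *; set (r := e2pi (w3 / w1)) in *.
  set (qt := e2pi (- (w2 / w1))) in *; set (rt := e2pi (- (w1 / w3))) in *; set (pt := e2pi (- (w2 / w3))) in *.
  set (A := fun u => modN1 w1 w2 w3 u * modN2 w1 w2 w3 u *
    (dpoch (e2pi (- (u / w3)) * rt * 1) rt pt * dpoch (e2pi (- (u / w3)) * pt) 0 pt)).
  set (B := fun u => e2pi (- (Pcub w1 w2 w3 u / 2)) * (dpoch (e2pi (u / w2) * q) q p * dpoch (e2pi (u / w2) * p) 0 p *
    modD2 w1 w2 w3 u * modN3 w1 w2 w3 u)).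
  assert (H0 : (Cmod 0 < 1)%R) by (rewrite Cmod_0; lra).
  assert (Q0 : forall z y, (Cmod y < 1)%R -> dpoch z 0 y = qpoch z y).
  { intros z y Hy; rewrite dpoch_step, Cmult_0_r, dpoch_0 by assumption; ring. }
  assert (S3 : forall u, modD3 w1 w2 w3 u = (1 - e2pi (- (u / w3))) * (dpoch (e2pi (- (u / w3)) * rt * 1) rt pt * dpoch (e2pi (- (u / w3)) * pt) 0 pt)).
  { intros u; unfold modD3; fold rt pt; rewrite dpoch_step, Cmult_1_r, Q0, qpoch_step by assumption; ring. }
  assert (S1 : forall u, modD1 w1 w2 w3 u = (1 - e2pi (u / w2)) * (dpoch (e2pi (u / w2) * q) q p * dpoch (e2pi (u / w2) * p) 0 p)).
  { intros u; unfold modD1; fold q p; rewrite dpoch_step, Q0, qpoch_step by assumption; ring. }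
  assert (E : forall u, (1 - e2pi (- (u / w3))) * A u = (1 - e2pi (u / w2)) * B u).
  { intros u; assert (M := modular_identity w1 w2 w3 u Hg); rewrite S3, S1 in M; unfold A, B.
    transitivity (modN1 w1 w2 w3 u * modN2 w1 w2 w3 u * ((1 - e2pi (- (u / w3))) * (dpoch (e2pi (- (u / w3)) * rt * 1) rt pt * dpoch (e2pi (- (u / w3)) * pt) 0 pt))); [ring|].
    rewrite M; ring. }
  assert (UA : uapp pol (disc 0 1) A).
  { unfold A, modN1, modN2, Cdiv; apply uapp_mult; [apply pol_alg|apply uapp_mult; [apply pol_alg| |]|apply uapp_mult; [apply pol_alg| |]];
      (apply uapp_dpoch_cst; [assumption|assumption|uapp_tac]). }
  assert (UB : uapp pol (disc 0 1) B).
  { unfold B, modD2, modN3, Pcub, Cdiv; apply uapp_mult; [apply pol_alg|uapp_tac|].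
    apply uapp_mult; [apply pol_alg|apply uapp_mult; [apply pol_alg|apply uapp_mult; [apply pol_alg| |]|]|];
      (apply uapp_dpoch_cst; [assumption|assumption|uapp_tac]). }
  (* Both factors [1 - e2pi _] vanish to first order at [u = 0]. *)
  assert (EX : A 0 * w2 = - (B 0 * w3)).
  { set (v := fun n : nat => 0 + (/ INR (S n))%R * 1).
    assert (Hv : Ccvg v 0) by apply Ccvg_approach.
    assert (Hvn : forall n, v n <> 0).
    { intros n En; unfold v in En; rewrite Cplus_0_l, Cmult_1_r in En; apply RtoC_inj in En; generalize (inv_nat_le_1 n); lra. }
    set (D := fun b u => CI (fun t => Cexp (2 * PI * Ci * b * u * t))).
    assert (HD : forall b u, e2pi (b * u) - 1 = 2 * PI * Ci * b * u * D b u).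
    { intros b u; unfold e2pi, D; rewrite <- Cexp_integral; do 2 f_equal; ring. }
    assert (HDl : forall b, Ccvg (fun n => D b (v n)) 1).
    { intros b; apply Ccvg_eps; intros eps He.
      assert (Hk : exists K : R, (0 < K)%R /\ (Cmod (2 * PI * Ci * b) <= K)%R).
      { exists (Cmod (2 * PI * Ci * b) + 1)%R; generalize (Cmod_ge_0 (2 * PI * Ci * b)); split; lra. }
      destruct Hk as [K [HK0 HK]].
      set (m := (2 * (2 * exp 1 * K))%R).
      assert (Hm : (0 < m)%R) by (unfold m; generalize (exp_pos 1); intros; nra).
      destruct (proj1 (Ccvg_eps v 0) Hv (Rmin (/ K) (eps / (2 * m)))) as [N HN].
      { apply Rmin_pos; [now apply Rinv_0_lt_compat|apply Rdiv_lt_0_compat; lra]. }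
      exists N; intros n Hn; specialize (HN n Hn).
      replace (v n - 0) with (v n) in HN by ring.
      assert (N1 : (Cmod (v n) < / K)%R) by (eapply Rlt_le_trans; [apply HN|apply Rmin_l]).
      assert (N2 : (Cmod (v n) < eps / (2 * m))%R) by (eapply Rlt_le_trans; [apply HN|apply Rmin_r]).
      unfold D; rewrite <- (CI_const 1).
      apply Rle_lt_trans with (2 * (2 * exp 1 * (K * Cmod (v n))))%R.
      - apply CI_cont01_close; [|apply cont01_const|].
        + apply Cder_cont01; intros; eexists; apply (Cder_Cexp (fun t => 2 * PI * Ci * b * v n * t)), Cder_scal, Cder_id.
        + intros t Ht.
          assert (Hbt : (Cmod (2 * PI * Ci * b * v n * t) <= K * Cmod (v n))%R).
          { rewrite Cmod_mult, (Cmod_mult _ (v n)), (Cmod_R t), (Rabs_pos_eq t) by lra.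
            generalize (Cmod_ge_0 (v n)) (Cmod_ge_0 (2 * PI * Ci * b)); intros.
            apply Rle_trans with (Cmod (2 * PI * Ci * b) * Cmod (v n) * 1)%R; [|nra].
            apply Rmult_le_compat_l; [now apply Rmult_le_pos|lra]. }
          assert (Hb1 : (K * Cmod (v n) <= 1)%R).
          { left; apply Rmult_lt_compat_l with (r := K) in N1; [|exact HK0]; rewrite Rinv_r in N1; lra. }
          eapply Rle_trans; [apply Cexp_minus_1_bound; lra|].
          apply Rmult_le_compat_l; [generalize (exp_pos 1); lra|exact Hbt].
      - replace (2 * (2 * exp 1 * (K * Cmod (v n))))%R with (m * Cmod (v n))%R by (unfold m; ring).
        apply Rmult_lt_compat_l with (r := m) in N2; [|exact Hm].
        replace (m * (eps / (2 * m)))%R with (eps / 2)%R in N2 by (field; lra); lra. }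
    assert (L1 : Ccvg (fun n => D (- / w3) (v n) * A (v n) * w2) (1 * A 0 * w2)).
    { apply Ccvg_mult; [apply Ccvg_mult; [apply HDl|]|apply Ccvg_const]; apply (uapp_pol_Ccvg A 0 1); auto; lra. }
    assert (L2 : Ccvg (fun n => - (1) * (D (/ w2) (v n) * B (v n) * w3)) (- (1) * (1 * B 0 * w3))).
    { apply Ccvg_mult; [apply Ccvg_const|]; apply Ccvg_mult; [apply Ccvg_mult; [apply HDl|]|apply Ccvg_const]; apply (uapp_pol_Ccvg B 0 1); auto; lra. }
    replace (A 0 * w2) with (1 * A 0 * w2) by ring; replace (- (B 0 * w3)) with (- (1) * (1 * B 0 * w3)) by ring.
    apply (Ccvg_unique _ _ _ L1); apply Ccvg_ext with (2 := L2); intros n.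
    assert (En := E (v n)).
    replace (- (v n / w3)) with (- / w3 * v n) in En by (unfold Cdiv; ring).
    replace (v n / w2) with (/ w2 * v n) in En by (unfold Cdiv; ring).
    replace (1 - e2pi (- / w3 * v n)) with (- (e2pi (- / w3 * v n) - 1)) in En by ring.
    replace (1 - e2pi (/ w2 * v n)) with (- (e2pi (/ w2 * v n) - 1)) in En by ring.
    rewrite !HD in En.
    specialize (Hvn n).
    revert En Hvn; generalize (D (- / w3) (v n)); intros d3; generalize (D (/ w2) (v n)); intros d2; generalize (A (v n)); intros a; generalize (B (v n)); intros b; generalize (v n); intros x En Hx.
    assert (Hk := two_PI_Ci_neq_0); revert Hk En; generalize (2 * PI * Ci); intros k Hk En.
    replace (d3 * a * w2) with (- (k * - / w3 * x * d3) * a * (w2 * w3 / (k * x))) by (field; auto).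
    rewrite En; field; auto. }
  unfold A, B, modN1, modN2, modD2, modN3 in EX; fold q p r qt rt pt in EX.
  replace (0 / w2) with (RtoC 0) in EX by (unfold Cdiv; ring).
  replace (0 / w1) with (RtoC 0) in EX by (unfold Cdiv; ring).
  replace (0 / w3) with (RtoC 0) in EX by (unfold Cdiv; ring).
  replace (- RtoC 0) with (RtoC 0) in EX by ring.
  rewrite e2pi_0, !Cmult_1_l, Cmult_1_r, !Q0 in EX by assumption.
  rewrite (dpoch_sym qt qt r), (dpoch_step qt r qt), (dpoch_sym _ r qt) in EX by assumption.
  rewrite (dpoch_sym rt rt pt), (dpoch_step rt pt rt), (dpoch_sym _ pt rt) in EX by assumption.
  rewrite (dpoch_step r qt r), (dpoch_sym q q p), (dpoch_step q p q), (dpoch_sym _ p q) in EX by assumption.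
  replace (r * qt) with (qt * r) in EX by ring.
  assert (Hlt : forall a b, (Cmod a < 1)%R -> (Cmod b < 1)%R -> (Cmod (a * b) < 1)%R).
  { intros a b Ha Hb; generalize (Cmod_mult_pow_lt_1 a b 1 Ha Hb); simpl; now rewrite Cmult_1_r. }
  assert (N1 := dpoch_neq_0_small (q * p) q p (Hlt _ _ Hq Hp) Hq Hp).
  assert (N2 := dpoch_neq_0_small (qt * r) qt r (Hlt _ _ Hqt Hr) Hqt Hr).
  assert (N3 := dpoch_neq_0_small (rt * pt) rt pt (Hlt _ _ Hrt Hpt) Hrt Hpt).
  revert EX N1 N2 N3; generalize (dpoch (q * p) q p); intros d1; generalize (dpoch (qt * r) qt r); intros d2.
  generalize (dpoch (rt * pt) rt pt); intros d3 EX N1 N2 N3.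
  match goal with |- ?a = ?b => transitivity (a * (d1 * d2 * d3) * / (d1 * d2 * d3)); [field; auto|] end.
  match type of EX with ?a = ?b => match goal with |- ?c * / _ = _ => replace c with a by ring end end.
  rewrite EX; field; auto.
Qed.

Definition kapval (w1 w2 w3 : C) : C :=
  - (w3 / w2) * e2pi (- (Pcub w1 w2 w3 0 / 2)) *
  (qpoch (p_ w1 w2 w3) (p_ w1 w2 w3) * qpoch (r_ w1 w2 w3) (r_ w1 w2 w3)) *
  (/ qpoch (e2pi (- (w1 / w3))) (e2pi (- (w1 / w3))) * / qpoch (e2pi (- (w2 / w3))) (e2pi (- (w2 / w3)))).

Lemma qratio_generic_value (w1 w2 w3 : C) : generic w1 w2 w3 -> qratio_generic w1 w2 w3 = kapval w1 w2 w3.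
Proof.
  intros Hg; assert (K := kappa_generic _ _ _ Hg).
  destruct (generic_neq_0 _ _ _ Hg) as [H1 [H2 H3]]; destruct Hg as [I12 [I31 I32]].
  assert (Q1 := qpoch_self_neq_0 _ (Cmod_e2pi_lt_1 _ I12)).
  assert (Q2 := qpoch_self_neq_0 _ (Cmod_e2pi_lt_1 _ (Im_inv_neg _ _ H3 H1 I31))).
  assert (Q3 := qpoch_self_neq_0 _ (Cmod_e2pi_lt_1 _ (Im_inv_neg _ _ H3 H2 I32))).
  unfold qratio_generic, kapval, q_, p_, r_, qt_.
  revert K Q1 Q2 Q3; generalize (qpoch (e2pi (- (w2 / w1))) (e2pi (- (w2 / w1)))); intros a.
  generalize (qpoch (e2pi (- (w1 / w3))) (e2pi (- (w1 / w3)))); intros b.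
  generalize (qpoch (e2pi (- (w2 / w3))) (e2pi (- (w2 / w3)))); intros c.
  generalize (qpoch (e2pi (w1 / w2)) (e2pi (w1 / w2))); intros d K Q1 Q2 Q3.
  transitivity (a * (b * c) * w2 * / (b * c * w2 * d)); [field; auto|].
  rewrite K; field; auto.
Qed.

Lemma disc_ok (w1 w3 : C) : w1 <> 0 -> w3 <> 0 -> (0 < Im (w3 / w1))%R -> exists d y : R, (0 < d)%R /\ (0 < y)%R /\
  forall w, (Cmod (w - w1) <= d)%R -> w <> 0 /\ (y <= Im (- (w / w3)))%R /\ (0 < Im (w3 / w))%R.
Proof.
  intros H1 H3 I; assert (J := Im_inv_neg _ _ H3 H1 I).
  set (i := Im (- (w1 / w3))) in *.
  assert (Hm : (0 < Cmod w3)%R) by now apply Cmod_gt_0.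
  exists (Cmod w3 * (i / 2))%R, (i / 2)%R; split; [apply Rmult_lt_0_compat; lra|split; [lra|]].
  intros w Hw.
  assert (Hi : (i / 2 <= Im (- (w / w3)))%R).
  { replace (- (w / w3)) with (- (w1 / w3) + - ((w - w1) / w3)) by (field; exact H3).
    rewrite Im_plus; fold i.
    assert (Hb : (Rabs (Im (- ((w - w1) / w3))) <= i / 2)%R).
    { eapply Rle_trans; [apply Im_abs_Cmod|]; rewrite Cmod_opp, Cmod_div by assumption.
      apply Rmult_le_reg_r with (Cmod w3); [exact Hm|]; unfold Rdiv at 1; rewrite Rmult_assoc, Rinv_l by lra; lra. }
    apply Rabs_le_between in Hb; lra. }
  assert (Hw0 : w <> 0).
  { intros ->; unfold Cdiv in Hi; rewrite Cmult_0_l in Hi; simpl in Hi; lra. }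
  split; [exact Hw0|split; [exact Hi|]].
  replace (w3 / w) with (- (w3 / - w)) by (field; exact Hw0).
  apply Im_inv_neg; [|exact H3|].
  - intros E; apply Hw0; replace w with (- - w) by ring; rewrite E; ring.
  - rewrite Cdiv_opp_l; lra.
Qed.

Lemma continuation_generic (w1 w2 w3 : C) (f F : C -> C) (d : R) : w1 <> 0 -> w2 <> 0 -> w3 <> 0 ->
  (0 <= Im (w1 / w2))%R -> (0 < Im (w3 / w1))%R -> (0 < Im (w3 / w2))%R -> (0 < d)%R ->
  uapp pol (disc w1 d) F -> (forall w, generic w w2 w3 -> (Cmod (w - w1) <= d)%R -> f w = F w) ->
  continuation (fun w => generic w w2 w3) f w1 = F w1.
Proof.
  intros H1 H2 H3 I12 I31 I32 Hd HF Hf.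
  destruct (disc_ok w1 w3 H1 H3 I31) as [d1 [y [Hd1 [Hy Hok]]]].
  assert (Hm : (0 < Cmod w2)%R) by now apply Cmod_gt_0.
  set (e := (d1 / Cmod w2)%R); assert (He : (0 < e)%R) by (apply Rdiv_lt_0_compat; lra).
  apply (continuation_eq _ _ _ _ (fun n => w1 + (/ INR (S n))%R * (e * Ci * w2))); [apply Ccvg_approach| |].
  - intros n; destruct (inv_nat_le_1 n) as [J1 J2]; revert J1 J2; generalize (/ INR (S n))%R; intros s J1 J2.
    destruct (Hok (w1 + s * (e * Ci * w2))) as [W1 [W2 W3]].
    { replace (w1 + s * (e * Ci * w2) - w1) with (s * e * Ci * w2) by ring.
      rewrite !Cmod_mult, Cmod_Ci, !Cmod_R, !Rabs_pos_eq, Rmult_1_r by lra.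
      replace (s * e * Cmod w2)%R with (s * d1)%R by (unfold e; field; lra).
      rewrite <- (Rmult_1_l d1) at 2; apply Rmult_le_compat_r; lra. }
    split; [|split; assumption].
    replace ((w1 + s * (e * Ci * w2)) / w2) with (w1 / w2 + s * e * Ci) by (field; exact H2).
    rewrite Im_plus; replace (Im (s * e * Ci)) with (s * e)%R by (simpl; ring).
    assert (0 < s * e)%R by now apply Rmult_lt_0_compat. lra.
  - exists (mkposreal d Hd), F; split; [|split; [|reflexivity]]; simpl.
    + intros z Hz; now apply (uapp_pol_ex_derive F w1 z d).
    + intros z Hz Hg; symmetry; apply Hf; [exact Hg|lra].
Qed.

Lemma modD3_neq_0 (w1 w2 w3 u : C) : (0 < Im (- (w1 / w3)))%R -> (0 < Im (- (w2 / w3)))%R ->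
  (Cmod (e2pi (- (u / w3))) <= 1)%R -> e2pi (- (u / w3)) <> 1 -> modD3 w1 w2 w3 u <> 0.
Proof.
  intros J1 J2 Hz Hz1 E; unfold modD3 in E.
  assert (Hx := Cmod_e2pi_lt_1 _ J1); assert (Hy := Cmod_e2pi_lt_1 _ J2).
  destruct (dpoch_zero _ _ _ Hx Hy E) as [j [k Hjk]]; clear E.
  revert Hz Hz1 Hx Hy Hjk; generalize (e2pi (- (u / w3))); intros z; generalize (e2pi (- (w1 / w3))); intros x.
  generalize (e2pi (- (w2 / w3))); intros y Hz Hz1 Hx Hy Hjk.
  assert (P : forall w n, (Cmod w < 1)%R -> (0 <= Cmod w ^ n <= 1)%R).
  { intros w n Hw; split; [apply pow_le, Cmod_ge_0|rewrite <- (pow1 n); apply pow_incr; split; [apply Cmod_ge_0|lra]]. }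
  assert (Em : (Cmod z * Cmod x ^ j * Cmod y ^ k = 1)%R).
  { rewrite <- !Cmod_pow, <- !Cmod_mult; replace (z * x ^ j * y ^ k) with (1 - (1 - z * x ^ j * y ^ k)) by ring.
    rewrite Hjk; replace (1 - 0) with (RtoC 1) by ring; apply Cmod_1. }
  generalize (P x j Hx) (P y k Hy) (Cmod_ge_0 z); intros Pj Pk Pz.
  destruct j as [|j].
  - destruct k as [|k].
    + simpl in Hjk; apply Hz1; replace z with (1 - (1 - z * 1 * 1)) by ring; rewrite Hjk; ring.
    + generalize (P y k Hy) (Cmod_ge_0 y); intros; simpl in Em; rewrite Rmult_1_r in Em.
      assert (Cmod y * Cmod y ^ k < 1)%R by nra; assert (0 <= Cmod y * Cmod y ^ k)%R by nra; nra.
  - generalize (P x j Hx) (Cmod_ge_0 x); intros; simpl in Em.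
    assert (Cmod x * Cmod x ^ j < 1)%R by nra; assert (0 <= Cmod x * Cmod x ^ j)%R by nra.
    assert (Cmod z * (Cmod x * Cmod x ^ j) < 1)%R by nra.
    assert (0 <= Cmod z * (Cmod x * Cmod x ^ j))%R by nra; nra.
Qed.

Lemma uapp_Pcub (w1 w2 w3 u : C) (d : R) : w2 <> 0 -> w3 <> 0 ->
  (forall w, disc w1 d w -> w <> 0) -> uapp pol (disc w1 d) (fun w => / w) ->
  uapp pol (disc w1 d) (fun w => e2pi (- (Pcub w w2 w3 u / 2))).
Proof.
  intros H2 H3 Hne Hi.
  apply uapp_ext with (fun w => e2pi (- ((/ w * / (3 * w2 * w3) * (u - (w + w2 + w3) * / 2) *
    (u * u - u * (w + w2 + w3) + w * (w2 * w3 * / 2) * (/ w + / w2 + / w3))) * / 2))).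
  - intros w Hw; specialize (Hne w Hw); unfold Pcub; do 2 f_equal; field; auto.
  - apply uapp_e2pi; [apply pol_alg|].
    repeat first [assumption
      | apply uapp_plus; [apply pol_alg| | ] | apply uapp_minus; [apply pol_alg| | ] | apply uapp_opp; [apply pol_alg| ]
      | apply uapp_const; apply pol_alg | apply (uapp_in pol _ (fun u => u)); apply pol_id
      | apply uapp_mult; [apply pol_alg| | ] ].
Qed.

Lemma uapp_inv_id (w1 : C) : w1 <> 0 -> exists e : R, (0 < e)%R /\ uapp pol (disc w1 e) (fun w => / w).
Proof.
  intros H; destruct (uapp_pol_inv (fun w => w) w1 1) as [e [He [Hi _]]]; [lra|apply uapp_in, pol_id|exact H|].
  exists e; split; [lra|exact Hi].
Qed.

Lemma uapp_rt_bound (w1 w3 : C) (d y : R) : (0 < y)%R -> (forall w, disc w1 d w -> (y <= Im (- (w / w3)))%R) ->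
  exists s : R, (0 <= s < 1)%R /\ forall w, disc w1 d w -> (Cmod (e2pi (- (w / w3))) <= s)%R.
Proof.
  intros Hy H; exists (exp (- (2 * PI * y))); split.
  - split; [left; apply exp_pos|rewrite <- exp_0; apply exp_increasing].
    generalize PI_RGT_0; intros; apply Ropp_lt_gt_0_contravar; apply Rmult_lt_0_compat; lra.
  - intros w Hw; apply Cmod_e2pi_le; auto.
Qed.

Lemma uapp_disc_le (f : C -> C) (a : C) (d e : R) : (e <= d)%R -> uapp pol (disc a d) f -> uapp pol (disc a e) f.
Proof. intros H; apply uapp_sub; unfold disc; intros; lra. Qed.

Lemma G_value (w1 w2 w3 u : C) : w1 <> 0 -> w2 <> 0 -> w3 <> 0 ->
  (0 <= Im (w1 / w2))%R -> (0 < Im (w3 / w1))%R -> (0 < Im (w3 / w2))%R ->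
  (Cmod (e2pi (- (u / w3))) <= 1)%R -> e2pi (- (u / w3)) <> 1 -> G w1 w2 w3 u = Gval w1 w2 w3 u.
Proof.
  intros H1 H2 H3 I12 I31 I32 Hz Hz1; unfold G.
  assert (J2 := Im_inv_neg _ _ H3 H2 I32).
  destruct (excluded_middle_informative (generic w1 w2 w3)) as [Hg|_].
  { apply G_generic_value; [exact Hg|]; apply modD3_neq_0; auto; now apply Im_inv_neg. }
  destruct (disc_ok w1 w3 H1 H3 I31) as [d [y [Hd [Hy Hok]]]].
  destruct (uapp_rt_bound w1 w3 d y Hy (fun w Hw => proj1 (proj2 (Hok w Hw)))) as [s [Hs Hrt]].
  assert (Hpt := Cmod_e2pi_lt_1 _ J2).
  set (m := Rmax s (Cmod (e2pi (- (w2 / w3))))).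
  assert (Hm : (0 <= m < 1)%R) by (unfold m; split; [eapply Rle_trans; [apply Hs|apply Rmax_l]|apply Rmax_lub_lt; lra]).
  assert (Urt : uapp pol (disc w1 d) (fun w => e2pi (- (w / w3)))) by (unfold Cdiv; uapp_tac).
  assert (UD : uapp pol (disc w1 d) (fun w => modD3 w w2 w3 u)).
  { unfold modD3; apply uapp_dpoch with m; auto; try apply pol_alg; try (apply uapp_const, pol_alg).
    - intros w Hw; eapply Rle_trans; [now apply Hrt|apply Rmax_l].
    - intros; apply Rmax_r. }
  assert (UN : uapp pol (disc w1 d) (fun w => modN3 w w2 w3 u)).
  { unfold modN3; apply uapp_dpoch with m; auto; try apply pol_alg; try (apply uapp_const, pol_alg).
    - apply uapp_mult; [apply pol_alg|apply uapp_mult; [apply pol_alg|apply uapp_const, pol_alg|exact Urt]|apply uapp_const, pol_alg].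
    - intros w Hw; eapply Rle_trans; [now apply Hrt|apply Rmax_l].
    - intros; apply Rmax_r. }
  assert (Haa : forall e : R, (0 <= e)%R -> disc w1 e w1).
  { intros e He; unfold disc; replace (w1 - w1) with (RtoC 0) by ring; rewrite Cmod_0; exact He. }
  destruct (Hok w1 (Haa d (Rlt_le _ _ Hd))) as [_ [J1 _]].
  destruct (uapp_pol_inv _ w1 d Hd UD) as [d1 [Hd1 [UDi _]]]; [apply modD3_neq_0; auto; lra|].
  destruct (uapp_inv_id w1 H1) as [d2 [Hd2 Ui]].
  set (e := Rmin d1 d2); assert (He : (0 < e)%R) by (apply Rmin_pos; lra).
  assert (E1 : (e <= d1)%R) by apply Rmin_l; assert (E2 : (e <= d2)%R) by apply Rmin_r.
  apply (continuation_generic w1 w2 w3 _ (fun w => Gval w w2 w3 u) e); auto.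
  - unfold Gval; apply uapp_mult; [apply pol_alg| |apply uapp_mult; [apply pol_alg| |]].
    + apply uapp_Pcub; auto; [|now apply uapp_disc_le with d2].
      intros w Hw; apply (Hok w); unfold disc in Hw; lra.
    + apply uapp_disc_le with d; [lra|exact UN].
    + now apply uapp_disc_le with d1.
  - intros w Hg Hw; apply G_generic_value; [exact Hg|]; apply modD3_neq_0; auto.
    destruct (Hok w) as [_ [K _]]; lra.
Qed.

Lemma qratio_value (w1 w2 w3 : C) : w1 <> 0 -> w2 <> 0 -> w3 <> 0 ->
  (0 <= Im (w1 / w2))%R -> (0 < Im (w3 / w1))%R -> (0 < Im (w3 / w2))%R -> qratio w1 w2 w3 = kapval w1 w2 w3.
Proof.
  intros H1 H2 H3 I12 I31 I32; unfold qratio.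
  destruct (excluded_middle_informative (generic w1 w2 w3)) as [Hg|_]; [now apply qratio_generic_value|].
  destruct (disc_ok w1 w3 H1 H3 I31) as [d [y [Hd [Hy Hok]]]].
  destruct (uapp_rt_bound w1 w3 d y Hy (fun w Hw => proj1 (proj2 (Hok w Hw)))) as [s [Hs Hrt]].
  assert (Urt : uapp pol (disc w1 d) (fun w => e2pi (- (w / w3)))) by (unfold Cdiv; uapp_tac).
  assert (UQ : uapp pol (disc w1 d) (fun w => qpoch (e2pi (- (w / w3))) (e2pi (- (w / w3))))).
  { apply uapp_qpoch with s; auto; apply pol_alg. }
  assert (Haa : forall e : R, (0 <= e)%R -> disc w1 e w1).
  { intros e He; unfold disc; replace (w1 - w1) with (RtoC 0) by ring; rewrite Cmod_0; exact He. }
  destruct (uapp_pol_inv _ w1 d Hd UQ) as [d1 [Hd1 [UQi _]]].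
  { apply qpoch_self_neq_0; eapply Rle_lt_trans; [apply Hrt, Haa; lra|lra]. }
  destruct (uapp_inv_id w1 H1) as [d2 [Hd2 Ui]].
  assert (Ur : uapp pol (disc w1 d2) (fun w => e2pi (w3 / w))).
  { unfold Cdiv; apply uapp_e2pi; [apply pol_alg|]; apply uapp_mult; [apply pol_alg|apply uapp_const, pol_alg|exact Ui]. }
  assert (Hr := Cmod_e2pi_lt_1 _ I31).
  destruct (uapp_pol_continuous _ w1 d2 ((1 - Cmod (e2pi (w3 / w1))) / 2) Hd2 ltac:(lra) Ur) as [d3 [Hd3 Hrc]].
  set (t := ((1 + Cmod (e2pi (w3 / w1))) / 2)%R).
  assert (Ht : (0 <= t < 1)%R) by (unfold t; generalize (Cmod_ge_0 (e2pi (w3 / w1))); lra).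
  assert (Hrb : forall w, disc w1 d3 w -> (Cmod (e2pi (w3 / w)) <= t)%R).
  { intros w Hw; specialize (Hrc w Hw); generalize (Cmod_triangle (e2pi (w3 / w) - e2pi (w3 / w1)) (e2pi (w3 / w1))).
    replace (e2pi (w3 / w) - e2pi (w3 / w1) + e2pi (w3 / w1)) with (e2pi (w3 / w)) by ring; unfold t; lra. }
  assert (UR : uapp pol (disc w1 d3) (fun w => qpoch (e2pi (w3 / w)) (e2pi (w3 / w)))).
  { apply uapp_qpoch with t; auto; try apply pol_alg; apply uapp_disc_le with d2; auto; lra. }
  set (e := Rmin d1 d3); assert (He : (0 < e)%R) by (apply Rmin_pos; lra).
  assert (E1 : (e <= d1)%R) by apply Rmin_l; assert (E2 : (e <= d3)%R) by apply Rmin_r.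
  apply (continuation_generic w1 w2 w3 _ (fun w => kapval w w2 w3) e); auto.
  - unfold kapval, p_, r_.
    apply uapp_mult; [apply pol_alg|apply uapp_mult; [apply pol_alg|apply uapp_mult; [apply pol_alg| |]|]|].
    + apply uapp_const, pol_alg.
    + apply uapp_Pcub; auto; [|apply uapp_disc_le with d2; [lra|exact Ui]].
      intros w Hw; apply (Hok w); unfold disc in Hw; lra.
    + apply uapp_mult; [apply pol_alg|apply uapp_const, pol_alg|now apply uapp_disc_le with d3].
    + apply uapp_mult; [apply pol_alg|now apply uapp_disc_le with d1|apply uapp_const, pol_alg].
  - intros w Hg _; now apply qratio_generic_value.
Qed.

Lemma kappa_value (w1 w2 w3 : C) : w1 <> 0 -> w2 <> 0 -> w3 <> 0 ->
  (0 <= Im (w1 / w2))%R -> (0 < Im (w3 / w1))%R -> (0 < Im (w3 / w2))%R ->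
  kappa w1 w2 w3 = 2 * (w3 / w2) * e2pi (- (Pcub w1 w2 w3 0 / 2)) *
   (/ qpoch (e2pi (- (w1 / w3))) (e2pi (- (w1 / w3))) * / qpoch (e2pi (- (w2 / w3))) (e2pi (- (w2 / w3)))).
Proof.
  intros H1 H2 H3 I12 I31 I32; unfold kappa; rewrite qratio_value by assumption; unfold kapval.
  assert (Q1 : qpoch (p_ w1 w2 w3) (p_ w1 w2 w3) <> 0) by (apply qpoch_self_neq_0; now apply Cmod_e2pi_lt_1).
  assert (Q2 : qpoch (r_ w1 w2 w3) (r_ w1 w2 w3) <> 0) by (apply qpoch_self_neq_0; now apply Cmod_e2pi_lt_1).
  revert Q1 Q2; generalize (qpoch (p_ w1 w2 w3) (p_ w1 w2 w3)); intros a; generalize (qpoch (r_ w1 w2 w3) (r_ w1 w2 w3)); intros b Qa Qb.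
  assert (Q3 := qpoch_self_neq_0 _ (Cmod_e2pi_lt_1 _ (Im_inv_neg _ _ H3 H1 I31))).
  assert (Q4 := qpoch_self_neq_0 _ (Cmod_e2pi_lt_1 _ (Im_inv_neg _ _ H3 H2 I32))).
  field; auto.
Qed.

(** * The theta function identity *)

Definition umono (K : C * C -> Prop) (f : C * C -> C) : Prop := uapp trig K f /\ uapp trig K (fun x => / f x).

Lemma umono_const (a b c d : R) (k : C) : umono (strip a b c d) (fun _ => k).
Proof. split; apply uapp_const, trig_alg. Qed.

Lemma umono_fst (K : C * C -> Prop) : umono K (fun x => e2pi (fst x)).
Proof.
  split; apply uapp_in.
  - destruct (trig_e2pi 1 1 0) as [l Hl]; exists l; intros x; rewrite <- Hl, Cmult_1_l; f_equal; ring.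
  - destruct (trig_e2pi 1 (-1) 0) as [l Hl]; exists l; intros x; rewrite <- Hl, Cmult_1_l, <- e2pi_opp; f_equal; ring.
Qed.

Lemma umono_snd (K : C * C -> Prop) : umono K (fun x => e2pi (snd x)).
Proof.
  split; apply uapp_in.
  - destruct (trig_e2pi 1 0 1) as [l Hl]; exists l; intros x; rewrite <- Hl, Cmult_1_l; f_equal; ring.
  - destruct (trig_e2pi 1 0 (-1)) as [l Hl]; exists l; intros x; rewrite <- Hl, Cmult_1_l, <- e2pi_opp; f_equal; ring.
Qed.

Lemma umono_mult (a b c d : R) (f g : C * C -> C) : umono (strip a b c d) f -> umono (strip a b c d) g ->
  umono (strip a b c d) (fun x => f x * g x).
Proof.
  intros [F1 F2] [G1 G2]; split; [apply uapp_mult; auto using trig_alg|].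
  apply uapp_ext with (fun x => / f x * / g x); [intros; symmetry; apply Cinv_mult_total|].
  apply uapp_mult; auto using trig_alg.
Qed.

Lemma umono_inv (K : C * C -> Prop) (f : C * C -> C) : umono K f -> umono K (fun x => / f x).
Proof.
  intros [F1 F2]; split; [exact F2|]; apply uapp_ext with f; [intros; symmetry; apply Cinv_inv_total|exact F1].
Qed.

Lemma umono_div (a b c d : R) (f g : C * C -> C) : umono (strip a b c d) f -> umono (strip a b c d) g ->
  umono (strip a b c d) (fun x => f x / g x).
Proof. intros Hf Hg; unfold Cdiv; apply umono_mult; [exact Hf|now apply umono_inv]. Qed.

Lemma uapp_theta (a b c d : R) (f : C * C -> C) (p : C) : (Cmod p < 1)%R -> umono (strip a b c d) f ->
  uapp trig (strip a b c d) (fun x => theta (f x) p).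
Proof.
  intros Hp [F1 F2]; unfold theta.
  apply uapp_mult; [apply trig_alg| |];
    (apply uapp_qpoch with (Cmod p); [apply trig_alg|split; [apply Cmod_ge_0|exact Hp]| |apply uapp_const, trig_alg|intros; lra]).
  - exact F1.
  - unfold Cdiv; apply uapp_mult; [apply trig_alg|apply uapp_const, trig_alg|exact F2].
Qed.

Ltac umono_tac :=
  repeat first
  [ apply umono_const | apply umono_fst | apply umono_snd
  | apply umono_mult | apply umono_div | apply umono_inv ].

Lemma RInt_reflect (g : R -> R) : ex_RInt g 0 1 -> RInt (fun t => g (1 - t)%R) 0 1 = RInt g 0 1.
Proof.
  intros Hg; apply is_RInt_unique.
  assert (H : is_RInt g ((-1) * 0 + 1) ((-1) * 1 + 1) (@opp R_AbelianGroup (RInt g 0 1))).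
  { replace ((-1) * 0 + 1)%R with 1%R by ring; replace ((-1) * 1 + 1)%R with 0%R by ring.
    apply (is_RInt_swap (V := R_NormedModule)), (RInt_correct (V := R_CompleteNormedModule)), Hg. }
  apply (is_RInt_comp_lin (V := R_NormedModule)) in H.
  apply (is_RInt_scal (V := R_NormedModule) _ _ _ (-1)%R) in H.
  replace (RInt g 0 1) with (scal (-1)%R (@opp R_AbelianGroup (RInt g 0 1))).
  2: { unfold scal, opp; simpl; unfold mult; simpl; generalize (RInt g 0 1); intros r; change R in r; ring. }
  eapply is_RInt_ext; [|exact H]; intros t _; unfold scal; simpl; unfold mult; simpl.
  replace (-1 * t + 1)%R with (1 - t)%R by ring; ring.
Qed.

Lemma CI_reflect (f : R -> C) : cont01 f -> CI (fun t => f (1 - t)%R) = CI f.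
Proof.
  intros Hf; unfold CI; f_equal.
  - apply (RInt_reflect (fun t => Re (f t))), cont01_ex_Re, Hf.
  - apply (RInt_reflect (fun t => Im (f t))), cont01_ex_Im, Hf.
Qed.

(* Odd theta functions of degree 6, in the variable [s] with [z = e2pi s]. *)
Definition odd6 (b : C) (f : C -> C) : Prop :=
  (forall c : R, uapp trig (strip (- c) c 0 0) (fun x => f (fst x))) /\
  (forall s, f (s + b) = e2pi (- (3 * b + 6 * s)) * f s) /\
  (forall s, f (- s) = - f s).

Lemma coef_lin (f g : C -> C) (k l : C) (n : Z) (v : C) : cont01 (fun t => f (v + t)) -> cont01 (fun t => g (v + t)) ->
  coef (fun s => k * f s + l * g s) n v = k * coef f n v + l * coef g n v.
Proof.
  intros Hf Hg; assert (He := cont01_shift_e2pi n v); unfold coef.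
  rewrite <- !CI_scal, <- CI_plus; try (repeat first [apply cont01_mult|apply cont01_const]; assumption).
  apply CI_ext; intros; ring.
Qed.

Lemma odd6_cont (b : C) (f : C -> C) (v : C) : odd6 b f -> cont01 (fun t => f (v + t)).
Proof.
  intros [H _]; apply (uapp_line_cont01 (- Rabs (Im v)) (Rabs (Im v)) 0 0 (fun x => f (fst x)) v 0); [apply H| |simpl; lra].
  unfold Rabs; destruct (Rcase_abs (Im v)); lra.
Qed.

Lemma odd6_coef_indep (b : C) (f : C -> C) (n : Z) (v v' : C) : odd6 b f -> coef f n v = coef f n v'.
Proof.
  intros [H _]; set (c := Rmax (Rabs (Im v)) (Rabs (Im v'))).
  assert (Hc : (Rabs (Im v) <= c)%R) by apply Rmax_l; assert (Hc' : (Rabs (Im v') <= c)%R) by apply Rmax_r.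
  apply Rabs_le_between in Hc; apply Rabs_le_between in Hc'.
  apply (uapp_coef (- c) c 0 0 (fun x => f (fst x)) n v v' 0); auto; simpl; lra.
Qed.

Lemma odd6_coef_rec (b : C) (f : C -> C) (n : Z) : odd6 b f -> coef f n 0 = e2pi (- (IZR (n + 3) * b)) * coef f (n + 6) 0.
Proof.
  intros H; rewrite (odd6_coef_indep b f n 0 (0 + b) H); destruct H as [Hu [Hq Ho]].
  unfold coef; rewrite <- CI_scal.
  - apply CI_ext; intros t _; replace (0 + b + t) with (0 + t + b) by ring; rewrite Hq.
    rewrite (Cmult_comm (e2pi _) (f _)), <- Cmult_assoc, <- e2pi_plus.
    rewrite (Cmult_comm (f (0 + t))), (Cmult_comm (f (0 + t))), Cmult_assoc, <- e2pi_plus.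
    f_equal; f_equal; rewrite !plus_IZR, !RtoC_plus; ring.
  - apply cont01_mult; [|apply cont01_shift_e2pi]; apply (odd6_cont b); repeat split; assumption.
Qed.

Lemma odd6_coef_odd (b : C) (f : C -> C) (n : Z) : odd6 b f -> coef f (- n) 0 = - coef f n 0.
Proof.
  intros H; rewrite (odd6_coef_indep b f n 0 (- (1)) H).
  assert (Hc : forall v m, cont01 (fun t => f (v + t) * e2pi (- (IZR m * (v + t))))).
  { intros v m; apply cont01_mult; [apply (odd6_cont b f v H)|apply cont01_shift_e2pi]. }
  unfold coef; rewrite <- (CI_reflect (fun t => f (0 + t) * _)) by apply Hc.
  replace (- CI (fun t => f (- (1) + t) * e2pi (- (IZR n * (- (1) + t)))))
    with (- (1) * CI (fun t => f (- (1) + t) * e2pi (- (IZR n * (- (1) + t))))) by ring.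
  rewrite <- CI_scal by apply Hc.
  apply CI_ext; intros t _; rewrite RtoC_minus, opp_IZR, RtoC_opp.
  replace (0 + (1 - t)) with (- (- (1) + t)) by ring; destruct H as [_ [_ Ho]]; rewrite Ho.
  replace (- (- IZR n * - (- (1) + t))) with (- (IZR n * (- (1) + t))) by ring; ring.
Qed.

Lemma Copp_self_0 (z : C) : z = - z -> z = 0.
Proof.
  intros H; replace z with ((z - - z) / 2) by field; rewrite <- H; field.
Qed.

Lemma odd6_zero (b : C) (f : C -> C) : odd6 b f -> coef f 1 0 = 0 -> coef f 2 0 = 0 -> forall s, f s = 0.
Proof.
  intros H C1 C2.
  assert (Hrec := fun n => odd6_coef_rec b f n H); assert (Hodd := fun n => odd6_coef_odd b f n H).
  assert (Hup : forall n, coef f n 0 = 0 -> coef f (n + 6) 0 = 0).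
  { intros n Hn; rewrite Hrec in Hn; apply Cmult_integral in Hn; destruct Hn as [Hn|Hn]; [now apply e2pi_neq_0 in Hn|exact Hn]. }
  assert (Hdown : forall n, coef f (n + 6) 0 = 0 -> coef f n 0 = 0) by (intros n Hn; rewrite Hrec, Hn; ring).
  assert (C0 : coef f 0 0 = 0) by (apply Copp_self_0; exact (Hodd 0%Z)).
  assert (Cm1 : coef f (-1) 0 = 0) by (transitivity (- coef f 1 0); [exact (Hodd 1%Z)|rewrite C1; ring]).
  assert (Cm2 : coef f (-2) 0 = 0) by (transitivity (- coef f 2 0); [exact (Hodd 2%Z)|rewrite C2; ring]).
  assert (C3 : coef f 3 0 = 0).
  { apply Copp_self_0; transitivity (coef f (- (3)) 0); [|exact (Hodd 3%Z)].
    rewrite (Hrec (- (3))%Z); simpl Z.add.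
    replace (- (0 * b)) with (RtoC 0) by ring; rewrite e2pi_0; ring. }
  assert (Hall : forall r, coef f r 0 = 0 -> forall k : Z, coef f (r + 6 * k) 0 = 0).
  { intros r Hr; apply Z.bi_induction.
    - intros ? ? ->; reflexivity.
    - now rewrite Z.mul_0_r, Z.add_0_r.
    - intros k; replace (r + 6 * Z.succ k)%Z with (r + 6 * k + 6)%Z by ring; split; auto. }
  assert (Hn : forall n, coef f n 0 = 0).
  { intros n; assert (Hd := Z.div_mod (n + 2) 6 ltac:(lia)); assert (Hm := Z.mod_pos_bound (n + 2) 6 ltac:(lia)).
    set (r := ((n + 2) mod 6)%Z) in *; set (k := ((n + 2) / 6)%Z) in *.
    replace n with (r - 2 + 6 * k)%Z by lia; apply Hall.
    assert (Hr : (r = 0 \/ r = 1 \/ r = 2 \/ r = 3 \/ r = 4 \/ r = 5)%Z) by lia.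
    destruct Hr as [-> | [-> | [-> | [-> | [-> | ->]]]]]; assumption. }
  intros s; destruct H as [Hu _].
  apply (uapp_unique (- Rabs (Im s)) (Rabs (Im s)) 0 0 (fun x => f (fst x)) 0 0 (Hu _)); simpl.
  - generalize (Rabs_pos (Im s)); lra.
  - lra.
  - exact Hn.
  - unfold Rabs; destruct (Rcase_abs (Im s)); lra.
Qed.

Lemma odd6_lin (b k l : C) (f g : C -> C) : odd6 b f -> odd6 b g -> odd6 b (fun s => k * f s + l * g s).
Proof.
  intros [F1 [F2 F3]] [G1 [G2 G3]]; split; [|split].
  - intros c; apply uapp_plus; [apply trig_alg| |]; apply uapp_scal; auto using trig_alg.
  - intros s; rewrite F2, G2; ring.
  - intros s; rewrite F3, G3; ring.
Qed.

Lemma odd6_three (b al be : C) (f f1 f2 : C -> C) : odd6 b f -> odd6 b f1 -> odd6 b f2 ->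
  f al = 0 -> f be = 0 -> f1 al = 0 -> f2 be = 0 -> f1 be <> 0 -> f2 al <> 0 -> forall s, f s = 0.
Proof.
  intros H H1 H2 Fa Fb F1a F2b F1b F2a.
  set (c := fun (g : C -> C) n => coef g n 0).
  assert (Hc := fun v => odd6_cont b f v H); assert (Hc1 := fun v => odd6_cont b f1 v H1); assert (Hc2 := fun v => odd6_cont b f2 v H2).
  assert (L : forall k k1 k2 s, (k * c f 1%Z + k1 * c f1 1%Z + k2 * c f2 1%Z = 0) -> (k * c f 2%Z + k1 * c f1 2%Z + k2 * c f2 2%Z = 0) ->
    k * f s + k1 * f1 s + k2 * f2 s = 0).
  { intros k k1 k2 s E1 E2.
    assert (Ho : odd6 b (fun s => 1 * (k * f s + k1 * f1 s) + k2 * f2 s)) by (repeat apply odd6_lin; assumption).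
    assert (Hcc : forall v, cont01 (fun t => k * f (v + t) + k1 * f1 (v + t))).
    { intros v; apply cont01_plus; apply cont01_mult; auto using cont01_const. }
    assert (HS : forall n, coef (fun s => 1 * (k * f s + k1 * f1 s) + k2 * f2 s) n 0 = k * c f n + k1 * c f1 n + k2 * c f2 n).
    { intros n; rewrite (coef_lin (fun s => k * f s + k1 * f1 s) f2), coef_lin by auto; unfold c; ring. }
    transitivity (1 * (k * f s + k1 * f1 s) + k2 * f2 s); [ring|].
    apply (odd6_zero b _ Ho); rewrite HS; assumption. }
  set (dd := c f1 1%Z * c f2 2%Z - c f1 2%Z * c f2 1%Z).
  destruct (Ceq_dec dd 0) as [Hd|Hd].
  - exfalso.
    destruct (Ceq_dec (c f2 1%Z) 0) as [E21|E21]; [destruct (Ceq_dec (c f2 2%Z) 0) as [E22|E22]|].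
    + apply F2a; transitivity (0 * f al + 0 * f1 al + 1 * f2 al); [ring|apply L; [rewrite E21; ring|rewrite E22; ring]].
    + assert (E11 : c f2 2%Z * f1 be - c f1 2%Z * f2 be = 0).
      { transitivity (0 * f be + c f2 2%Z * f1 be + - c f1 2%Z * f2 be); [ring|apply L; [|ring]].
        transitivity dd; [unfold dd; ring|exact Hd]. }
      rewrite F2b in E11; apply F1b; replace (f1 be) with (/ c f2 2%Z * (c f2 2%Z * f1 be - c f1 2%Z * 0)) by (field; auto).
      rewrite E11; ring.
    + assert (E11 : c f2 1%Z * f1 be - c f1 1%Z * f2 be = 0).
      { transitivity (0 * f be + c f2 1%Z * f1 be + - c f1 1%Z * f2 be); [ring|apply L; [ring|]].
        transitivity (- dd); [unfold dd; ring|rewrite Hd; ring]. }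
      rewrite F2b in E11; apply F1b; replace (f1 be) with (/ c f2 1%Z * (c f2 1%Z * f1 be - c f1 1%Z * 0)) by (field; auto).
      rewrite E11; ring.
  - set (k1 := - (c f 1%Z * c f2 2%Z - c f 2%Z * c f2 1%Z)); set (k2 := - (c f1 1%Z * c f 2%Z - c f1 2%Z * c f 1%Z)).
    assert (HL : forall s, dd * f s + k1 * f1 s + k2 * f2 s = 0).
    { intros s; apply L; unfold dd, k1, k2; ring. }
    assert (K1 : k1 = 0).
    { assert (E := HL be); rewrite Fb, F2b in E; replace (dd * 0 + k1 * f1 be + k2 * 0) with (k1 * f1 be) in E by ring.
      apply Cmult_integral in E; tauto. }
    assert (K2 : k2 = 0).
    { assert (E := HL al); rewrite Fa, F1a in E; replace (dd * 0 + k1 * 0 + k2 * f2 al) with (k2 * f2 al) in E by ring.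
      apply Cmult_integral in E; tauto. }
    intros s; assert (E := HL s); rewrite K1, K2 in E; replace (dd * f s + 0 * f1 s + 0 * f2 s) with (dd * f s) in E by ring.
    apply Cmult_integral in E; tauto.
Qed.

Lemma theta_swap (t u p : C) : (Cmod p < 1)%R -> t <> 0 -> u <> 0 -> theta (t / u) p = - (theta (u / t) p * (t / u)).
Proof.
  intros Hp Ht Hu; replace (t / u) with (/ (u / t)) at 1 by (field; auto).
  assert (u / t <> 0) by (unfold Cdiv; apply Cmult_neq_0; [exact Hu|now apply Cinv_neq_0_C]).
  rewrite theta_inv by assumption; field; auto.
Qed.

Definition psi1 (p t z : C) : C := / z * theta (z * z) p * (theta (t * z) p * theta (t / z) p).

Definition psi3 (p t0 t1 t2 t3 t4 z : C) : C :=
  / z * / z * (theta (t0 * z) p * theta (t1 * z) p * theta (t2 * z) p * theta (t3 * z) p * theta (t4 * z) p) *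
    theta (t0 * t1 * t2 * t3 * t4 / z) p -
  z * z * (theta (t0 / z) p * theta (t1 / z) p * theta (t2 / z) p * theta (t3 / z) p * theta (t4 / z) p) *
    theta (t0 * t1 * t2 * t3 * t4 * z) p.

Lemma theta_shift_up (c z p : C) : (Cmod p < 1)%R -> c <> 0 -> z <> 0 -> p <> 0 ->
  theta (c * (z * p)) p = - (theta (c * z) p / (c * z)).
Proof.
  intros; replace (c * (z * p)) with (p * (c * z)) by ring; apply theta_shift; auto; now apply Cmult_neq_0.
Qed.

Lemma theta_shift_down (c z p : C) : (Cmod p < 1)%R -> c <> 0 -> z <> 0 -> p <> 0 ->
  theta (c / (z * p)) p = - (theta (c / z) p * (c / (z * p))).
Proof.
  intros Hp Hc Hz Hp0.
  assert (Hw : c / (z * p) <> 0) by (unfold Cdiv; apply Cmult_neq_0; [exact Hc|apply Cinv_neq_0_C, Cmult_neq_0; auto]).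
  assert (E := theta_shift (c / (z * p)) p Hp Hw Hp0).
  replace (p * (c / (z * p))) with (c / z) in E by (field; auto).
  rewrite E; field; auto.
Qed.

Lemma theta_sq_shift (z p : C) : (Cmod p < 1)%R -> z <> 0 -> p <> 0 ->
  theta (z * p * (z * p)) p = theta (z * z) p / (p * (z * z * (z * z))).
Proof.
  intros Hp Hz Hp0.
  replace (z * p * (z * p)) with (p * (p * (z * z))) by ring.
  rewrite !theta_shift by (auto; repeat apply Cmult_neq_0; auto); field; auto.
Qed.

Lemma odd6_psi1 (b t : C) : (0 < Im b)%R -> t <> 0 -> odd6 b (fun s => psi1 (e2pi b) t (e2pi s)).
Proof.
  intros Hb Ht; assert (Hp := Cmod_e2pi_lt_1 _ Hb); assert (Hp0 := e2pi_neq_0 b).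
  split; [|split].
  - intros c; unfold psi1; apply uapp_mult; [apply trig_alg|apply uapp_mult; [apply trig_alg| |]|apply uapp_mult; [apply trig_alg| |]];
      try (apply uapp_theta; [exact Hp|umono_tac]).
    apply (umono_fst _).
  - intros s; unfold psi1; assert (Hz := e2pi_neq_0 s).
    replace (e2pi (- (3 * b + 6 * s))) with (/ (e2pi b ^ 3 * e2pi s ^ 6)).
    2: { replace (- (3 * b + 6 * s)) with (- (b + b + b + (s + s + s + s + s + s))) by ring.
      rewrite e2pi_opp, !e2pi_plus; f_equal; simpl; ring. }
    rewrite e2pi_plus, theta_sq_shift, theta_shift_up, theta_shift_down by auto.
    revert Hz Hp0; generalize (e2pi s) (e2pi b); intros z p Hz Hp0; field; auto.
  - intros s; unfold psi1; rewrite e2pi_opp; assert (Hz := e2pi_neq_0 s); revert Hz; generalize (e2pi s); intros z Hz.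
    replace (/ z * / z) with (/ (z * z)) by (field; auto).
    rewrite theta_inv by (auto using Cmult_neq_0).
    replace (t * / z) with (t / z) by reflexivity; replace (t / / z) with (t * z) by (field; auto); field; auto.
Qed.

Lemma odd6_psi3 (b t0 t1 t2 t3 t4 : C) : (0 < Im b)%R -> t0 <> 0 -> t1 <> 0 -> t2 <> 0 -> t3 <> 0 -> t4 <> 0 ->
  odd6 b (fun s => psi3 (e2pi b) t0 t1 t2 t3 t4 (e2pi s)).
Proof.
  intros Hb H0 H1 H2 H3 H4; assert (Hp := Cmod_e2pi_lt_1 _ Hb); assert (Hp0 := e2pi_neq_0 b).
  assert (HT : t0 * t1 * t2 * t3 * t4 <> 0) by (repeat apply Cmult_neq_0; auto).
  split; [|split].
  - intros c; unfold psi3; apply uapp_minus; [apply trig_alg| |];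
    repeat first [ apply uapp_theta; [exact Hp|umono_tac; fail]
                 | apply (umono_fst _)
                 | apply uapp_mult; [apply trig_alg| |] ].
  - intros s; unfold psi3; assert (Hz := e2pi_neq_0 s).
    replace (e2pi (- (3 * b + 6 * s))) with (/ (e2pi b ^ 3 * e2pi s ^ 6)).
    2: { replace (- (3 * b + 6 * s)) with (- (b + b + b + (s + s + s + s + s + s))) by ring.
      rewrite e2pi_opp, !e2pi_plus; f_equal; simpl; ring. }
    rewrite e2pi_plus, !theta_shift_up, !theta_shift_down by auto.
    revert Hz Hp0; generalize (e2pi s) (e2pi b); intros z p Hz Hp0; field; repeat split; auto.
  - intros s; unfold psi3; rewrite e2pi_opp; assert (Hz := e2pi_neq_0 s); revert Hz; generalize (e2pi s); intros z Hz.
    assert (D : forall t, t / / z = t * z) by (intros; field; auto).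
    rewrite !D; unfold Cdiv; rewrite Cinv_inv_total; ring.
Qed.

Lemma theta_identity (b a0 t1 t2 t3 t4 aT z : C) (t0 := e2pi a0) (T := e2pi aT) (p := e2pi b) :
  (0 < Im b)%R -> t1 <> 0 -> t2 <> 0 -> t3 <> 0 -> t4 <> 0 -> z <> 0 -> T = t0 * t1 * t2 * t3 * t4 ->
  theta (T * T) p <> 0 -> theta (t0 * T) p <> 0 -> theta (t0 / T) p <> 0 -> theta (t0 * t0) p <> 0 -> theta (T / t0) p <> 0 ->
  theta (z * z) p * (theta (t0 * z) p * theta (t0 / z) p * (theta (T / t1) p * theta (T / t2) p * theta (T / t3) p * theta (T / t4) p) -
    theta (T * z) p * theta (T / z) p * (theta (t0 * t1) p * theta (t0 * t2) p * theta (t0 * t3) p * theta (t0 * t4) p)) +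
  t0 * theta (t0 * T) p * (/ z * (theta (t0 * z) p * theta (t1 * z) p * theta (t2 * z) p * theta (t3 * z) p * theta (t4 * z) p) * theta (T / z) p -
    z * z * z * (theta (t0 / z) p * theta (t1 / z) p * theta (t2 / z) p * theta (t3 / z) p * theta (t4 / z) p) * theta (T * z) p) = 0.
Proof.
  intros Hb H1 H2 H3 H4 Hz HT N1 N2 N3 N4 N5.
  assert (Hp := Cmod_e2pi_lt_1 _ Hb); fold p in Hp; assert (Hp0 : p <> 0) by apply e2pi_neq_0.
  assert (H0 : t0 <> 0) by apply e2pi_neq_0; assert (HT0 : T <> 0) by apply e2pi_neq_0.
  set (M := theta (T / t1) p * theta (T / t2) p * theta (T / t3) p * theta (T / t4) p).
  set (M' := theta (t0 * t1) p * theta (t0 * t2) p * theta (t0 * t3) p * theta (t0 * t4) p).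
  destruct (e2pi_surj z Hz) as [s Hs].
  set (f1 := fun s => psi1 p t0 (e2pi s)); set (f2 := fun s => psi1 p T (e2pi s)); set (f3 := fun s => psi3 p t0 t1 t2 t3 t4 (e2pi s)).
  assert (O1 : odd6 b f1) by (now apply odd6_psi1).
  assert (O2 : odd6 b f2) by (now apply odd6_psi1).
  assert (O3 : odd6 b f3) by (now apply odd6_psi3).
  set (f := fun s => 1 * (M * f1 s + - M' * f2 s) + (t0 * theta (t0 * T) p) * f3 s).
  assert (O : odd6 b f) by (repeat apply odd6_lin; assumption).
  assert (Et0 : e2pi a0 = t0) by reflexivity; assert (ET0 : e2pi aT = T) by reflexivity.
  clearbody t0 T p.
  assert (T1 : theta 1 p = 0) by now apply theta_1.
  assert (E0 : t0 / t0 = 1) by (field; auto). assert (ET : T / T = 1) by (field; auto).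
  assert (F1a : f1 a0 = 0) by (unfold f1, psi1; rewrite Et0; rewrite E0, T1; ring).
  assert (F2b : f2 aT = 0) by (unfold f2, psi1; rewrite ET0; rewrite ET, T1; ring).
  assert (Hf : forall s, f s = 0).
  { apply (odd6_three b a0 aT f f1 f2); auto.
    - unfold f; rewrite F1a; unfold f2, f3, psi1, psi3; rewrite Et0; rewrite <- HT, E0, T1.
      rewrite (Cmult_comm T t0), (Cmult_comm t1 t0), (Cmult_comm t2 t0), (Cmult_comm t3 t0), (Cmult_comm t4 t0); unfold M'; field; auto.
    - unfold f; rewrite F2b; unfold f1, f3, psi1, psi3; rewrite ET0; rewrite <- HT, ET, T1.
      assert (S : forall t : C, t <> 0 -> theta (t / T) p = - (theta (T / t) p * (t / T))) by (intros t Ht; apply theta_swap; [exact Hp|exact Ht|exact HT0]).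
      rewrite (S t1), (S t2), (S t3), (S t4) by assumption.
      assert (HTi : t1 * t2 * t3 * t4 = T / t0) by (rewrite HT; field; auto).
      replace (1 * (M * (/ T * theta (T * T) p * (theta (t0 * T) p * theta (t0 / T) p)) + - M' * 0) + t0 * theta (t0 * T) p *
        (/ T * / T * (theta (t0 * T) p * theta (t1 * T) p * theta (t2 * T) p * theta (t3 * T) p * theta (t4 * T) p) * 0 -
         T * T * (theta (t0 / T) p * - (theta (T / t1) p * (t1 / T)) * - (theta (T / t2) p * (t2 / T)) * - (theta (T / t3) p * (t3 / T)) * - (theta (T / t4) p * (t4 / T))) * theta (T * T) p))
      with (theta (T * T) p * theta (t0 * T) p * theta (t0 / T) p * M * (/ T - t0 / (T * T) * (t1 * t2 * t3 * t4))) by (unfold M; field; auto).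
      rewrite HTi; field; auto.
    - unfold f1, psi1; rewrite ET0; auto using Cmult_neq_0, Cinv_neq_0_C.
    - unfold f2, psi1; rewrite Et0, (Cmult_comm T t0); auto using Cmult_neq_0, Cinv_neq_0_C.
  }
  assert (E := Hf s); unfold f, f1, f2, f3, psi1, psi3 in E; rewrite Hs, <- HT in E.
  unfold M, M' in *.
  transitivity (z * 0); [rewrite <- E; field; exact Hz|ring].
Qed.

(** * The shift equation of the elliptic beta integral *)

(* Elliptic gamma and theta functions with all arguments and bases given by their
   exponents: [e2pi u] at the bases [e2pi a] and [e2pi b]. *)
Definition eg (a b u : C) : C := egamma (e2pi u) (e2pi a) (e2pi b).

Definition th (b u : C) : C := theta (e2pi u) (e2pi b).

Lemma e2pi_mul_div (a b u : C) : e2pi a * e2pi b / e2pi u = e2pi (a + b - u).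
Proof. rewrite e2pi_minus, e2pi_plus; reflexivity. Qed.

Lemma th_shift (b u : C) : (0 < Im b)%R -> th b (b + u) = - (th b u * e2pi (- u)).
Proof.
  intros Hb; unfold th; rewrite e2pi_plus, theta_shift, e2pi_opp; auto using Cmod_e2pi_lt_1, e2pi_neq_0.
Qed.

Lemma th_opp (b u : C) : (0 < Im b)%R -> th b (- u) = - (th b u * e2pi (- u)).
Proof.
  intros Hb; unfold th; rewrite !e2pi_opp, theta_inv; auto using Cmod_e2pi_lt_1, e2pi_neq_0.
Qed.

Lemma Cmod_e2pi_mono (u v : C) : (Im u < Im v)%R -> (Cmod (e2pi v) < Cmod (e2pi u))%R.
Proof.
  intros H; replace v with (v - u + u) by ring; rewrite e2pi_plus, Cmod_mult.
  assert (Cmod (e2pi (v - u)) < 1)%R by (apply Cmod_e2pi_lt_1; unfold Im in *; simpl; lra).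
  assert (0 < Cmod (e2pi u))%R by (apply Cmod_gt_0, e2pi_neq_0); nra.
Qed.

Lemma th_neq_0 (b u : C) : (0 < Im u < Im b)%R -> th b u <> 0.
Proof.
  intros H; apply theta_neq_0; [apply Cmod_e2pi_lt_1; lra|split; [apply Cmod_e2pi_mono; lra|apply Cmod_e2pi_lt_1; lra]].
Qed.

Lemma th_opp_neq_0 (b u : C) : (0 < Im u < Im b)%R -> th b (- u) <> 0.
Proof.
  intros H Z; rewrite th_opp in Z by lra.
  assert (Z' : th b u * e2pi (- u) = 0) by (transitivity (- - (th b u * e2pi (- u))); [ring|rewrite Z; ring]).
  clear Z; apply Cmult_integral in Z'; rename Z' into Z.
  destruct Z as [Z|Z]; [now apply th_neq_0 in Z|now apply e2pi_neq_0 in Z].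
Qed.

Lemma eg_shift (a b u : C) : (0 < Im a)%R -> (0 < Im b)%R -> (0 < Im u)%R -> eg a b (a + u) = th b u * eg a b u.
Proof.
  intros Ha Hb Hu; unfold eg, th; rewrite e2pi_plus.
  apply egamma_shift; auto using Cmod_e2pi_lt_1, e2pi_neq_0, dpoch_neq_0_small.
Qed.

Lemma eg_inv_shift (a b u : C) : (0 < Im a)%R -> (0 < Im b)%R -> (Im u < Im b)%R -> / eg a b u = / eg a b (a + u) * th b u.
Proof.
  intros Ha Hb Hu; unfold eg, egamma, th, theta, Cdiv.
  rewrite !Cinv_mult_total, !Cinv_inv_total.
  assert (Hx := Cmod_e2pi_lt_1 a Ha); assert (Hy := Cmod_e2pi_lt_1 b Hb).
  fold (Cdiv (e2pi a * e2pi b) (e2pi u)) (Cdiv (e2pi a * e2pi b) (e2pi (a + u))) (Cdiv (e2pi b) (e2pi u)).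
  rewrite !e2pi_mul_div, <- e2pi_minus.
  replace (a + b - (a + u)) with (b - u) by ring.
  assert (N : dpoch (e2pi (b - u)) (e2pi a) (e2pi b) <> 0).
  { apply dpoch_neq_0_small; auto; apply Cmod_e2pi_lt_1; unfold Im in *; simpl; lra. }
  rewrite (dpoch_step (e2pi u)), (dpoch_step (e2pi (b - u))) in * by assumption.
  rewrite <- !e2pi_plus in *.
  replace (u + a) with (a + u) by ring; replace (b - u + a) with (a + b - u) in * by ring.
  assert (N1 : qpoch (e2pi (b - u)) (e2pi b) <> 0) by (intros E; apply N; rewrite E; ring).
  assert (N2 : dpoch (e2pi (a + b - u)) (e2pi a) (e2pi b) <> 0) by (intros E; apply N; rewrite E; ring).
  field; auto.
Qed.

Lemma th_identity (b a0 a1 a2 a3 a4 s : C) (A := a0 + a1 + a2 + a3 + a4) :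
  (0 < Im b)%R -> (0 < Im a0)%R -> (0 < Im a1)%R -> (0 < Im a2)%R -> (0 < Im a3)%R -> (0 < Im a4)%R -> (2 * Im A < Im b)%R ->
  th b (2 * s) * (th b (a0 + s) * th b (a0 - s) * (th b (A - a1) * th b (A - a2) * th b (A - a3) * th b (A - a4)) -
    th b (A + s) * th b (A - s) * (th b (a0 + a1) * th b (a0 + a2) * th b (a0 + a3) * th b (a0 + a4))) =
  - (e2pi a0 * th b (a0 + A) * (e2pi (- s) * (th b (a0 + s) * th b (a1 + s) * th b (a2 + s) * th b (a3 + s) * th b (a4 + s)) * th b (A - s) -
    e2pi (3 * s) * (th b (a0 - s) * th b (a1 - s) * th b (a2 - s) * th b (a3 - s) * th b (a4 - s)) * th b (A + s))).
Proof.
  intros Hb H0 H1 H2 H3 H4 HA.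
  assert (HI : (Im A = Im a0 + Im a1 + Im a2 + Im a3 + Im a4)%R) by (unfold A, Im; simpl; ring).
  assert (E := theta_identity b a0 (e2pi a1) (e2pi a2) (e2pi a3) (e2pi a4) A (e2pi s)); cbv zeta in E.
  assert (Ip : forall u v, Im (u + v) = (Im u + Im v)%R) by reflexivity.
  assert (Im_ : forall u v, Im (u - v) = (Im u - Im v)%R) by reflexivity.
  assert (E3 : e2pi s * e2pi s * e2pi s = e2pi (3 * s)) by (rewrite <- !e2pi_plus; f_equal; ring).
  rewrite E3 in E; unfold th; replace (2 * s) with (s + s) by ring.
  rewrite <- !e2pi_minus, <- !e2pi_plus, <- e2pi_opp in E.
  assert (N : forall u, (0 < Im u < Im b)%R -> theta (e2pi u) (e2pi b) <> 0) by exact (th_neq_0 b).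
  specialize (E Hb (e2pi_neq_0 _) (e2pi_neq_0 _) (e2pi_neq_0 _) (e2pi_neq_0 _) (e2pi_neq_0 _) eq_refl).
  match goal with |- ?l = ?r => assert (E' : l - r = 0); [|replace l with (l - r + r) by ring; rewrite E'; ring] end.
  etransitivity; [|apply E].
  - ring.
  - apply N; rewrite Ip; lra.
  - apply N; rewrite Ip; lra.
  - replace (a0 - A) with (- (A - a0)) by ring; apply th_opp_neq_0; rewrite Im_; lra.
  - apply N; rewrite Ip; lra.
  - apply N; rewrite Im_; lra.
Qed.

(* The integrand; [A] is kept as a separate parameter and is always the sum of the
   [ai].  The factor with [th] is [/ (eg (2 * s) * eg (- (2 * s)))]. *)
Definition W (a b A a0 a1 a2 a3 a4 s : C) : C :=
  eg a b (a0 + s) * eg a b (a0 - s) * (eg a b (a1 + s) * eg a b (a1 - s)) * (eg a b (a2 + s) * eg a b (a2 - s)) *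
  (eg a b (a3 + s) * eg a b (a3 - s)) * (eg a b (a4 + s) * eg a b (a4 - s)) *
  (th b (2 * s) * th a (- (2 * s))) * (/ eg a b (A + s) * / eg a b (A - s)).

(* The inverse of the conjectured dependence of the integral on the parameters. *)
Definition Nv (a b a0 a1 a2 a3 a4 : C) (A := a0 + a1 + a2 + a3 + a4) : C :=
  / eg a b (a0 + a1) * / eg a b (a0 + a2) * / eg a b (a0 + a3) * / eg a b (a0 + a4) *
  (/ eg a b (a1 + a2) * / eg a b (a1 + a3) * / eg a b (a1 + a4) * / eg a b (a2 + a3) * / eg a b (a2 + a4) * / eg a b (a3 + a4)) *
  (eg a b (A - a0) * (eg a b (A - a1) * eg a b (A - a2) * eg a b (A - a3) * eg a b (A - a4))).

(* [tele] certifies the difference equation in [a0]: the defect of the integrand is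
   [- (tele s + tele (- s))], and [tele (s - a) = - tele (- s)], so that its integral
   vanishes. *)
Definition tele (a b A a0 a1 a2 a3 a4 s : C) : C :=
  e2pi a0 * th b (a0 + A) *
  (eg a b (a + a0 + s) * eg a b (a0 - s) * (eg a b (a + a1 + s) * eg a b (a1 - s)) * (eg a b (a + a2 + s) * eg a b (a2 - s)) *
   (eg a b (a + a3 + s) * eg a b (a3 - s)) * (eg a b (a + a4 + s) * eg a b (a4 - s))) *
  th a (- (2 * s)) * e2pi (- s) * (/ eg a b (a + A + s) * / eg a b (A - s)).

Lemma tele_opp (a b A a0 a1 a2 a3 a4 s : C) : (0 < Im a)%R -> tele a b A a0 a1 a2 a3 a4 (- s) =
  - (e2pi a0 * th b (a0 + A) *
  (eg a b (a + a0 - s) * eg a b (a0 + s) * (eg a b (a + a1 - s) * eg a b (a1 + s)) * (eg a b (a + a2 - s) * eg a b (a2 + s)) *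
   (eg a b (a + a3 - s) * eg a b (a3 + s)) * (eg a b (a + a4 - s) * eg a b (a4 + s))) *
  th a (- (2 * s)) * e2pi (3 * s) * (/ eg a b (a + A - s) * / eg a b (A + s))).
Proof.
  intros Ha; unfold tele; assert (D : forall u, u - - s = u + s) by (intros; ring).
  rewrite !D; replace (- (2 * - s)) with (- (- (2 * s))) by ring.
  rewrite (th_opp a (- (2 * s))) by assumption.
  replace (e2pi (- - s)) with (e2pi s) by (f_equal; ring).
  replace (e2pi (3 * s)) with (e2pi (- - (2 * s)) * e2pi s) by (rewrite <- e2pi_plus; f_equal; ring).
  unfold Cminus; ring.
Qed.

Lemma tele_shift (a b A a0 a1 a2 a3 a4 s : C) : (0 < Im a)%R -> tele a b A a0 a1 a2 a3 a4 (s - a) = - tele a b A a0 a1 a2 a3 a4 (- s).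
Proof.
  intros Ha; rewrite tele_opp by assumption; unfold tele.
  assert (D1 : forall u, u - (s - a) = a + u - s) by (intros; ring).
  assert (D2 : forall u, a + u + (s - a) = u + s) by (intros; ring).
  rewrite !D1, !D2; replace (- (2 * (s - a))) with (a + (a + - (2 * s))) by ring.
  rewrite !th_shift by assumption.
  replace (e2pi (3 * s)) with (e2pi (- - (2 * s)) * e2pi (- (a + - (2 * s))) * e2pi (- (s - a))) by (rewrite <- !e2pi_plus; f_equal; ring).
  ring.
Qed.

Lemma W_shift (a b a0 a1 a2 a3 a4 s : C) (A := a0 + a1 + a2 + a3 + a4) : (0 < Im a)%R -> (0 < Im b)%R ->
  (0 < Im a0)%R -> (0 < Im a1)%R -> (0 < Im a2)%R -> (0 < Im a3)%R -> (0 < Im a4)%R -> (2 * Im A < Im b)%R -> Im s = 0%R ->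
  th b (A - a1) * th b (A - a2) * th b (A - a3) * th b (A - a4) * W a b (a + A) (a + a0) a1 a2 a3 a4 s -
  th b (a0 + a1) * th b (a0 + a2) * th b (a0 + a3) * th b (a0 + a4) * W a b A a0 a1 a2 a3 a4 s =
  - (tele a b A a0 a1 a2 a3 a4 s + tele a b A a0 a1 a2 a3 a4 (- s)).
Proof.
  intros Ha Hb H0 H1 H2 H3 H4 HA Hs; rewrite tele_opp by assumption.
  assert (E := th_identity b a0 a1 a2 a3 a4 s Hb H0 H1 H2 H3 H4 HA); cbv zeta in E; fold A in E.
  assert (HI : (Im A = Im a0 + Im a1 + Im a2 + Im a3 + Im a4)%R) by (unfold A, Im; simpl; ring).
  clearbody A.
  assert (Sp : forall u, (0 < Im u)%R -> eg a b (a + u + s) = th b (u + s) * eg a b (u + s)).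
  { intros u Hu; rewrite <- Cplus_assoc; apply eg_shift; auto; unfold Im in *; simpl; lra. }
  assert (Sm : forall u, (0 < Im u)%R -> eg a b (a + u - s) = th b (u - s) * eg a b (u - s)).
  { intros u Hu; unfold Cminus; rewrite <- Cplus_assoc; apply eg_shift; auto; unfold Im in *; simpl; lra. }
  assert (Ip : / eg a b (A + s) = / eg a b (a + A + s) * th b (A + s)).
  { rewrite <- Cplus_assoc; apply eg_inv_shift; auto; unfold Im in *; simpl; lra. }
  assert (Im' : / eg a b (A - s) = / eg a b (a + A - s) * th b (A - s)).
  { replace (a + A - s) with (a + (A - s)) by ring; apply eg_inv_shift; auto; unfold Im in *; simpl; lra. }
  unfold W, tele; rewrite Ip, Im', (Sp a0), (Sp a1), (Sp a2), (Sp a3), (Sp a4), (Sm a0), (Sm a1), (Sm a2), (Sm a3), (Sm a4) by assumption.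
  set (Q := eg a b (a0 + s) * eg a b (a0 - s) * (eg a b (a1 + s) * eg a b (a1 - s)) * (eg a b (a2 + s) * eg a b (a2 - s)) *
    (eg a b (a3 + s) * eg a b (a3 - s)) * (eg a b (a4 + s) * eg a b (a4 - s)) * th a (- (2 * s)) * (/ eg a b (a + A + s) * / eg a b (a + A - s))).
  match type of E with ?l = ?r => transitivity (Q * l); [unfold Q; ring|rewrite E; unfold Q; ring] end.
Qed.

Lemma Nv_shift (a b a0 a1 a2 a3 a4 : C) (A := a0 + a1 + a2 + a3 + a4) : (0 < Im a)%R -> (0 < Im b)%R ->
  (0 < Im a0)%R -> (0 < Im a1)%R -> (0 < Im a2)%R -> (0 < Im a3)%R -> (0 < Im a4)%R -> (Im A < Im b)%R ->
  Nv a b (a + a0) a1 a2 a3 a4 * (th b (a0 + a1) * th b (a0 + a2) * th b (a0 + a3) * th b (a0 + a4)) =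
  Nv a b a0 a1 a2 a3 a4 * (th b (A - a1) * th b (A - a2) * th b (A - a3) * th b (A - a4)).
Proof.
  intros Ha Hb H0 H1 H2 H3 H4 HA; unfold Nv; fold A.
  assert (HI : (Im A = Im a0 + Im a1 + Im a2 + Im a3 + Im a4)%R) by (unfold A, Im; simpl; ring).
  replace (a + a0 + a1 + a2 + a3 + a4) with (a + A) by (unfold A; ring); clearbody A.
  assert (Sp : forall u, (Im (a0 + u) < Im b)%R -> / eg a b (a0 + u) = / eg a b (a + a0 + u) * th b (a0 + u)).
  { intros u Hu; rewrite <- Cplus_assoc; now apply eg_inv_shift. }
  assert (Sm : forall u, (0 < Im (A - u))%R -> eg a b (a + A - u) = th b (A - u) * eg a b (A - u)).
  { intros u Hu; unfold Cminus; rewrite <- Cplus_assoc; now apply eg_shift. }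
  replace (a + A - (a + a0)) with (A - a0) by ring.
  rewrite (Sp a1), (Sp a2), (Sp a3), (Sp a4), (Sm a1), (Sm a2), (Sm a3), (Sm a4) by (unfold Im in *; simpl; lra).
  ring.
Qed.

(** * The elliptic beta integral does not depend on its parameters *)

Definition aff (L : C * C -> C) : Prop := exists (n m : Z) (c : C), forall x, L x = IZR n * fst x + IZR m * snd x + c.

Lemma aff_const (c : C) : aff (fun _ => c).
Proof. exists 0%Z, 0%Z, c; intros x; ring. Qed.

Lemma aff_fst : aff (fun x => fst x).
Proof. exists 1%Z, 0%Z, 0; intros x; ring. Qed.

Lemma aff_snd : aff (fun x => snd x).
Proof. exists 0%Z, 1%Z, 0; intros x; ring. Qed.

Lemma aff_plus (L M : C * C -> C) : aff L -> aff M -> aff (fun x => L x + M x).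
Proof.
  intros [n [m [c HL]]] [n' [m' [c' HM]]]; exists (n + n')%Z, (m + m')%Z, (c + c'); intros x.
  rewrite HL, HM, !plus_IZR, !RtoC_plus; ring.
Qed.

Lemma aff_opp (L : C * C -> C) : aff L -> aff (fun x => - L x).
Proof.
  intros [n [m [c HL]]]; exists (- n)%Z, (- m)%Z, (- c); intros x; rewrite HL, !opp_IZR, !RtoC_opp; ring.
Qed.

Lemma aff_minus (L M : C * C -> C) : aff L -> aff M -> aff (fun x => L x - M x).
Proof. intros HL HM; apply aff_plus; [exact HL|now apply aff_opp]. Qed.

Lemma aff_double (L : C * C -> C) : aff L -> aff (fun x => 2 * L x).
Proof.
  intros [n [m [c HL]]]; exists (n + n)%Z, (m + m)%Z, (c + c); intros x; rewrite HL, !plus_IZR, !RtoC_plus; ring.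
Qed.

Ltac aff_tac := repeat first [apply aff_const|apply aff_fst|apply aff_snd|apply aff_double|apply aff_minus|apply aff_opp|apply aff_plus].

Lemma uapp_e2pi_aff (a b c d : R) (L : C * C -> C) : aff L -> uapp trig (strip a b c d) (fun x => e2pi (L x)).
Proof.
  intros [n [m [k HL]]]; apply uapp_ext with (fun x => e2pi k * e2pi (IZR n * fst x + IZR m * snd x)).
  - intros x _; rewrite HL, (e2pi_plus _ k); ring.
  - apply uapp_in, trig_e2pi.
Qed.

Lemma uapp_th (a b c d : R) (be : C) (L : C * C -> C) : (0 < Im be)%R -> aff L -> uapp trig (strip a b c d) (fun x => th be (L x)).
Proof.
  intros Hb HL; apply uapp_theta; [now apply Cmod_e2pi_lt_1|split; [now apply uapp_e2pi_aff|]].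
  apply uapp_ext with (fun x => e2pi (- L x)); [intros; apply e2pi_opp|now apply uapp_e2pi_aff, aff_opp].
Qed.

Lemma uapp_eg_ratio (a b c d eta : R) (al be : C) (L M : C * C -> C) : (0 < Im al)%R -> (0 < Im be)%R -> (0 < eta)%R -> aff L -> aff M ->
  (forall x, strip a b c d x -> (eta <= Im (M x))%R) ->
  uapp trig (strip a b c d) (fun x => dpoch (e2pi (L x)) (e2pi al) (e2pi be) * / dpoch (e2pi (M x)) (e2pi al) (e2pi be)).
Proof.
  intros Hal Hbe He HL HM Heta; assert (HA := trig_alg a b c d).
  destruct (two_bounds _ _ (Cmod_e2pi_lt_1 al Hal) (Cmod_e2pi_lt_1 be Hbe)) as [r [Hr [H1 H2]]].
  apply uapp_mult; [exact HA| |].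
  - apply uapp_dpoch with r; auto using uapp_const, uapp_e2pi_aff.
  - apply uapp_dpoch_inv with (Cmod (e2pi (0, eta)%R)) r; auto using uapp_const, uapp_e2pi_aff.
    + split; [apply Cmod_ge_0|apply Cmod_e2pi_lt_1; exact He].
    + intros x Hx; rewrite (Cmod_e2pi (0, eta)%R); apply Cmod_e2pi_le, Heta, Hx.
Qed.

Lemma uapp_eg (a b c d eta : R) (al be : C) (L : C * C -> C) : (0 < Im al)%R -> (0 < Im be)%R -> (0 < eta)%R -> aff L ->
  (forall x, strip a b c d x -> (eta <= Im (L x))%R) -> uapp trig (strip a b c d) (fun x => eg al be (L x)).
Proof.
  intros Hal Hbe He HL Heta.
  eapply uapp_ext; [|apply (uapp_eg_ratio a b c d eta al be (fun x => al + be - L x) L); auto; aff_tac; exact HL].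
  intros x _; unfold eg, egamma; now rewrite e2pi_mul_div.
Qed.

Lemma uapp_eg_inv (a b c d eta : R) (al be : C) (L : C * C -> C) : (0 < Im al)%R -> (0 < Im be)%R -> (0 < eta)%R -> aff L ->
  (forall x, strip a b c d x -> (Im (L x) <= Im al + Im be - eta)%R) -> uapp trig (strip a b c d) (fun x => / eg al be (L x)).
Proof.
  intros Hal Hbe He HL Heta.
  eapply uapp_ext; [|apply (uapp_eg_ratio a b c d eta al be L (fun x => al + be - L x)); auto; [aff_tac; exact HL|]].
  - intros x _; unfold eg, egamma, Cdiv; rewrite Cinv_mult_total, Cinv_inv_total.
    fold (Cdiv (e2pi al * e2pi be) (e2pi (L x))); rewrite e2pi_mul_div; ring.
  - intros x Hx; specialize (Heta x Hx); unfold Im in *; simpl in *; lra.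
Qed.

Lemma uapp_const_line (c d h : R) (f : C -> C) (k : C) : uapp trig (strip c d 0 0) (fun x => f (fst x)) -> (c <= h <= d)%R ->
  (forall s, Im s = h -> f s = k) -> forall s, (c <= Im s <= d)%R -> f s = k.
Proof.
  intros Hf Hh Hk s Hs.
  assert (E : f s + - k = 0).
  { apply (uapp_unique c d 0 0 (fun x => f (fst x) + - k) (0, h)%R 0); auto.
    - apply uapp_plus; auto using trig_alg, uapp_const.
    - simpl; lra.
    - intros n; unfold coef; simpl; rewrite (CI_ext _ (fun _ => 0)); [apply CI_const|].
      intros t _; rewrite Hk; [ring|unfold Im; simpl; ring]. }
  replace (f s) with (f s + - k + k) by ring; rewrite E; ring.
Qed.

Lemma uapp_doubly_periodic (c d h : R) (a : C) (f : C -> C) : uapp trig (strip c d 0 0) (fun x => f (fst x)) ->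
  (0 < Im a)%R -> (c <= h)%R -> (h + Im a <= d)%R -> (forall s, Im s = h -> f (a + s) = f s) ->
  forall s s', (c <= Im s <= d)%R -> (c <= Im s' <= d)%R -> f s = f s'.
Proof.
  intros Hf Ha Hc Hd Hp; set (v := (0, h)%R : C).
  assert (Hv : Im v = h) by reflexivity.
  assert (Hl : forall t : R, Im (v + t) = h) by (intros; unfold Im, v; simpl; ring).
  assert (Hcont : cont01 (fun t => f (v + t))).
  { apply (uapp_line_cont01 c d 0 0 (fun x => f (fst x)) v 0); auto; [rewrite Hv; lra|simpl; lra]. }
  assert (Hn : forall n, n <> 0%Z -> coef f n v = 0).
  { intros n Hn.
    assert (E : coef f n v = coef f n (a + v)).
    { apply (uapp_coef c d 0 0 (fun x => f (fst x)) n v (a + v) 0); auto.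
      - rewrite Hv; lra.
      - change (Im (a + v)) with (Im a + Im v)%R; rewrite Hv; lra.
      - simpl; lra. }
    assert (E2 : coef f n (a + v) = e2pi (- (IZR n * a)) * coef f n v).
    { unfold coef; rewrite <- CI_scal by (apply cont01_mult; [exact Hcont|apply cont01_shift_e2pi]).
      apply CI_ext; intros t _; rewrite <- Cplus_assoc, Hp by apply Hl.
      replace (- (IZR n * (a + (v + t)))) with (- (IZR n * a) + - (IZR n * (v + t))) by ring; rewrite e2pi_plus; ring. }
    assert (E3 : (1 - e2pi (- (IZR n * a))) * coef f n v = 0).
    { transitivity (coef f n v - e2pi (- (IZR n * a)) * coef f n v); [ring|]; rewrite <- E2, E; ring. }
    apply Cmult_integral in E3; destruct E3 as [E3|E3]; [exfalso|exact E3].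
    assert (E4 : Cmod (e2pi (- (IZR n * a))) = 1%R).
    { replace (e2pi (- (IZR n * a))) with (1 - (1 - e2pi (- (IZR n * a)))) by ring; rewrite E3.
      replace (1 - 0) with (RtoC 1) by ring; apply Cmod_1. }
    rewrite Cmod_e2pi in E4.
    assert (E5 : (- (2 * PI * Im (- (IZR n * a))) = 0)%R) by (apply exp_inv; rewrite E4; symmetry; apply exp_0).
    replace (Im (- (IZR n * a)))%R with (- (IZR n * Im a))%R in E5 by (unfold Im; simpl; ring).
    assert (IZR n <> 0)%R by (intros Z; apply eq_IZR in Z; auto).
    assert (2 * PI <> 0)%R by (generalize PI_RGT_0; lra).
    assert (E6 : ((2 * PI) * (IZR n * Im a) = 0)%R) by lra.
    apply Rmult_integral in E6; destruct E6 as [E6|E6]; [lra|].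
    apply Rmult_integral in E6; destruct E6; lra. }
  set (k := coef f 0 v).
  assert (Hk : forall s, (c <= Im s <= d)%R -> f s = k).
  { intros s Hs; assert (E : 1 * f s + - k * 1 = 0).
    { apply (uapp_unique c d 0 0 (fun x => 1 * f (fst x) + - k * 1) v 0); auto.
      - apply uapp_plus; [apply trig_alg|now apply uapp_scal; [apply trig_alg|]|apply uapp_const, trig_alg].
      - rewrite Hv; lra.
      - simpl; lra.
      - intros n; rewrite (coef_lin f (fun _ => 1)); auto using cont01_const.
        assert (E1 : coef (fun _ => 1) n v = CI (fun t => e2pi (IZR (- n) * (v + t)))).
        { unfold coef; apply CI_ext; intros t _; rewrite opp_IZR, RtoC_opp, Cmult_1_l; f_equal; ring. }
        rewrite E1, CI_e2pi_shift; destruct (Z.eq_dec (- n) 0) as [Z|Z].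
        + replace n with 0%Z by lia; unfold k; ring.
        + rewrite Hn by lia; ring. }
    replace (f s) with (1 * f s + - k * 1 + k) by ring; rewrite E; ring. }
  intros s s' Hs Hs'; now rewrite !Hk.
Qed.

Ltac im_tac := unfold strip, Im in *; simpl in *; lra.

Ltac uprod := lazymatch goal with
  | |- uapp _ _ (fun x => @?f x * @?g x) => apply (uapp_mult _ _ f g); [apply trig_alg|uprod|uprod]
  | |- uapp _ _ (fun x => th ?be (@?L x)) => apply (uapp_th _ _ _ _ be L); [assumption|aff_tac]
  | |- uapp _ _ (fun x => e2pi (@?L x)) => apply (uapp_e2pi_aff _ _ _ _ L); aff_tac
  | |- uapp _ _ (fun x => eg ?al ?be (@?L x)) => eapply (uapp_eg _ _ _ _ _ al be L); [assumption|assumption| |aff_tac|intros ? ?]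
  | |- uapp _ _ (fun x => / eg ?al ?be (@?L x)) => eapply (uapp_eg_inv _ _ _ _ _ al be L); [assumption|assumption| |aff_tac|intros ? ?]
  | |- uapp _ _ (fun x => _) => apply uapp_const, trig_alg
  end.

Lemma exists_pos_le6 (r1 r2 r3 r4 r5 r6 : R) : (0 < r1)%R -> (0 < r2)%R -> (0 < r3)%R -> (0 < r4)%R -> (0 < r5)%R -> (0 < r6)%R ->
  exists eps : R, (0 < eps /\ eps <= r1 /\ eps <= r2 /\ eps <= r3 /\ eps <= r4 /\ eps <= r5 /\ eps <= r6)%R.
Proof.
  intros; exists (Rmin r1 (Rmin r2 (Rmin r3 (Rmin r4 (Rmin r5 r6))))).
  split; [repeat apply Rmin_pos; assumption|].
  assert (A := Rmin_l r1 (Rmin r2 (Rmin r3 (Rmin r4 (Rmin r5 r6))))); assert (A' := Rmin_r r1 (Rmin r2 (Rmin r3 (Rmin r4 (Rmin r5 r6))))).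
  assert (B := Rmin_l r2 (Rmin r3 (Rmin r4 (Rmin r5 r6)))); assert (B' := Rmin_r r2 (Rmin r3 (Rmin r4 (Rmin r5 r6)))).
  assert (D := Rmin_l r3 (Rmin r4 (Rmin r5 r6))); assert (D' := Rmin_r r3 (Rmin r4 (Rmin r5 r6))).
  assert (E := Rmin_l r4 (Rmin r5 r6)); assert (E' := Rmin_r r4 (Rmin r5 r6)).
  assert (F := Rmin_l r5 r6); assert (F' := Rmin_r r5 r6); lra.
Qed.

Lemma Cmult4_neq_0 (u1 u2 u3 u4 : C) : u1 <> 0 -> u2 <> 0 -> u3 <> 0 -> u4 <> 0 -> u1 * u2 * u3 * u4 <> 0.
Proof. intros; auto using Cmult_neq_0. Qed.

Section beta.
Variables a b a1 a2 a3 a4 : C.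
Hypotheses (Ha : (0 < Im a)%R) (Hb : (0 < Im b)%R) (H1 : (0 < Im a1)%R) (H2 : (0 < Im a2)%R) (H3 : (0 < Im a3)%R) (H4 : (0 < Im a4)%R).

Lemma CI_tele (a0 : C) (A := a0 + a1 + a2 + a3 + a4) : (0 < Im a0)%R -> (Im A < Im b)%R ->
  cont01 (fun t => tele a b A a0 a1 a2 a3 a4 t) /\ cont01 (fun t => tele a b A a0 a1 a2 a3 a4 (- t)) /\
  CI (fun t => tele a b A a0 a1 a2 a3 a4 t) = 0 /\ CI (fun t => tele a b A a0 a1 a2 a3 a4 (- t)) = 0.
Proof.
  intros H0 HA; clearbody A.
  set (f := tele a b A a0 a1 a2 a3 a4).
  assert (Hf : uapp trig (strip (- Im a) 0 0 0) (fun x => f (fst x))).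
  { assert (HT := trig_alg (- Im a) 0 0 0).
    destruct (exists_pos_le6 (Im a0) (Im a1) (Im a2) (Im a3) (Im a4) (Im b - Im A)) as [eps He]; try lra.
    unfold f, tele; uprod; try exact (proj1 He); cbv beta; im_tac. }
  assert (Hcoef : forall v, coef f 0 v = CI (fun t => f (v + t))).
  { intros v; apply CI_ext; intros t _; rewrite Cmult_0_l; replace (- 0) with (RtoC 0) by ring; rewrite e2pi_0; ring. }
  assert (Hline : forall v v', (- Im a <= Im v <= 0)%R -> (- Im a <= Im v' <= 0)%R -> CI (fun t => f (v + t)) = CI (fun t => f (v' + t))).
  { intros v v' Hv Hv'; rewrite <- !Hcoef; apply (uapp_coef (- Im a) 0 0 0 (fun x => f (fst x)) 0 v v' 0); auto; simpl; lra. }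
  assert (Hcont : cont01 (fun t => f t)).
  { apply (uapp_trig_cont01 _ (fun x => f (fst x)) 0 0 1 0) in Hf; [|intros t _; im_tac].
    eapply cont01_ext; [|exact Hf]; intros; simpl; f_equal; ring. }
  assert (Hcont' : cont01 (fun t => f (- t))).
  { apply (uapp_trig_cont01 _ (fun x => f (fst x)) 0 0 (- (1)) 0) in Hf; [|intros t _; im_tac].
    eapply cont01_ext; [|exact Hf]; intros; simpl; f_equal; ring. }
  assert (R1 : CI (fun t => f t) = CI (fun t => f (- t))).
  { transitivity (CI (fun t => f (- (1) + t))).
    - transitivity (CI (fun t => f (0 + t))); [apply CI_ext; intros; f_equal; ring|apply Hline; im_tac].
    - rewrite <- (CI_reflect (fun t => f (- t))) by exact Hcont'.
      apply CI_ext; intros t _; rewrite RtoC_minus; f_equal; ring. }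
  assert (R2 : CI (fun t => f t) = - CI (fun t => f (- t))).
  { transitivity (CI (fun t => f (- a + t))).
    - transitivity (CI (fun t => f (0 + t))); [apply CI_ext; intros; f_equal; ring|apply Hline; im_tac].
    - replace (- CI (fun t => f (- t))) with (- (1) * CI (fun t => f (- t))) by ring; rewrite <- CI_scal by exact Hcont'.
      apply CI_ext; intros t _; replace (- a + t) with (t - a) by ring; unfold f; rewrite tele_shift by exact Ha; ring. }
  assert (Z : CI (fun t => f (- t)) = 0) by (apply Copp_self_0; rewrite <- R2; symmetry; exact R1).
  split; [exact Hcont|split; [exact Hcont'|split; [rewrite R1; exact Z|exact Z]]].
Qed.

Lemma uapp_W (c d eps : R) : (0 < eps)%R -> (eps <= c)%R -> (eps <= Im a1)%R -> (eps <= Im a2)%R -> (eps <= Im a3)%R -> (eps <= Im a4)%R ->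
  (d + Im a1 + Im a2 + Im a3 + Im a4 + eps <= Im a + Im b)%R ->
  uapp trig (strip c d 0 0) (fun x => W a b (fst x + a1 + a2 + a3 + a4) (fst x) a1 a2 a3 a4 (snd x)).
Proof.
  intros He Hc E1 E2 E3 E4 Hd; assert (HT := trig_alg c d 0 0); unfold W.
  uprod; try exact He; cbv beta; im_tac.
Qed.

Definition EI (a0 : C) : C := CI (fun t => W a b (a0 + a1 + a2 + a3 + a4) a0 a1 a2 a3 a4 t).

Definition EB (a0 : C) : C := EI a0 * Nv a b a0 a1 a2 a3 a4.

Lemma W_cont (a0 : C) : (0 < Im a0)%R -> (Im a0 + Im a1 + Im a2 + Im a3 + Im a4 < Im a + Im b)%R ->
  cont01 (fun t => W a b (a0 + a1 + a2 + a3 + a4) a0 a1 a2 a3 a4 t).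
Proof.
  intros H0 HA.
  destruct (exists_pos_le6 (Im a0) (Im a1) (Im a2) (Im a3) (Im a4) (Im a + Im b - (Im a0 + Im a1 + Im a2 + Im a3 + Im a4))) as [eps He]; try lra.
  assert (Hu := uapp_W (Im a0) (Im a0) eps ltac:(lra) ltac:(lra) ltac:(lra) ltac:(lra) ltac:(lra) ltac:(lra) ltac:(lra)).
  apply (uapp_trig_cont01 _ _ a0 0 0 1) in Hu; [|intros t _; im_tac].
  eapply cont01_ext; [|exact Hu]; intros t _; simpl.
  replace (a0 + 0 * t) with a0 by ring; f_equal; ring.
Qed.

Lemma EB_shift (a0 : C) : (0 < Im a0)%R -> (2 * (Im a0 + Im a1 + Im a2 + Im a3 + Im a4) < Im b)%R -> EB (a + a0) = EB a0.
Proof.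
  intros H0 HA; set (A := a0 + a1 + a2 + a3 + a4).
  assert (HI : (Im A = Im a0 + Im a1 + Im a2 + Im a3 + Im a4)%R) by (unfold A, Im; simpl; ring).
  set (MA := th b (A - a1) * th b (A - a2) * th b (A - a3) * th b (A - a4)).
  set (MB := th b (a0 + a1) * th b (a0 + a2) * th b (a0 + a3) * th b (a0 + a4)).
  assert (NA : MA <> 0) by (apply Cmult4_neq_0; apply th_neq_0; im_tac).
  assert (NB : MB <> 0) by (apply Cmult4_neq_0; apply th_neq_0; im_tac).
  destruct (CI_tele a0 H0) as [T1 [T2 [T3 T4]]]; [fold A; lra|].
  assert (C1 := W_cont (a + a0) ltac:(im_tac) ltac:(im_tac)); assert (C0 := W_cont a0 H0 ltac:(lra)).
  assert (E : MA * EI (a + a0) - MB * EI a0 = 0).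
  { unfold EI; rewrite <- !CI_scal, <- CI_minus by (try (apply cont01_mult; [apply cont01_const|]); assumption).
    transitivity (CI (fun t => - (1) * (tele a b A a0 a1 a2 a3 a4 t + tele a b A a0 a1 a2 a3 a4 (- t)))).
    - apply CI_ext; intros t _; fold A; replace (a + a0 + a1 + a2 + a3 + a4) with (a + A) by (unfold A; ring).
      assert (Ws := W_shift a b a0 a1 a2 a3 a4 t Ha Hb H0 H1 H2 H3 H4); fold A in Ws; cbv zeta in Ws; fold MA MB in Ws.
      rewrite Ws; [ring|lra|reflexivity].
    - rewrite CI_scal, CI_plus by (try apply cont01_plus; assumption); fold A in T3, T4; rewrite T3, T4; ring. }
  assert (EN := Nv_shift a b a0 a1 a2 a3 a4 Ha Hb H0 H1 H2 H3 H4); fold A MA MB in EN; specialize (EN ltac:(lra)).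
  assert (Z : EB (a + a0) * (MA * MB) - EB a0 * (MA * MB) = 0).
  { unfold EB; transitivity (MA * EI (a + a0) * (Nv a b (a + a0) a1 a2 a3 a4 * MB) - MB * EI a0 * (Nv a b a0 a1 a2 a3 a4 * MA)); [ring|].
    rewrite EN; transitivity ((MA * EI (a + a0) - MB * EI a0) * (Nv a b a0 a1 a2 a3 a4 * MA)); [ring|rewrite E; ring]. }
  assert (Z' : (EB (a + a0) - EB a0) * (MA * MB) = 0) by (rewrite <- Z; ring).
  apply Cmult_integral in Z'; destruct Z' as [Z'|Z']; [|apply Cmult_integral in Z'; tauto].
  transitivity (EB (a + a0) - EB a0 + EB a0); [ring|rewrite Z'; ring].
Qed.

Lemma uapp_EB (c d : R) : (0 < c)%R -> (d + Im a1 + Im a2 + Im a3 + Im a4 < Im a + Im b)%R -> uapp trig (strip c d 0 0) (fun x => EB (fst x)).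
Proof.
  intros Hc Hd.
  destruct (exists_pos_le6 c (Im a1) (Im a2) (Im a3) (Im a4) (Im a + Im b - (d + Im a1 + Im a2 + Im a3 + Im a4))) as [eps He]; try lra.
  assert (HT := trig_alg c d 0 0).
  assert (Hu := uapp_W c d eps ltac:(lra) ltac:(lra) ltac:(lra) ltac:(lra) ltac:(lra) ltac:(lra) ltac:(lra)).
  apply (uapp_CI c d 0 0 _ 0) in Hu; [|simpl; lra].
  unfold EB; apply uapp_mult; [exact HT| |].
  - eapply uapp_ext; [|exact Hu]; intros x _; unfold EI; simpl; apply CI_ext; intros; f_equal; ring.
  - unfold Nv; uprod; try exact (proj1 He); cbv beta; im_tac.
Qed.

Lemma EB_const_first (s s' : C) : (2 * (Im a1 + Im a2 + Im a3 + Im a4) < Im b)%R ->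
  (0 < Im s)%R -> (Im s + Im a1 + Im a2 + Im a3 + Im a4 < Im a + Im b)%R ->
  (0 < Im s')%R -> (Im s' + Im a1 + Im a2 + Im a3 + Im a4 < Im a + Im b)%R -> EB s = EB s'.
Proof.
  intros HH Hs1 Hs2 Hs1' Hs2'.
  set (h := ((Im b / 2 - (Im a1 + Im a2 + Im a3 + Im a4)) / 2)%R).
  assert (Hh : (0 < h /\ 2 * (h + Im a1 + Im a2 + Im a3 + Im a4) < Im b)%R) by (unfold h; lra).
  set (c := Rmin h (Rmin (Im s) (Im s'))); set (d := Rmax (h + Im a) (Rmax (Im s) (Im s'))).
  assert (Hc : (0 < c)%R) by (unfold c; repeat apply Rmin_pos; lra).
  assert (Hd : (d + Im a1 + Im a2 + Im a3 + Im a4 < Im a + Im b)%R).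
  { assert (d < Im a + Im b - (Im a1 + Im a2 + Im a3 + Im a4))%R; [|lra].
    unfold d; repeat apply Rmax_lub_lt; lra. }
  assert (B1 := Rmin_l h (Rmin (Im s) (Im s'))); assert (B2 := Rmin_r h (Rmin (Im s) (Im s'))).
  assert (B3 := Rmin_l (Im s) (Im s')); assert (B4 := Rmin_r (Im s) (Im s')).
  assert (D1 := Rmax_l (h + Im a) (Rmax (Im s) (Im s'))); assert (D2 := Rmax_r (h + Im a) (Rmax (Im s) (Im s'))).
  assert (D3 := Rmax_l (Im s) (Im s')); assert (D4 := Rmax_r (Im s) (Im s')); fold c in B1, B2; fold d in D1, D2.
  apply (uapp_doubly_periodic c d h a EB (uapp_EB c d Hc Hd)); auto; try lra.
  intros u Hu; apply EB_shift; rewrite Hu; lra.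
Qed.

Lemma EB_const_line (h : R) (k s : C) : (0 < h)%R -> (h <= Im s)%R -> (Im s + Im a1 + Im a2 + Im a3 + Im a4 < Im a + Im b)%R ->
  (forall u, Im u = h -> EB u = k) -> EB s = k.
Proof.
  intros Hh Hs HA Hk; apply (uapp_const_line h (Im s) h EB k); auto; [|lra|lra].
  apply uapp_EB; auto.
Qed.

End beta.

Definition Beta (a b a0 a1 a2 a3 a4 : C) : C := EB a b a1 a2 a3 a4 a0.

Definition balanced (a b a0 a1 a2 a3 a4 : C) : Prop :=
  (0 < Im a0 /\ 0 < Im a1 /\ 0 < Im a2 /\ 0 < Im a3 /\ 0 < Im a4 /\ Im a0 + Im a1 + Im a2 + Im a3 + Im a4 < Im a + Im b)%R.

Lemma Beta_rot (a b a0 a1 a2 a3 a4 : C) : Beta a b a0 a1 a2 a3 a4 = Beta a b a1 a2 a3 a4 a0.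
Proof.
  unfold Beta, EB, EI, Nv.
  replace (a1 + a2 + a3 + a4 + a0) with (a0 + a1 + a2 + a3 + a4) by ring.
  rewrite (Cplus_comm a1 a0), (Cplus_comm a2 a0), (Cplus_comm a3 a0), (Cplus_comm a4 a0).
  f_equal; [|ring].
  apply CI_ext; intros t _; unfold W; ring.
Qed.

Section const.
Variables a b : C.
Hypotheses (Ha : (0 < Im a)%R) (Hb : (0 < Im b)%R).

Lemma Beta_const_base (h : R) (a0 a1 a2 a3 a4 : C) : (0 < h)%R -> (8 * h < Im b)%R ->
  Im a0 = h -> Im a1 = h -> Im a2 = h -> Im a3 = h -> Im a4 = h ->
  Beta a b a0 a1 a2 a3 a4 = Beta a b (0, h)%R (0, h)%R (0, h)%R (0, h)%R (0, h)%R.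
Proof.
  intros Hh Hh8; set (u := (0, h)%R : C); assert (Hu : Im u = h) by reflexivity; clearbody u.
  assert (S : forall c0 c1 c2 c3 c4, Im c0 = h -> Im c1 = h -> Im c2 = h -> Im c3 = h -> Im c4 = h ->
    Beta a b c0 c1 c2 c3 c4 = Beta a b c1 c2 c3 c4 u).
  { intros c0 c1 c2 c3 c4 E0 E1 E2 E3 E4; rewrite <- (Beta_rot a b u).
    unfold Beta; apply EB_const_first; lra. }
  intros E0 E1 E2 E3 E4.
  rewrite S, S, S, S, S by assumption; reflexivity.
Qed.

Lemma Beta_const_step (h : R) (k a0 a1 a2 a3 a4 : C) : (0 < h <= Im a0)%R -> balanced a b a0 a1 a2 a3 a4 ->
  (forall u, Im u = h -> Beta a b u a1 a2 a3 a4 = k) -> Beta a b a0 a1 a2 a3 a4 = k.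
Proof.
  intros Hh [B0 [B1 [B2 [B3 [B4 B5]]]]] H; apply (EB_const_line a b a1 a2 a3 a4 Ha Hb B1 B2 B3 B4 h k a0); lra || exact H.
Qed.

Lemma Beta_const_value (h : R) (a0 a1 a2 a3 a4 : C) : balanced a b a0 a1 a2 a3 a4 -> (0 < h)%R -> (8 * h < Im b)%R ->
  (h <= Im a0)%R -> (h <= Im a1)%R -> (h <= Im a2)%R -> (h <= Im a3)%R -> (h <= Im a4)%R ->
  Beta a b a0 a1 a2 a3 a4 = Beta a b (0, h)%R (0, h)%R (0, h)%R (0, h)%R (0, h)%R.
Proof.
  set (k := Beta a b (0, h)%R (0, h)%R (0, h)%R (0, h)%R (0, h)%R).
  intros [B0 [B1 [B2 [B3 [B4 B5]]]]] Hh Hh8 E0 E1 E2 E3 E4.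
  apply (Beta_const_step h); [lra|unfold balanced; lra|intros u0 U0; rewrite Beta_rot].
  apply (Beta_const_step h); [lra|unfold balanced; lra|intros u1 U1; rewrite Beta_rot].
  apply (Beta_const_step h); [lra|unfold balanced; lra|intros u2 U2; rewrite Beta_rot].
  apply (Beta_const_step h); [lra|unfold balanced; lra|intros u3 U3; rewrite Beta_rot].
  apply (Beta_const_step h); [lra|unfold balanced; lra|intros u4 U4].
  now apply Beta_const_base.
Qed.

Lemma Beta_const (a0 a1 a2 a3 a4 c0 c1 c2 c3 c4 : C) : balanced a b a0 a1 a2 a3 a4 -> balanced a b c0 c1 c2 c3 c4 ->
  Beta a b a0 a1 a2 a3 a4 = Beta a b c0 c1 c2 c3 c4.
Proof.
  intros HB HC; assert (B := HB); assert (D := HC); unfold balanced in B, D.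
  destruct (exists_pos_le6 (Im a0) (Im a1) (Im a2) (Im a3) (Im a4) (Im b / 9)) as [e1 He1]; try lra.
  destruct (exists_pos_le6 (Im c0) (Im c1) (Im c2) (Im c3) (Im c4) (Im b / 9)) as [e2 He2]; try lra.
  assert (H1 := Rmin_l e1 e2); assert (H2 := Rmin_r e1 e2); assert (H3 : (0 < Rmin e1 e2)%R) by (apply Rmin_pos; lra).
  rewrite (Beta_const_value (Rmin e1 e2) a0 a1 a2 a3 a4), (Beta_const_value (Rmin e1 e2) c0 c1 c2 c3 c4); auto; lra.
Qed.
End const.

(** * A pair of Poisson kernels *)

Definition kerS (rho : R) (t : C) : C := / (1 + rho * e2pi (2 * t)).

Lemma uapp_kerS (rho : R) (k : Z) : (0 < rho < 1)%R -> k = 1%Z \/ k = (-1)%Z ->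
  uapp trig (strip 0 0 0 0) (fun x => kerS rho (IZR k * fst x)).
Proof.
  intros Hr Hk; assert (HT := trig_alg 0 0 0 0).
  apply uapp_ext with (fun x => / (1 - (- rho * e2pi (2 * (IZR k * fst x))))); [intros; unfold kerS; f_equal; ring|].
  apply uapp_inv_one_sub with rho; [exact HT|lra| |].
  - apply uapp_scal; [exact HT|]; apply (uapp_e2pi_aff 0 0 0 0 (fun x => 2 * (IZR k * fst x))).
    apply aff_double; exists k, 0%Z, 0; intros x; ring.
  - intros x [Hx _]; rewrite Cmod_mult, Cmod_opp, Cmod_R, Rabs_pos_eq by lra.
    replace (2 * (IZR k * fst x)) with (RtoC (2 * IZR k * Re (fst x))).
    + rewrite Cmod_e2pi_R; lra.
    + assert (Im (fst x) = 0%R) by lra; apply C_eq; unfold Re, Im in *; simpl; rewrite ?H; ring.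
Qed.

Lemma kerS_cont (rho : R) : (0 < rho < 1)%R -> cont01 (fun t => kerS rho t).
Proof.
  intros Hr; assert (H := uapp_kerS rho 1 Hr (or_introl eq_refl)).
  apply (uapp_trig_cont01 _ _ 0 0 1 0) in H; [|intros t _; im_tac].
  eapply cont01_ext; [|exact H]; intros t _; simpl; f_equal; ring.
Qed.

Lemma kerS_opp_cont (rho : R) : (0 < rho < 1)%R -> cont01 (fun t => kerS rho (- t)).
Proof.
  intros Hr; assert (H := uapp_kerS rho (-1) Hr (or_intror eq_refl)).
  apply (uapp_trig_cont01 _ _ 0 0 1 0) in H; [|intros t _; im_tac].
  eapply cont01_ext; [|exact H]; intros t _; simpl; f_equal; ring.
Qed.

Definition delta (m : Z) : C := if Z.eq_dec m 0 then 1 else 0.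

Lemma CI_e2pi_delta (m : Z) : CI (fun t => e2pi (IZR m * t)) = delta m.
Proof. unfold delta; rewrite <- (CI_e2pi_shift m 0); apply CI_ext; intros; f_equal; ring. Qed.

Definition momS (rho : R) (m : Z) : C := CI (fun t => e2pi (IZR m * t) * kerS rho t).

Lemma kerS_den_bound (rho t : R) : (0 < rho < 1)%R -> (1 - rho <= Cmod (1 + rho * e2pi (2 * t)))%R.
Proof.
  intros Hr; replace (1 + rho * e2pi (2 * t)) with (1 - (- rho * e2pi (2 * t))) by ring.
  apply one_sub_Cmod_lower; rewrite Cmod_mult, Cmod_opp, Cmod_R, Rabs_pos_eq, <- RtoC_mult, Cmod_e2pi_R by lra; lra.
Qed.

Lemma kerS_den_neq_0 (rho t : R) : (0 < rho < 1)%R -> 1 + rho * e2pi (2 * t) <> 0.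
Proof. intros Hr E; generalize (kerS_den_bound rho t Hr); rewrite E, Cmod_0; lra. Qed.

Lemma momS_rec (rho : R) (m : Z) : (0 < rho < 1)%R -> momS rho m = delta m - rho * momS rho (m + 2).
Proof.
  intros Hr; assert (Hk := kerS_cont rho Hr); unfold momS.
  rewrite <- CI_e2pi_delta, <- CI_scal, <- CI_minus; try (repeat apply cont01_mult; auto using cont01_const, cont01_e2pi_IZR).
  apply CI_ext; intros t _; rewrite plus_IZR, RtoC_plus, Cmult_plus_distr_r, e2pi_plus; unfold kerS.
  field; now apply kerS_den_neq_0.
Qed.

Lemma momS_bound (rho : R) (m : Z) : (0 < rho < 1)%R -> (Cmod (momS rho m) <= 2 * / (1 - rho))%R.
Proof.
  intros Hr; apply CI_bound; [apply cont01_mult; [apply cont01_e2pi_IZR|now apply kerS_cont]|].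
  intros t _; rewrite Cmod_mult, <- RtoC_mult, Cmod_e2pi_R, Rmult_1_l; unfold kerS.
  rewrite Cmod_inv by (now apply kerS_den_neq_0).
  apply Rinv_le_contravar; [lra|now apply kerS_den_bound].
Qed.

Lemma momS_pos (rho : R) (m : Z) : (0 < rho < 1)%R -> (0 < m)%Z -> momS rho m = 0.
Proof.
  intros Hr Hm.
  assert (H : forall k : nat, (Cmod (momS rho m) <= rho ^ k * (2 * / (1 - rho)))%R).
  { intros k; revert m Hm; induction k as [|k IH]; intros m Hm.
    - simpl; rewrite Rmult_1_l; now apply momS_bound.
    - rewrite momS_rec by assumption; unfold delta; destruct (Z.eq_dec m 0); [lia|].
      replace (0 - rho * momS rho (m + 2)) with (- (rho * momS rho (m + 2))) by ring.
      rewrite Cmod_opp, Cmod_mult, Cmod_R, Rabs_pos_eq by lra; simpl; rewrite Rmult_assoc.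
      apply Rmult_le_compat_l; [lra|apply IH; lia]. }
  apply Cmod_small_eq; intros eps He; replace (momS rho m - 0) with (momS rho m) by ring.
  assert (L := lim_geom (2 * / (1 - rho)) rho ltac:(lra)); apply is_lim_seq_spec in L.
  destruct (L (mkposreal eps He)) as [N HN]; specialize (HN N (le_n _)); simpl in HN; rewrite Rminus_0_r in HN.
  specialize (H N); generalize (Rle_abs (2 * / (1 - rho) * rho ^ N)); lra.
Qed.

Definition avg4 (m : Z) : C := (e2pi (IZR m * (1 / 4)%R) + e2pi (IZR m * (- (1 / 4))%R)) / 2.

Lemma e2pi_half : e2pi (/ 2) = - (1).
Proof.
  replace (/ 2) with (RtoC (/ 2)) by (now rewrite RtoC_inv by lra); rewrite e2pi_R.
  replace (2 * PI * / 2)%R with PI by field; rewrite cos_PI, sin_PI; apply C_eq; simpl; ring.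
Qed.

Lemma e2pi_opp_half : e2pi (- / 2) = - (1).
Proof. rewrite e2pi_opp, e2pi_half; field; intros E; apply (f_equal Re) in E; simpl in E; lra. Qed.

Lemma avg4_0 : avg4 0 = 1.
Proof. unfold avg4; rewrite !Cmult_0_l, e2pi_0; field. Qed.

Lemma avg4_1 : avg4 (-1) = 0.
Proof.
  unfold avg4; rewrite <- !RtoC_mult, !e2pi_R.
  replace (2 * PI * (-1 * (1 / 4)))%R with (- (PI / 2))%R by field.
  replace (2 * PI * (-1 * - (1 / 4)))%R with (PI / 2)%R by field.
  rewrite cos_neg, sin_neg, cos_PI2, sin_PI2; apply C_eq; simpl; field.
Qed.

Lemma avg4_step (m : Z) : avg4 m = - avg4 (m + 2).
Proof.
  unfold avg4; rewrite plus_IZR, RtoC_plus, !Cmult_plus_distr_r, !e2pi_plus, <- !RtoC_mult.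
  replace (RtoC (2 * (1 / 4))) with (/ 2) by (rewrite <- RtoC_inv by lra; f_equal; field).
  replace (RtoC (2 * - (1 / 4))) with (- / 2) by (rewrite <- RtoC_inv, <- RtoC_opp by lra; f_equal; field).
  rewrite e2pi_half, e2pi_opp_half; field.
Qed.

Lemma avg4_opp (m : Z) : avg4 (- m) = avg4 m.
Proof.
  unfold avg4; rewrite opp_IZR, RtoC_opp, RtoC_opp, Cplus_comm; do 2 f_equal; f_equal; ring.
Qed.

Lemma momS_neg (j : nat) : exists k : nat, forall rho : R, (0 < rho < 1)%R -> momS rho (- Z.of_nat j) = avg4 (- Z.of_nat j) * rho ^ k.
Proof.
  assert (H : (exists k : nat, forall rho : R, (0 < rho < 1)%R -> momS rho (- Z.of_nat j) = avg4 (- Z.of_nat j) * rho ^ k) /\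
    (exists k : nat, forall rho : R, (0 < rho < 1)%R -> momS rho (- Z.of_nat (S j)) = avg4 (- Z.of_nat (S j)) * rho ^ k)).
  { induction j as [|j [[k IH] IH']].
    - split; exists O; intros rho Hr; simpl Z.opp.
      + rewrite momS_rec, momS_pos, avg4_0 by (auto; lia); unfold delta; simpl; ring.
      + rewrite momS_rec, momS_pos, avg4_1 by (auto; lia); unfold delta; simpl; ring.
    - split; [exact IH'|]; exists (S k); intros rho Hr.
      rewrite momS_rec, avg4_step by assumption.
      replace (- Z.of_nat (S (S j)) + 2)%Z with (- Z.of_nat j)%Z by lia; rewrite IH by assumption.
      unfold delta; destruct (Z.eq_dec _ 0); [lia|]; simpl; ring. }
  exact (proj1 H).
Qed.

Definition poisson (rho : R) (t : C) : C := (1 - rho * rho) * (kerS rho t * kerS rho (- t)).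

Lemma poisson_cont (rho : R) : (0 < rho < 1)%R -> cont01 (fun t => poisson rho t).
Proof.
  intros Hr; apply cont01_mult; [apply cont01_const|]; apply cont01_mult; [now apply kerS_cont|now apply kerS_opp_cont].
Qed.

Lemma poisson_split (rho t : R) : (0 < rho < 1)%R -> poisson rho t = kerS rho t + kerS rho (- t) - 1.
Proof.
  intros Hr; unfold poisson, kerS; assert (N1 := kerS_den_neq_0 rho t Hr); assert (N2 := kerS_den_neq_0 rho (- t) Hr).
  rewrite RtoC_opp in N2; replace (2 * - t) with (- (2 * t)) in * by ring.
  rewrite e2pi_opp in *; assert (Hz := e2pi_neq_0 (2 * t)); revert Hz N1 N2; generalize (e2pi (2 * t)); intros z Hz N1 N2.
  assert (N3 : z + rho <> 0) by (intros E; apply N2; replace (1 + rho * / z) with ((z + rho) / z) by (field; auto); rewrite E; field; auto).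
  field; auto.
Qed.

Lemma poisson_moment (m : Z) : exists k : nat, forall rho : R, (0 < rho < 1)%R ->
  CI (fun t => poisson rho t * e2pi (IZR m * t)) = avg4 m * rho ^ k.
Proof.
  destruct (momS_neg (Z.abs_nat m)) as [k Hk]; exists k; intros rho Hr; specialize (Hk rho Hr).
  rewrite Nat2Z.inj_abs_nat in Hk.
  assert (E : CI (fun t => poisson rho t * e2pi (IZR m * t)) = momS rho m + momS rho (- m) - delta m).
  { transitivity (CI (fun t => e2pi (IZR m * t) * kerS rho t + e2pi (IZR m * t) * kerS rho (- t)%C - e2pi (IZR m * t))).
    - apply CI_ext; intros t _; rewrite poisson_split by assumption; ring.
    - assert (C1 := cont01_mult _ _ (cont01_e2pi_IZR m) (kerS_cont rho Hr)).
      assert (C2 := cont01_mult _ _ (cont01_e2pi_IZR m) (kerS_opp_cont rho Hr)).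
      rewrite CI_minus, CI_plus, CI_e2pi_delta by (try apply cont01_plus; auto using cont01_e2pi_IZR).
      f_equal; f_equal; unfold momS.
      rewrite <- (CI_reflect (fun t => e2pi (IZR (- m) * t) * kerS rho t)) by (apply cont01_mult; [apply cont01_e2pi_IZR|now apply kerS_cont]).
      apply CI_ext; intros t _; rewrite RtoC_minus, opp_IZR, RtoC_opp; unfold kerS.
      replace (- IZR m * (1 - t)) with (IZR m * t + IZR (- m)) by (rewrite opp_IZR, RtoC_opp; ring).
      replace (2 * (1 - t)) with (2 * - t + IZR 2) by ring.
      rewrite !e2pi_plus, !e2pi_IZR, !Cmult_1_r; reflexivity. }
  rewrite E; clear E; destruct (Z_lt_le_dec 0 m) as [Hm|Hm].
  - rewrite (momS_pos rho m), Z.abs_eq in * by (auto; lia); rewrite Hk, avg4_opp; unfold delta; destruct (Z.eq_dec m 0); [lia|ring].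
  - rewrite Z.abs_neq, Z.opp_involutive in Hk by lia; rewrite Hk; unfold delta; destruct (Z.eq_dec m 0) as [->|Hm0].
    + simpl Z.opp; rewrite momS_rec, momS_pos by (auto; lia); unfold delta; simpl.
      rewrite momS_rec, momS_pos in Hk by (auto; lia); unfold delta in Hk; simpl in Hk; rewrite <- Hk; ring.
    + rewrite (momS_pos rho (- m)) by (auto; lia); ring.
Qed.

Lemma poisson_real (rho t : R) : (0 < rho < 1)%R -> exists q : R, (0 <= q)%R /\ poisson rho t = RtoC q.
Proof.
  intros Hr; set (c := cos (2 * PI * (2 * t))).
  assert (Hc := COS_bound (2 * PI * (2 * t))); fold c in Hc.
  assert (Hd : (0 < 1 + 2 * rho * c + rho * rho)%R) by nra.
  exists ((1 - rho * rho) * / (1 + 2 * rho * c + rho * rho))%R; split.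
  - apply Rmult_le_pos; [nra|left; now apply Rinv_0_lt_compat].
  - unfold poisson, kerS; rewrite <- Cinv_mult_total, RtoC_mult, RtoC_inv by lra; rewrite RtoC_minus, RtoC_mult; do 2 f_equal.
    rewrite <- RtoC_opp, <- !RtoC_mult, !e2pi_R; replace (2 * PI * (2 * - t))%R with (- (2 * PI * (2 * t)))%R by ring.
    rewrite cos_neg, sin_neg; fold c; assert (S := sin2_cos2 (2 * PI * (2 * t))); unfold Rsqr in S; fold c in S.
    apply C_eq; simpl; [|ring].
    revert S; generalize (sin (2 * PI * (2 * t))); intros s S.
    transitivity (1 + 2 * rho * c + rho * rho * (s * s + c * c))%R; [ring|rewrite S; ring].
Qed.

Lemma poisson_total (rho : R) : (0 < rho < 1)%R -> CI (fun t => poisson rho t) = 1.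
Proof.
  intros Hr; transitivity (CI (fun t => kerS rho t + kerS rho (- t) - 1)); [apply CI_ext; intros; now apply poisson_split|].
  assert (C1 := kerS_cont rho Hr); assert (C2 := kerS_opp_cont rho Hr).
  assert (E : CI (fun t => kerS rho t) = 1).
  { transitivity (momS rho 0).
    - apply CI_ext; intros t _; rewrite Cmult_0_l, e2pi_0; ring.
    - rewrite momS_rec, momS_pos by (auto; lia); unfold delta; simpl; ring. }
  rewrite CI_minus, CI_plus, CI_const, E by (try apply cont01_plus; auto using cont01_const).
  rewrite <- (CI_reflect (fun t => kerS rho (- t))) by exact C2.
  rewrite (CI_ext _ (fun t => kerS rho t)); [rewrite E; ring|].
  intros t _; unfold kerS; rewrite RtoC_minus; replace (2 * - (1 - t)) with (2 * t + IZR (-2)) by ring.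
  now rewrite e2pi_plus, e2pi_IZR, Cmult_1_r.
Qed.

Lemma poisson_bound (rho M : R) (g : R -> C) : (0 < rho < 1)%R -> cont01 g -> (forall t, (0 <= t <= 1)%R -> (Cmod (g t) <= M)%R) ->
  (Cmod (CI (fun t => poisson rho t * g t)%C) <= 2 * M)%R.
Proof.
  intros Hr Hg HM; assert (Hc := poisson_cont rho Hr).
  replace (2 * M)%R with (2 * RInt (fun t => M * Re (poisson rho t)) 0 1)%R.
  - apply CI_le; [now apply cont01_mult| |].
    + apply (ex_RInt_scal (V := R_NormedModule)), cont01_ex_Re, Hc.
    + intros t Ht; rewrite Cmod_mult; destruct (poisson_real rho t Hr) as [q [Hq ->]].
      rewrite Cmod_R, Rabs_pos_eq, Rmult_comm by assumption; apply Rmult_le_compat_r; [exact Hq|auto].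
  - f_equal; apply is_RInt_unique.
    assert (E : RInt (fun t => Re (poisson rho t)) 0 1 = 1%R).
    { change (Re (CI (fun t => poisson rho t)) = 1%R); now rewrite poisson_total. }
    assert (HI : is_RInt (fun t => M * Re (poisson rho t))%R 0 1 (M * RInt (fun t => Re (poisson rho t)) 0 1)%R).
    { apply (is_RInt_scal (V := R_NormedModule)), (RInt_correct (V := R_CompleteNormedModule)), cont01_ex_Re, Hc. }
    rewrite E, Rmult_1_r in HI; exact HI.
Qed.

(* The points of the upper imaginary axis along which the parameters degenerate. *)
Definition zeta (e0 : R) (n : nat) : C := (0, e0 * / INR (S n))%R.

Definition rho_ (e0 : R) (n : nat) : R := exp (- (2 * PI * (2 * (e0 * / INR (S n))))).

Lemma rho_e2pi (e0 : R) (n : nat) : RtoC (rho_ e0 n) = e2pi (2 * zeta e0 n).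
Proof.
  unfold rho_, zeta, e2pi, Cexp; set (x := (e0 * / INR (S n))%R).
  replace (Re (2 * PI * Ci * (2 * (0, x)%R))) with (- (2 * PI * (2 * x)))%R by (unfold Re; simpl; ring).
  replace (Im (2 * PI * Ci * (2 * (0, x)%R))) with 0%R by (unfold Im; simpl; ring).
  rewrite cos_0, sin_0; apply C_eq; simpl; ring.
Qed.

Lemma zeta_bounds (e0 : R) (n : nat) : (0 < e0)%R -> (0 < Im (zeta e0 n) <= e0)%R.
Proof.
  intros He; change (0 < e0 * / INR (S n) <= e0)%R; assert (Hn : (1 <= INR (S n))%R) by (rewrite S_INR; generalize (pos_INR n); lra).
  assert (0 < / INR (S n) <= 1)%R.
  { split; [apply Rinv_0_lt_compat; lra|]; rewrite <- Rinv_1; apply Rinv_le_contravar; lra. }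
  nra.
Qed.

Lemma zeta_strip (e0 : R) (n : nat) (s : C) : (0 < e0)%R -> Im s = 0%R -> strip 0 e0 0 0 (zeta e0 n, s).
Proof. intros He Hs; assert (Hz := zeta_bounds e0 n He); split; cbn [fst snd]; lra. Qed.

Lemma rho_bounds (e0 : R) (n : nat) : (0 < e0)%R -> (0 < rho_ e0 n < 1)%R.
Proof.
  intros He; split; [apply exp_pos|]; unfold rho_; apply Rlt_le_trans with (exp 0); [|rewrite exp_0; lra]; apply exp_increasing.
  assert (H := zeta_bounds e0 n He); change (0 < e0 * / INR (S n) <= e0)%R in H.
  assert (0 < PI * (e0 * / INR (S n)))%R by (apply Rmult_lt_0_compat; [apply PI_RGT_0|lra]); lra.
Qed.

Lemma e2pi_zeta_cvg (e0 : R) (k : C) : Ccvg (fun n => e2pi (k * zeta e0 n)) 1.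
Proof.
  set (L := (Cmod (2 * PI * Ci * (k * Ci)) * Rabs e0)%R).
  assert (HL : forall n, Cmod (2 * PI * Ci * (k * zeta e0 n)) = (L * / INR (S n))%R).
  { intros n; replace (zeta e0 n) with (Ci * (RtoC e0 * RtoC (/ INR (S n)))) by (unfold zeta; apply C_eq; simpl; ring).
    replace (2 * PI * Ci * (k * (Ci * (e0 * RtoC (/ INR (S n)))))) with ((2 * PI * Ci * (k * Ci)) * (e0 * RtoC (/ INR (S n)))) by ring.
    rewrite Cmod_mult, (Cmod_mult (RtoC e0)), !Cmod_R; unfold L; rewrite (Rabs_pos_eq (/ INR (S n))); [ring|].
    left; apply Rinv_0_lt_compat, lt_0_INR; lia. }
  assert (HL0 : (0 <= L)%R) by (apply Rmult_le_pos; [apply Cmod_ge_0|apply Rabs_pos]).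
  destruct (INR_archimed 1 L ltac:(lra)) as [n0 Hn0]; rewrite Rmult_1_r in Hn0.
  assert (Lim : is_lim_seq (fun n => 2 * exp 1 * L * / INR (S n))%R 0%R).
  { replace (Finite 0) with (Rbar_mult (2 * exp 1 * L)%R 0%R) by (simpl; f_equal; ring).
    apply is_lim_seq_scal_l; apply (is_lim_seq_incr_1 (fun n => / INR n)%R).
    replace (Finite 0) with (Rbar_inv p_infty) by reflexivity; apply is_lim_seq_inv; [apply is_lim_seq_INR|discriminate]. }
  apply Ccvg_eps; intros eps He; apply is_lim_seq_spec in Lim; destruct (Lim (mkposreal eps He)) as [N HN].
  exists (Nat.max n0 N); intros n Hn; specialize (HN n ltac:(lia)); simpl in HN; rewrite Rminus_0_r in HN.
  assert (HS : (L <= INR (S n))%R) by (apply Rle_trans with (INR n0); [lra|apply le_INR; lia]).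
  assert (Hp : (0 < INR (S n))%R) by (apply lt_0_INR; lia).
  unfold e2pi; eapply Rle_lt_trans; [apply Cexp_minus_1_bound|].
  - rewrite HL; apply Rmult_le_reg_r with (INR (S n)); [exact Hp|]; rewrite Rmult_assoc, Rinv_l; lra.
  - rewrite HL; rewrite <- Rmult_assoc; eapply Rle_lt_trans; [apply Rle_abs|exact HN].
Qed.

Lemma rho_cvg (e0 : R) : Ccvg (fun n => RtoC (rho_ e0 n)) 1.
Proof. apply Ccvg_ext with (fun n => e2pi (2 * zeta e0 n)); [intros; now rewrite rho_e2pi|apply e2pi_zeta_cvg]. Qed.

Lemma Cpow_1_base (k : nat) : RtoC 1 ^ k = 1.
Proof. induction k as [|k IH]; simpl; [reflexivity|rewrite IH; ring]. Qed.

Lemma Ccvg_pow (s : nat -> C) (l : C) (k : nat) : Ccvg s l -> Ccvg (fun n => s n ^ k) (l ^ k).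
Proof. intros H; induction k; simpl; [apply Ccvg_const|now apply Ccvg_mult]. Qed.

Definition avgf (f : C * C -> C) : C := (f (RtoC 0, RtoC (1 / 4)) + f (RtoC 0, RtoC (- (1 / 4)))) / 2.

Lemma trig_poisson (e0 : R) (f : C * C -> C) : (0 < e0)%R -> trig f ->
  Ccvg (fun n => CI (fun t => poisson (rho_ e0 n) t * f (zeta e0 n, RtoC t))) (avgf f).
Proof.
  intros He [l Hl].
  assert (H : Ccvg (fun n => CI (fun t => poisson (rho_ e0 n) t * teval l (zeta e0 n, RtoC t))) (avgf (teval l))).
  { clear Hl; induction l as [|[[c k] m] l IH].
    - apply Ccvg_ext with (fun _ => 0).
      + intros n; rewrite (CI_ext _ (fun _ => 0)) by (intros; simpl; ring); now rewrite CI_const.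
      + unfold avgf; simpl; replace ((0 + 0) / 2) with (RtoC 0) by field; apply Ccvg_const.
    - destruct (poisson_moment m) as [j Hj].
      apply Ccvg_ext with (fun n => c * e2pi (IZR k * zeta e0 n) * (avg4 m * rho_ e0 n ^ j) +
         CI (fun t => poisson (rho_ e0 n) t * teval l (zeta e0 n, RtoC t))).
      + intros n; assert (Hr := rho_bounds e0 n He); rewrite <- (Hj _ Hr).
        assert (Hp := poisson_cont _ Hr).
        assert (Ht : cont01 (fun t => teval l (zeta e0 n, RtoC t))).
        { assert (T := trig_cont01 (teval l) (zeta e0 n) 0 0 1 (ex_intro _ l (fun _ => eq_refl))).
          eapply cont01_ext; [|exact T]; intros t _; cbv beta; replace (zeta e0 n + 0 * t) with (zeta e0 n) by ring; replace (0 + 1 * t) with (RtoC t) by ring; reflexivity. }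
        assert (C1 := cont01_mult _ _ Hp (cont01_e2pi_IZR m)); assert (C2 := cont01_mult _ _ Hp Ht).
        rewrite <- CI_scal, <- CI_plus; [|apply cont01_mult; [apply cont01_const|exact C1]|exact C2|exact C1].
        apply CI_ext; intros t _; simpl teval; simpl fst; simpl snd; rewrite (e2pi_plus (IZR k * _)); ring.
      + replace (avgf (teval ((c, k, m) :: l))) with (c * 1 * (avg4 m * 1 ^ j) + avgf (teval l)).
        * apply Ccvg_plus; [|exact IH]; apply Ccvg_mult; [apply Ccvg_mult; [apply Ccvg_const|apply e2pi_zeta_cvg]|].
          apply Ccvg_mult; [apply Ccvg_const|apply Ccvg_pow, rho_cvg].
        * unfold avgf, avg4; simpl teval; simpl fst; simpl snd; rewrite !Cmult_0_r, !Cplus_0_l.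
          rewrite Cpow_1_base; field. }
  replace (avgf f) with (avgf (teval l)) by (unfold avgf; now rewrite !Hl).
  eapply Ccvg_ext; [|exact H]; intros n; apply CI_ext; intros; now rewrite Hl.
Qed.

Lemma uapp_poisson (e0 : R) (f : C * C -> C) : (0 < e0)%R -> uapp trig (strip 0 e0 0 0) f ->
  Ccvg (fun n => CI (fun t => poisson (rho_ e0 n) t * f (zeta e0 n, RtoC t))) (avgf f).
Proof.
  intros He Hf; apply Ccvg_eps; intros eps Heps; destruct (Hf (eps / 6)%R ltac:(lra)) as [P [HP HPf]].
  assert (HL := trig_poisson e0 P He HP); rewrite Ccvg_eps in HL; destruct (HL (eps / 3)%R ltac:(lra)) as [N HN].
  exists N; intros n Hn; specialize (HN n Hn).
  assert (Hr := rho_bounds e0 n He); assert (Hp := poisson_cont _ Hr); assert (Hz := zeta_bounds e0 n He).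
  assert (HS : forall t : R, strip 0 e0 0 0 (zeta e0 n, RtoC t)) by (intros t; now apply zeta_strip).
  assert (Hcf : forall g, uapp trig (strip 0 e0 0 0) g -> cont01 (fun t => g (zeta e0 n, RtoC t))).
  { intros g Hg; apply (uapp_trig_cont01 _ _ (zeta e0 n) 0 0 1) in Hg.
    - eapply cont01_ext; [|exact Hg]; intros t _; cbv beta; replace (zeta e0 n + 0 * t) with (zeta e0 n) by ring; replace (0 + 1 * t) with (RtoC t) by ring; reflexivity.
    - intros t _; replace (zeta e0 n + 0 * t) with (zeta e0 n) by ring; replace (0 + 1 * t) with (RtoC t) by ring; apply HS. }
  assert (Cf := Hcf f Hf); assert (CP := Hcf P (uapp_in _ _ _ HP)).
  assert (D1 : (Cmod (CI (fun t => poisson (rho_ e0 n) t * f (zeta e0 n, RtoC t))%C - CI (fun t => poisson (rho_ e0 n) t * P (zeta e0 n, RtoC t))%C) <= 2 * (eps / 6))%R).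
  { rewrite <- CI_minus by (apply cont01_mult; assumption).
    rewrite (CI_ext _ (fun t => poisson (rho_ e0 n) t * (f (zeta e0 n, RtoC t) + - (1) * P (zeta e0 n, RtoC t)))) by (intros; ring).
    apply poisson_bound; [exact Hr|apply cont01_plus; [exact Cf|apply cont01_mult; [apply cont01_const|exact CP]]|].
    intros t _; replace (f (zeta e0 n, RtoC t) + - (1) * P (zeta e0 n, RtoC t)) with (f (zeta e0 n, RtoC t) - P (zeta e0 n, RtoC t)) by ring.
    apply HPf, HS. }
  assert (D2 : (Cmod (avgf P - avgf f) <= eps / 6)%R).
  { assert (A1 := HPf (RtoC 0, RtoC (1 / 4)) ltac:(split; simpl; lra)); assert (A2 := HPf (RtoC 0, RtoC (- (1 / 4))) ltac:(split; simpl; lra)).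
    rewrite Cmod_sub_sym in A1, A2.
    unfold avgf; revert A1 A2; generalize (f (RtoC 0, RtoC (1 / 4))) (f (RtoC 0, RtoC (- (1 / 4)))) (P (RtoC 0, RtoC (1 / 4))) (P (RtoC 0, RtoC (- (1 / 4)))).
    intros f1 f2 p1 p2 A1 A2; replace ((p1 + p2) / 2 - (f1 + f2) / 2) with (RtoC (/ 2) * ((p1 - f1) + (p2 - f2))) by (rewrite RtoC_inv by lra; field).
    rewrite Cmod_mult, Cmod_R, Rabs_pos_eq by lra; generalize (Cmod_triangle (p1 - f1) (p2 - f2)); lra. }
  eapply Rle_lt_trans; [apply (Cmod_dist _ (CI (fun t => poisson (rho_ e0 n) t * P (zeta e0 n, RtoC t))))|].
  eapply Rle_lt_trans; [apply Rplus_le_compat_l, (Cmod_dist _ (avgf P))|]; lra.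
Qed.

Lemma uapp_zeta_cvg (e0 : R) (f : C * C -> C) (s : C) : (0 < e0)%R -> Im s = 0%R -> uapp trig (strip 0 e0 0 0) f ->
  Ccvg (fun n => f (zeta e0 n, s)) (f (RtoC 0, s)).
Proof.
  intros He Hs Hf; apply Ccvg_eps; intros eps Heps; destruct (Hf (eps / 3)%R ltac:(lra)) as [P [[l Hl] HPf]].
  assert (HL : Ccvg (fun n => P (zeta e0 n, s)) (P (RtoC 0, s))).
  { rewrite Hl; apply Ccvg_ext with (fun n => teval l (zeta e0 n, s)); [intros; now rewrite Hl|]; clear.
    induction l as [|[[c k] m] l IH]; simpl teval; [apply Ccvg_const|]; apply Ccvg_plus; [|exact IH].
    apply Ccvg_mult; [apply Ccvg_const|]; simpl fst; simpl snd; rewrite Cmult_0_r, e2pi_plus, e2pi_0.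
    apply Ccvg_ext with (fun n => e2pi (IZR k * zeta e0 n) * e2pi (IZR m * s)); [intros; now rewrite e2pi_plus|].
    apply Ccvg_mult; [apply e2pi_zeta_cvg|apply Ccvg_const]. }
  rewrite Ccvg_eps in HL; destruct (HL (eps / 3)%R ltac:(lra)) as [N HN]; exists N; intros n Hn; specialize (HN n Hn).
  assert (Hz := zeta_bounds e0 n He).
  assert (A1 := HPf (zeta e0 n, s) (zeta_strip e0 n s He Hs)); assert (A2 := HPf (RtoC 0, s) ltac:(split; simpl; lra)).
  rewrite Cmod_sub_sym in A2.
  eapply Rle_lt_trans; [apply (Cmod_dist _ (P (zeta e0 n, s)))|].
  eapply Rle_lt_trans; [apply Rplus_le_compat_l, (Cmod_dist _ (P (RtoC 0, s)))|]; lra.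
Qed.

(** * The value of the elliptic beta integral *)

(* [eg] without its pole at [u = 0]. *)
Definition egr (a b u : C) : C :=
  dpoch (e2pi (a + b - u)) (e2pi a) (e2pi b) *
  (/ dpoch (e2pi (u + b)) 0 (e2pi b) * / dpoch (e2pi (u + a)) 0 (e2pi a) * / dpoch (e2pi (u + a + b)) (e2pi a) (e2pi b)).

Lemma dpoch_qpoch (z y : C) : (Cmod y < 1)%R -> dpoch z 0 y = qpoch z y.
Proof.
  intros Hy; rewrite dpoch_step by (rewrite ?Cmod_0; lra); rewrite Cmult_0_r, dpoch_0; ring.
Qed.

Lemma eg_factor (a b u : C) : (0 < Im a)%R -> (0 < Im b)%R -> eg a b u = / (1 - e2pi u) * egr a b u.
Proof.
  intros Ha Hb; assert (Hx := Cmod_e2pi_lt_1 a Ha); assert (Hy := Cmod_e2pi_lt_1 b Hb).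
  unfold eg, egamma, egr; rewrite e2pi_mul_div, !dpoch_qpoch by assumption.
  unfold Cdiv; rewrite (dpoch_step (e2pi u)) by assumption.
  rewrite (qpoch_step (e2pi u)), (dpoch_sym (e2pi u * e2pi a)), (dpoch_step (e2pi u * e2pi a)) by assumption.
  rewrite (dpoch_sym (e2pi u * e2pi a * e2pi b)), <- !e2pi_plus by assumption; rewrite !Cinv_mult_total; ring.
Qed.

Lemma uapp_egr (c d : R) (a b : C) (L : C * C -> C) : (0 < Im a)%R -> (0 < Im b)%R -> aff L ->
  (forall x, strip c d 0 0 x -> (0 <= Im (L x))%R) -> uapp trig (strip c d 0 0) (fun x => egr a b (L x)).
Proof.
  intros Ha Hb HL H0; assert (HA := trig_alg c d 0 0).
  assert (Hx := Cmod_e2pi_lt_1 a Ha); assert (Hy := Cmod_e2pi_lt_1 b Hb).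
  destruct (two_bounds _ _ Hx Hy) as [r [Hr [H1 H2]]].
  assert (Hle : forall v u, (Im v <= Im u)%R -> (Cmod (e2pi u) <= Cmod (e2pi v))%R) by (intros v u H; rewrite (Cmod_e2pi v); now apply Cmod_e2pi_le).
  assert (Hinv : forall v p p', (0 < Im v)%R -> (Cmod p <= r)%R -> (Cmod p' <= r)%R -> uapp trig (strip c d 0 0) (fun x => / dpoch (e2pi (L x + v)) p p')).
  { intros v p p' Hv Hp Hp'; apply uapp_dpoch_inv with (Cmod (e2pi v)) r; auto using uapp_const.
    - split; [apply Cmod_ge_0|now apply Cmod_e2pi_lt_1].
    - apply (uapp_e2pi_aff _ _ _ _ (fun x => L x + v)); aff_tac; exact HL.
    - intros x Hs; apply Hle; specialize (H0 x Hs); change (Im v <= Im (L x) + Im v)%R; lra. }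
  unfold egr; apply uapp_mult; [exact HA| |apply uapp_mult; [exact HA|apply uapp_mult; [exact HA| |]|]].
  - apply uapp_dpoch with r; auto using uapp_const.
    apply (uapp_e2pi_aff _ _ _ _ (fun x => a + b - L x)); aff_tac; exact HL.
  - apply Hinv; auto; rewrite Cmod_0; lra.
  - apply Hinv; auto; rewrite Cmod_0; lra.
  - apply uapp_ext with (fun x => / dpoch (e2pi (L x + (a + b))) (e2pi a) (e2pi b)); [intros; now rewrite Cplus_assoc|].
    apply Hinv; auto; change (0 < Im a + Im b)%R; lra.
Qed.

Lemma eg_neq_0 (a b u : C) : (0 < Im a)%R -> (0 < Im b)%R -> (0 < Im u < Im a + Im b)%R -> eg a b u <> 0.
Proof.
  intros Ha Hb Hu; unfold eg, egamma; rewrite e2pi_mul_div; unfold Cdiv.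
  apply Cmult_neq_0; [|apply Cinv_neq_0_C]; apply dpoch_neq_0_small; auto using Cmod_e2pi_lt_1; [|apply Cmod_e2pi_lt_1; lra].
  apply Cmod_e2pi_lt_1; unfold Im in *; simpl; lra.
Qed.

Lemma egr_two_torsion (a b u : C) : (0 < Im a)%R -> (0 < Im b)%R -> e2pi (2 * u) = 1 ->
  egr a b u = / qpoch (e2pi u * e2pi b) (e2pi b) * / qpoch (e2pi u * e2pi a) (e2pi a).
Proof.
  intros Ha Hb Hu; assert (Hx := Cmod_e2pi_lt_1 a Ha); assert (Hy := Cmod_e2pi_lt_1 b Hb).
  unfold egr; rewrite !dpoch_qpoch by assumption.
  assert (E : e2pi (u + a + b) = e2pi (a + b - u)).
  { replace (u + a + b) with (a + b - u + 2 * u) by ring; rewrite e2pi_plus, Hu; ring. }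
  assert (N : dpoch (e2pi (a + b - u)) (e2pi a) (e2pi b) <> 0).
  { apply dpoch_neq_0_small; auto; apply Cmod_e2pi_lt_1.
    assert (Iu : Im u = 0%R).
    { assert (E1 : Cmod (e2pi (2 * u)) = 1%R) by (rewrite Hu; apply Cmod_1).
      rewrite Cmod_e2pi in E1; rewrite <- exp_0 in E1; apply exp_inv in E1.
      replace (Im (2 * u)) with (2 * Im u)%R in E1 by (unfold Im; simpl; ring).
      assert (E2 : (PI * Im u = 0)%R) by lra; apply Rmult_integral in E2; generalize PI_RGT_0; lra. }
    unfold Im in *; simpl; lra. }
  rewrite E, <- !e2pi_plus.
  transitivity (/ qpoch (e2pi (u + b)) (e2pi b) * / qpoch (e2pi (u + a)) (e2pi a) *
    (dpoch (e2pi (a + b - u)) (e2pi a) (e2pi b) * / dpoch (e2pi (a + b - u)) (e2pi a) (e2pi b))); [ring|].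
  rewrite Cinv_r by exact N; ring.
Qed.

Notation q4 := (RtoC (1 / 4)).

Lemma e2pi_q4 (u : C) : (1 - e2pi (q4 + u)) * (1 - e2pi (- q4 + u)) = 1 + e2pi (2 * u).
Proof.
  assert (E1 : e2pi q4 = Ci).
  { rewrite e2pi_R; replace (2 * PI * (1 / 4))%R with (PI / 2)%R by field; rewrite cos_PI2, sin_PI2; reflexivity. }
  replace (2 * u) with (u + u) by ring; rewrite !e2pi_plus, e2pi_opp, E1; generalize (e2pi u); intros z.
  replace (/ Ci) with (- Ci) by (rewrite <- (Cmult_1_l (/ Ci)); replace (RtoC 1) with (- (Ci * Ci)) by (apply C_eq; simpl; ring);
    field; intros E; apply (f_equal Im) in E; simpl in E; lra).
  replace ((1 - Ci * z) * (1 - - Ci * z)) with (1 - (Ci * Ci) * (z * z)) by ring.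
  replace (Ci * Ci) with (- (1)) by (apply C_eq; simpl; ring); ring.
Qed.

Section value.
Variables a b a2 a3 a4 : C.
Variable e0 : R.
Hypotheses (Ha : (0 < Im a)%R) (Hb : (0 < Im b)%R) (He : (0 < e0)%R) (He6 : (6 * e0 <= Im a + Im b)%R)
  (E2 : Im a2 = e0) (E3 : Im a3 = e0) (E4 : Im a4 = e0).

(* The integrand at [a0 = 1/4 + fst x], [a1 = - 1/4 + fst x] and integration variable
   [snd x], without the factor that becomes a Poisson kernel; likewise [hnv] for [Nv]. *)
Definition hreg (x : C * C) : C :=
  egr a b (q4 + fst x + snd x) * egr a b (q4 + fst x - snd x) * (egr a b (- q4 + fst x + snd x) * egr a b (- q4 + fst x - snd x)) *
  (eg a b (a2 + snd x) * eg a b (a2 - snd x)) * (eg a b (a3 + snd x) * eg a b (a3 - snd x)) * (eg a b (a4 + snd x) * eg a b (a4 - snd x)) *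
  (th b (2 * snd x) * th a (- (2 * snd x))) *
  (/ eg a b (2 * fst x + (a2 + a3 + a4) + snd x) * / eg a b (2 * fst x + (a2 + a3 + a4) - snd x)).

Definition hnv (x : C * C) : C :=
  / eg a b (q4 + fst x + a2) * / eg a b (q4 + fst x + a3) * / eg a b (q4 + fst x + a4) *
  (/ eg a b (- q4 + fst x + a2) * / eg a b (- q4 + fst x + a3) * / eg a b (- q4 + fst x + a4)) *
  (/ eg a b (a2 + a3) * / eg a b (a2 + a4) * / eg a b (a3 + a4)) *
  (eg a b (- q4 + fst x + (a2 + a3 + a4)) * eg a b (q4 + fst x + (a2 + a3 + a4)) *
  (eg a b (2 * fst x + (a3 + a4)) * eg a b (2 * fst x + (a2 + a4)) * eg a b (2 * fst x + (a2 + a3)))).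

Lemma uapp_hreg : uapp trig (strip 0 e0 0 0) hreg.
Proof.
  assert (R : forall L, aff L -> (forall x, strip 0 e0 0 0 x -> (0 <= Im (L x))%R) -> uapp trig (strip 0 e0 0 0) (fun x => egr a b (L x)))
    by (intros; now apply uapp_egr).
  assert (HT := trig_alg 0 e0 0 0).
  assert (P1 := R (fun x => q4 + fst x + snd x) ltac:(aff_tac) ltac:(intros; im_tac)).
  assert (P2 := R (fun x => q4 + fst x - snd x) ltac:(aff_tac) ltac:(intros; im_tac)).
  assert (P3 := R (fun x => - q4 + fst x + snd x) ltac:(aff_tac) ltac:(intros; im_tac)).
  assert (P4 := R (fun x => - q4 + fst x - snd x) ltac:(aff_tac) ltac:(intros; im_tac)).
  assert (PP := uapp_mult _ _ _ _ HT (uapp_mult _ _ _ _ HT P1 P2) (uapp_mult _ _ _ _ HT P3 P4)).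
  unfold hreg.
  apply (uapp_ext _ _ (fun x =>
    (egr a b (q4 + fst x + snd x) * egr a b (q4 + fst x - snd x) * (egr a b (- q4 + fst x + snd x) * egr a b (- q4 + fst x - snd x))) *
    ((eg a b (a2 + snd x) * eg a b (a2 - snd x)) * (eg a b (a3 + snd x) * eg a b (a3 - snd x)) * (eg a b (a4 + snd x) * eg a b (a4 - snd x)) *
    (th b (2 * snd x) * th a (- (2 * snd x))) *
    (/ eg a b (2 * fst x + (a2 + a3 + a4) + snd x) * / eg a b (2 * fst x + (a2 + a3 + a4) - snd x))))); [intros; ring|].
  apply uapp_mult; [exact HT|exact PP|]; clear R P1 P2 P3 P4 PP.
  uprod; try exact He; cbv beta; im_tac.
Qed.

Lemma uapp_hnv : uapp trig (strip 0 e0 0 0) hnv.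
Proof. unfold hnv; uprod; try exact He; cbv beta; im_tac. Qed.

Lemma Beta_zeta (n : nat) (K : C) : (forall c0 c1 c2 c3 c4, balanced a b c0 c1 c2 c3 c4 -> Beta a b c0 c1 c2 c3 c4 = K) ->
  K = CI (fun t => poisson (rho_ e0 n) t * hreg (zeta e0 n, RtoC t)) *
    (/ (1 + rho_ e0 n) * / egr a b (2 * zeta e0 n) * hnv (zeta e0 n, RtoC 0)).
Proof.
  intros HK; assert (Hz := zeta_bounds e0 n He); assert (Hr := rho_bounds e0 n He); assert (Hrz := rho_e2pi e0 n).
  set (rho := rho_ e0 n) in *; set (z := zeta e0 n) in *.
  rewrite <- (HK (q4 + z) (- q4 + z) a2 a3 a4); [|unfold balanced; im_tac].
  clear HK; unfold Beta, EB.
  assert (HA : q4 + z + (- q4 + z) + a2 + a3 + a4 = 2 * z + (a2 + a3 + a4)) by ring.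
  assert (E1 : CI (fun t => poisson rho t * hreg (z, RtoC t)) = (1 - rho * rho) * EI a b (- q4 + z) a2 a3 a4 (q4 + z)).
  { unfold EI; rewrite <- CI_scal.
    - apply CI_ext; intros t _; rewrite HA; unfold W, hreg, poisson; cbn [fst snd].
      rewrite (eg_factor a b (q4 + z + t)), (eg_factor a b (q4 + z - t)), (eg_factor a b (- q4 + z + t)), (eg_factor a b (- q4 + z - t)) by assumption.
      replace (kerS rho t) with (/ (1 - e2pi (q4 + z + t)) * / (1 - e2pi (- q4 + z + t))).
      2: { rewrite <- Cinv_mult_total, <- !Cplus_assoc, e2pi_q4; unfold kerS; rewrite Hrz, <- e2pi_plus; do 3 f_equal; ring. }
      replace (kerS rho (- t)) with (/ (1 - e2pi (q4 + z - t)) * / (1 - e2pi (- q4 + z - t))).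
      2: { unfold Cminus at 2 4; rewrite <- Cinv_mult_total, <- !Cplus_assoc, e2pi_q4; unfold kerS; rewrite Hrz, <- e2pi_plus; do 3 f_equal; ring. }
      ring.
    - apply W_cont; auto; im_tac. }
  rewrite E1; unfold Nv, hnv; cbn [fst snd]; rewrite !HA.
  replace (q4 + z + (- q4 + z)) with (2 * z) by ring.
  rewrite (eg_factor a b (2 * z)) by assumption; rewrite <- Hrz.
  replace (2 * z + (a2 + a3 + a4) - (q4 + z)) with (- q4 + z + (a2 + a3 + a4)) by ring.
  replace (2 * z + (a2 + a3 + a4) - (- q4 + z)) with (q4 + z + (a2 + a3 + a4)) by ring.
  replace (2 * z + (a2 + a3 + a4) - a2) with (2 * z + (a3 + a4)) by ring.
  replace (2 * z + (a2 + a3 + a4) - a3) with (2 * z + (a2 + a4)) by ring.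
  replace (2 * z + (a2 + a3 + a4) - a4) with (2 * z + (a2 + a3)) by ring.
  rewrite Cinv_mult_total, Cinv_inv_total.
  assert (Nr : 1 + RtoC rho <> 0) by (intros E; apply (f_equal Re) in E; simpl in E; lra).
  assert (E5 : (1 - rho * rho) * / (1 + rho) = 1 - rho) by (field; exact Nr).
  rewrite <- E5; ring.
Qed.

Lemma Beta_limit (K : C) : (forall c0 c1 c2 c3 c4, balanced a b c0 c1 c2 c3 c4 -> Beta a b c0 c1 c2 c3 c4 = K) ->
  K = avgf hreg * (/ 2 * / egr a b 0 * hnv (RtoC 0, RtoC 0)).
Proof.
  intros HK; apply (Ccvg_unique (fun _ => K)); [apply Ccvg_const|].
  eapply Ccvg_ext; [intros n; symmetry; apply (Beta_zeta n K HK)|].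
  apply Ccvg_mult; [apply uapp_poisson; [exact He|apply uapp_hreg]|].
  apply Ccvg_mult; [apply Ccvg_mult|apply uapp_zeta_cvg; [exact He|reflexivity|apply uapp_hnv]].
  - apply Ccvg_inv; [intros E; apply (f_equal Re) in E; simpl in E; lra|].
    replace (RtoC 2) with (1 + 1) by (apply C_eq; simpl; ring); apply Ccvg_plus; [apply Ccvg_const|apply rho_cvg].
  - apply Ccvg_inv.
    + rewrite egr_two_torsion; auto; [|rewrite Cmult_0_r; apply e2pi_0]; rewrite e2pi_0, !Cmult_1_l.
      apply Cmult_neq_0; apply Cinv_neq_0_C, qpoch_neq_0_small; now apply Cmod_e2pi_lt_1.
    + replace (RtoC 0) with (2 * RtoC 0) at 1 by ring.
      apply (uapp_zeta_cvg e0 (fun x => egr a b (2 * fst x)) 0); [exact He|reflexivity|].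
      apply uapp_egr; auto; [aff_tac|intros; im_tac].
Qed.

Lemma th_half (c : C) : (0 < Im c)%R -> th c (1 / 2) = 2 * (qpoch (- e2pi c) (e2pi c) * qpoch (- e2pi c) (e2pi c)) /\ th c (- (1 / 2)) = th c (1 / 2).
Proof.
  intros Hc; assert (Hx := Cmod_e2pi_lt_1 c Hc).
  assert (E : 1 / 2 = / 2) by field; rewrite E; split.
  - unfold th, theta; rewrite e2pi_half, qpoch_step by assumption.
    replace (e2pi c / - (1)) with (- e2pi c) by (field; intros H; apply (f_equal Re) in H; simpl in H; lra).
    replace (- (1) * e2pi c) with (- e2pi c) by ring; ring.
  - rewrite th_opp by assumption; rewrite e2pi_opp_half; ring.
Qed.

Lemma Beta_limit_value : avgf hreg * (/ 2 * / egr a b 0 * hnv (RtoC 0, RtoC 0)) =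
  2 * (/ qpoch (e2pi a) (e2pi a) * / qpoch (e2pi b) (e2pi b)).
Proof.
  assert (Hx := Cmod_e2pi_lt_1 a Ha); assert (Hy := Cmod_e2pi_lt_1 b Hb).
  set (s := a2 + a3 + a4).
  assert (Is : Im s = (3 * e0)%R) by (unfold s, Im in *; simpl; lra).
  assert (N : forall u, (0 < Im u <= 3 * e0)%R -> eg a b u <> 0) by (intros u Hu; apply eg_neq_0; auto; lra).
  destruct (th_half a Ha) as [Ta Ta']; destruct (th_half b Hb) as [Tb Tb'].
  set (Qa := qpoch (- e2pi a) (e2pi a)) in *; set (Qb := qpoch (- e2pi b) (e2pi b)) in *.
  set (Pa := qpoch (e2pi a) (e2pi a)); set (Pb := qpoch (e2pi b) (e2pi b)).
  assert (NQa : Qa <> 0) by (apply qpoch_neq_0_small; rewrite ?Cmod_opp; exact Hx).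
  assert (NQb : Qb <> 0) by (apply qpoch_neq_0_small; rewrite ?Cmod_opp; exact Hy).
  assert (NPa : Pa <> 0) by (now apply qpoch_neq_0_small).
  assert (NPb : Pb <> 0) by (now apply qpoch_neq_0_small).
  assert (G0 : egr a b 0 = / Pb * / Pa).
  { rewrite egr_two_torsion; auto; [|rewrite Cmult_0_r; apply e2pi_0]; now rewrite e2pi_0, !Cmult_1_l. }
  assert (H12 : 1 / 2 = / 2) by field.
  assert (Gh : egr a b (1 / 2) = / Qb * / Qa).
  { rewrite H12, egr_two_torsion; auto.
    - rewrite e2pi_half; unfold Qa, Qb; do 4 f_equal; ring.
    - replace (2 * / 2) with (IZR 1 : C) by (rewrite Cinv_r; [reflexivity|]; intros H; apply (f_equal Re) in H; simpl in H; lra); apply e2pi_IZR. }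
  assert (Gh' : egr a b (- (1 / 2)) = / Qb * / Qa).
  { rewrite H12, egr_two_torsion; auto.
    - rewrite e2pi_opp_half; unfold Qa, Qb; do 4 f_equal; ring.
    - replace (2 * - / 2) with (IZR (-1) : C) by (replace (2 * - / 2) with (- (2 * / 2)) by ring; rewrite Cinv_r; [apply C_eq; simpl; ring|]; intros H; apply (f_equal Re) in H; simpl in H; lra); apply e2pi_IZR. }
  assert (Hq : q4 + q4 = 1 / 2) by (rewrite <- RtoC_plus; unfold Cdiv; rewrite <- RtoC_inv, <- RtoC_mult by lra; f_equal; field).
  set (V := / Qb * / Qa * (/ Pb * / Pa) * (/ Pb * / Pa * (/ Qb * / Qa)) *
    (eg a b (a2 + q4) * eg a b (a2 - q4)) * (eg a b (a3 + q4) * eg a b (a3 - q4)) * (eg a b (a4 + q4) * eg a b (a4 - q4)) *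
    (2 * (Qb * Qb) * (2 * (Qa * Qa))) * (/ eg a b (s + q4) * / eg a b (s - q4))).
  assert (V1 : hreg (RtoC 0, q4) = V).
  { unfold hreg; cbn [fst snd]; fold s; rewrite Cmult_0_r, !Cplus_0_r, !Cplus_0_l.
    replace (q4 - q4) with (RtoC 0) by ring; replace (- q4 + q4) with (RtoC 0) by ring.
    replace (- q4 - q4) with (- (q4 + q4)) by ring; replace (2 * q4) with (q4 + q4) by ring.
    rewrite Hq, Gh, Gh', G0, Tb, Ta', Ta; reflexivity. }
  assert (V2 : hreg (RtoC 0, RtoC (- (1 / 4))) = V).
  { unfold hreg; cbn [fst snd]; fold s; rewrite Cmult_0_r, !Cplus_0_r, !Cplus_0_l, RtoC_opp.
    assert (D : forall u, u - - q4 = u + q4) by (intros; ring); rewrite !D.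
    assert (D' : forall u, u + - q4 = u - q4) by (intros; ring); rewrite !D'.
    replace (q4 - q4) with (RtoC 0) by ring; replace (- q4 + q4) with (RtoC 0) by ring.
    replace (- q4 - q4) with (- (q4 + q4)) by ring; replace (2 * - q4) with (- (q4 + q4)) by ring.
    replace (- - (q4 + q4)) with (q4 + q4) by ring.
    rewrite Hq, Gh, Gh', G0, Tb', Tb, Ta; unfold V; ring. }
  assert (V3 : hnv (RtoC 0, RtoC 0) = / (eg a b (a2 + q4) * eg a b (a2 - q4) * (eg a b (a3 + q4) * eg a b (a3 - q4)) * (eg a b (a4 + q4) * eg a b (a4 - q4))) *
    (eg a b (s + q4) * eg a b (s - q4))).
  { unfold hnv; cbn [fst snd]; fold s; rewrite Cmult_0_r, !Cplus_0_r, !Cplus_0_l.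
    assert (D : forall u, q4 + u = u + q4) by (intros; ring); rewrite !D.
    assert (D' : forall u, - q4 + u = u - q4) by (intros; ring); rewrite !D'.
    field; repeat split; apply N; im_tac. }
  unfold avgf; rewrite V1, V2, V3, G0; unfold V.
  field; repeat split; auto; apply N; im_tac.
Qed.
End value.

Lemma elliptic_beta (a b a0 a1 a2 a3 a4 : C) : (0 < Im a)%R -> (0 < Im b)%R -> balanced a b a0 a1 a2 a3 a4 ->
  Beta a b a0 a1 a2 a3 a4 = 2 * (/ qpoch (e2pi a) (e2pi a) * / qpoch (e2pi b) (e2pi b)).
Proof.
  intros Ha Hb HB; set (e0 := ((Im a + Im b) / 6)%R); set (u := (0, e0)%R : C).
  assert (He : (0 < e0)%R) by (unfold e0; lra); assert (He6 : (6 * e0 <= Im a + Im b)%R) by (unfold e0; lra).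
  rewrite <- (Beta_limit_value a b u u u e0) by (auto; reflexivity).
  apply (Beta_limit a b u u u e0); auto; try reflexivity.
  intros; now apply Beta_const.
Qed.

(** * The integral along the segment *)

Lemma is_RInt_ext_except (f g : R -> R) (c l : R) : (0 < c < 1)%R -> (forall t, (0 < t < 1)%R -> t <> c -> f t = g t) ->
  is_RInt f 0 1 l -> is_RInt g 0 1 l.
Proof.
  intros Hc Hfg Hf; assert (Ef : ex_RInt f 0 1) by (exists l; exact Hf).
  assert (E1 : ex_RInt f 0 c) by (apply (ex_RInt_Chasles_1 (V := R_CompleteNormedModule)) with 1%R; [lra|exact Ef]).
  assert (E2 : ex_RInt f c 1) by (apply (ex_RInt_Chasles_2 (V := R_CompleteNormedModule)) with 0%R; [lra|exact Ef]).
  apply (RInt_correct (V := R_CompleteNormedModule)) in E1; apply (RInt_correct (V := R_CompleteNormedModule)) in E2.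
  assert (E := is_RInt_Chasles (V := R_NormedModule) _ _ _ _ _ _ E1 E2).
  apply (is_RInt_unique (V := R_CompleteNormedModule)) in E; apply (is_RInt_unique (V := R_CompleteNormedModule)) in Hf.
  rewrite Hf in E; rewrite E.
  apply (is_RInt_Chasles (V := R_NormedModule)) with c.
  - eapply is_RInt_ext; [|exact E1]; rewrite Rmin_left, Rmax_right by lra; intros t Ht; apply Hfg; lra.
  - eapply is_RInt_ext; [|exact E2]; rewrite Rmin_left, Rmax_right by lra; intros t Ht; apply Hfg; lra.
Qed.

Lemma is_RInt_CI_except (f g : R -> C) (c : R) : (0 < c < 1)%R -> cont01 f -> (forall t, (0 < t < 1)%R -> t <> c -> f t = g t) ->
  @is_RInt C_R_NormedModule g 0 1 (CI f).
Proof.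
  intros Hc Hf Hfg; apply (is_RInt_fct_extend_pair (U := R_NormedModule) (V := R_NormedModule)).
  - apply (is_RInt_ext_except (fun t => Re (f t)) _ c); [exact Hc|intros t Ht Htc; unfold Re; now rewrite Hfg|].
    apply (RInt_correct (V := R_CompleteNormedModule)), cont01_ex_Re, Hf.
  - apply (is_RInt_ext_except (fun t => Im (f t)) _ c); [exact Hc|intros t Ht Htc; unfold Im; now rewrite Hfg|].
    apply (RInt_correct (V := R_CompleteNormedModule)), cont01_ex_Im, Hf.
Qed.

Lemma Gval_eg (w1 w2 w3 u : C) : Gval w1 w2 w3 u = e2pi (- (Pcub w1 w2 w3 u / 2)) * eg (- (w1 / w3)) (- (w2 / w3)) (- (u / w3)).
Proof.
  unfold Gval, modN3, modD3, eg, egamma; rewrite e2pi_mul_div, <- !e2pi_plus.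
  replace (- (w1 / w3) + - (w2 / w3) - - (u / w3)) with (u / w3 + - (w1 / w3) + - (w2 / w3)) by ring; reflexivity.
Qed.

Lemma eg_opp_inv (a b u : C) : (0 < Im a)%R -> (0 < Im b)%R -> Im u = 0%R -> / (eg a b u * eg a b (- u)) = th b u * th a (- u).
Proof.
  intros Ha Hb Hu; assert (Hx := Cmod_e2pi_lt_1 a Ha); assert (Hy := Cmod_e2pi_lt_1 b Hb).
  unfold eg, egamma, th, theta; rewrite !e2pi_mul_div, <- !e2pi_minus.
  unfold Cdiv; rewrite !Cinv_mult_total, !Cinv_inv_total.
  rewrite (dpoch_step (e2pi u)), (dpoch_sym (e2pi u * e2pi a)), (dpoch_step (e2pi u * e2pi a)) by assumption.
  rewrite (dpoch_sym (e2pi (- u))), (dpoch_step (e2pi (- u))), (dpoch_sym (e2pi (- u) * e2pi b)), (dpoch_step (e2pi (- u) * e2pi b)) by assumption.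
  rewrite (dpoch_sym (e2pi u * e2pi a * e2pi b)), <- !e2pi_plus by assumption.
  replace (a - - u) with (u + a) by ring; replace (b - u) with (- u + b) by ring.
  replace (a + b - - u) with (u + a + b) by ring; replace (- u + b + a) with (a + b - u) by ring.
  field; split; apply dpoch_neq_0_small; auto; apply Cmod_e2pi_lt_1; unfold Im in *; simpl; lra.
Qed.

Lemma e2pi_R_neq_1 (x : R) : (forall n : Z, x <> IZR n) -> e2pi x <> 1.
Proof.
  intros Hx E; rewrite e2pi_R in E; apply (f_equal Re) in E; simpl in E.
  assert (S := sin_eq_0_0 (PI * x)).
  assert (H0 : sin (PI * x) = 0%R).
  { replace (2 * PI * x)%R with (2 * (PI * x))%R in E by ring; rewrite cos_2a_sin in E.
    assert (E' : (sin (PI * x) * sin (PI * x) = 0)%R) by lra; apply Rmult_integral in E'; tauto. }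
  destruct (S H0) as [k Hk]; apply (Hx k).
  apply Rmult_eq_reg_l with PI; [rewrite Hk; ring|generalize PI_RGT_0; lra].
Qed.

Lemma e2pi_1_sub_2t (t : R) : (0 < t < 1)%R -> t <> (1 / 2)%R -> e2pi (1 - 2 * t)%R <> 1 /\ e2pi (- (1 - 2 * t))%R <> 1.
Proof.
  intros Ht Hh; assert (H : forall n : Z, (1 - 2 * t)%R <> IZR n).
  { intros n E; assert (H1 : (IZR (-1) < IZR n)%R) by (rewrite <- E; lra); assert (H2 : (IZR n < IZR 1)%R) by (rewrite <- E; lra).
    apply lt_IZR in H1; apply lt_IZR in H2; assert (n = 0%Z) by lia; subst; lra. }
  split; apply e2pi_R_neq_1; [exact H|]; intros n E; apply (H (- n)%Z); rewrite opp_IZR, <- E; ring.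
Qed.

Lemma Pcub_sum (w1 w2 w3 g0 g1 g2 g3 g4 u : C) (A := g0 + g1 + g2 + g3 + g4) (P := Pcub w1 w2 w3) : w1 <> 0 -> w2 <> 0 -> w3 <> 0 ->
  P (g0 + u) + P (g0 - u) + (P (g1 + u) + P (g1 - u)) + (P (g2 + u) + P (g2 - u)) + (P (g3 + u) + P (g3 - u)) + (P (g4 + u) + P (g4 - u)) -
  (P (2 * u) + P (- (2) * u) + (P (A + u) + P (A - u))) =
  P (g0 + g1) + P (g0 + g2) + P (g0 + g3) + P (g0 + g4) + P (g1 + g2) + P (g1 + g3) + P (g1 + g4) + P (g2 + g3) + P (g2 + g4) + P (g3 + g4) -
  (P (A - g0) + P (A - g1) + P (A - g2) + P (A - g3) + P (A - g4)) + P 0.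
Proof. intros H1 H2 H3; unfold P, A, Pcub; field; auto. Qed.

Lemma CI_W_shift (a b a0 a1 a2 a3 a4 : C) : (0 < Im a)%R -> (0 < Im b)%R -> balanced a b a0 a1 a2 a3 a4 ->
  cont01 (fun t => W a b (a0 + a1 + a2 + a3 + a4) a0 a1 a2 a3 a4 (RtoC (1 / 2 - t))) /\
  CI (fun t => W a b (a0 + a1 + a2 + a3 + a4) a0 a1 a2 a3 a4 (RtoC (1 / 2 - t))) = EI a b a1 a2 a3 a4 a0.
Proof.
  intros Ha Hb [B0 [B1 [B2 [B3 [B4 B5]]]]]; set (f := W a b (a0 + a1 + a2 + a3 + a4) a0 a1 a2 a3 a4).
  destruct (exists_pos_le6 (Im a0) (Im a1) (Im a2) (Im a3) (Im a4) (Im a + Im b - (Im a0 + Im a1 + Im a2 + Im a3 + Im a4))) as [eps He]; try lra.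
  assert (Hf : uapp trig (strip 0 0 0 0) (fun x => f (fst x))).
  { unfold f, W; uprod; try exact (proj1 He); cbv beta; im_tac. }
  assert (Hc : cont01 (fun t => f (RtoC (1 / 2 - t)))).
  { apply (uapp_trig_cont01 _ _ (RtoC (1 / 2)) 0 (- (1)) 0) in Hf; [|intros t _; im_tac].
    eapply cont01_ext; [|exact Hf]; intros t _; cbn [fst]; f_equal; rewrite RtoC_minus; ring. }
  split; [exact Hc|].
  assert (H0 : forall v, CI (fun t => f (v + t)) = coef f 0 v).
  { intros v; apply CI_ext; intros t _; rewrite Cmult_0_l; replace (- 0) with (RtoC 0) by ring; rewrite e2pi_0; ring. }
  rewrite <- CI_reflect by exact Hc.
  transitivity (CI (fun t => f (RtoC (- (1 / 2)) + t))).
  - apply CI_ext; intros t _; f_equal; rewrite <- RtoC_plus; f_equal; field.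
  - transitivity (CI (fun t => f (0 + t))); [|apply CI_ext; intros; unfold f; f_equal; ring].
    rewrite !H0; apply (uapp_coef 0 0 0 0 (fun x => f (fst x)) 0 _ _ 0); auto; simpl; lra.
Qed.

Lemma Nv_neq_0 (a b a0 a1 a2 a3 a4 : C) (A := a0 + a1 + a2 + a3 + a4) : (0 < Im a)%R -> (0 < Im b)%R -> balanced a b a0 a1 a2 a3 a4 ->
  Nv a b a0 a1 a2 a3 a4 <> 0.
Proof.
  intros Ha Hb [B0 [B1 [B2 [B3 [B4 B5]]]]]; unfold Nv; cbv zeta.
  assert (N : forall u, (0 < Im u < Im a + Im b)%R -> eg a b u <> 0) by (intros; now apply eg_neq_0).
  assert (N' : forall u, (0 < Im u < Im a + Im b)%R -> / eg a b u <> 0) by (intros; now apply Cinv_neq_0_C, eg_neq_0).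
  assert (M : forall u v : C, u <> 0 -> v <> 0 -> u * v <> 0) by (intros; now apply Cmult_neq_0).
  repeat match goal with |- Cmult ?u ?v <> _ => apply (M u v) end; (apply N' || apply N); im_tac.
Qed.

Theorem theorem2 (w1 w2 w3 : C) (g : nat -> C)
  (hw1 : w1 <> 0) (hw2 : w2 <> 0) (hw3 : w3 <> 0)
  (h12 : (0 <= Im (w1 / w2))%R)
  (h31 : (0 < Im (w3 / w1))%R)
  (h32 : (0 < Im (w3 / w2))%R)
  (hg : forall n : nat, (n <= 4)%nat -> (Im (g n / w3) < 0)%R)
  (hA : (0 < Im ((sum_n g 4 - w1 - w2) / w3))%R) :
  let A : C := sum_n g 4 in
  is_segment_int
    (fun u : C =>
       Cprod 5 (fun n => Gpm w1 w2 w3 (g n) u) /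
       (G w1 w2 w3 (2 * u) * G w1 w2 w3 (- (2) * u) * Gpm w1 w2 w3 A u) / w2)
    (- w3 / 2) (w3 / 2)
    (kappa w1 w2 w3 *
       (Cprod 5 (fun m => Cprod m (fun n => G w1 w2 w3 (g n + g m))) /
        Cprod 5 (fun n => G w1 w2 w3 (A - g n)))).
Proof.
  intros A.
  assert (EA : A = g 0%nat + g 1%nat + g 2%nat + g 3%nat + g 4%nat) by (unfold A; rewrite !sum_Sn, sum_O; reflexivity).
  fold A in hA.
  set (a := - (w1 / w3)); set (b := - (w2 / w3)); set (al := fun n => - (g n / w3)).
  assert (Ha : (0 < Im a)%R) by (now apply Im_inv_neg).
  assert (Hb : (0 < Im b)%R) by (now apply Im_inv_neg).
  assert (Hal : forall n, (n <= 4)%nat -> (0 < Im (al n))%R) by (intros n Hn; specialize (hg n Hn); unfold al, Im in *; simpl in *; lra).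
  set (S := al 0%nat + al 1%nat + al 2%nat + al 3%nat + al 4%nat).
  assert (ES : - (A / w3) = S) by (rewrite EA; unfold S, al, Cdiv; ring).
  assert (HB : balanced a b (al 0%nat) (al 1%nat) (al 2%nat) (al 3%nat) (al 4%nat)).
  { unfold balanced; repeat (split; [apply Hal; lia|]).
    assert (HS : (Im S < Im a + Im b)%R).
    { rewrite <- ES; replace ((A - w1 - w2) / w3) with (A / w3 + a + b) in hA by (unfold a, b, Cdiv; ring).
      unfold Im in *; simpl in *; lra. }
    unfold S, Im in *; simpl in *; lra. }
  assert (IS : (0 < Im S)%R) by (unfold balanced in HB; unfold S, Im in *; simpl in *; lra).
  assert (Gv : forall u, (0 < Im (- (u / w3)))%R -> G w1 w2 w3 u = e2pi (- (Pcub w1 w2 w3 u / 2)) * eg a b (- (u / w3))).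
  { intros u Hu; rewrite <- Gval_eg; assert (Hc := Cmod_e2pi_lt_1 _ Hu); apply G_value; auto; [lra|].
    intros E; rewrite E, Cmod_1 in Hc; lra. }
  assert (Gr : forall u (s : R), - (u / w3) = RtoC s -> e2pi s <> 1 -> G w1 w2 w3 u = e2pi (- (Pcub w1 w2 w3 u / 2)) * eg a b s).
  { intros u s Es Hs; rewrite <- Es; unfold a, b; rewrite <- Gval_eg; apply G_value; auto; rewrite Es; [rewrite Cmod_e2pi_R; lra|exact Hs]. }
  set (P := Pcub w1 w2 w3).
  set (E0 := P (g 0%nat + g 1%nat) + P (g 0%nat + g 2%nat) + P (g 0%nat + g 3%nat) + P (g 0%nat + g 4%nat) + P (g 1%nat + g 2%nat) +
    P (g 1%nat + g 3%nat) + P (g 1%nat + g 4%nat) + P (g 2%nat + g 3%nat) + P (g 2%nat + g 4%nat) + P (g 3%nat + g 4%nat) -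
    (P (A - g 0%nat) + P (A - g 1%nat) + P (A - g 2%nat) + P (A - g 3%nat) + P (A - g 4%nat))).
  destruct (CI_W_shift a b _ _ _ _ _ Ha Hb HB) as [Wc WI].
  unfold is_segment_int.
  set (k := w3 / w2 * e2pi (- ((E0 + P 0) / 2))).
  assert (EV : kappa w1 w2 w3 *
       (Cprod 5 (fun m => Cprod m (fun n => G w1 w2 w3 (g n + g m))) /
        Cprod 5 (fun n => G w1 w2 w3 (A - g n))) = CI (fun t => k * W a b S (al 0%nat) (al 1%nat) (al 2%nat) (al 3%nat) (al 4%nat) (RtoC (1 / 2 - t)))).
  { rewrite CI_scal by exact Wc; unfold S; rewrite WI.
    assert (NB := Nv_neq_0 a b _ _ _ _ _ Ha Hb HB); assert (VB := elliptic_beta a b _ _ _ _ _ Ha Hb HB); unfold Beta, EB in VB.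
    rewrite kappa_value by assumption; fold a b.
    replace (EI a b (al 1%nat) (al 2%nat) (al 3%nat) (al 4%nat) (al 0%nat)) with
      (2 * (/ qpoch (e2pi a) (e2pi a) * / qpoch (e2pi b) (e2pi b)) * / Nv a b (al 0%nat) (al 1%nat) (al 2%nat) (al 3%nat) (al 4%nat))
      by (rewrite <- VB; field; exact NB).
    assert (Gs : forall i j, (i <= 4)%nat -> (j <= 4)%nat -> G w1 w2 w3 (g i + g j) = e2pi (- (P (g i + g j) / 2)) * eg a b (al i + al j)).
    { intros i j Hi Hj; assert (E : - ((g i + g j) / w3) = al i + al j) by (unfold al, Cdiv; ring).
      rewrite Gv; rewrite E; [reflexivity|]; generalize (Hal i Hi) (Hal j Hj); unfold Im; simpl; lra. }
    assert (Gd : forall i, (i <= 4)%nat -> G w1 w2 w3 (A - g i) = e2pi (- (P (A - g i) / 2)) * eg a b (S - al i)).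
    { intros i Hi; assert (E : - ((A - g i) / w3) = S - al i) by (rewrite <- ES; unfold al, Cdiv; ring).
      rewrite Gv; rewrite E; [reflexivity|]; unfold balanced in HB; unfold S.
      assert (Hi' : (i = 0 \/ i = 1 \/ i = 2 \/ i = 3 \/ i = 4)%nat) by lia.
      destruct Hi' as [-> | [-> | [-> | [-> | ->]]]]; unfold Im in *; simpl in *; lra. }
    simpl Cprod; rewrite !Gs, !Gd by lia.
    unfold Nv; fold S; unfold k.
    assert (EE : e2pi (- ((E0 + P 0) / 2)) = e2pi (- (P (g 0%nat + g 1%nat) / 2)) * e2pi (- (P (g 0%nat + g 2%nat) / 2)) *
      e2pi (- (P (g 0%nat + g 3%nat) / 2)) * e2pi (- (P (g 0%nat + g 4%nat) / 2)) * e2pi (- (P (g 1%nat + g 2%nat) / 2)) *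
      e2pi (- (P (g 1%nat + g 3%nat) / 2)) * e2pi (- (P (g 1%nat + g 4%nat) / 2)) * e2pi (- (P (g 2%nat + g 3%nat) / 2)) *
      e2pi (- (P (g 2%nat + g 4%nat) / 2)) * e2pi (- (P (g 3%nat + g 4%nat) / 2)) *
      (/ e2pi (- (P (A - g 0%nat) / 2)) * / e2pi (- (P (A - g 1%nat) / 2)) * / e2pi (- (P (A - g 2%nat) / 2)) *
       / e2pi (- (P (A - g 3%nat) / 2)) * / e2pi (- (P (A - g 4%nat) / 2))) * e2pi (- (P 0 / 2))).
    { rewrite <- !e2pi_opp, <- !e2pi_plus; f_equal; unfold E0; field. }
    rewrite EE; fold P; unfold Cdiv; rewrite !Cinv_mult_total, !Cinv_inv_total.
    replace (/ 1) with (RtoC 1) by field; ring. }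
  rewrite EV; apply is_RInt_CI_except with (1 / 2)%R; [lra|apply cont01_mult; [apply cont01_const|exact Wc]|].
  intros t Ht Hth; cbv beta; set (u := - w3 / 2 + t * (w3 / 2 - - w3 / 2)); set (s := RtoC (1 / 2 - t)).
  assert (Is : Im s = 0%R) by reflexivity.
  assert (Eu : - (u / w3) = s).
  { unfold s, u; rewrite RtoC_minus; unfold Rdiv; rewrite RtoC_mult, RtoC_inv by lra; field; exact hw3. }
  assert (Gp : forall n, (n <= 4)%nat -> G w1 w2 w3 (g n + u) = e2pi (- (P (g n + u) / 2)) * eg a b (al n + s)).
  { intros n Hn; assert (E : - ((g n + u) / w3) = al n + s) by (rewrite <- Eu; unfold al, Cdiv; ring).
    rewrite Gv; rewrite E; [reflexivity|]; change (0 < Im (al n) + Im s)%R; rewrite Is; generalize (Hal n Hn); lra. }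
  assert (Gm : forall n, (n <= 4)%nat -> G w1 w2 w3 (g n - u) = e2pi (- (P (g n - u) / 2)) * eg a b (al n - s)).
  { intros n Hn; assert (E : - ((g n - u) / w3) = al n - s) by (rewrite <- Eu; unfold al, Cdiv; ring).
    rewrite Gv; rewrite E; [reflexivity|]; change (0 < Im (al n) + - Im s)%R; rewrite Is; generalize (Hal n Hn); lra. }
  assert (GAp : G w1 w2 w3 (A + u) = e2pi (- (P (A + u) / 2)) * eg a b (S + s)).
  { assert (E : - ((A + u) / w3) = S + s) by (rewrite <- Eu, <- ES; unfold Cdiv; ring).
    rewrite Gv; rewrite E; [reflexivity|]; change (0 < Im S + Im s)%R; rewrite Is; lra. }
  assert (GAm : G w1 w2 w3 (A - u) = e2pi (- (P (A - u) / 2)) * eg a b (S - s)).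
  { assert (E : - ((A - u) / w3) = S - s) by (rewrite <- Eu, <- ES; unfold Cdiv; ring).
    rewrite Gv; rewrite E; [reflexivity|]; change (0 < Im S + - Im s)%R; rewrite Is; lra. }
  destruct (e2pi_1_sub_2t t Ht Hth) as [N1 N2].
  assert (E2s : RtoC (1 - 2 * t) = 2 * s) by (unfold s; rewrite <- RtoC_mult; f_equal; field).
  assert (G2p : G w1 w2 w3 (2 * u) = e2pi (- (P (2 * u) / 2)) * eg a b (2 * s)).
  { rewrite <- E2s; refine (Gr (2 * u) (1 - 2 * t)%R _ N1); rewrite E2s, <- Eu; unfold Cdiv; ring. }
  assert (G2m : G w1 w2 w3 (- (2) * u) = e2pi (- (P (- (2) * u) / 2)) * eg a b (- (2 * s))).
  { rewrite <- E2s, <- (RtoC_opp (1 - 2 * t)); refine (Gr (- (2) * u) (- (1 - 2 * t))%R _ N2).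
    rewrite RtoC_opp, E2s, <- Eu; unfold Cdiv; ring. }
  simpl Cprod; unfold Gpm; rewrite !Gp, !Gm, GAp, GAm, G2p, G2m by lia.
  replace (w3 / 2 - - w3 / 2) with w3 by field.
  unfold W; rewrite <- eg_opp_inv by (auto; rewrite <- E2s; reflexivity).
  assert (EE : e2pi (- ((E0 + P 0) / 2)) = e2pi (- (P (g 0%nat + u) / 2)) * e2pi (- (P (g 0%nat - u) / 2)) *
    e2pi (- (P (g 1%nat + u) / 2)) * e2pi (- (P (g 1%nat - u) / 2)) * e2pi (- (P (g 2%nat + u) / 2)) * e2pi (- (P (g 2%nat - u) / 2)) *
    e2pi (- (P (g 3%nat + u) / 2)) * e2pi (- (P (g 3%nat - u) / 2)) * e2pi (- (P (g 4%nat + u) / 2)) * e2pi (- (P (g 4%nat - u) / 2)) *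
    (/ e2pi (- (P (2 * u) / 2)) * / e2pi (- (P (- (2) * u) / 2)) * / e2pi (- (P (A + u) / 2)) * / e2pi (- (P (A - u) / 2)))).
  { rewrite <- !e2pi_opp, <- !e2pi_plus; f_equal; unfold E0; rewrite EA.
    unfold P; rewrite <- (Pcub_sum w1 w2 w3 _ _ _ _ _ u hw1 hw2 hw3); field. }
  unfold k; rewrite EE; unfold Cdiv; rewrite !Cinv_mult_total; ring.
Qed.
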